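(* For $\lambda>0$ the reflection coefficient $\beta(\lambda)$ of the rational potential $u_0$ is given by $$\beta(\lambda)=\frac{i}{\epsilon}\,e^{-\frac{2\pi}{\epsilon}\sum_{p=1}^Pc_p}\int_{-\infty}^{\infty}e^{-ih(z;\lambda)/\epsilon}\Big(u_0(z)-\sum_{p=1}^P\frac{v_p(\lambda)}{z-z_p}\Big)\,dz,$$ where $v_p(\lambda)=c_pW_+(z_p;\lambda)$, $p=1,\dots,P$, and where these coefficients are determined by the linear system $\mathbf{A}^>(\lambda)\mathbf{v}(\lambda)=\mathbf{b}^>(\lambda)$ for $\mathbf{v}(\lambda)=(v_1(\lambda),\dots,v_P(\lambda))^{\mathsf T}$, with $$A^>_{mp}(\lambda):=\int_{C_m^>}\frac{e^{-ih(z;\lambda)/\epsilon}}{z-z_p}\,dz,\qquad b^>_m(\lambda):=-\lambda\int_{C_m^>}e^{-ih(z;\lambda)/\epsilon}\,dz.$$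
   Context: A star denotes complex conjugation. Let $\epsilon>0$, $P\ge 1$, let $c_1,\dots,c_P$ be nonzero complex numbers with $\sum_{p=1}^P(c_p+c_p^* )=0$, and let $z_1,\dots,z_P\in\mathbb{C}$ satisfy $\mathrm{Im}\{z_p\}>0$ and $\mathrm{Re}\{z_1\}<\dots<\mathrm{Re}\{z_P\}$. The potential is $u_0(x)=\sum_{p=1}^P\big(\frac{c_p}{x-z_p}+\frac{c_p^*}{x-z_p^*}\big)$. Define $$f(x):=\sum_{p=1}^P\Big[c_p\big(\mathrm{Log}(i(x-z_p))+\tfrac{\pi i}{2}\big)+c_p^*\big(\mathrm{Log}(-i(x-z_p^* ))-\tfrac{\pi i}{2}\big)\Big],\qquad h(x;\lambda):=\lambda x+f(x),$$ with $\mathrm{Log}$ the principal branch, so $f'=u_0$; $f$ is analytic on $G:=\mathbb{C}\setminus\bigcup_{p}\big(\{z_p+it:t\ge 0\}\cup\{z_p^*-it:t\ge0\}\big)$, and $G_0:=\{\mathrm{Re}\{x\}<\mathrm{Re}\{z_1\}\}$. Spectral problem: $i\epsilon\frac{dw^+}{dx}+\lambda(w^+-w_0)=-\mathcal{C}^+[u_0w^+]$ on $\mathbb{R}$, where $w_0$ is a constant, $w^+$ is the boundary value of a function analytic and bounded for $\mathrm{Im}\{x\}>0$, and $\mathcal{C}^+[\varphi](x):=\lim_{\delta\downarrow0}\frac1{2\pi i}\int_{-\infty}^\infty\frac{\varphi(y)}{y-(x+ i\delta)}dy$. For $\lambda>0$, the Jost solutions are: $M=W_+$, the solution with $w_0=1$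 and $M\to1$ as $x\to-\infty$; $\overline N$, the solution with $w_0=1$ and $\overline N\to1$ as $x\to+\infty$; $N$, the solution with $w_0=0$ and $Ne^{-i\lambda x/\epsilon}\to1$ as $x\to+\infty$. The reflection coefficient $\beta:(0,\infty)\to\mathbb{C}$ is defined by the scattering relation $M(x;\lambda)-\overline N(x;\lambda)=\beta(\lambda)N(x;\lambda)$, so that $\beta(\lambda)=\lim_{x\to+\infty}e^{-i\lambda x/\epsilon}(W_+(x;\lambda)-1)$. For $\lambda>0$ one has the representation $W_+(x;\lambda)=-\frac{i}{\epsilon}e^{ih(x;\lambda)/\epsilon}\int_{-\infty}^x e^{-ih(z;\lambda)/\epsilon}\big(\lambda+\sum_{p=1}^P\frac{v_p(\lambda)}{z-z_p}\big)dz$ (convergent improper integral) with $v_p(\lambda)=c_pW_+(z_p;\lambda)$. Contours: $C_m^>:=U_m^>$ unless $ic_m/\epsilon$ is a strictly negative integer, in which case $C_m^>:=\ell_0(z_m)$. Here $\ell_0(z_m)$ originates at $-i\infty$ in $G_0$, runs in $G$, and terminates at $z_m$. $U_m^>$ is a contour on the Riemann surface of $f$ originating at $-i\infty$ in $G_0$ (with $f(\infty)=0$) and ending at $-i\infty$ over $G_0$, having encircled $z_1,\dots,z_m$ each exactly once in the positive sense and no other singularity of $f$; concretely, it goes from $-i\infty$ in $G_0$ within $G$ (below $z_1,\dots,z_m$ and above all $z_p^*$) up to the region between the upward cuts of $z_m$ and $z_{m+1}$ (to the right of the cut of $z_P$ if $m=P$), then returns above $z_m,\dots,z_1$, crossing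 the upward cuts of $z_m,\dots,z_1$ with $f$ continued analytically, back over $G_0$ and down to $-i\infty$. *)

(* Defs.v *)
From Stdlib Require Import Reals.
From Coquelicot Require Import Coquelicot.

Open Scope R_scope.

(** ** Complex exponential and principal logarithm *)

Definition Cexp (x : C) : C :=
  (exp (Re x) * cos (Im x), exp (Re x) * sin (Im x)).

(* The principal argument, with values in (-PI, PI] for x <> 0. *)
Definition Carg (x : C) : R :=
  if Rle_dec 0 (Im x) then acos (Re x / Cmod x) else - acos (Re x / Cmod x).

Definition Clog (x : C) : C := (ln (Cmod x), Carg x).

(** ** The rational potential

    Poles [z p] and residues [c p] are indexed by [1 <= p <= P], as in all the
    sums below; the values of [c] and [z] at other indices are irrelevant. *)

Definition Csum (P : nat) (a : nat -> C) : C :=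
  sum_n_m (G := C_AbelianMonoid) a 1 P.

Definition u0 (P : nat) (c z : nat -> C) (x : C) : C :=
  Csum P (fun p => c p / (x - z p) + Cconj (c p) / (x - Cconj (z p)))%C.

Definition f (P : nat) (c z : nat -> C) (x : C) : C :=
  Csum P (fun p =>
    c p * (Clog (Ci * (x - z p)) + RtoC PI * Ci / 2)
    + Cconj (c p) * (Clog (- Ci * (x - Cconj (z p))) - RtoC PI * Ci / 2))%C.

Definition h (P : nat) (c z : nat -> C) (lam : R) (x : C) : C :=
  (RtoC lam * x + f P c z x)%C.

(** ** The domains [G] and [G_0] *)

Definition up_ray (a x : C) : Prop := Re x = Re a /\ Im a <= Im x.

Definition down_ray (a x : C) : Prop := Re x = Re a /\ Im x <= Im a.

Definition in_G (P : nat) (z : nat -> C) (x : C) : Prop :=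
  forall p : nat, (1 <= p <= P)%nat ->
    ~ up_ray (z p) x /\ ~ down_ray (Cconj (z p)) x.

Definition in_G0 (z : nat -> C) (x : C) : Prop := Re x < Re (z 1%nat).

(** ** The spectral problem and the Jost solutions *)

(* [C^+ phi] takes the value [l] at the real point [x]. *)
Definition is_Cplus (phi : R -> C) (x : R) (l : C) : Prop :=
  exists J : R -> C,
    (forall delta : R, 0 < delta ->
       is_RInt_gen (V := C_R_NormedModule)
         (fun y : R => (phi y / (RtoC y - (RtoC x + Ci * RtoC delta)))%C)
         (Rbar_locally m_infty) (Rbar_locally p_infty) (J delta)) /\
    filterlim (fun delta : R => (/ (2 * RtoC PI * Ci) * J delta)%C)
      (at_right 0) (locally l).

(* A function w^+ on the real line together with its extension to the upper
   half-plane is encoded as a single [W : C -> C], of which only the values on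
   [Im x >= 0] matter; w^+ is the restriction of [W] to the real line. *)
Definition bounded_analytic_extension (W : C -> C) : Prop :=
  (forall x : C, 0 < Im x -> ex_derive (K := C_AbsRing) (V := C_NormedModule) W x) /\
  (exists B : R, forall x : C, 0 < Im x -> Cmod (W x) <= B) /\
  (forall x : R,
     filterlim W (within (fun y : C => 0 < Im y) (locally (RtoC x)))
       (locally (W (RtoC x)))).

Definition solves_spectral (eps : R) (P : nat) (c z : nat -> C) (lam : R)
    (w0 : C) (W : C -> C) : Prop :=
  bounded_analytic_extension W /\
  forall x : R, exists dw Cw : C,
    is_derive (V := C_R_NormedModule) (fun t : R => W (RtoC t)) x dw /\
    is_Cplus (fun y : R => (u0 P c z (RtoC y) * W (RtoC y))%C) x Cw /\
    (Ci * RtoC eps * dw + RtoC lam * (W (RtoC x) - w0) = - Cw)%C.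

(* The Jost solution M = W_+. *)
Definition is_Jost_M (eps : R) (P : nat) (c z : nat -> C) (lam : R)
    (M : C -> C) : Prop :=
  solves_spectral eps P c z lam (RtoC 1) M /\
  filterlim (fun x : R => M (RtoC x)) (Rbar_locally m_infty) (locally (RtoC 1)).

Definition is_Jost_Nbar (eps : R) (P : nat) (c z : nat -> C) (lam : R)
    (Nbar : C -> C) : Prop :=
  solves_spectral eps P c z lam (RtoC 1) Nbar /\
  filterlim (fun x : R => Nbar (RtoC x)) (Rbar_locally p_infty) (locally (RtoC 1)).

Definition is_Jost_N (eps : R) (P : nat) (c z : nat -> C) (lam : R)
    (N : C -> C) : Prop :=
  solves_spectral eps P c z lam (RtoC 0) N /\
  filterlim
    (fun x : R => (N (RtoC x) * Cexp (- Ci * RtoC lam * RtoC x / RtoC eps))%C)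
    (Rbar_locally p_infty) (locally (RtoC 1)).

(** ** Contours on the Riemann surface of [f]

    A contour is a C^1 map [path] from the open line to the plane, with
    derivative [speed], together with the values [branch] of the determination
    of [f] carried along it.  As [speed] may vanish, every piecewise smooth
    contour has such a parametrization; an end point, finite or not, is the
    limit of [path] at the corresponding end of the line. *)
Record contour : Type := Contour {
  path : R -> C;
  speed : R -> C;
  branch : R -> C
}.

(* [branch] is a continuous determination of [f] along [path]:
   near each point it is given by a local primitive of [u0]. *)
Definition continues_f (P : nat) (c z : nat -> C) (gam : contour) : Prop :=
  forall t0 : R, exists g : C -> C,
    locally (path gam t0)
      (fun x : C => is_derive (K := C_AbsRing) (V := C_NormedModule) g x (u0 P c z x)) /\
    locally t0 (fun t : R => branch gam t = g (path gam t)).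

Definition tends_to_minus_i_infty_in_G0 (z : nat -> C) (gam : contour)
    (F : (R -> Prop) -> Prop) : Prop :=
  filterlim (fun t : R => Im (path gam t)) F (Rbar_locally m_infty) /\
  F (fun t : R => in_G0 z (path gam t)).

Definition contour_from_minus_i_infty (P : nat) (c z : nat -> C)
    (gam : contour) : Prop :=
  (forall t : R, is_derive (V := C_R_NormedModule) (path gam) t (speed gam t)) /\
  (forall t : R, continuous (speed gam) t) /\
  continues_f P c z gam /\
  tends_to_minus_i_infty_in_G0 z gam (Rbar_locally m_infty) /\
  Rbar_locally m_infty (fun t : R => branch gam t = f P c z (path gam t)).

Definition is_ell0 (P : nat) (c z : nat -> C) (m : nat) (gam : contour) : Prop :=
  contour_from_minus_i_infty P c z gam /\
  (forall t : R, in_G P z (path gam t)) /\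
  filterlim (path gam) (Rbar_locally p_infty) (locally (z m)).

(* The parameter value 0 is the turning point between the upward cuts of
   [z m] and [z (m+1)].  Before it the contour stays in [G].  After it the
   contour may cross the upward cuts of z_1, ..., z_m, but not the vertical
   half-lines from these points downwards (so it passes above them, and keeps
   off the cuts of their conjugates), nor any cut attached to the other poles.
   This fixes the homotopy class: z_1, ..., z_m are encircled once,
   counterclockwise, and no other singularity is. *)
Definition is_U (P : nat) (c z : nat -> C) (m : nat) (gam : contour) : Prop :=
  contour_from_minus_i_infty P c z gam /\
  (forall t : R, t <= 0 -> in_G P z (path gam t)) /\
  Re (z m) < Re (path gam 0) /\
  ((m < P)%nat -> Re (path gam 0) < Re (z (S m))) /\
  (forall t : R, 0 <= t -> forall p : nat, (1 <= p <= P)%nat ->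
     ((p <= m)%nat -> ~ down_ray (z p) (path gam t)) /\
     ((m < p)%nat ->
        ~ up_ray (z p) (path gam t) /\ ~ down_ray (Cconj (z p)) (path gam t))) /\
  tends_to_minus_i_infty_in_G0 z gam (Rbar_locally p_infty).

Definition exceptional (eps : R) (c : nat -> C) (m : nat) : Prop :=
  exists n : nat, (Ci * c m / RtoC eps = - RtoC (INR (S n)))%C.

(* [gam] is an admissible choice of the contour C_m^>. *)
Definition is_Cm (eps : R) (P : nat) (c z : nat -> C) (m : nat)
    (gam : contour) : Prop :=
  (exceptional eps c m -> is_ell0 P c z m gam) /\
  (~ exceptional eps c m -> is_U P c z m gam).

(** ** Integrals *)

(* e^{-i h / eps} along a contour, with [f] continued along it. *)
Definition contour_phase (eps lam : R) (gam : contour) (t : R) : C :=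
  Cexp (- Ci * (RtoC lam * path gam t + branch gam t) / RtoC eps)%C.

Definition A_integrand (eps lam : R) (z : nat -> C) (gam : contour) (p : nat)
    (t : R) : C :=
  (contour_phase eps lam gam t / (path gam t - z p) * speed gam t)%C.

Definition b_integrand (eps lam : R) (gam : contour) (t : R) : C :=
  (contour_phase eps lam gam t * speed gam t)%C.

Definition ex_int_line (F : R -> C) : Prop :=
  ex_RInt_gen (V := C_R_NormedModule) F (Rbar_locally m_infty) (Rbar_locally p_infty).

(* The improper integral over the line; a junk value if it diverges. *)
Definition int_line (F : R -> C) : C :=
  RInt_gen (V := C_R_CompleteNormedModule) F
    (Rbar_locally m_infty) (Rbar_locally p_infty).

Definition A_entry (eps lam : R) (z : nat -> C) (Gam : nat -> contour)
    (m p : nat) : C :=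
  int_line (A_integrand eps lam z (Gam m) p).

Definition b_entry (eps lam : R) (Gam : nat -> contour) (m : nat) : C :=
  (- RtoC lam * int_line (b_integrand eps lam (Gam m)))%C.

Definition beta_integrand (eps : R) (P : nat) (c z : nat -> C) (lam : R)
    (v : nat -> C) (x : R) : C :=
  (Cexp (- Ci * h P c z lam (RtoC x) / RtoC eps)
   * (u0 P c z (RtoC x) - Csum P (fun p => v p / (RtoC x - z p))))%C.

(* Main.v *)
(* Write [E = e^{-ih/eps}] and [R = lam w_0 + sum d_p / (x - z_p)]. All the integrals in the
   statement are increments of primitives of [E R] on the plane cut along vertical half-lines,
   so that no homotopy of contours is needed: for each [m] take the branch [f_m] of [f] whose cuts
   at z_1, ..., z_m point downwards, and the primitive of [E_m R] that vanishes at -i oo in G_0;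
   the integral over U_m is the difference, at the turning point, of the primitives for 0 and m.

   The residue theorem gives [C^+[u0 M] = u0 M - sum v_p / (x - z_p)] on the real line, so M solves
   a first order linear ODE there. Hence [((M - 1) E)' = (i/eps) E (u0 - sum v_p / (x - z_p))], whose
   integral over the line is [beta e^{-if(+oo)/eps}] with [f(+oo) = 2 pi i sum c_p]; and [i eps M E_m] is the normalised
   primitive of [E_m R] with [w_0 = 1], [d = v], first on the real line, then in the upper half-plane,
   because a function that is analytic in a rectangle and vanishes on one edge is zero. So v solves the system.

   If d is in the kernel of A, the primitives [F_m] of [E_m R] with [w_0 = 0] match across the cuts and
   [Y = - (i/eps) F / E] is analytic in the upper half-plane: at z_q it has at most a pole, whose order
   the ODE reduces to 0 unless [i c_q / eps] is a negative integer, in which case the contour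
   ell_0(z_q) forces [F] to vanish there to the order of [E]. On the real line
   [|Y|^2 = ((t - X) |Y|^2)' + (2/eps) Im ((t - X) conj(R) Y)], and the integral of
   [(x - X) conj(R(conj x)) Y] over [-X, X] is moved to the other three sides of a tall
   rectangle, where [Y ~ R / lam] makes it negligible or gives it a favourable sign.
   Hence Y, then R, then d vanish. *)

Require Import Defs.
From Stdlib Require Import Reals.
From Coquelicot Require Import Coquelicot.
From Stdlib Require Import Lra Lia List Classical ClassicalEpsilon.

Open Scope R_scope.

(** That the system determines v means that its matrix is injective, and there the obstacle sits at
    +oo. The function Y built from a kernel vector obeys a first order equation and is normalised at
    -oo, so at +oo it may keep a multiple of e^{i lam x / eps}; nothing says beforehand that |Y|^2
    is integrable. The weight t - X vanishes at the right end of [-X, X], so the only boundary term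
    is the one at -X, where Y = O(1/X). On the vertical side above X the oscillating part decays
    like e^{-lam s / eps} in the height s, and the weight is only i s there, so that this part costs
    O(1/X). With X = n^2 and a rectangle of height n^3 all the errors are O(1/n), whereas the
    integrals of the nonnegative |Y|^2 grow with the interval.

    The function Y needs only two of the branches, m = 0 and m = P: below each pole the first one is
    available, above it the second, and together they cover the closed upper half-plane without the
    poles. The intermediate branches serve to prove that these two agree in every strip between
    consecutive poles. *)

Definition Cder (f : C -> C) (x l : C) : Prop :=
  forall e, 0 < e -> exists d, 0 < d /\ forall y, Cmod (y - x) < d ->
    Cmod (f y - f x - l * (y - x))%C <= e * Cmod (y - x).

Definition Ccont (f : C -> C) (x : C) : Prop :=
  forall e, 0 < e -> exists d, 0 < d /\ forall y, Cmod (y - x) < d ->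
    Cmod (f y - f x) < e.

Notation Rder := (is_derive (K := R_AbsRing) (V := C_R_NormedModule)).
Notation Rcont := (continuous (T := R_UniformSpace) (U := C_UniformSpace)).

(** * Elementary inequalities and the rules of calculus for [Cder], [Ccont], [Rder] and [Rcont] *)

Lemma Cmod_triangle_rev (x y : C) : Cmod x - Cmod y <= Cmod (x - y).
Proof.
  replace x with ((x - y) + y)%C at 1 by ring.
  generalize (Cmod_triangle (x - y) y); lra.
Qed.

Lemma Cmod_sub_sym (x y : C) : Cmod (x - y) = Cmod (y - x).
Proof. rewrite <- Cmod_opp. f_equal. ring. Qed.

Lemma im_le_Cmod (x : C) : Rabs (Im x) <= Cmod x.
Proof.
  rewrite <- (Rabs_pos_eq (Cmod x)) by apply Cmod_ge_0.
  apply Rsqr_le_abs_0. rewrite !Rsqr_pow2, Cmod2_alt. generalize (pow2_ge_0 (Re x)); lra.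
Qed.

Lemma Cmod_le_Re_Im (x : C) : Cmod x <= Rabs (Re x) + Rabs (Im x).
Proof.
  rewrite <- (Rabs_pos_eq (Cmod x)) by apply Cmod_ge_0.
  rewrite <- (Rabs_pos_eq (Rabs (Re x) + Rabs (Im x)))
    by (generalize (Rabs_pos (Re x)) (Rabs_pos (Im x)); lra).
  apply Rsqr_le_abs_0. rewrite !Rsqr_pow2, Cmod2_alt.
  rewrite <- (pow2_abs (Re x)), <- (pow2_abs (Im x)).
  generalize (Rabs_pos (Re x)) (Rabs_pos (Im x)); nra.
Qed.

Lemma C_ext (x y : C) : Re x = Re y -> Im x = Im y -> x = y.
Proof. destruct x, y; simpl; intros; subst; reflexivity. Qed.

Lemma re_minus (x y : C) : Re (x - y) = Re x - Re y.
Proof. reflexivity. Qed.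

Lemma im_minus (x y : C) : Im (x - y) = Im x - Im y.
Proof. reflexivity. Qed.

Lemma locally_Cmod (x : C) (P : C -> Prop) :
  locally (T := C_UniformSpace) x P <-> exists d, 0 < d /\ forall y, Cmod (y - x) < d -> P y.
Proof.
  split.
  - intros [d Hd]. exists d. split; [apply cond_pos|].
    intros y Hy. apply Hd, C_NormedModule_mixin_compat1, Hy.
  - intros (d & Hd & H). exists (mkposreal (d / 2) ltac:(lra)). intros y [H1 H2]. apply H.
    change (Rabs (Re y - Re x) < d / 2) in H1. change (Rabs (Im y - Im x) < d / 2) in H2.
    generalize (Cmod_le_Re_Im (y - x)). rewrite re_minus, im_minus. lra.
Qed.

Lemma filterlim_Cmod {T} (F : (T -> Prop) -> Prop) {FF : Filter F} (g : T -> C) (l : C) :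
  filterlim g F (locally (T := C_UniformSpace) l) <->
  (forall e, 0 < e -> F (fun t => Cmod (g t - l) < e)).
Proof.
  split.
  - intros H e He. apply (H (fun y => Cmod (y - l) < e)). apply locally_Cmod. exists e. auto.
  - intros H P HP. apply locally_Cmod in HP. destruct HP as (d & Hd & HP).
    unfold filtermap. apply filter_imp with (2 := H d Hd). intros; auto.
Qed.

Lemma Rcont_iff (g : R -> C) (t : R) :
  Rcont g t <-> forall e, 0 < e -> exists d, 0 < d /\ forall s, Rabs (s - t) < d -> Cmod (g s - g t) < e.
Proof.
  unfold continuous. rewrite filterlim_Cmod by apply _. split; intros H e He.
  - destruct (H e He) as [d Hd]. exists d. split; [apply cond_pos|]. intros s Hs. apply Hd, Hs.
  - destruct (H e He) as (d & Hd & Hs). exists (mkposreal d Hd). intros s H1. apply Hs, H1.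
Qed.

(** The bridge to the derivative that occurs in the definitions. The rules of calculus are proved
    with explicit epsilons in [Cmod]; the equivalence serves where an assumption on a [contour] or
    on an analytic extension enters. *)
Lemma Cder_is_derive (f : C -> C) (x l : C) :
  Cder f x l <-> is_derive (K := C_AbsRing) (V := C_NormedModule) f x l.
Proof.
  split.
  - intros H. split; [apply is_linear_scal_l|].
    intros y Hy. apply (is_filter_lim_locally_unique (K := C_AbsRing) (V := AbsRing_NormedModule C_AbsRing)) in Hy. subst y.
    intros e. destruct (H e (cond_pos e)) as (d & Hd & Hs).
    exists (mkposreal d Hd). intros y Hy.
    change (Cmod (y - x) < d) in Hy. specialize (Hs y Hy).
    change (Cmod (f y - f x - (y - x) * l)%C <= e * Cmod (y - x)).
    replace ((y - x) * l)%C with (l * (y - x))%C by ring. exact Hs.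
  - intros [_ H] e He. specialize (H x (fun P HP => HP) (mkposreal e He)).
    destruct H as [d Hd]. exists d. split; [apply cond_pos|]. intros y Hy.
    specialize (Hd y Hy). simpl in Hd.
    change (Cmod (f y - f x - (y - x) * l)%C <= e * Cmod (y - x)) in Hd.
    replace (l * (y - x))%C with ((y - x) * l)%C by ring. exact Hd.
Qed.

Lemma Rder_iff (g : R -> C) (t : R) (l : C) :
  Rder g t l <-> forall e, 0 < e -> exists d, 0 < d /\ forall s, Rabs (s - t) < d ->
    Cmod (g s - g t - l * RtoC (s - t))%C <= e * Rabs (s - t).
Proof.
  split.
  - intros [_ H] e He. specialize (H t (fun P HP => HP) (mkposreal e He)).
    destruct H as [d Hd]. exists d. split; [apply cond_pos|]. intros s Hs.
    specialize (Hd s Hs). rewrite <- Cmod_norm in Hd.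
    change (Cmod (g s - g t - scal (s - t)%R l)%C <= e * Rabs (s - t)) in Hd.
    rewrite scal_R_Cmult in Hd. rewrite Cmult_comm. exact Hd.
  - intros H. split; [apply is_linear_scal_l|].
    intros y Hy. apply (is_filter_lim_locally_unique (K := R_AbsRing) (V := AbsRing_NormedModule R_AbsRing)) in Hy. subst y.
    intros e. destruct (H e (cond_pos e)) as (d & Hd & Hs).
    exists (mkposreal d Hd). intros s Hst. specialize (Hs s Hst).
    rewrite <- Cmod_norm.
    change (Cmod (g s - g t - scal (s - t)%R l)%C <= e * Rabs (s - t)).
    rewrite scal_R_Cmult, Cmult_comm. exact Hs.
Qed.

Lemma Cder_ext_loc (f g : C -> C) (x l : C) (d : R) :
  0 < d -> (forall y, Cmod (y - x) < d -> f y = g y) -> Cder f x l -> Cder g x l.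
Proof.
  intros Hd Hfg H e He. destruct (H e He) as (d' & Hd' & Hs).
  exists (Rmin d d'). split; [apply Rmin_pos; assumption|].
  intros y Hy. rewrite <- !Hfg.
  - apply Hs. eapply Rlt_le_trans; [exact Hy|apply Rmin_r].
  - replace (x - x)%C with (RtoC 0) by ring. rewrite Cmod_0. exact Hd.
  - eapply Rlt_le_trans; [exact Hy|apply Rmin_l].
Qed.

Lemma Cder_const (k x : C) : Cder (fun _ => k) x 0.
Proof.
  intros e He. exists 1. split; [lra|]. intros y _.
  replace (k - k - 0 * (y - x))%C with (RtoC 0) by ring. rewrite Cmod_0.
  generalize (Cmod_ge_0 (y - x)); nra.
Qed.

Lemma Cder_id (x : C) : Cder (fun y => y) x 1.
Proof.
  intros e He. exists 1. split; [lra|]. intros y _.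
  replace (y - x - 1 * (y - x))%C with (RtoC 0) by ring. rewrite Cmod_0.
  generalize (Cmod_ge_0 (y - x)); nra.
Qed.

Lemma Cder_plus (f g : C -> C) (x l m : C) :
  Cder f x l -> Cder g x m -> Cder (fun y => f y + g y)%C x (l + m)%C.
Proof.
  intros H1 H2 e He.
  destruct (H1 (e / 2)) as (d1 & Hd1 & Hs1); [lra|].
  destruct (H2 (e / 2)) as (d2 & Hd2 & Hs2); [lra|].
  exists (Rmin d1 d2). split; [apply Rmin_pos; assumption|]. intros y Hy.
  specialize (Hs1 y (Rlt_le_trans _ _ _ Hy (Rmin_l _ _))).
  specialize (Hs2 y (Rlt_le_trans _ _ _ Hy (Rmin_r _ _))).
  replace (f y + g y - (f x + g x) - (l + m) * (y - x))%C
    with ((f y - f x - l * (y - x)) + (g y - g x - m * (y - x)))%C by ring.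
  eapply Rle_trans; [apply Cmod_triangle|]. lra.
Qed.

Lemma Cder_cont (f : C -> C) (x l : C) : Cder f x l -> Ccont f x.
Proof.
  intros H e He. destruct (H 1 Rlt_0_1) as (d & Hd & Hs).
  assert (H0 := Cmod_ge_0 l).
  exists (Rmin d (e / (2 + Cmod l))). split.
  { apply Rmin_pos; [assumption|]. apply Rdiv_lt_0_compat; lra. }
  intros y Hy.
  assert (Hy1 := Rlt_le_trans _ _ _ Hy (Rmin_l _ _)).
  assert (Hy2 := Rlt_le_trans _ _ _ Hy (Rmin_r _ _)). specialize (Hs y Hy1).
  replace (f y - f x)%C with ((f y - f x - l * (y - x)) + l * (y - x))%C by ring.
  eapply Rle_lt_trans; [apply Cmod_triangle|]. rewrite Cmod_mult.
  apply (Rmult_lt_compat_r (2 + Cmod l)) in Hy2; [|lra].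
  unfold Rdiv in Hy2. rewrite Rmult_assoc, Rinv_l, Rmult_1_r in Hy2 by lra.
  generalize (Cmod_ge_0 (y - x)); nra.
Qed.

Lemma Ccont_bounded (f : C -> C) (x : C) : Ccont f x ->
  exists d, 0 < d /\ forall y, Cmod (y - x) < d -> Cmod (f y) <= Cmod (f x) + 1.
Proof.
  intros H. destruct (H 1 Rlt_0_1) as (d & Hd & Hs). exists d. split; [assumption|].
  intros y Hy. specialize (Hs y Hy). generalize (Cmod_triangle_rev (f y) (f x)). lra.
Qed.

Lemma Cder_mult (f g : C -> C) (x l m : C) :
  Cder f x l -> Cder g x m -> Cder (fun y => f y * g y)%C x (l * g x + f x * m)%C.
Proof.
  intros H1 H2 e He.
  destruct (Ccont_bounded _ _ (Cder_cont _ _ _ H2)) as (d0 & Hd0 & Hs0).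
  set (K := Cmod (g x) + 1 + Cmod (f x)).
  assert (HK : 1 <= K) by (unfold K; generalize (Cmod_ge_0 (g x)) (Cmod_ge_0 (f x)); lra).
  assert (Hl := Cmod_ge_0 l).
  destruct (H1 (e / (4 * K))) as (d1 & Hd1 & Hs1); [apply Rdiv_lt_0_compat; lra|].
  destruct (H2 (e / (4 * K))) as (d2 & Hd2 & Hs2); [apply Rdiv_lt_0_compat; lra|].
  destruct (Cder_cont _ _ _ H2 (e / (4 * (1 + Cmod l)))) as (d3 & Hd3 & Hs3);
    [apply Rdiv_lt_0_compat; lra|].
  exists (Rmin (Rmin d0 d1) (Rmin d2 d3)). split; [repeat apply Rmin_pos; assumption|]. intros y Hy.
  assert (Hya := Rlt_le_trans _ _ _ Hy (Rmin_l _ _)).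
  assert (Hyb := Rlt_le_trans _ _ _ Hy (Rmin_r _ _)).
  specialize (Hs0 y (Rlt_le_trans _ _ _ Hya (Rmin_l _ _))).
  specialize (Hs1 y (Rlt_le_trans _ _ _ Hya (Rmin_r _ _))).
  specialize (Hs2 y (Rlt_le_trans _ _ _ Hyb (Rmin_l _ _))).
  specialize (Hs3 y (Rlt_le_trans _ _ _ Hyb (Rmin_r _ _))).
  replace (f y * g y - f x * g x - (l * g x + f x * m) * (y - x))%C
    with ((f y - f x - l * (y - x)) * g y + f x * (g y - g x - m * (y - x))
          + l * (y - x) * (g y - g x))%C by ring.
  eapply Rle_trans; [apply Cmod_triangle|].
  eapply Rle_trans; [apply Rplus_le_compat_r, Cmod_triangle|]. rewrite !Cmod_mult.
  set (D := Cmod (y - x)) in *. assert (HD : 0 <= D) by apply Cmod_ge_0.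
  assert (A1 : Cmod (f y - f x - l * (y - x)) * Cmod (g y) <= e / (4 * K) * D * K).
  { apply Rmult_le_compat; try apply Cmod_ge_0; [exact Hs1|].
    unfold K; generalize (Cmod_ge_0 (f x)); lra. }
  assert (A2 : Cmod (f x) * Cmod (g y - g x - m * (y - x)) <= K * (e / (4 * K) * D)).
  { apply Rmult_le_compat; try apply Cmod_ge_0; [|exact Hs2].
    unfold K; generalize (Cmod_ge_0 (g x)); lra. }
  assert (A3 : Cmod l * D * Cmod (g y - g x) <= (1 + Cmod l) * D * (e / (4 * (1 + Cmod l)))).
  { apply Rmult_le_compat; try apply Cmod_ge_0; [nra| |lra].
    apply Rmult_le_compat_r; lra. }
  replace (e / (4 * K) * D * K) with (e / 4 * D) in A1 by (field; lra).
  replace (K * (e / (4 * K) * D)) with (e / 4 * D) in A2 by (field; lra).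
  replace ((1 + Cmod l) * D * (e / (4 * (1 + Cmod l)))) with (e / 4 * D) in A3 by (field; lra).
  nra.
Qed.

Lemma Cder_ext (f g : C -> C) (x l : C) : (forall y, f y = g y) -> Cder f x l -> Cder g x l.
Proof. intros H. apply Cder_ext_loc with (d := 1); [lra|]. auto. Qed.

Lemma Cder_eq (f : C -> C) (x l m : C) : l = m -> Cder f x l -> Cder f x m.
Proof. intros ->; auto. Qed.

Lemma Cder_scal (k : C) (f : C -> C) (x l : C) : Cder f x l -> Cder (fun y => k * f y)%C x (k * l)%C.
Proof.
  intros H. eapply Cder_eq; [|apply Cder_mult; [apply Cder_const|exact H]]. simpl; ring.
Qed.

Lemma Cder_minus (f g : C -> C) (x l m : C) :
  Cder f x l -> Cder g x m -> Cder (fun y => f y - g y)%C x (l - m)%C.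
Proof.
  intros H1 H2. apply Cder_ext with (f := fun y => (f y + (-1) * g y)%C); [intros; ring|].
  eapply Cder_eq; [|apply Cder_plus; [exact H1|apply Cder_scal, H2]]. ring.
Qed.

Lemma Cder_comp (f g : C -> C) (x l m : C) :
  Cder f (g x) l -> Cder g x m -> Cder (fun y => f (g y)) x (l * m)%C.
Proof.
  intros H1 H2 e He.
  assert (Hl := Cmod_ge_0 l). assert (Hm := Cmod_ge_0 m).
  destruct (H2 (Rmin 1 (e / (2 * (1 + Cmod l))))) as (d2 & Hd2 & Hs2).
  { apply Rmin_pos; [lra|]. apply Rdiv_lt_0_compat; lra. }
  destruct (H1 (e / (2 * (1 + Cmod m)))) as (d1 & Hd1 & Hs1); [apply Rdiv_lt_0_compat; lra|].
  destruct (Cder_cont _ _ _ H2 d1 Hd1) as (d3 & Hd3 & Hs3).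
  exists (Rmin d2 d3). split; [apply Rmin_pos; assumption|]. intros y Hy.
  specialize (Hs2 y (Rlt_le_trans _ _ _ Hy (Rmin_l _ _))).
  specialize (Hs3 y (Rlt_le_trans _ _ _ Hy (Rmin_r _ _))).
  specialize (Hs1 (g y) Hs3).
  set (D := Cmod (y - x)) in *. assert (HD : 0 <= D) by apply Cmod_ge_0.
  assert (B : Cmod (g y - g x) <= (1 + Cmod m) * D).
  { replace (g y - g x)%C with ((g y - g x - m * (y - x)) + m * (y - x))%C by ring.
    eapply Rle_trans; [apply Cmod_triangle|]. rewrite Cmod_mult. fold D.
    assert (Rmin 1 (e / (2 * (1 + Cmod l))) * D <= 1 * D)
      by (apply Rmult_le_compat_r; [assumption|apply Rmin_l]). lra. }
  assert (B2 : Cmod (g y - g x - m * (y - x)) <= e / (2 * (1 + Cmod l)) * D).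
  { eapply Rle_trans; [exact Hs2|]. apply Rmult_le_compat_r; [assumption|apply Rmin_r]. }
  replace (f (g y) - f (g x) - l * m * (y - x))%C
    with ((f (g y) - f (g x) - l * (g y - g x)) + l * (g y - g x - m * (y - x)))%C by ring.
  eapply Rle_trans; [apply Cmod_triangle|]. rewrite Cmod_mult.
  assert (A1 : Cmod (f (g y) - f (g x) - l * (g y - g x)) <= e / 2 * D).
  { eapply Rle_trans; [exact Hs1|].
    replace (e / 2 * D) with (e / (2 * (1 + Cmod m)) * ((1 + Cmod m) * D)) by (field; lra).
    apply Rmult_le_compat_l; [|exact B]. apply Rlt_le, Rdiv_lt_0_compat; lra. }
  assert (A2 : Cmod l * Cmod (g y - g x - m * (y - x)) <= (1 + Cmod l) * (e / (2 * (1 + Cmod l)) * D)).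
  { apply Rmult_le_compat; try apply Cmod_ge_0; lra. }
  replace ((1 + Cmod l) * (e / (2 * (1 + Cmod l)) * D)) with (e / 2 * D) in A2 by (field; lra).
  lra.
Qed.

Lemma Cder_inv (x : C) : x <> 0 -> Cder Cinv x (- / (x * x))%C.
Proof.
  intros Hx e He. assert (Hc : 0 < Cmod x) by (apply Cmod_gt_0; assumption).
  set (r := Cmod x) in *.
  exists (Rmin (r / 2) (e * r * r * r / 2)). split.
  { apply Rmin_pos; [lra|]. assert (0 < e * r * r * r) by (repeat apply Rmult_lt_0_compat; assumption). lra. }
  intros y Hy.
  assert (Hya := Rlt_le_trans _ _ _ Hy (Rmin_l _ _)).
  assert (Hyb := Rlt_le_trans _ _ _ Hy (Rmin_r _ _)).
  assert (Hry : r / 2 < Cmod y).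
  { generalize (Cmod_triangle_rev x (x - y)). replace (x - (x - y))%C with y by ring.
    rewrite (Cmod_sub_sym x y). fold r. lra. }
  assert (Hy0 : y <> 0) by (apply Cmod_gt_0; lra).
  replace (/ y - / x - - / (x * x) * (y - x))%C with ((y - x) * (y - x) / (x * x * y))%C
    by (field; split; assumption).
  rewrite Cmod_div by (repeat apply Cmult_neq_0; assumption).
  rewrite !Cmod_mult. fold r. set (D := Cmod (y - x)) in *. assert (HD : 0 <= D) by apply Cmod_ge_0.
  apply Rle_div_l; [repeat apply Rmult_lt_0_compat; lra|].
  rewrite Rmult_comm with (r1 := e), Rmult_assoc. apply Rmult_le_compat_l; [assumption|].
  apply Rle_trans with (e * r * r * r / 2); [lra|].
  replace (e * (r * r * Cmod y)) with (e * r * r * Cmod y) by ring.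
  replace (e * r * r * r / 2) with (e * r * r * (r / 2)) by field.
  apply Rmult_le_compat_l; [|lra]. repeat apply Rmult_le_pos; lra.
Qed.

Lemma Cder_inv_comp (g : C -> C) (x m : C) :
  g x <> 0 -> Cder g x m -> Cder (fun y => / g y)%C x (- m / (g x * g x))%C.
Proof.
  intros H0 H. eapply Cder_eq; [|apply Cder_comp; [apply Cder_inv, H0|exact H]].
  field; assumption.
Qed.

Lemma Cder_div (f g : C -> C) (x l m : C) : g x <> 0 -> Cder f x l -> Cder g x m ->
  Cder (fun y => f y / g y)%C x ((l * g x - f x * m) / (g x * g x))%C.
Proof.
  intros H0 H1 H2. apply (Cder_eq (fun y => f y * / g y)%C x (l * / g x + f x * (- m / (g x * g x)))%C); [|apply (Cder_mult f (fun y => / g y)%C); [exact H1|apply (Cder_inv_comp g); assumption]].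
  field; assumption.
Qed.

Lemma Cder_unique (f : C -> C) (x l m : C) : Cder f x l -> Cder f x m -> l = m.
Proof.
  intros H1 H2. destruct (Ceq_dec l m) as [|Hn]; [assumption|exfalso].
  assert (Hp : 0 < Cmod (l - m)) by (apply Cmod_gt_0, Cminus_eq_contra, Hn).
  destruct (H1 (Cmod (l - m) / 4)) as (d1 & Hd1 & Hs1); [lra|].
  destruct (H2 (Cmod (l - m) / 4)) as (d2 & Hd2 & Hs2); [lra|].
  assert (Hd : 0 < Rmin d1 d2) by (apply Rmin_pos; assumption).
  set (y := (x + RtoC (Rmin d1 d2 / 2))%C).
  assert (Hy : (y - x)%C = RtoC (Rmin d1 d2 / 2)) by (unfold y; ring).
  assert (Hyn : Cmod (y - x) = Rmin d1 d2 / 2) by (rewrite Hy, Cmod_R, Rabs_pos_eq; lra).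
  generalize (Rmin_l d1 d2) (Rmin_r d1 d2); intros.
  assert (A1 := Hs1 y ltac:(lra)). assert (A2 := Hs2 y ltac:(lra)).
  assert (Cmod ((l - m) * (y - x)) <= Cmod (l - m) / 2 * Cmod (y - x)).
  { replace ((l - m) * (y - x))%C with ((f y - f x - m * (y - x)) - (f y - f x - l * (y - x)))%C by ring.
    eapply Rle_trans; [apply Cmod_triangle|]. rewrite Cmod_opp. lra. }
  rewrite Cmod_mult in H3. rewrite Hyn in H3. nra.
Qed.

(** The mixed chain rule: it turns a primitive in the plane into a primitive along a parametrized
    curve. *)
Lemma Cder_Rder (f : C -> C) (g : R -> C) (t : R) (l m : C) :
  Cder f (g t) l -> Rder g t m -> Rder (fun s => f (g s)) t (l * m)%C.
Proof.
  rewrite !Rder_iff. intros H1 H2 e He.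
  assert (Hl := Cmod_ge_0 l). assert (Hm := Cmod_ge_0 m).
  destruct (H2 (Rmin 1 (e / (2 * (1 + Cmod l))))) as (d2 & Hd2 & Hs2).
  { apply Rmin_pos; [lra|]. apply Rdiv_lt_0_compat; lra. }
  destruct (H1 (e / (2 * (1 + Cmod m)))) as (d1 & Hd1 & Hs1); [apply Rdiv_lt_0_compat; lra|].
  exists (Rmin d2 (d1 / (1 + Cmod m))). split.
  { apply Rmin_pos; [assumption|]. apply Rdiv_lt_0_compat; lra. }
  intros y Hy.
  assert (Hy3 := Rlt_le_trans _ _ _ Hy (Rmin_r _ _)).
  specialize (Hs2 y (Rlt_le_trans _ _ _ Hy (Rmin_l _ _))).
  set (D := Rabs (y - t)) in *. assert (HD : 0 <= D) by apply Rabs_pos.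
  assert (B : Cmod (g y - g t) <= (1 + Cmod m) * D).
  { replace (g y - g t)%C with ((g y - g t - m * RtoC (y - t)) + m * RtoC (y - t))%C by ring.
    eapply Rle_trans; [apply Cmod_triangle|]. rewrite Cmod_mult, Cmod_R. fold D.
    assert (Rmin 1 (e / (2 * (1 + Cmod l))) * D <= 1 * D)
      by (apply Rmult_le_compat_r; [assumption|apply Rmin_l]). lra. }
  specialize (Hs1 (g y)). lapply Hs1; clear Hs1; [intros Hs1|].
  2:{ eapply Rle_lt_trans; [exact B|]. apply Rlt_div_r in Hy3; lra. }
  assert (B2 : Cmod (g y - g t - m * RtoC (y - t)) <= e / (2 * (1 + Cmod l)) * D).
  { eapply Rle_trans; [exact Hs2|]. apply Rmult_le_compat_r; [assumption|apply Rmin_r]. }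
  replace (f (g y) - f (g t) - l * m * RtoC (y - t))%C
    with ((f (g y) - f (g t) - l * (g y - g t)) + l * (g y - g t - m * RtoC (y - t)))%C by ring.
  eapply Rle_trans; [apply Cmod_triangle|]. rewrite Cmod_mult.
  assert (A1 : Cmod (f (g y) - f (g t) - l * (g y - g t)) <= e / 2 * D).
  { eapply Rle_trans; [exact Hs1|].
    replace (e / 2 * D) with (e / (2 * (1 + Cmod m)) * ((1 + Cmod m) * D)) by (field; lra).
    apply Rmult_le_compat_l; [|exact B]. apply Rlt_le, Rdiv_lt_0_compat; lra. }
  assert (A2 : Cmod l * Cmod (g y - g t - m * RtoC (y - t)) <= (1 + Cmod l) * (e / (2 * (1 + Cmod l)) * D)).
  { apply Rmult_le_compat; try apply Cmod_ge_0; lra. }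
  replace ((1 + Cmod l) * (e / (2 * (1 + Cmod l)) * D)) with (e / 2 * D) in A2 by (field; lra).
  lra.
Qed.

Lemma Rder_eq (g : R -> C) (t : R) (l m : C) : l = m -> Rder g t l -> Rder g t m.
Proof. intros ->; auto. Qed.

Lemma Rder_affine (a k : C) (t : R) : Rder (fun s => a + k * RtoC s)%C t k.
Proof.
  apply Rder_iff. intros e He. exists 1. split; [lra|]. intros s _.
  replace (a + k * RtoC s - (a + k * RtoC t) - k * RtoC (s - t))%C with (RtoC 0)
    by (rewrite RtoC_minus; ring).
  rewrite Cmod_0. generalize (Rabs_pos (s - t)); nra.
Qed.

Lemma Rder_plus (g k : R -> C) (t : R) (l m : C) :
  Rder g t l -> Rder k t m -> Rder (fun s => g s + k s)%C t (l + m)%C.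
Proof. apply (is_derive_plus (K := R_AbsRing) (V := C_R_NormedModule)). Qed.

Lemma Rder_scal (k : C) (g : R -> C) (t : R) (l : C) :
  Rder g t l -> Rder (fun s => k * g s)%C t (k * l)%C.
Proof.
  intros H. apply (Cder_Rder (fun y => k * y)%C g t k l); [|exact H].
  eapply Cder_eq; [|apply Cder_scal, Cder_id]. ring.
Qed.

(** By polarization, 4 g k = (g + k)^2 - (g - k)^2, the product rule reduces to squares, and a
    square is differentiated by the chain rule [Cder_Rder]. *)
Lemma Rder_mult (g k : R -> C) (t : R) (l m : C) :
  Rder g t l -> Rder k t m -> Rder (fun s => g s * k s)%C t (l * k t + g t * m)%C.
Proof.
  intros H1 H2.
  apply is_derive_ext with (f := fun s => (/ 4 * ((g s + k s) * (g s + k s) - (g s - k s) * (g s - k s)))%C).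
  { intros s. match goal with |- ?a = ?b => change (@eq C a b) end. field. }
  assert (S : forall (q : R -> C) (n : C), Rder q t n -> Rder (fun s => q s * q s)%C t (2 * q t * n)%C).
  { intros q n Hq. apply (Cder_Rder (fun y => y * y)%C q t (2 * q t)%C n); [|exact Hq].
    apply (Cder_eq _ _ (1 * q t + q t * 1)%C); [ring|]. apply (Cder_mult (fun y => y) (fun y => y)); apply Cder_id. }
  assert (Hm : Rder (fun s => g s - k s)%C t (l - m)%C).
  { apply (is_derive_minus (K := R_AbsRing) (V := C_R_NormedModule)); assumption. }
  eapply Rder_eq; [|apply Rder_scal; apply (is_derive_minus (K := R_AbsRing) (V := C_R_NormedModule));
    apply S; [apply Rder_plus; eassumption|exact Hm]].
  change (/ 4 * (2 * (g t + k t) * (l + m) - 2 * (g t - k t) * (l - m)) = l * k t + g t * m)%C. field.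
Qed.

Lemma Rder_cont (g : R -> C) (t : R) (l : C) : Rder g t l -> Rcont g t.
Proof.
  intros H. apply (ex_derive_continuous (K := R_AbsRing) (V := C_R_NormedModule)). exists l. exact H.
Qed.

Lemma Ccont_const (k x : C) : Ccont (fun _ => k) x.
Proof. eapply Cder_cont, Cder_const. Qed.

Lemma Ccont_id (x : C) : Ccont (fun y => y) x.
Proof. eapply Cder_cont, Cder_id. Qed.

Lemma Ccont_plus (f g : C -> C) (x : C) : Ccont f x -> Ccont g x -> Ccont (fun y => f y + g y)%C x.
Proof.
  intros H1 H2 e He.
  destruct (H1 (e / 2)) as (d1 & Hd1 & Hs1); [lra|].
  destruct (H2 (e / 2)) as (d2 & Hd2 & Hs2); [lra|].
  exists (Rmin d1 d2). split; [apply Rmin_pos; assumption|]. intros y Hy.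
  specialize (Hs1 y (Rlt_le_trans _ _ _ Hy (Rmin_l _ _))).
  specialize (Hs2 y (Rlt_le_trans _ _ _ Hy (Rmin_r _ _))).
  replace (f y + g y - (f x + g x))%C with ((f y - f x) + (g y - g x))%C by ring.
  eapply Rle_lt_trans; [apply Cmod_triangle|]. lra.
Qed.

Lemma Ccont_mult (f g : C -> C) (x : C) : Ccont f x -> Ccont g x -> Ccont (fun y => f y * g y)%C x.
Proof.
  intros H1 H2 e He.
  destruct (Ccont_bounded _ _ H2) as (d0 & Hd0 & Hs0).
  assert (Hg := Cmod_ge_0 (g x)). assert (Hf := Cmod_ge_0 (f x)).
  destruct (H1 (e / (2 * (Cmod (g x) + 1)))) as (d1 & Hd1 & Hs1); [apply Rdiv_lt_0_compat; lra|].
  destruct (H2 (e / (2 * (Cmod (f x) + 1)))) as (d2 & Hd2 & Hs2); [apply Rdiv_lt_0_compat; lra|].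
  exists (Rmin d0 (Rmin d1 d2)). split; [repeat apply Rmin_pos; assumption|]. intros y Hy.
  assert (Hyb := Rlt_le_trans _ _ _ Hy (Rmin_r _ _)).
  specialize (Hs0 y (Rlt_le_trans _ _ _ Hy (Rmin_l _ _))).
  specialize (Hs1 y (Rlt_le_trans _ _ _ Hyb (Rmin_l _ _))).
  specialize (Hs2 y (Rlt_le_trans _ _ _ Hyb (Rmin_r _ _))).
  replace (f y * g y - f x * g x)%C with ((f y - f x) * g y + f x * (g y - g x))%C by ring.
  eapply Rle_lt_trans; [apply Cmod_triangle|]. rewrite !Cmod_mult.
  assert (A1 : Cmod (f y - f x) * Cmod (g y) <= Cmod (f y - f x) * (Cmod (g x) + 1)).
  { apply Rmult_le_compat_l; [apply Cmod_ge_0|exact Hs0]. }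
  assert (A2 : Cmod (f x) * Cmod (g y - g x) <= (Cmod (f x) + 1) * Cmod (g y - g x)).
  { apply Rmult_le_compat_r; [apply Cmod_ge_0|lra]. }
  apply Rlt_div_r in Hs1; [|lra]. apply Rlt_div_r in Hs2; [|lra].
  assert (B1 : Cmod (f y - f x) * (Cmod (g x) + 1) < e / 2) by nra.
  assert (B2 : (Cmod (f x) + 1) * Cmod (g y - g x) < e / 2) by nra. lra.
Qed.

Lemma Ccont_comp (f g : C -> C) (x : C) : Ccont f (g x) -> Ccont g x -> Ccont (fun y => f (g y)) x.
Proof.
  intros H1 H2 e He. destruct (H1 e He) as (d1 & Hd1 & Hs1).
  destruct (H2 d1 Hd1) as (d2 & Hd2 & Hs2). exists d2. auto.
Qed.

Lemma Ccont_minus (f g : C -> C) (x : C) : Ccont f x -> Ccont g x -> Ccont (fun y => f y - g y)%C x.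
Proof.
  intros H1 H2. apply (Ccont_plus f (fun y => - g y)%C x H1).
  apply (Ccont_comp Copp g); [|exact H2]. intros e He. exists e. split; [exact He|].
  intros y Hy. replace (- y - - g x)%C with (- (y - g x))%C by ring. rewrite Cmod_opp. exact Hy.
Qed.

Lemma Ccont_inv (g : C -> C) (x : C) : g x <> 0 -> Ccont g x -> Ccont (fun y => / g y)%C x.
Proof. intros H0 H. apply (Ccont_comp Cinv g); [|exact H]. eapply Cder_cont, Cder_inv, H0. Qed.

Lemma Ccont_div (f g : C -> C) (x : C) : g x <> 0 -> Ccont f x -> Ccont g x -> Ccont (fun y => f y / g y)%C x.
Proof. intros H0 H1 H2. apply Ccont_mult; [exact H1|apply Ccont_inv; assumption]. Qed.

Lemma Ccont_ext_loc (f g : C -> C) (x : C) (d : R) :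
  0 < d -> (forall y, Cmod (y - x) < d -> f y = g y) -> Ccont f x -> Ccont g x.
Proof.
  intros Hd Hfg H e He. destruct (H e He) as (d' & Hd' & Hs).
  exists (Rmin d d'). split; [apply Rmin_pos; assumption|].
  intros y Hy. rewrite <- !Hfg.
  - apply Hs. eapply Rlt_le_trans; [exact Hy|apply Rmin_r].
  - replace (x - x)%C with (RtoC 0) by ring. rewrite Cmod_0. exact Hd.
  - eapply Rlt_le_trans; [exact Hy|apply Rmin_l].
Qed.

Lemma Ccont_Rcont (f : C -> C) (g : R -> C) (t : R) :
  Ccont f (g t) -> Rcont g t -> Rcont (fun s => f (g s)) t.
Proof.
  rewrite !Rcont_iff. intros H1 H2 e He. destruct (H1 e He) as (d1 & Hd1 & Hs1).
  destruct (H2 d1 Hd1) as (d2 & Hd2 & Hs2). exists d2. auto.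
Qed.

Lemma Rcont_affine (a k : C) (t : R) : Rcont (fun s => a + k * RtoC s)%C t.
Proof. eapply Rder_cont, Rder_affine. Qed.

Lemma Rcont_mult (g k : R -> C) (t : R) : Rcont g t -> Rcont k t -> Rcont (fun s => g s * k s)%C t.
Proof.
  rewrite !Rcont_iff. intros H1 H2 e He.
  destruct (H2 1 Rlt_0_1) as (d0 & Hd0 & Hs0).
  assert (Hg := Cmod_ge_0 (g t)). assert (Hk := Cmod_ge_0 (k t)).
  destruct (H1 (e / (2 * (Cmod (k t) + 1)))) as (d1 & Hd1 & Hs1); [apply Rdiv_lt_0_compat; lra|].
  destruct (H2 (e / (2 * (Cmod (g t) + 1)))) as (d2 & Hd2 & Hs2); [apply Rdiv_lt_0_compat; lra|].
  exists (Rmin d0 (Rmin d1 d2)). split; [repeat apply Rmin_pos; assumption|]. intros y Hy.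
  assert (Hyb := Rlt_le_trans _ _ _ Hy (Rmin_r _ _)).
  specialize (Hs0 y (Rlt_le_trans _ _ _ Hy (Rmin_l _ _))).
  specialize (Hs1 y (Rlt_le_trans _ _ _ Hyb (Rmin_l _ _))).
  specialize (Hs2 y (Rlt_le_trans _ _ _ Hyb (Rmin_r _ _))).
  assert (Hs3 : Cmod (k y) <= Cmod (k t) + 1) by (generalize (Cmod_triangle_rev (k y) (k t)); lra).
  replace (g y * k y - g t * k t)%C with ((g y - g t) * k y + g t * (k y - k t))%C by ring.
  eapply Rle_lt_trans; [apply Cmod_triangle|]. rewrite !Cmod_mult.
  assert (A1 : Cmod (g y - g t) * Cmod (k y) <= Cmod (g y - g t) * (Cmod (k t) + 1)).
  { apply Rmult_le_compat_l; [apply Cmod_ge_0|exact Hs3]. }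
  assert (A2 : Cmod (g t) * Cmod (k y - k t) <= (Cmod (g t) + 1) * Cmod (k y - k t)).
  { apply Rmult_le_compat_r; [apply Cmod_ge_0|lra]. }
  apply Rlt_div_r in Hs1; [|lra]. apply Rlt_div_r in Hs2; [|lra].
  assert (B1 : Cmod (g y - g t) * (Cmod (k t) + 1) < e / 2) by nra.
  assert (B2 : (Cmod (g t) + 1) * Cmod (k y - k t) < e / 2) by nra. lra.
Qed.

Lemma Rcont_plus (g k : R -> C) (t : R) : Rcont g t -> Rcont k t -> Rcont (fun s => g s + k s)%C t.
Proof. apply (continuous_plus (K := R_AbsRing) (V := C_R_NormedModule)). Qed.

(** * Integrals of complex-valued functions over real intervals *)

Definition CI (F : R -> C) (a b : R) : C := RInt (V := C_R_CompleteNormedModule) F a b.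

Definition ex_CI (F : R -> C) (a b : R) : Prop := ex_RInt (V := C_R_NormedModule) F a b.
Notation is_CI := (is_RInt (V := C_R_NormedModule)).

Lemma is_CI_unique (F : R -> C) (a b : R) (l : C) : is_CI F a b l -> CI F a b = l.
Proof. apply (is_RInt_unique (V := C_R_CompleteNormedModule)). Qed.

Lemma CI_correct (F : R -> C) (a b : R) : ex_CI F a b -> is_CI F a b (CI F a b).
Proof. apply (RInt_correct (V := C_R_CompleteNormedModule)). Qed.

Lemma ex_CI_cont (F : R -> C) (a b : R) :
  (forall t, Rmin a b <= t <= Rmax a b -> Rcont F t) -> ex_CI F a b.
Proof. apply (ex_RInt_continuous (V := C_R_CompleteNormedModule)). Qed.

Lemma is_CI_FTC (Phi F : R -> C) (a b : R) :
  (forall t, Rmin a b <= t <= Rmax a b -> Rder Phi t (F t)) ->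
  (forall t, Rmin a b <= t <= Rmax a b -> Rcont F t) ->
  is_CI F a b (Phi b - Phi a)%C.
Proof. apply (is_RInt_derive (V := C_R_CompleteNormedModule)). Qed.

Lemma CI_FTC (Phi F : R -> C) (a b : R) :
  (forall t, Rmin a b <= t <= Rmax a b -> Rder Phi t (F t)) ->
  (forall t, Rmin a b <= t <= Rmax a b -> Rcont F t) ->
  CI F a b = (Phi b - Phi a)%C.
Proof. intros; apply is_CI_unique, is_CI_FTC; assumption. Qed.

Lemma CI_Chasles (F : R -> C) (a b c : R) :
  ex_CI F a b -> ex_CI F b c -> (CI F a b + CI F b c)%C = CI F a c.
Proof. apply (RInt_Chasles (V := C_R_CompleteNormedModule)). Qed.

Lemma CI_ext (F G : R -> C) (a b : R) :
  (forall t, Rmin a b < t < Rmax a b -> F t = G t) -> CI F a b = CI G a b.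
Proof. apply (RInt_ext (V := C_R_CompleteNormedModule)). Qed.

Lemma CI_plus (F G : R -> C) (a b : R) : ex_CI F a b -> ex_CI G a b ->
  CI (fun t => F t + G t)%C a b = (CI F a b + CI G a b)%C.
Proof. apply (RInt_plus (V := C_R_CompleteNormedModule)). Qed.

Lemma CI_minus (F G : R -> C) (a b : R) : ex_CI F a b -> ex_CI G a b ->
  CI (fun t => F t - G t)%C a b = (CI F a b - CI G a b)%C.
Proof. apply (RInt_minus (V := C_R_CompleteNormedModule)). Qed.

Lemma ex_CI_minus (F G : R -> C) (a b : R) : ex_CI F a b -> ex_CI G a b -> ex_CI (fun t => F t - G t)%C a b.
Proof. apply (ex_RInt_minus (V := C_R_NormedModule)). Qed.

Lemma is_CI_pair (F : R -> C) (a b : R) (l : C) :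
  is_CI F a b l <->
  is_RInt (fun t => Re (F t)) a b (Re l) /\ is_RInt (fun t => Im (F t)) a b (Im l).
Proof.
  split.
  - intros H. split.
    + apply (is_RInt_fct_extend_fst (U := R_NormedModule) (V := R_NormedModule) F a b l H).
    + apply (is_RInt_fct_extend_snd (U := R_NormedModule) (V := R_NormedModule) F a b l H).
  - intros [H1 H2]. rewrite (surjective_pairing l).
    apply (is_RInt_fct_extend_pair (U := R_NormedModule) (V := R_NormedModule) F a b _ _ H1 H2).
Qed.

(** The scalars of the module in which the integral lives are real, so a complex factor is treated
    on real and imaginary parts. *)
Lemma is_CI_scal (k : C) (F : R -> C) (a b : R) (l : C) :
  is_CI F a b l -> is_CI (fun t => k * F t)%C a b (k * l)%C.
Proof.
  rewrite !is_CI_pair. intros [H1 H2]. split; simpl.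
  - apply (is_RInt_minus (V := R_NormedModule)); apply (is_RInt_scal (V := R_NormedModule)); assumption.
  - apply (is_RInt_plus (V := R_NormedModule)); apply (is_RInt_scal (V := R_NormedModule)); assumption.
Qed.

Lemma CI_scal (k : C) (F : R -> C) (a b : R) : ex_CI F a b ->
  CI (fun t => k * F t)%C a b = (k * CI F a b)%C.
Proof. intros H. apply is_CI_unique, is_CI_scal, CI_correct, H. Qed.

Lemma CI_bound (F : R -> C) (a b K : R) : a <= b -> ex_CI F a b ->
  (forall t, a <= t <= b -> Cmod (F t) <= K) -> Cmod (CI F a b) <= K * (b - a).
Proof.
  intros Hab Hex HK. rewrite Cmod_norm, Rmult_comm.
  apply (norm_RInt_le_const (V := C_R_NormedModule)) with (f := F); [assumption| |apply CI_correct, Hex].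
  intros t Ht. rewrite <- Cmod_norm. apply HK, Ht.
Qed.

Lemma is_CI_swap (F : R -> C) (a b : R) (l : C) : is_CI F a b l -> is_CI F b a (- l)%C.
Proof. apply (is_RInt_swap (V := C_R_NormedModule)). Qed.

Lemma CI_swap (F : R -> C) (a b : R) : ex_CI F a b -> CI F b a = (- CI F a b)%C.
Proof. intros H. apply is_CI_unique, is_CI_swap, CI_correct, H. Qed.

Lemma Cmod_CI_dist (F : R -> C) (a b K : R) :
  (forall t, Rmin a b <= t <= Rmax a b -> Rcont F t) ->
  (forall t, Rmin a b <= t <= Rmax a b -> Cmod (F t) <= K) -> Cmod (CI F a b) <= K * Rabs (b - a).
Proof.
  intros Hc HK. destruct (Rle_dec a b) as [H|H].
  - rewrite Rmin_left, Rmax_right in * by assumption. rewrite Rabs_pos_eq by lra.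
    apply CI_bound; auto. apply ex_CI_cont. rewrite Rmin_left, Rmax_right by assumption. auto.
  - assert (Hex : ex_CI F b a) by (apply ex_CI_cont; rewrite Rmin_comm, Rmax_comm; auto).
    rewrite Rmin_right, Rmax_left in * by lra. rewrite CI_swap by assumption.
    rewrite Cmod_opp, Rabs_left1 by lra. replace (- (b - a)) with (a - b) by ring.
    apply CI_bound; auto; lra.
Qed.

Lemma Rder_bound (Phi F : R -> C) (a b K : R) :
  (forall t, Rmin a b <= t <= Rmax a b -> Rder Phi t (F t)) ->
  (forall t, Rmin a b <= t <= Rmax a b -> Rcont F t) ->
  (forall t, Rmin a b <= t <= Rmax a b -> Cmod (F t) <= K) ->
  Cmod (Phi b - Phi a) <= K * Rabs (b - a).
Proof.
  intros Hd Hc HK. rewrite <- (CI_FTC Phi F) by assumption. apply Cmod_CI_dist; assumption.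
Qed.

Lemma Rder_zero_const (Phi : R -> C) (a b : R) :
  (forall t, Rmin a b <= t <= Rmax a b -> Rder Phi t (RtoC 0)) -> Phi a = Phi b.
Proof.
  intros Hd. assert (H : Cmod (Phi b - Phi a) <= 0 * Rabs (b - a)).
  { apply Rder_bound with (F := fun _ => RtoC 0); [assumption| |].
    - intros; apply continuous_const.
    - intros; rewrite Cmod_0; lra. }
  rewrite Rmult_0_l in H. symmetry. apply Ceq_minus, Cmod_eq_0.
  generalize (Cmod_ge_0 (Phi b - Phi a)); lra.
Qed.

Lemma Rder_horiz (c t : R) : Rder (fun x => (x, c) : C) t (RtoC 1).
Proof.
  apply (is_derive_ext (K := R_AbsRing) (V := C_R_NormedModule)) with (f := fun x => ((0, c) + 1 * RtoC x)%C).
  - intros s. apply C_ext; simpl; ring.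
  - apply Rder_affine.
Qed.

Lemma Rder_vert (a t : R) : Rder (fun y => (a, y) : C) t Ci.
Proof.
  apply (is_derive_ext (K := R_AbsRing) (V := C_R_NormedModule)) with (f := fun x => ((a, 0) + Ci * RtoC x)%C).
  - intros s. apply C_ext; simpl; ring.
  - apply Rder_affine.
Qed.

Lemma Ccont_horiz (f : C -> C) (c t : R) : Ccont f (t, c) -> Rcont (fun x => f (x, c)) t.
Proof. intros H. apply (Ccont_Rcont f (fun x => (x, c))); [exact H|]. eapply Rder_cont, Rder_horiz. Qed.

Lemma Ccont_vert (f : C -> C) (a t : R) : Ccont f (a, t) -> Rcont (fun y => f (a, y)) t.
Proof. intros H. apply (Ccont_Rcont f (fun y => (a, y))); [exact H|]. eapply Rder_cont, Rder_vert. Qed.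

Lemma Cder_horiz (f : C -> C) (c t : R) (l : C) : Cder f (t, c) l -> Rder (fun x => f (x, c)) t l.
Proof.
  intros H. eapply Rder_eq; [|apply (Cder_Rder f (fun x => (x, c))); [exact H|apply Rder_horiz]]. ring.
Qed.

Lemma Cder_vert (f : C -> C) (a t : R) (l : C) : Cder f (a, t) l -> Rder (fun y => f (a, y)) t (l * Ci)%C.
Proof. intros H. apply (Cder_Rder f (fun y => (a, y))); [exact H|apply Rder_vert]. Qed.

(** * Goursat's theorem and Cauchy's formula on rectangles *)

(** The integral of f dz along the boundary of the rectangle, counterclockwise when a <= b and c <=
    d. No order of the bounds is built in, so that swapping two of them changes the sign. *)
Definition RI (f : C -> C) (a b c d : R) : C :=
  (CI (fun x => f (x, c)) a b + Ci * CI (fun y => f (b, y)) c d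
   - CI (fun x => f (x, d)) a b - Ci * CI (fun y => f (a, y)) c d)%C.

Definition rect_cont (f : C -> C) (a b c d : R) : Prop :=
  forall x y, a <= x <= b -> c <= y <= d -> Ccont f (x, y).

Lemma ex_CI_horiz (f : C -> C) (a b c : R) : a <= b ->
  (forall x, a <= x <= b -> Ccont f (x, c)) -> ex_CI (fun x => f (x, c)) a b.
Proof.
  intros Hab H. apply ex_CI_cont. rewrite Rmin_left, Rmax_right by assumption.
  intros; apply Ccont_horiz; auto.
Qed.

Lemma ex_CI_vert (f : C -> C) (a c d : R) : c <= d ->
  (forall y, c <= y <= d -> Ccont f (a, y)) -> ex_CI (fun y => f (a, y)) c d.
Proof.
  intros Hab H. apply ex_CI_cont. rewrite Rmin_left, Rmax_right by assumption.
  intros; apply Ccont_vert; auto.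
Qed.

Ltac exci :=
  lazymatch goal with
  | |- ex_CI (fun x => ?f (x, ?c)) _ _ => apply (ex_CI_horiz f)
  | |- ex_CI (fun x => ?f (?c, x)) _ _ => apply (ex_CI_vert f)
  end; [lra|];
  intros; match goal with
  | H : rect_cont ?f _ _ _ _ |- Ccont ?f _ => apply H; lra
  | H : forall x, _ -> Ccont ?f _ /\ _ |- Ccont ?f _ => apply H; lra
  end.

Lemma RI_split_v (f : C -> C) (a m b c d : R) : a <= m <= b -> c <= d ->
  rect_cont f a b c d -> RI f a b c d = (RI f a m c d + RI f m b c d)%C.
Proof.
  intros Hm Hcd H. unfold RI.
  rewrite <- (CI_Chasles (fun x => f (x, c)) a m b) by exci.
  rewrite <- (CI_Chasles (fun x => f (x, d)) a m b) by exci. ring.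
Qed.

Lemma RI_split_h (f : C -> C) (a b c m d : R) : a <= b -> c <= m <= d ->
  rect_cont f a b c d -> RI f a b c d = (RI f a b c m + RI f a b m d)%C.
Proof.
  intros Hm Hcd H. unfold RI.
  rewrite <- (CI_Chasles (fun y => f (a, y)) c m d) by exci.
  rewrite <- (CI_Chasles (fun y => f (b, y)) c m d) by exci. ring.
Qed.

(** Continuity is asked on the edges only, because the integrands of interest have poles inside the
    rectangle. *)
Definition bd_cont (f : C -> C) (a b c d : R) : Prop :=
  (forall x, a <= x <= b -> Ccont f (x, c) /\ Ccont f (x, d)) /\
  (forall y, c <= y <= d -> Ccont f (a, y) /\ Ccont f (b, y)).

Lemma rect_bd_cont (f : C -> C) (a b c d : R) : a <= b -> c <= d -> rect_cont f a b c d -> bd_cont f a b c d.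
Proof. intros Hab Hcd H. split; split; apply H; lra. Qed.

Lemma RI_plus (f g : C -> C) (a b c d : R) : a <= b -> c <= d ->
  bd_cont f a b c d -> bd_cont g a b c d ->
  RI (fun w => f w + g w)%C a b c d = (RI f a b c d + RI g a b c d)%C.
Proof.
  intros Hab Hcd [] []. unfold RI. rewrite !CI_plus by exci. ring.
Qed.

Lemma RI_scal (k : C) (f : C -> C) (a b c d : R) : a <= b -> c <= d ->
  bd_cont f a b c d ->
  RI (fun w => k * f w)%C a b c d = (k * RI f a b c d)%C.
Proof.
  intros Hab Hcd []. unfold RI. rewrite !CI_scal by exci. ring.
Qed.

Lemma RI_bound (f : C -> C) (a b c d K : R) : a <= b -> c <= d ->
  (forall x, a <= x <= b -> Ccont f (x, c) /\ Ccont f (x, d) /\ Cmod (f (x, c)) <= K /\ Cmod (f (x, d)) <= K) ->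
  (forall y, c <= y <= d -> Ccont f (a, y) /\ Ccont f (b, y) /\ Cmod (f (a, y)) <= K /\ Cmod (f (b, y)) <= K) ->
  Cmod (RI f a b c d) <= 2 * K * ((b - a) + (d - c)).
Proof.
  intros Hab Hcd Hx Hy. unfold RI.
  set (u1 := CI (fun x => f (x, c)) a b). set (u2 := CI (fun y => f (b, y)) c d).
  set (u3 := CI (fun x => f (x, d)) a b). set (u4 := CI (fun y => f (a, y)) c d).
  assert (B1 : Cmod u1 <= K * (b - a)) by (apply CI_bound; [assumption|apply ex_CI_horiz; [assumption|]; apply Hx|apply Hx]).
  assert (B3 : Cmod u3 <= K * (b - a)) by (apply CI_bound; [assumption|apply ex_CI_horiz; [assumption|]; apply Hx|apply Hx]).
  assert (B2 : Cmod u2 <= K * (d - c)) by (apply CI_bound; [assumption|apply ex_CI_vert; [assumption|]; apply Hy|apply Hy]).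
  assert (B4 : Cmod u4 <= K * (d - c)) by (apply CI_bound; [assumption|apply ex_CI_vert; [assumption|]; apply Hy|apply Hy]).
  assert (T := Cmod_triangle (u1 + Ci * u2 - u3) (- (Ci * u4))).
  assert (T2 := Cmod_triangle (u1 + Ci * u2) (- u3)). assert (T3 := Cmod_triangle u1 (Ci * u2)).
  rewrite !Cmod_opp, ?Cmod_mult in *.
  assert (Hi : Cmod Ci = 1) by (unfold Cmod, Ci; simpl; replace (0 * (0 * 1) + 1 * (1 * 1)) with 1 by ring; apply sqrt_1).
  rewrite Hi in *. unfold Cminus in *. lra.
Qed.

Lemma RI_ext (f g : C -> C) (a b c d : R) : a <= b -> c <= d ->
  (forall x, a <= x <= b -> f (x, c) = g (x, c) /\ f (x, d) = g (x, d)) ->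
  (forall y, c <= y <= d -> f (a, y) = g (a, y) /\ f (b, y) = g (b, y)) ->
  RI f a b c d = RI g a b c d.
Proof.
  intros Hab Hcd Hx Hy. unfold RI.
  rewrite (CI_ext (fun x => f (x, c)) (fun x => g (x, c))), (CI_ext (fun x => f (x, d)) (fun x => g (x, d))),
   (CI_ext (fun y => f (a, y)) (fun y => g (a, y))), (CI_ext (fun y => f (b, y)) (fun y => g (b, y))); [reflexivity|..];
  rewrite Rmin_left, Rmax_right by assumption; intros t Ht;
  solve [apply Hx; lra | apply Hy; lra].
Qed.

(** An affine function has a quadratic primitive. In Goursat's argument this allows the tangent
    approximation to be subtracted at no cost. *)
Lemma RI_affine (k l w : C) (a b c d : R) : a <= b -> c <= d ->
  RI (fun y => k + l * (y - w))%C a b c d = 0.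
Proof.
  intros Hab Hcd.
  set (Phi := fun y : C => (k * y + l * (/ 2 * ((y - w) * (y - w))))%C).
  assert (HP : forall y, Cder Phi y (k + l * (y - w))%C).
  { intros y. unfold Phi.
    apply (Cder_eq _ _ (k * 1 + l * (/ 2 * ((1 - 0) * (y - w) + (y - w) * (1 - 0))))%C); [field|].
    assert (Hy : Cder (fun y => y - w)%C y (1 - 0)%C) by (apply Cder_minus; [apply Cder_id|apply Cder_const]).
    apply Cder_plus; [apply Cder_scal, Cder_id|].
    apply (Cder_scal l), (Cder_scal (/ 2)%C), (Cder_mult (fun y => y - w)%C (fun y => y - w)%C); exact Hy. }
  assert (HC : forall y, Ccont (fun y => k + l * (y - w))%C y).
  { intros y. apply Ccont_plus; [apply Ccont_const|]. apply Ccont_mult; [apply Ccont_const|].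
    apply Ccont_minus; [apply Ccont_id|apply Ccont_const]. }
  unfold RI.
  rewrite (CI_FTC (fun x => Phi (x, c)) (fun x => k + l * ((x, c) - w))%C a b); [|intros; apply Cder_horiz, HP|intros; apply (Ccont_horiz (fun y => k + l * (y - w))%C), HC].
  rewrite (CI_FTC (fun x => Phi (x, d)) (fun x => k + l * ((x, d) - w))%C a b); [|intros; apply Cder_horiz, HP|intros; apply (Ccont_horiz (fun y => k + l * (y - w))%C), HC].
  assert (V : forall a, (Ci * CI (fun y : R => (k + l * ((a, y) - w))%C) c d)%C = (Phi (a, d) - Phi (a, c))%C).
  { intros a'. rewrite <- CI_scal by (apply (ex_CI_vert (fun y => k + l * (y - w))%C); [assumption|intros; apply HC]).
    apply (CI_FTC (fun y => Phi (a', y))); intros.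
    - eapply Rder_eq; [|apply Cder_vert, HP]. apply Cmult_comm.
    - apply (Ccont_vert (fun y => Ci * (k + l * (y - w)))%C). apply Ccont_mult; [apply Ccont_const|apply HC]. }
  rewrite !V. ring.
Qed.

Lemma Cmod_4_ge (x1 x2 x3 x4 : C) (t : R) : t <= Cmod (x1 + x2 + (x3 + x4)) ->
  Cmod x1 < t / 4 -> Cmod x2 < t / 4 -> Cmod x3 < t / 4 -> t / 4 <= Cmod x4.
Proof.
  intros. assert (T1 := Cmod_triangle (x1 + x2) (x3 + x4)).
  assert (T2 := Cmod_triangle x1 x2). assert (T3 := Cmod_triangle x3 x4). lra.
Qed.

(* Lower left corner of the [n]-th rectangle in Goursat's bisection. *)
Fixpoint corner (f : C -> C) (p q u v t : R) (n : nat) : R * R :=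
  match n with
  | O => (p, q)
  | S n =>
      let '(x, y) := corner f p q u v t n in
      let u' := u / 2 ^ S n in let v' := v / 2 ^ S n in let t' := t / 4 ^ S n in
      if Rle_dec t' (Cmod (RI f x (x + u') y (y + v'))) then (x, y)
      else if Rle_dec t' (Cmod (RI f (x + u') (x + u' + u') y (y + v'))) then (x + u', y)
      else if Rle_dec t' (Cmod (RI f x (x + u') (y + v') (y + v' + v'))) then (x, y + v')
      else (x + u', y + v')
  end.

(** The four quarter integrals add up to the whole, so if three of them stay below a quarter of the
    bound, the last one reaches it; this is why the last alternative of [corner] is taken without a
    test. *)
Lemma corner_spec (f : C -> C) (p q u v t : R) (Hu : 0 <= u) (Hv : 0 <= v)
  (Hc : rect_cont f p (p + u) q (q + v)) (Ht : t <= Cmod (RI f p (p + u) q (q + v))) (n : nat) :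
  let '(x, y) := corner f p q u v t n in
  p <= x /\ x + u / 2 ^ n <= p + u /\ q <= y /\ y + v / 2 ^ n <= q + v /\
  t / 4 ^ n <= Cmod (RI f x (x + u / 2 ^ n) y (y + v / 2 ^ n)).
Proof.
  induction n as [|n IH].
  - simpl. unfold Rdiv. rewrite Rinv_1, !Rmult_1_r. repeat split; lra.
  - cbn [corner]. destruct (corner f p q u v t n) as [x y]. cbv zeta. destruct IH as (H1 & H2 & H3 & H4 & H5).
    set (u' := u / 2 ^ S n) in *. set (v' := v / 2 ^ S n) in *. set (t' := t / 4 ^ S n) in *.
    assert (Hp2 : 0 < 2 ^ n) by (apply pow_lt; lra). assert (Hp4 : 0 < 4 ^ n) by (apply pow_lt; lra).
    assert (Eu : u / 2 ^ n = u' + u') by (unfold u'; simpl; field; lra).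
    assert (Ev : v / 2 ^ n = v' + v') by (unfold v'; simpl; field; lra).
    assert (Et : t / 4 ^ n / 4 = t') by (unfold t'; simpl; field; lra).
    assert (Pu : 0 <= u') by (apply Rdiv_le_0_compat; [assumption|apply pow_lt; lra]).
    assert (Pv : 0 <= v') by (apply Rdiv_le_0_compat; [assumption|apply pow_lt; lra]).
    rewrite Eu, Ev in *.
    assert (Hc' : rect_cont f x (x + (u' + u')) y (y + (v' + v'))) by (intros ? ? ? ?; apply Hc; lra).
    replace (x + (u' + u')) with (x + u' + u') in * by ring.
    replace (y + (v' + v')) with (y + v' + v') in * by ring.
    rewrite (RI_split_h _ _ _ _ (y + v')) in H5; [|lra|lra|assumption].
    rewrite (RI_split_v f x (x + u') _ y), (RI_split_v f x (x + u') _ (y + v')) in H5;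
      [|lra|lra|intros ? ? ? ?; apply Hc'; lra|lra|lra|intros ? ? ? ?; apply Hc'; lra].
    destruct (Rle_dec t' _) as [A1|A1]; [|destruct (Rle_dec t' _) as [A2|A2];
      [|destruct (Rle_dec t' _) as [A3|A3]]]; repeat split; try lra.
    rewrite <- Et. rewrite <- Et in *. eapply Cmod_4_ge; [exact H5|lra..].
Qed.

Lemma corner_step (f : C -> C) (p q u v t : R) (Hu : 0 <= u) (Hv : 0 <= v) (n : nat) :
  let cr := corner f p q u v t in
  fst (cr n) <= fst (cr (S n)) /\ fst (cr (S n)) + u / 2 ^ S n <= fst (cr n) + u / 2 ^ n /\
  snd (cr n) <= snd (cr (S n)) /\ snd (cr (S n)) + v / 2 ^ S n <= snd (cr n) + v / 2 ^ n.
Proof.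
  intros cr. subst cr. cbn [corner]. destruct (corner f p q u v t n) as [x y]. cbv zeta.
  set (u' := u / 2 ^ S n) in *. set (v' := v / 2 ^ S n) in *.
  assert (Hp2 : 0 < 2 ^ n) by (apply pow_lt; lra).
  assert (Eu : u / 2 ^ n = u' + u') by (unfold u'; simpl; field; lra).
  assert (Ev : v / 2 ^ n = v' + v') by (unfold v'; simpl; field; lra).
  assert (Pu : 0 <= u') by (apply Rdiv_le_0_compat; [assumption|apply pow_lt; lra]).
  assert (Pv : 0 <= v') by (apply Rdiv_le_0_compat; [assumption|apply pow_lt; lra]).
  rewrite Eu, Ev.
  destruct (Rle_dec _ _); [|destruct (Rle_dec _ _); [|destruct (Rle_dec _ _)]]; simpl; lra.
Qed.

Lemma nested_point (a w : nat -> R) :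
  (forall n, 0 <= w n) -> (forall n, a n <= a (S n)) -> (forall n, a (S n) + w (S n) <= a n + w n) ->
  exists x, forall n, a n <= x <= a n + w n.
Proof.
  intros Hw Ha Hb.
  assert (Ha' : forall n k, a n <= a (n + k)%nat).
  { intros n k. induction k; [rewrite Nat.add_0_r; lra|]. rewrite Nat.add_succ_r. specialize (Ha (n + k)%nat). lra. }
  assert (Hb' : forall n k, a (n + k)%nat + w (n + k)%nat <= a n + w n).
  { intros n k. induction k; [rewrite Nat.add_0_r; lra|]. rewrite Nat.add_succ_r. specialize (Hb (n + k)%nat). lra. }
  assert (H : forall n m, a n <= a m + w m).
  { intros n m. destruct (Nat.le_ge_cases n m) as [L|L].
    - replace m with (n + (m - n))%nat by lia. specialize (Ha' n (m - n)%nat). specialize (Hw (n + (m - n))%nat). lra.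
    - replace n with (m + (n - m))%nat by lia. specialize (Hb' m (n - m)%nat). specialize (Hw (m + (n - m))%nat). lra. }
  destruct (completeness (fun y => exists n, y = a n)) as [x [H1 H2]].
  - exists (a O + w O). intros y [n ->]. apply H.
  - exists (a O), O. reflexivity.
  - exists x. intros n. split; [apply H1; exists n; reflexivity|].
    apply H2. intros y [m ->]. apply H.
Qed.

Lemma Goursat_closed (f : C -> C) (a b c d : R) : a <= b -> c <= d ->
  (forall x y, a <= x <= b -> c <= y <= d -> exists l, Cder f (x, y) l) -> RI f a b c d = 0.
Proof.
  intros Hab Hcd Hd. destruct (Ceq_dec (RI f a b c d) 0) as [|Hn]; [assumption|exfalso].
  set (t := Cmod (RI f a b c d)). assert (Ht : 0 < t) by (apply Cmod_gt_0, Hn).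
  set (u := b - a). set (v := d - c).
  assert (Hu : 0 <= u) by (unfold u; lra). assert (Hv : 0 <= v) by (unfold v; lra).
  assert (Hc : rect_cont f a (a + u) c (c + v)).
  { intros x y Hx Hy. destruct (Hd x y) as [l Hl]; unfold u, v in *; try lra. eapply Cder_cont, Hl. }
  assert (Ht' : t <= Cmod (RI f a (a + u) c (c + v))).
  { unfold t, u, v. replace (a + (b - a)) with b by ring. replace (c + (d - c)) with d by ring. lra. }
  pose proof (corner_spec f a c u v t Hu Hv Hc Ht') as Sp.
  pose proof (corner_step f a c u v t Hu Hv) as St.
  set (cr := corner f a c u v t) in *.
  assert (P2 : forall n, 0 < 2 ^ n) by (intros; apply pow_lt; lra).
  destruct (nested_point (fun n => fst (cr n)) (fun n => u / 2 ^ n)) as [x Hx].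
  { intros; apply Rdiv_le_0_compat; auto. } { intros; apply St. } { intros; apply St. }
  destruct (nested_point (fun n => snd (cr n)) (fun n => v / 2 ^ n)) as [y Hy].
  { intros; apply Rdiv_le_0_compat; auto. } { intros; apply St. } { intros; apply St. }
  destruct (Hd x y) as [l Hl].
  { specialize (Hx O). cbn in Hx. unfold u in *. lra. }
  { specialize (Hy O). cbn in Hy. unfold v in *. lra. }
  (* With this tolerance the final estimate reads t <= 2 e (u + v)^2, and the right-hand side is
     smaller than t. The added 1 keeps the denominator positive for a degenerate rectangle. *)
  set (e := t / (4 * (u + v + 1) * (u + v + 1))).
  assert (He : 0 < e) by (apply Rdiv_lt_0_compat; [assumption|nra]).
  destruct (Hl e He) as (r & Hr & Hs).
  destruct (nfloor_ex ((u + v + 1) / r)) as [n [_ Hn2]]; [apply Rdiv_le_0_compat; lra|].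
  assert (Hn3 : (u + v) / 2 ^ n < r).
  { assert (INR n + 1 <= 2 ^ n).
    { clear. induction n; [simpl; lra|]. rewrite S_INR. simpl. generalize (pos_INR n). lra. }
    apply Rlt_div_l; [apply P2|]. apply Rlt_div_l in Hn2; [|assumption]. nra. }
  specialize (Sp n). specialize (Hx n). specialize (Hy n). destruct (cr n) as [xn yn]. simpl in Hx, Hy.
  destruct Sp as (S1 & S2 & S3 & S4 & S5).
  set (un := u / 2 ^ n) in *. set (vn := v / 2 ^ n) in *.
  assert (E : (u + v) / 2 ^ n = un + vn) by (unfold un, vn; field; generalize (P2 n); lra).
  rewrite E in Hn3.
  assert (Pu : 0 <= un) by (apply Rdiv_le_0_compat; auto). assert (Pv : 0 <= vn) by (apply Rdiv_le_0_compat; auto).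
  (* The remainder of the tangent approximation at the limit point: it has the same boundary
     integral as f, and on the small rectangle it is at most e times the half-perimeter. *)
  set (g := fun w => (f w + (-1) * (f (x, y) + l * (w - (x, y))))%C).
  assert (Caff : forall w, Ccont (fun w => f (x, y) + l * (w - (x, y)))%C w).
  { intros w. apply Ccont_plus; [apply Ccont_const|]. apply Ccont_mult; [apply Ccont_const|].
    apply Ccont_minus; [apply Ccont_id|apply Ccont_const]. }
  assert (RIg : RI f xn (xn + un) yn (yn + vn) = RI g xn (xn + un) yn (yn + vn)).
  { unfold g. rewrite (RI_plus f (fun w => (-1) * (f (x, y) + l * (w - (x, y))))%C); [|lra|lra| |].
    - rewrite (RI_scal (-1) (fun w => (f (x, y) + l * (w - (x, y))))%C); [|lra|lra|apply rect_bd_cont; [lra|lra|intros ? ? ? ?; apply Caff]].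
      rewrite RI_affine by lra. ring.
    - apply rect_bd_cont; [lra|lra|]. intros ? ? ? ?; apply Hc; lra.
    - apply rect_bd_cont; [lra|lra|]. intros ? ? ? ?. apply Ccont_mult; [apply Ccont_const|apply Caff]. }
  assert (Bg : forall x' y', xn <= x' <= xn + un -> yn <= y' <= yn + vn ->
    Ccont g (x', y') /\ Cmod (g (x', y')) <= e * (un + vn)).
  { intros x' y' Hx' Hy'. split.
    - apply Ccont_plus; [apply Hc; lra|]. apply Ccont_mult; [apply Ccont_const|apply Caff].
    - assert (Hm : Cmod ((x', y') - (x, y)) <= un + vn).
      { eapply Rle_trans; [apply Cmod_le_Re_Im|]. rewrite re_minus, im_minus. simpl.
        assert (Rabs (x' - x) <= un) by (apply Rabs_le; lra).
        assert (Rabs (y' - y) <= vn) by (apply Rabs_le; lra). lra. }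
      unfold g. replace (f (x', y') + -1 * (f (x, y) + l * ((x', y') - (x, y))))%C
        with (f (x', y') - f (x, y) - l * ((x', y') - (x, y)))%C by ring.
      eapply Rle_trans; [apply Hs; lra|]. apply Rmult_le_compat_l; lra. }
  assert (HB : Cmod (RI g xn (xn + un) yn (yn + vn)) <= 2 * (e * (un + vn)) * ((xn + un - xn) + (yn + vn - yn))).
  { apply RI_bound; try lra.
    - intros x' Hx'. repeat split; apply Bg; lra.
    - intros y' Hy'. repeat split; apply Bg; lra. }
  rewrite <- RIg in HB.
  assert (F1 : t / 4 ^ n <= 2 * e * (un + vn) * (un + vn)).
  { eapply Rle_trans; [exact S5|]. eapply Rle_trans; [exact HB|]. apply Req_le. ring. }
  rewrite <- E in F1.
  replace (4 ^ n) with (2 ^ n * 2 ^ n) in F1 by (rewrite <- Rpow_mult_distr; f_equal; ring).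
  assert (F2 : t <= 2 * e * (u + v) * (u + v)).
  { apply (Rmult_le_compat_r (2 ^ n * 2 ^ n)) in F1; [|generalize (P2 n); nra].
    replace (t / (2 ^ n * 2 ^ n) * (2 ^ n * 2 ^ n)) with t in F1 by (field; generalize (P2 n); lra).
    replace (2 * e * ((u + v) / 2 ^ n) * ((u + v) / 2 ^ n) * (2 ^ n * 2 ^ n)) with (2 * e * (u + v) * (u + v)) in F1
      by (field; generalize (P2 n); lra). exact F1. }
  assert (F3 : e * (4 * (u + v + 1) * (u + v + 1)) = t) by (unfold e; field; lra).
  nra.
Qed.

Lemma Ccont_2d (f : C -> C) (x y : R) : Ccont f (x, y) ->
  continuity_2d_pt (fun x y => Re (f (x, y))) x y /\ continuity_2d_pt (fun x y => Im (f (x, y))) x y.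
Proof.
  intros H. split; intros e.
  - destruct (H e (cond_pos e)) as (d & Hd & Hs). exists (mkposreal (d / 2) ltac:(lra)).
    intros x' y' Hx Hy. simpl in Hx, Hy. rewrite <- re_minus.
    eapply Rle_lt_trans; [apply re_le_Cmod|]. apply Hs.
    eapply Rle_lt_trans; [apply Cmod_le_Re_Im|]. rewrite re_minus, im_minus. simpl. lra.
  - destruct (H e (cond_pos e)) as (d & Hd & Hs). exists (mkposreal (d / 2) ltac:(lra)).
    intros x' y' Hx Hy. simpl in Hx, Hy. rewrite <- im_minus.
    eapply Rle_lt_trans; [apply im_le_Cmod|]. apply Hs.
    eapply Rle_lt_trans; [apply Cmod_le_Re_Im|]. rewrite re_minus, im_minus. simpl. lra.
Qed.

Lemma rect_unifcont (f : C -> C) (a b c d : R) : rect_cont f a b c d ->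
  forall e, 0 < e -> exists r, 0 < r /\ forall x y x' y',
    a <= x <= b -> c <= y <= d -> a <= x' <= b -> c <= y' <= d ->
    Rabs (x' - x) < r -> Rabs (y' - y) < r -> Cmod (f (x', y') - f (x, y)) < e.
Proof.
  intros H e He.
  destruct (uniform_continuity_2d (fun x y => Re (f (x, y))) a b c d) with (eps := mkposreal (e / 2) ltac:(lra)) as [r1 H1].
  { intros x y Hx Hy. apply Ccont_2d, H; assumption. }
  destruct (uniform_continuity_2d (fun x y => Im (f (x, y))) a b c d) with (eps := mkposreal (e / 2) ltac:(lra)) as [r2 H2].
  { intros x y Hx Hy. apply Ccont_2d, H; assumption. }
  exists (Rmin r1 r2). split; [apply Rmin_pos; apply cond_pos|].
  intros x y x' y' Hx Hy Hx' Hy' Hdx Hdy.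
  specialize (H1 x y x' y' Hx Hy Hx' Hy' (Rlt_le_trans _ _ _ Hdx (Rmin_l _ _)) (Rlt_le_trans _ _ _ Hdy (Rmin_l _ _))).
  specialize (H2 x y x' y' Hx Hy Hx' Hy' (Rlt_le_trans _ _ _ Hdx (Rmin_r _ _)) (Rlt_le_trans _ _ _ Hdy (Rmin_r _ _))).
  simpl in H1, H2. eapply Rle_lt_trans; [apply Cmod_le_Re_Im|]. rewrite re_minus, im_minus. lra.
Qed.

(** The corner (a, c) is joined to any point by N steps shorter than the radius of uniform
    continuity for tolerance 1; the modulus grows by at most 1 at each step, and N depends only on
    the rectangle. *)
Lemma rect_bounded (f : C -> C) (a b c d : R) : a <= b -> c <= d -> rect_cont f a b c d ->
  exists K, 0 <= K /\ forall x y, a <= x <= b -> c <= y <= d -> Cmod (f (x, y)) <= K.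
Proof.
  intros Hab Hcd H. destruct (rect_unifcont f a b c d H 1 Rlt_0_1) as (r & Hr & Hs).
  destruct (nfloor_ex ((b - a + (d - c) + 1) / r)) as [n [_ Hn]]; [apply Rdiv_le_0_compat; lra|].
  set (N := INR n + 1) in *. assert (HN : 1 <= N) by (unfold N; generalize (pos_INR n); lra).
  apply Rlt_div_l in Hn; [|assumption].
  exists (Cmod (f (a, c)) + N). split; [generalize (Cmod_ge_0 (f (a, c))); lra|].
  intros x y Hx Hy.
  assert (P : forall k, INR k <= N -> Cmod (f (a + INR k / N * (x - a), c + INR k / N * (y - c))) <= Cmod (f (a, c)) + INR k).
  { induction k as [|k IH]; intros Hk.
    - simpl. unfold Rdiv. rewrite !Rmult_0_l, !Rplus_0_r. lra.
    - rewrite S_INR in *. specialize (IH ltac:(lra)).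
      assert (Pk := pos_INR k).
      assert (T1 : 0 <= INR k / N <= 1).
      { split; [apply Rdiv_le_0_compat; lra|]. apply Rle_div_l; lra. }
      assert (T2 : 0 <= (INR k + 1) / N <= 1).
      { split; [apply Rdiv_le_0_compat; lra|]. apply Rle_div_l; lra. }
      assert (T3 : (INR k + 1) / N - INR k / N = / N) by (field; lra).
      assert (T4 : 0 < / N) by (apply Rinv_0_lt_compat; lra).
      set (s1 := INR k / N) in *. set (s2 := (INR k + 1) / N) in *.
      assert (T5 : / N * (b - a + (d - c) + 1) < r).
      { rewrite Rmult_comm. apply Rlt_div_l; lra. }
      assert (D := Hs (a + s1 * (x - a)) (c + s1 * (y - c)) (a + s2 * (x - a)) (c + s2 * (y - c))).
      lapply D; [clear D; intros D|nra]. lapply D; [clear D; intros D|nra].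
      lapply D; [clear D; intros D|nra]. lapply D; [clear D; intros D|nra].
      lapply D; [clear D; intros D|].
      2:{ replace (a + s2 * (x - a) - (a + s1 * (x - a))) with (/ N * (x - a)) by (rewrite <- T3; ring).
          rewrite Rabs_pos_eq; [nra|]. apply Rmult_le_pos; lra. }
      lapply D; [clear D; intros D|].
      2:{ replace (c + s2 * (y - c) - (c + s1 * (y - c))) with (/ N * (y - c)) by (rewrite <- T3; ring).
          rewrite Rabs_pos_eq; [nra|]. apply Rmult_le_pos; lra. }
      generalize (Cmod_triangle_rev (f (a + s2 * (x - a), c + s2 * (y - c))) (f (a + s1 * (x - a), c + s1 * (y - c)))). lra. }
  specialize (P (S n)). rewrite S_INR in P. fold N in P. specialize (P (Rle_refl _)).
  replace (N / N) with 1 in P by (field; lra). rewrite !Rmult_1_l in P.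
  replace (a + (x - a)) with x in P by ring. replace (c + (y - c)) with y in P by ring. exact P.
Qed.

Lemma Cmod_Ci : Cmod Ci = 1.
Proof. unfold Cmod, Ci; simpl. replace (0 * (0 * 1) + 1 * (1 * 1)) with 1 by ring. apply sqrt_1. Qed.

(** If one dimension is small, the two long edges are close and run in opposite directions, so they
    cancel up to uniform continuity, and the short edges are bounded by their length. *)
Lemma RI_thin (f : C -> C) (a b c d : R) : a <= b -> c <= d -> rect_cont f a b c d ->
  forall e, 0 < e -> exists r, 0 < r /\ forall a' b' c' d', a <= a' <= b' -> b' <= b -> c <= c' <= d' -> d' <= d ->
    (b' - a' < r \/ d' - c' < r) -> Cmod (RI f a' b' c' d') <= e.
Proof.
  intros Hab Hcd Hc e He.
  destruct (rect_bounded f a b c d Hab Hcd Hc) as (K & HK & HB).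
  set (L := b - a + (d - c) + 1).
  destruct (rect_unifcont f a b c d Hc (e / (2 * L))) as (r & Hr & Hs); [apply Rdiv_lt_0_compat; unfold L; lra|].
  exists (Rmin r (e / (4 * (K + 1)))). split; [apply Rmin_pos; [assumption|apply Rdiv_lt_0_compat; lra]|].
  assert (EL : 0 < e / (2 * L)) by (apply Rdiv_lt_0_compat; unfold L; lra).
  assert (EL2 : e / (2 * L) * L = e / 2) by (field; unfold L; lra).
  assert (HL : b - a <= L /\ d - c <= L) by (unfold L; lra).
  intros a' b' c' d' Ha Hb Hc' Hd Hthin.
  assert (Ki : forall u, Cmod (Ci * u) = Cmod u) by (intros; rewrite Cmod_mult, Cmod_Ci; ring).
  destruct Hthin as [Ht|Ht]; unfold RI;
    assert (Ht1 := Rlt_le_trans _ _ _ Ht (Rmin_l _ _)); assert (Ht2 := Rlt_le_trans _ _ _ Ht (Rmin_r _ _));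
    apply Rlt_div_r in Ht2; try lra.
  - assert (B1 : Cmod (CI (fun x => f (x, c')) a' b') <= K * (b' - a')).
    { apply CI_bound; [lra|exci|intros; apply HB; lra]. }
    assert (B2 : Cmod (CI (fun x => f (x, d')) a' b') <= K * (b' - a')).
    { apply CI_bound; [lra|exci|intros; apply HB; lra]. }
    assert (B3 : Cmod (CI (fun y => (f (b', y) - f (a', y))%C) c' d') <= e / (2 * L) * (d' - c')).
    { apply CI_bound; [lra| |].
      - apply ex_CI_minus; exci.
      - intros t Htt. apply Rlt_le, Hs; try lra; rewrite Rabs_pos_eq; lra. }
    rewrite CI_minus in B3 by exci.
    set (u1 := CI (fun x => f (x, c')) a' b') in *. set (u2 := CI (fun x => f (x, d')) a' b') in *.
    set (u3 := CI (fun y => f (b', y)) c' d') in *. set (u4 := CI (fun y => f (a', y)) c' d') in *.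
    replace (u1 + Ci * u3 - u2 - Ci * u4)%C with (u1 + (- u2 + Ci * (u3 - u4)))%C by ring.
    eapply Rle_trans; [apply Cmod_triangle|]. eapply Rle_trans; [apply Rplus_le_compat_l, Cmod_triangle|].
    rewrite Cmod_opp, Ki. nra.
  - assert (B1 : Cmod (CI (fun y => f (a', y)) c' d') <= K * (d' - c')).
    { apply CI_bound; [lra|exci|intros; apply HB; lra]. }
    assert (B2 : Cmod (CI (fun y => f (b', y)) c' d') <= K * (d' - c')).
    { apply CI_bound; [lra|exci|intros; apply HB; lra]. }
    assert (B3 : Cmod (CI (fun x => (f (x, c') - f (x, d'))%C) a' b') <= e / (2 * L) * (b' - a')).
    { apply CI_bound; [lra| |].
      - apply ex_CI_minus; exci.
      - intros t Htt. apply Rlt_le, Hs; try lra; try (rewrite Rabs_pos_eq; lra).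
        rewrite Rabs_left1; lra. }
    rewrite CI_minus in B3 by exci.
    set (u1 := CI (fun x => f (x, c')) a' b') in *. set (u2 := CI (fun x => f (x, d')) a' b') in *.
    set (u3 := CI (fun y => f (b', y)) c' d') in *. set (u4 := CI (fun y => f (a', y)) c' d') in *.
    replace (u1 + Ci * u3 - u2 - Ci * u4)%C with ((u1 - u2) + (Ci * u3 + - (Ci * u4)))%C by ring.
    eapply Rle_trans; [apply Cmod_triangle|]. eapply Rle_trans; [apply Rplus_le_compat_l, Cmod_triangle|].
    rewrite Cmod_opp, !Ki. nra.
Qed.

(** A frame of width s is cut off. The closed inner rectangle contributes nothing, and the four
    strips of the frame are thin. *)
Lemma Goursat_open (f : C -> C) (a b c d : R) : a < b -> c < d -> rect_cont f a b c d ->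
  (forall x y, a < x < b -> c < y < d -> exists l, Cder f (x, y) l) -> RI f a b c d = 0.
Proof.
  intros Hab Hcd Hc Hd. apply Cmod_eq_0. apply Rle_antisym; [|apply Cmod_ge_0].
  apply le_epsilon. intros e He.
  destruct (RI_thin f a b c d) with (e := e / 4) as (r & Hr & Hs); try lra; [assumption|].
  set (s := Rmin (r / 2) (Rmin ((b - a) / 4) ((d - c) / 4))).
  assert (Hs0 : 0 < s) by (repeat apply Rmin_pos; lra).
  assert (Hs1 : s <= r / 2) by apply Rmin_l.
  assert (Hs2 : s <= (b - a) / 4) by (eapply Rle_trans; [apply Rmin_r|apply Rmin_l]).
  assert (Hs3 : s <= (d - c) / 4) by (eapply Rle_trans; [apply Rmin_r|apply Rmin_r]).
  rewrite (RI_split_v f a (a + s) b) by (try assumption; lra).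
  rewrite (RI_split_v f (a + s) (b - s) b) by (try lra; intros ? ? ? ?; apply Hc; lra).
  rewrite (RI_split_h f (a + s) (b - s) c (c + s) d) by (try lra; intros ? ? ? ?; apply Hc; lra).
  rewrite (RI_split_h f (a + s) (b - s) (c + s) (d - s) d) by (try lra; intros ? ? ? ?; apply Hc; lra).
  rewrite (Goursat_closed f (a + s) (b - s) (c + s) (d - s)) by (try lra; intros; apply Hd; lra).
  assert (A1 := Hs a (a + s) c d ltac:(lra) ltac:(lra) ltac:(lra) ltac:(lra) ltac:(lra)).
  assert (A2 := Hs (b - s) b c d ltac:(lra) ltac:(lra) ltac:(lra) ltac:(lra) ltac:(lra)).
  assert (A3 := Hs (a + s) (b - s) c (c + s) ltac:(lra) ltac:(lra) ltac:(lra) ltac:(lra) ltac:(lra)).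
  assert (A4 := Hs (a + s) (b - s) (d - s) d ltac:(lra) ltac:(lra) ltac:(lra) ltac:(lra) ltac:(lra)).
  rewrite Cplus_0_l.
  match goal with |- Cmod (?u1 + (?u2 + ?u3 + ?u4)) <= _ =>
    assert (T1 := Cmod_triangle u1 (u2 + u3 + u4)); assert (T2 := Cmod_triangle (u2 + u3) u4);
    assert (T3 := Cmod_triangle u2 u3) end. lra.
Qed.

(** The list holds abscissae of points at which mere continuity is known, such as filled removable
    singularities. Cutting along these vertical lines moves such points to edges, where
    [Goursat_open] asks only for continuity. *)
Theorem Goursat (l : list R) (f : C -> C) (a b c d : R) : a < b -> c < d -> rect_cont f a b c d ->
  (forall x y, a < x < b -> c < y < d -> ~ In x l -> exists k, Cder f (x, y) k) -> RI f a b c d = 0.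
Proof.
  revert a b. induction l as [|r l IH]; intros a b Hab Hcd Hc Hd.
  - apply Goursat_open; auto.
  - destruct (Rlt_dec a r) as [H1|H1]; [destruct (Rlt_dec r b) as [H2|H2]|].
    + rewrite (RI_split_v f a r b) by (try assumption; lra).
      rewrite (IH a r), (IH r b); try lra; try (apply Cplus_0_l);
        try (intros ? ? ? ?; apply Hc; lra); intros x y Hx Hy Hn; apply Hd; try lra;
        intros [->|]; [lra|contradiction|lra|contradiction].
    + apply IH; auto. intros x y Hx Hy Hn. apply Hd; auto. intros [->|]; [lra|contradiction].
    + apply IH; auto. intros x y Hx Hy Hn. apply Hd; auto. intros [->|]; [lra|contradiction].
Qed.

Opaque CI ex_CI.

(** * The exponential and the logarithm *)

Lemma Cexp_plus (x y : C) : Cexp (x + y) = (Cexp x * Cexp y)%C.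
Proof.
  unfold Cexp. rewrite re_plus, im_plus, exp_plus, cos_plus, sin_plus.
  apply C_ext; simpl; ring.
Qed.

Lemma Cmod_Cexp (x : C) : Cmod (Cexp x) = exp (Re x).
Proof.
  unfold Cmod, Cexp; simpl.
  replace (exp (Re x) * cos (Im x) * (exp (Re x) * cos (Im x) * 1) +
    exp (Re x) * sin (Im x) * (exp (Re x) * sin (Im x) * 1))
    with (exp (Re x) ^ 2 * (Rsqr (sin (Im x)) + Rsqr (cos (Im x)))) by (unfold Rsqr; ring).
  rewrite sin2_cos2, Rmult_1_r. apply sqrt_pow2, Rlt_le, exp_pos.
Qed.

Lemma Cexp_0 : Cexp 0 = 1.
Proof. unfold Cexp; simpl. rewrite exp_0, cos_0, sin_0. apply C_ext; simpl; ring. Qed.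

Lemma Cexp_neq_0 (x : C) : Cexp x <> 0.
Proof. apply Cmod_gt_0. rewrite Cmod_Cexp. apply exp_pos. Qed.

Lemma R_der_eps (g : R -> R) (x l : R) : is_derive g x l -> forall e, 0 < e ->
  exists d, 0 < d /\ forall y, Rabs (y - x) < d -> Rabs (g y - g x - l * (y - x)) <= e * Rabs (y - x).
Proof.
  intros [_ H] e He. specialize (H x (fun P HP => HP) (mkposreal e He)).
  destruct H as [d Hd]. exists d. split; [apply cond_pos|]. intros s Hs.
  specialize (Hd s Hs). change (Rabs (g s - g x - (s - x) * l) <= e * Rabs (s - x)) in Hd.
  rewrite Rmult_comm with (r1 := l). exact Hd.
Qed.

Lemma Cder_Cexp_0 : Cder Cexp 0 1.
Proof.
  intros e He.
  destruct (R_der_eps exp 0 1) with (e := Rmin 1 (e / 8)) as (d1 & Hd1 & H1).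
  { auto_derive; [trivial|]. rewrite exp_0; ring. } { apply Rmin_pos; lra. }
  destruct (R_der_eps cos 0 0) with (e := e / 8) as (d2 & Hd2 & H2).
  { auto_derive; [trivial|]. rewrite sin_0; ring. } { lra. }
  destruct (R_der_eps sin 0 1) with (e := e / 8) as (d3 & Hd3 & H3).
  { auto_derive; [trivial|]. rewrite cos_0; ring. } { lra. }
  set (d4 := Rmin 1 (e / 8)). assert (Hd4 : 0 < d4) by (apply Rmin_pos; lra).
  set (d := Rmin (Rmin d1 d2) (Rmin d3 (d4 / 2))).
  assert (Hdp : 0 < d) by (repeat apply Rmin_pos; lra).
  exists d. split; [assumption|]. intros y Hy.
  replace (y - 0)%C with y in * by ring.
  assert (L1 := re_le_Cmod y). assert (L2 := im_le_Cmod y).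
  assert (K1 : d <= d1) by (unfold d; eapply Rle_trans; apply Rmin_l).
  assert (K2 : d <= d2) by (unfold d; eapply Rle_trans; [apply Rmin_l|apply Rmin_r]).
  assert (K3 : d <= d3) by (unfold d; eapply Rle_trans; [apply Rmin_r|apply Rmin_l]).
  assert (K4 : d <= d4 / 2) by (unfold d; eapply Rle_trans; [apply Rmin_r|apply Rmin_r]).
  assert (K5 : d4 <= 1) by apply Rmin_l. assert (K6 : d4 <= e / 8) by apply Rmin_r.
  set (a := Re y) in *. set (b := Im y) in *. set (D := Cmod y) in *.
  specialize (H1 a). specialize (H2 b). specialize (H3 b).
  rewrite Rminus_0_r in H1, H2, H3. rewrite exp_0 in H1. rewrite cos_0 in H2. rewrite sin_0 in H3.
  specialize (H1 ltac:(lra)). specialize (H2 ltac:(lra)). specialize (H3 ltac:(lra)).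
  assert (E1 : Rmin 1 (e / 8) <= 1) by apply Rmin_l. assert (E2 : Rmin 1 (e / 8) <= e / 8) by apply Rmin_r.
  assert (Ha := Rabs_pos a). assert (Hb := Rabs_pos b).
  assert (X1 : Rabs (exp a - 1) <= 2 * D).
  { replace (exp a - 1) with ((exp a - 1 - 1 * a) + a) by ring.
    eapply Rle_trans; [apply Rabs_triang|]. nra. }
  assert (X2 : 0 < exp a <= 2).
  { split; [apply exp_pos|]. apply Rabs_le_between in X1. lra. }
  eapply Rle_trans; [apply Cmod_le_Re_Im|]. rewrite Cexp_0.
  replace (Re (Cexp y - 1 - 1 * y)) with (exp a * (cos b - 1) + (exp a - 1 - 1 * a)) by (unfold a, b, Cexp, Re, Im; simpl; ring).
  replace (Im (Cexp y - 1 - 1 * y)) with (exp a * (sin b - b) + (exp a - 1) * b) by (unfold a, b, Cexp, Re, Im; simpl; ring).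
  assert (T1 := Rabs_triang (exp a * (cos b - 1)) (exp a - 1 - 1 * a)).
  assert (T2 := Rabs_triang (exp a * (sin b - b)) ((exp a - 1) * b)).
  rewrite !Rabs_mult in T1, T2. rewrite (Rabs_pos_eq (exp a)) in T1, T2 by lra.
  replace (cos b - 1 - 0 * b) with (cos b - 1) in H2 by ring.
  replace (sin b - 0 - 1 * b) with (sin b - b) in H3 by ring.
  assert (HD : 0 <= D) by apply Cmod_ge_0.
  assert (Y1 : exp a * Rabs (cos b - 1) <= 2 * (e / 8 * D)).
  { apply Rmult_le_compat; try lra; [apply Rabs_pos|]. eapply Rle_trans; [exact H2|]. apply Rmult_le_compat_l; lra. }
  assert (Y2 : exp a * Rabs (sin b - b) <= 2 * (e / 8 * D)).
  { apply Rmult_le_compat; try lra; [apply Rabs_pos|]. eapply Rle_trans; [exact H3|]. apply Rmult_le_compat_l; lra. }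
  assert (Y3 : Rabs (exp a - 1) * Rabs b <= e / 8 * D).
  { apply Rmult_le_compat; try lra; try apply Rabs_pos. }
  assert (Y4 : Rabs (exp a - 1 - 1 * a) <= e / 8 * D).
  { eapply Rle_trans; [exact H1|]. apply Rmult_le_compat; try lra. unfold d4 in Hd4. lra. }
  rewrite (Rabs_mult (exp a - 1) b) in T2. assert (0 <= e * D) by nra. lra.
Qed.

Lemma Cder_Cexp (x : C) : Cder Cexp x (Cexp x).
Proof.
  apply Cder_ext with (f := fun y => (Cexp x * Cexp (y - x))%C).
  { intros y. rewrite <- Cexp_plus. f_equal. ring. }
  apply (Cder_eq _ _ (Cexp x * (1 * (1 - 0)))%C); [ring|].
  apply Cder_scal. apply (Cder_comp Cexp (fun y => y - x)%C).
  - replace (x - x)%C with (RtoC 0) by ring. apply Cder_Cexp_0.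
  - apply Cder_minus; [apply Cder_id|apply Cder_const].
Qed.

Lemma Cmod_sqr (w : C) : Cmod w * Cmod w = Re w * Re w + Im w * Im w.
Proof. generalize (Cmod2_alt w). simpl. rewrite !Rmult_1_r. auto. Qed.

Lemma div_Cmod_bound (w : C) : w <> 0 -> -1 <= Re w / Cmod w <= 1.
Proof.
  intros H. assert (Hr : 0 < Cmod w) by (apply Cmod_gt_0, H).
  generalize (re_le_Cmod w). intros H1. apply Rabs_le_between in H1.
  split; [apply Rle_div_r|apply Rle_div_l]; lra.
Qed.

Lemma Cexp_Clog (w : C) : w <> 0 -> Cexp (Clog w) = w.
Proof.
  intros H. assert (Hr : 0 < Cmod w) by (apply Cmod_gt_0, H).
  assert (Hb := div_Cmod_bound w H).
  unfold Cexp, Clog; simpl Re; simpl Im. rewrite exp_ln by assumption.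
  assert (Hs : sin (acos (Re w / Cmod w)) = Rabs (Im w) / Cmod w).
  { rewrite sin_acos by assumption.
    replace (1 - Rsqr (Re w / Cmod w)) with (Rsqr (Im w / Cmod w)).
    - rewrite sqrt_Rsqr_abs, Rabs_div by lra. f_equal. apply Rabs_pos_eq; lra.
    - unfold Rsqr. generalize (Cmod_sqr w). intros E.
      replace (Im w / Cmod w * (Im w / Cmod w)) with ((Im w * Im w) / (Cmod w * Cmod w)) by (field; lra).
      replace (Im w * Im w) with (Cmod w * Cmod w - Re w * Re w) by lra. field. lra. }
  unfold Carg. destruct (Rle_dec 0 (Im w)) as [Hi|Hi].
  - rewrite cos_acos, Hs, Rabs_pos_eq by assumption. apply C_ext; simpl; field; lra.
  - rewrite cos_neg, sin_neg, cos_acos, Hs, Rabs_left by lra. apply C_ext; simpl; field; lra.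
Qed.

Lemma sqrt_div_Cmod (w : C) (x y : R) : w <> 0 -> 0 < y -> Cmod w * Cmod w = x * x + y * y ->
  sqrt (1 - (x / Cmod w)²) = y / Cmod w.
Proof.
  intros H Hy E. assert (Hr : 0 < Cmod w) by (apply Cmod_gt_0, H).
  replace (1 - (x / Cmod w)²) with ((y / Cmod w)²).
  - apply sqrt_Rsqr, Rlt_le, Rdiv_lt_0_compat; assumption.
  - unfold Rsqr. replace (y / Cmod w * (y / Cmod w)) with ((y * y) / (Cmod w * Cmod w)) by (field; lra).
    replace (y * y) with (Cmod w * Cmod w - x * x) by lra. field. lra.
Qed.

Lemma acos_div_Cmod (w : C) (y : R) : 0 < y -> Cmod w * Cmod w = Re w * Re w + y * y ->
  acos (Re w / Cmod w) = PI / 2 - atan (Re w / y).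
Proof.
  intros Hy E.
  assert (Hw : w <> 0). { apply Cmod_gt_0. generalize (Cmod_ge_0 w). nra. }
  assert (Hr : 0 < Cmod w) by (apply Cmod_gt_0, Hw).
  rewrite acos_asin, asin_atan.
  - rewrite sqrt_div_Cmod with (y := y) by assumption. do 2 f_equal. field. lra.
  - split; [apply Rlt_div_r|apply Rlt_div_l]; nra.
  - apply div_Cmod_bound, Hw.
Qed.

(** The definition of [Carg] splits along the real axis. Each of the upper, lower and right
    half-planes has its own arctangent formula; together they cover [slit], and continuity can be
    read off locally from one of them. *)
Lemma Carg_upper (w : C) : 0 < Im w -> Carg w = PI / 2 - atan (Re w / Im w).
Proof.
  intros H. unfold Carg. destruct (Rle_dec 0 (Im w)); [|lra].
  apply acos_div_Cmod; [assumption|apply Cmod_sqr].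
Qed.

Lemma Carg_lower (w : C) : Im w < 0 -> Carg w = - (PI / 2) - atan (Re w / Im w).
Proof.
  intros H. unfold Carg. destruct (Rle_dec 0 (Im w)); [lra|].
  rewrite (acos_div_Cmod w (- Im w)); [|lra|rewrite Cmod_sqr; ring].
  replace (Re w / - Im w) with (- (Re w / Im w)) by (field; lra). rewrite atan_opp. lra.
Qed.

Lemma Carg_right (w : C) : 0 < Re w -> Carg w = atan (Im w / Re w).
Proof.
  intros H. destruct (Rtotal_order (Im w) 0) as [H1|[H1|H1]].
  - rewrite Carg_lower by assumption.
    replace (Im w / Re w) with (- / (Re w / - Im w)) by (field; lra).
    rewrite atan_opp, atan_inv by (apply Rdiv_lt_0_compat; lra).
    replace (Re w / - Im w) with (- (Re w / Im w)) by (field; lra). rewrite atan_opp. lra.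
  - unfold Carg. rewrite H1. destruct (Rle_dec 0 0); [|lra].
    replace (Cmod w) with (Re w).
    + unfold Rdiv. rewrite Rinv_r, Rmult_0_l, acos_1, atan_0 by lra. reflexivity.
    + apply Rsqr_inj; [lra|apply Cmod_ge_0|]. unfold Rsqr. rewrite Cmod_sqr, H1. ring.
  - rewrite Carg_upper by assumption.
    replace (Im w / Re w) with (/ (Re w / Im w)) by (field; lra).
    rewrite atan_inv by (apply Rdiv_lt_0_compat; lra). reflexivity.
Qed.

Definition slit (w : C) : Prop := 0 < Re w \/ Im w <> 0.

Lemma slit_neq_0 (w : C) : slit w -> w <> 0.
Proof. intros [H|H] ->; simpl in H; lra. Qed.

Lemma Rcomp_Ccont_atan (w : C) (p q : C -> R) (s : R) (g : C -> R) :
  q w <> 0 -> (forall y, Rabs (p y - p w) <= Cmod (y - w)) -> (forall y, Rabs (q y - q w) <= Cmod (y - w)) ->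
  (exists d, 0 < d /\ forall y, Cmod (y - w) < d -> g y = s + atan (p y / q y)) ->
  forall e, 0 < e -> exists d, 0 < d /\ forall y, Cmod (y - w) < d -> Rabs (g y - g w) < e.
Proof.
  intros Hq Hp1 Hq1 (d0 & Hd0 & Hg) e He.
  assert (Hc : continuity_2d_pt (fun x y => atan (x / y)) (p w) (q w)).
  { apply continuity_1d_2d_pt_comp with (f := atan) (g := fun x y => x / y).
    - apply derivable_continuous_pt, derivable_pt_atan.
    - apply continuity_2d_pt_mult; [apply continuity_2d_pt_id1|].
      apply continuity_2d_pt_inv; [apply continuity_2d_pt_id2|assumption]. }
  destruct (Hc (mkposreal e He)) as [d Hd]. exists (Rmin d0 d).
  split; [apply Rmin_pos; [assumption|apply cond_pos]|]. intros y Hy.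
  assert (H0 := Rlt_le_trans _ _ _ Hy (Rmin_l _ _)). assert (H1 := Rlt_le_trans _ _ _ Hy (Rmin_r _ _)).
  rewrite (Hg y H0), (Hg w).
  2:{ replace (w - w)%C with (RtoC 0) by ring. rewrite Cmod_0; assumption. }
  replace (s + atan (p y / q y) - (s + atan (p w / q w))) with (atan (p y / q y) - atan (p w / q w)) by ring.
  apply Hd; eapply Rle_lt_trans; eauto.
Qed.

Lemma Re_lip (w y : C) : Rabs (Re y - Re w) <= Cmod (y - w).
Proof. rewrite <- re_minus. apply re_le_Cmod. Qed.

Lemma Im_lip (w y : C) : Rabs (Im y - Im w) <= Cmod (y - w).
Proof. rewrite <- im_minus. apply im_le_Cmod. Qed.

Lemma Carg_cont (w : C) : slit w ->
  forall e, 0 < e -> exists d, 0 < d /\ forall y, Cmod (y - w) < d -> Rabs (Carg y - Carg w) < e.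
Proof.
  intros Hw. destruct (Rlt_dec 0 (Re w)) as [H|H].
  - apply (Rcomp_Ccont_atan w Im Re 0); [lra|apply Im_lip|apply Re_lip|].
    exists (Re w). split; [assumption|]. intros y Hy. rewrite Carg_right; [ring|].
    generalize (Re_lip w y). intros T. apply Rabs_le_between in T. lra.
  - destruct Hw as [|Hw]; [contradiction|].
    assert (N : forall e, 0 < e -> exists d, 0 < d /\ forall y, Cmod (y - w) < d -> Rabs (- Carg y - (- Carg w)) < e).
    { destruct (Rlt_dec 0 (Im w)) as [H1|H1].
      - apply (Rcomp_Ccont_atan w Re Im (- (PI / 2))) with (g := fun y => - Carg y); [lra|apply Re_lip|apply Im_lip|].
        exists (Im w). split; [assumption|]. intros y Hy. rewrite Carg_upper; [ring|].
        generalize (Im_lip w y). intros T. apply Rabs_le_between in T. lra.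
      - apply (Rcomp_Ccont_atan w Re Im (PI / 2)) with (g := fun y => - Carg y); [lra|apply Re_lip|apply Im_lip|].
        exists (- Im w). split; [lra|]. intros y Hy. rewrite Carg_lower; [ring|].
        generalize (Im_lip w y). intros T. apply Rabs_le_between in T. lra. }
    intros e He. destruct (N e He) as (d & Hd & Hs). exists d. split; [assumption|].
    intros y Hy. specialize (Hs y Hy). replace (Carg y - Carg w) with (- (- Carg y - - Carg w)) by ring.
    rewrite Rabs_Ropp. exact Hs.
Qed.

Lemma Clog_cont (w : C) : slit w -> Ccont Clog w.
Proof.
  intros Hw e He.
  destruct (Carg_cont w Hw (e / 2)) as (d1 & Hd1 & H1); [lra|].
  assert (Hr : 0 < Cmod w) by (apply Cmod_gt_0, slit_neq_0, Hw).
  assert (Hl : continuity_pt ln (Cmod w)).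
  { apply derivable_continuous_pt. exists (/ Cmod w). apply derivable_pt_lim_ln, Hr. }
  destruct (proj1 (continuity_pt_filterlim _ _) Hl (fun y => Rabs (y - ln (Cmod w)) < e / 2)) as [d2 Hd2].
  { exists (mkposreal (e / 2) ltac:(lra)). intros y Hy. exact Hy. }
  exists (Rmin d1 d2). split; [apply Rmin_pos; [assumption|apply cond_pos]|]. intros y Hy.
  eapply Rle_lt_trans; [apply Cmod_le_Re_Im|]. rewrite re_minus, im_minus. simpl Re; simpl Im.
  specialize (H1 y (Rlt_le_trans _ _ _ Hy (Rmin_l _ _))).
  assert (H2 : Rabs (ln (Cmod y) - ln (Cmod w)) < e / 2).
  { apply Hd2. apply Rle_lt_trans with (2 := Rlt_le_trans _ _ _ Hy (Rmin_r _ _)).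
    change (Rabs (Cmod y - Cmod w) <= Cmod (y - w)). apply Rabs_le.
    generalize (Cmod_triangle_rev y w) (Cmod_triangle_rev w y). rewrite (Cmod_sub_sym w y). lra. }
  lra.
Qed.

(** Differentiation of an inverse function: the expansion of [Cexp] at [Clog w] is solved for the
    increment of the logarithm, which is small by continuity. *)
Lemma Cder_Clog (w : C) : slit w -> Cder Clog w (/ w)%C.
Proof.
  intros Hw e He. assert (Hw0 := slit_neq_0 w Hw).
  assert (Hr : 0 < Cmod w) by (apply Cmod_gt_0, Hw0). set (r := Cmod w) in *.
  set (e' := Rmin (r / 2) (e * r * r / 2)).
  assert (He' : 0 < e') by (apply Rmin_pos; [lra|]; apply Rdiv_lt_0_compat; [|lra]; repeat apply Rmult_lt_0_compat; assumption).
  destruct (Cder_Cexp (Clog w) e' He') as (d1 & Hd1 & H1).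
  destruct (Clog_cont w Hw d1 Hd1) as (d2 & Hd2 & H2).
  exists (Rmin d2 r). split; [apply Rmin_pos; assumption|]. intros y Hy.
  specialize (H1 (Clog y) (H2 y (Rlt_le_trans _ _ _ Hy (Rmin_l _ _)))).
  assert (Hy0 : y <> 0).
  { intros ->. assert (Hy' := Rlt_le_trans _ _ _ Hy (Rmin_r _ _)).
    replace (0 - w)%C with (- w)%C in Hy' by ring. rewrite Cmod_opp in Hy'. fold r in Hy'. lra. }
  rewrite !Cexp_Clog in H1 by assumption.
  set (eta := (Clog y - Clog w)%C) in *. set (D := Cmod (y - w)) in *.
  assert (E1 : e' <= r / 2) by apply Rmin_l. assert (E2 : e' <= e * r * r / 2) by apply Rmin_r.
  assert (He0 := Cmod_ge_0 eta). assert (HD : 0 <= D) by apply Cmod_ge_0.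
  assert (B : r * Cmod eta <= D + e' * Cmod eta).
  { unfold r. rewrite <- Cmod_mult. replace (w * eta)%C with ((y - w) - (y - w - w * eta))%C by ring.
    eapply Rle_trans; [apply Cmod_triangle|]. rewrite Cmod_opp. fold D. lra. }
  (* An a priori bound of the increment of the logarithm by that of the argument: since e' <= r / 2,
     the error term is absorbed in the left-hand side. *)
  assert (B2 : r * Cmod eta <= 2 * D) by nra.
  replace (eta - / w * (y - w))%C with (- (y - w - w * eta) / w)%C by (field; assumption).
  rewrite Cmod_div, Cmod_opp by assumption. fold r.
  apply Rle_div_l; [assumption|].
  eapply Rle_trans; [exact H1|].
  apply Rle_trans with (e * r * r / 2 * Cmod eta); [apply Rmult_le_compat_r; assumption|].
  replace (e * r * r / 2 * Cmod eta) with (e * r / 2 * (r * Cmod eta)) by field.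
  apply Rle_trans with (e * r / 2 * (2 * D)); [|lra].
  apply Rmult_le_compat_l; [|assumption]. apply Rlt_le, Rdiv_lt_0_compat; [nra|lra].
Qed.

Lemma Clog_quadrant (u : C) : 0 < Re u -> 0 < Im u -> (Clog u - Clog (- Ci * u))%C = (0, PI / 2).
Proof.
  intros H1 H2. unfold Clog. rewrite Cmod_mult, Cmod_opp, Cmod_Ci, Rmult_1_l.
  rewrite Carg_upper by assumption.
  assert (E1 : Re (- Ci * u) = Im u) by (unfold Re, Im; simpl; ring).
  assert (E2 : Im (- Ci * u) = - Re u) by (unfold Re, Im; simpl; ring).
  rewrite Carg_right, E1, E2 by (rewrite E1; assumption).
  replace (- Re u / Im u) with (- (Re u / Im u)) by (field; lra). rewrite atan_opp.
  apply C_ext; simpl; ring.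
Qed.

Lemma CI_inv_edge (k a v : C) (s t : R) : s <= t -> k <> 0 ->
  (forall x, s <= x <= t -> slit (k * (a + v * RtoC x))%C) ->
  (v * CI (fun x => / (a + v * RtoC x))%C s t)%C = (Clog (k * (a + v * RtoC t)) - Clog (k * (a + v * RtoC s)))%C.
Proof.
  intros Hst Hk H.
  assert (N : forall x, s <= x <= t -> (a + v * RtoC x)%C <> 0).
  { intros x Hx E. apply (slit_neq_0 _ (H x Hx)). rewrite E. ring. }
  assert (Hc : forall x, s <= x <= t -> Rcont (fun x => / (a + v * RtoC x))%C x).
  { intros x Hx. apply (Ccont_Rcont Cinv (fun x => a + v * RtoC x)%C); [|apply Rcont_affine].
    eapply Cder_cont, Cder_inv, N, Hx. }
  rewrite <- CI_scal by (apply ex_CI_cont; rewrite Rmin_left, Rmax_right by assumption; exact Hc).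
  apply (CI_FTC (fun x => Clog (k * (a + v * RtoC x))%C)); rewrite Rmin_left, Rmax_right by assumption; intros x Hx.
  - eapply Rder_eq; [|apply (Cder_Rder Clog (fun x => k * (a + v * RtoC x))%C);
      [apply Cder_Clog, H, Hx|apply Rder_scal, Rder_affine]].
    field. split; [apply N, Hx|exact Hk].
  - apply Rcont_mult; [apply continuous_const|]. apply Hc, Hx.
Qed.

Lemma bd_cont_inv (a b c d p q : R) : a < p < b -> c < q < d ->
  bd_cont (fun w => / (w - (p, q)))%C a b c d.
Proof.
  intros Hp Hq. assert (H : forall w : C, w <> (p, q) -> Ccont (fun w => / (w - (p, q)))%C w).
  { intros w Hw. apply (Ccont_inv (fun w => w - (p, q))%C); [apply Cminus_eq_contra, Hw|].
    apply Ccont_minus; [apply Ccont_id|apply Ccont_const]. }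
  split; intros t Ht; split; apply H; intros E; apply (f_equal fst) in E as E1; apply (f_equal snd) in E as E2;
    simpl in *; lra.
Qed.

Definition mkC (x y : R) : C := (x, y).

(** On each edge a rotated logarithm is a primitive: the factors i, 1, -i, -1 turn the bottom,
    right, top and left edges into the right half-plane. At each corner the two rotated logarithms
    differ by i pi / 2, and four quarter turns give 2 i pi. *)
Lemma RI_inv (a b c d p q : R) : a < p < b -> c < q < d ->
  RI (fun w => / (w - (p, q)))%C a b c d = (2 * RtoC PI * Ci)%C.
Proof.
  intros Hp Hq. unfold RI.
  assert (E1 : CI (fun x => / ((x, c) - (p, q)))%C a b = (Clog (Ci * (mkC (b - p) (c - q))) - Clog (Ci * (mkC (a - p) (c - q))))%C).
  { rewrite (CI_ext _ (fun x => / (mkC (- p) (c - q) + 1 * RtoC x))%C).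
    2:{ intros. f_equal. apply C_ext; simpl; ring. }
    rewrite <- (Cmult_1_l (CI _ a b)). rewrite (CI_inv_edge Ci); [|lra|apply Ci_nz|].
    - f_equal; [|f_equal]; do 2 f_equal; apply C_ext; simpl; ring.
    - intros x Hx. left. simpl. lra. }
  assert (E3 : CI (fun x => / ((x, d) - (p, q)))%C a b = (Clog (- Ci * (mkC (b - p) (d - q))) - Clog (- Ci * (mkC (a - p) (d - q))))%C).
  { rewrite (CI_ext _ (fun x => / (mkC (- p) (d - q) + 1 * RtoC x))%C).
    2:{ intros. f_equal. apply C_ext; simpl; ring. }
    rewrite <- (Cmult_1_l (CI _ a b)). rewrite (CI_inv_edge (- Ci)%C); [|lra| |].
    - f_equal; [|f_equal]; do 2 f_equal; apply C_ext; simpl; ring.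
    - intros E. apply (f_equal Im) in E. simpl in E. lra.
    - intros x Hx. left. simpl. lra. }
  assert (E2 : (Ci * CI (fun y => / ((b, y) - (p, q))) c d)%C = (Clog (mkC (b - p) (d - q)) - Clog (mkC (b - p) (c - q)))%C).
  { rewrite (CI_ext _ (fun x => / (mkC (b - p) (- q) + Ci * RtoC x))%C).
    2:{ intros. f_equal. apply C_ext; simpl; ring. }
    rewrite (CI_inv_edge 1); [|lra|apply C1_nz|].
    - f_equal; [|f_equal]; f_equal; apply C_ext; simpl; ring.
    - intros x Hx. left. simpl. lra. }
  assert (E4 : (Ci * CI (fun y => / ((a, y) - (p, q))) c d)%C = (Clog (- (mkC (a - p) (d - q))) - Clog (- (mkC (a - p) (c - q))))%C).
  { rewrite (CI_ext _ (fun x => / (mkC (a - p) (- q) + Ci * RtoC x))%C).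
    2:{ intros. f_equal. apply C_ext; simpl; ring. }
    rewrite (CI_inv_edge (-1)%C); [|lra| |].
    - f_equal; [|f_equal]; f_equal; apply C_ext; simpl; ring.
    - intros E. apply (f_equal Re) in E. simpl in E. lra.
    - intros x Hx. left. simpl. lra. }
  rewrite E1, E2, E3, E4.
  assert (Q1 := Clog_quadrant (Ci * (mkC (b - p) (c - q)))). assert (Q2 := Clog_quadrant (mkC (b - p) (d - q))).
  assert (Q3 := Clog_quadrant (- Ci * (mkC (a - p) (d - q)))). assert (Q4 := Clog_quadrant (- (mkC (a - p) (c - q)))).
  specialize (Q1 ltac:(simpl; lra) ltac:(simpl; lra)). specialize (Q2 ltac:(simpl; lra) ltac:(simpl; lra)).
  specialize (Q3 ltac:(simpl; lra) ltac:(simpl; lra)). specialize (Q4 ltac:(simpl; lra) ltac:(simpl; lra)).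
  replace (- Ci * (Ci * (mkC (b - p) (c - q))))%C with (mkC (b - p) (c - q)) in Q1 by (apply C_ext; simpl; ring).
  replace (- Ci * (- Ci * (mkC (a - p) (d - q))))%C with (- (mkC (a - p) (d - q)))%C in Q3 by (apply C_ext; simpl; ring).
  replace (- Ci * - (mkC (a - p) (c - q)))%C with (Ci * (mkC (a - p) (c - q)))%C in Q4 by (apply C_ext; simpl; ring).
  set (l1 := Clog (Ci * (mkC (b - p) (c - q)))) in *. set (l2 := Clog (mkC (b - p) (c - q))) in *.
  set (l3 := Clog (mkC (b - p) (d - q))) in *. set (l4 := Clog (- Ci * (mkC (b - p) (d - q)))) in *.
  set (l5 := Clog (- Ci * (mkC (a - p) (d - q)))) in *. set (l6 := Clog (- (mkC (a - p) (d - q)))) in *.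
  set (l7 := Clog (- (mkC (a - p) (c - q)))) in *. set (l8 := Clog (Ci * (mkC (a - p) (c - q)))) in *.
  replace (l1 - l8 + (l3 - l2) - (l4 - l5) - (l6 - l7))%C
    with ((l1 - l2) + (l3 - l4) + (l5 - l6) + (l7 - l8))%C by ring.
  rewrite Q1, Q2, Q3, Q4. apply C_ext; simpl; field.
Qed.

(** * Cauchy's formula and the differentiation of Cauchy integrals *)

Lemma bd_cont_mult (f g : C -> C) (a b c d : R) :
  bd_cont f a b c d -> bd_cont g a b c d -> bd_cont (fun w => f w * g w)%C a b c d.
Proof.
  intros [H1 H2] [H3 H4]. split; intros t Ht; split; apply Ccont_mult;
    solve [apply H1, Ht | apply H2, Ht | apply H3, Ht | apply H4, Ht].
Qed.

Lemma bd_neq (a b c d p q : R) : a < p < b -> c < q < d ->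
  (forall x, a <= x <= b -> (x, c) <> (p, q) /\ (x, d) <> (p, q)) /\
  (forall y, c <= y <= d -> (a, y) <> (p, q) /\ (b, y) <> (p, q)).
Proof. intros. split; intros; split; intros [=]; lra. Qed.

Definition dquot (f : C -> C) (z k w : C) : C := if Ceq_dec w z then k else ((f w - f z) / (w - z))%C.

Lemma dquot_off (f : C -> C) (z k w : C) : w <> z ->
  exists d, 0 < d /\ forall y, Cmod (y - w) < d -> ((f y - f z) / (y - z))%C = dquot f z k y.
Proof.
  intros Hw. exists (Cmod (w - z)). split; [apply Cmod_gt_0, Cminus_eq_contra, Hw|].
  intros y Hy. unfold dquot. destruct (Ceq_dec y z) as [->|]; [|reflexivity].
  rewrite Cmod_sub_sym in Hy. lra.
Qed.

Lemma dquot_cont (f : C -> C) (z k : C) : Cder f z k -> forall w, Ccont f w -> Ccont (dquot f z k) w.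
Proof.
  intros Hk w Hw. destruct (Ceq_dec w z) as [->|E].
  - intros e He. destruct (Hk (e / 2)) as (r & Hr & Hs); [lra|].
    exists r. split; [assumption|]. intros w' Hw'. unfold dquot.
    destruct (Ceq_dec z z) as [_|]; [|congruence].
    destruct (Ceq_dec w' z) as [->|Hwz].
    + replace (k - k)%C with (RtoC 0) by ring. rewrite Cmod_0; assumption.
    + assert (Hn : (w' - z)%C <> 0) by (apply Cminus_eq_contra, Hwz).
      replace ((f w' - f z) / (w' - z) - k)%C with ((f w' - f z - k * (w' - z)) / (w' - z))%C by (field; assumption).
      rewrite Cmod_div by assumption. apply Cmod_gt_0 in Hn. apply Rlt_div_l; [assumption|].
      eapply Rle_lt_trans; [apply Hs, Hw'|]. nra.
  - destruct (dquot_off f z k w E) as (r & Hr & Hs). apply (Ccont_ext_loc _ _ _ r Hr Hs).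
    apply Ccont_div; [apply Cminus_eq_contra, E| |].
    + apply Ccont_minus; [assumption|apply Ccont_const].
    + apply Ccont_minus; [apply Ccont_id|apply Ccont_const].
Qed.

Lemma dquot_der (f : C -> C) (z k w : C) : w <> z -> (exists l, Cder f w l) -> exists l, Cder (dquot f z k) w l.
Proof.
  intros E [m Hm]. destruct (dquot_off f z k w E) as (r & Hr & Hs).
  eexists. apply (Cder_ext_loc _ _ _ _ r Hr Hs).
  apply (Cder_div (fun w => f w - f z)%C (fun w => w - z)%C); [apply Cminus_eq_contra, E| |];
    apply Cder_minus; try apply Cder_const; [exact Hm|apply Cder_id].
Qed.

(** Goursat's theorem is applied to the difference quotient [dquot], filled in with the derivative k
    at the centre. Its differentiability there is not at hand, so the abscissa p joins the list of
    exceptions. What remains is f(z) times the integral of 1 / (w - z). *)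
Theorem Cauchy_formula (l : list R) (f : C -> C) (a b c d p q : R) (k : C) :
  a < p < b -> c < q < d -> rect_cont f a b c d ->
  (forall x y, a < x < b -> c < y < d -> ~ In x l -> exists k, Cder f (x, y) k) ->
  Cder f (p, q) k ->
  RI (fun w => f w * / (w - (p, q)))%C a b c d = (2 * RtoC PI * Ci * f (p, q))%C.
Proof.
  intros Hp Hq Hc Hd Hk.
  set (z := (p, q) : C) in *.
  set (g := dquot f z k).
  assert (G0 : RI g a b c d = 0).
  { apply (Goursat (p :: l)); try lra.
    - intros x y Hx Hy. apply dquot_cont; [assumption|]. apply Hc; assumption.
    - intros x y Hx Hy Hn. apply dquot_der.
      + intros [= -> ->]. apply Hn. left. reflexivity.
      + apply Hd; try assumption. intros H; apply Hn; right; exact H. }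
  assert (Hbi := bd_cont_inv a b c d p q Hp Hq). fold z in Hbi.
  assert (Hbf : bd_cont f a b c d) by (apply rect_bd_cont; [lra|lra|assumption]).
  assert (Hb2 : bd_cont (fun w => - f z * / (w - z))%C a b c d).
  { apply (bd_cont_mult (fun _ => (- f z)%C)); [|assumption]. split; split; apply Ccont_const. }
  assert (E : RI g a b c d = (RI (fun w => f w * / (w - z)) a b c d - f z * (2 * RtoC PI * Ci))%C).
  { rewrite <- (RI_inv a b c d p q Hp Hq). fold z.
    transitivity (RI (fun w => f w * / (w - z) + - f z * / (w - z))%C a b c d).
    - destruct (bd_neq a b c d p q Hp Hq) as [N1 N2]. fold z in N1, N2.
      assert (A : forall w, w <> z -> g w = (f w * / (w - z) + - f z * / (w - z))%C).
      { intros w Hw. unfold g, dquot. destruct (Ceq_dec w z); [contradiction|]. field. apply Cminus_eq_contra, Hw. }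
      apply RI_ext; try lra; intros t Ht; split; apply A; solve [apply N1, Ht | apply N2, Ht].
    - rewrite (RI_plus (fun w => f w * / (w - z))%C (fun w => - f z * / (w - z))%C); try lra.
      + rewrite (RI_scal (- f z)%C (fun w => / (w - z))%C) by (try lra; assumption). ring.
      + apply bd_cont_mult; assumption.
      + assumption. }
  rewrite G0 in E. replace (2 * RtoC PI * Ci * f z)%C with (f z * (2 * RtoC PI * Ci))%C by ring.
  symmetry in E. apply Ceq_minus in E. exact E.
Qed.

Definition bd_le (f : C -> C) (a b c d K : R) : Prop :=
  (forall x, a <= x <= b -> Cmod (f (x, c)) <= K /\ Cmod (f (x, d)) <= K) /\
  (forall y, c <= y <= d -> Cmod (f (a, y)) <= K /\ Cmod (f (b, y)) <= K).

Lemma RI_bound' (f : C -> C) (a b c d K : R) : a <= b -> c <= d ->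
  bd_cont f a b c d -> bd_le f a b c d K -> Cmod (RI f a b c d) <= 2 * K * ((b - a) + (d - c)).
Proof.
  intros Hab Hcd [H1 H2] [H3 H4]. apply RI_bound; try assumption; intros t Ht; repeat split;
    solve [apply H1, Ht | apply H2, Ht | apply H3, Ht | apply H4, Ht].
Qed.

Lemma Cmod_inv_le (w : C) (r : R) : 0 < r -> r <= Cmod w -> Cmod (/ w) <= / r.
Proof.
  intros Hr H. rewrite Cmod_inv by (apply Cmod_gt_0; lra). apply Rinv_le_contravar; assumption.
Qed.

Definition bd_far (z : C) (a b c d r : R) : Prop :=
  (forall x, a <= x <= b -> r <= Cmod ((x, c) - z) /\ r <= Cmod ((x, d) - z)) /\
  (forall y, c <= y <= d -> r <= Cmod ((a, y) - z) /\ r <= Cmod ((b, y) - z)).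

Lemma bd_far_intro (p q a b c d r : R) : a + r <= p <= b - r -> c + r <= q <= d - r ->
  bd_far (p, q) a b c d r.
Proof.
  intros Hp Hq. split; intros t Ht; split.
  - eapply Rle_trans; [|apply im_le_Cmod]. simpl. eapply Rle_trans; [|rewrite <- Rabs_Ropp; apply Rle_abs]. lra.
  - eapply Rle_trans; [|apply im_le_Cmod]. simpl. eapply Rle_trans; [|apply Rle_abs]. lra.
  - eapply Rle_trans; [|apply re_le_Cmod]. simpl. eapply Rle_trans; [|rewrite <- Rabs_Ropp; apply Rle_abs]. lra.
  - eapply Rle_trans; [|apply re_le_Cmod]. simpl. eapply Rle_trans; [|apply Rle_abs]. lra.
Qed.

Lemma bd_far_cont (z : C) (a b c d r : R) : 0 < r -> bd_far z a b c d r -> bd_cont (fun w => / (w - z))%C a b c d.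
Proof.
  intros Hr [H1 H2]. assert (H : forall w : C, r <= Cmod (w - z) -> Ccont (fun w => / (w - z))%C w).
  { intros w Hw. apply (Ccont_inv (fun w => w - z)%C); [apply Cmod_gt_0; lra|].
    apply Ccont_minus; [apply Ccont_id|apply Ccont_const]. }
  split; intros t Ht; split; apply H; solve [apply H1, Ht | apply H2, Ht].
Qed.

Lemma bd_far_le (z : C) (a b c d r : R) : 0 < r -> bd_far z a b c d r -> bd_le (fun w => / (w - z))%C a b c d (/ r).
Proof.
  intros Hr [H1 H2]. split; intros t Ht; split; apply Cmod_inv_le; try assumption; solve [apply H1, Ht | apply H2, Ht].
Qed.

Lemma bd_le_mult (f g : C -> C) (a b c d K L : R) :
  bd_le f a b c d K -> bd_le g a b c d L -> bd_le (fun w => f w * g w)%C a b c d (K * L).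
Proof.
  intros [H1 H2] [H3 H4]. split; intros t Ht; split; rewrite Cmod_mult; apply Rmult_le_compat; try apply Cmod_ge_0;
    solve [apply H1, Ht | apply H2, Ht | apply H3, Ht | apply H4, Ht].
Qed.

(** The kernel is expanded exactly: 1/(w-x) = 1/(w-z) + (x-z)/(w-z)^2 + (x-z)^2/((w-x)(w-z)^2). The
    last term is bounded uniformly on the boundary while x stays within r / 2 of z, so it
    contributes a quadratic error. *)
Lemma Cauchy_type_der (k : C -> C) (a b c d K r : R) (z : C) : a <= b -> c <= d -> 0 <= K ->
  bd_cont k a b c d -> bd_le k a b c d K -> 0 < r -> bd_far z a b c d r ->
  Cder (fun x => RI (fun w => k w * / (w - x))%C a b c d) z
    (RI (fun w => k w * (/ (w - z) * / (w - z)))%C a b c d).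
Proof.
  intros Hab Hcd HK Hk HkK Hr Hz e He.
  set (L := 2 * (K * (/ (r / 2) * (/ r * / r))) * ((b - a) + (d - c))).
  assert (HL : 0 <= L).
  { unfold L. assert (0 < / (r / 2)) by (apply Rinv_0_lt_compat; lra). assert (0 < / r) by (apply Rinv_0_lt_compat; lra).
    repeat apply Rmult_le_pos; lra. }
  exists (Rmin (r / 2) (e / (L + 1))). split; [apply Rmin_pos; [lra|apply Rdiv_lt_0_compat; lra]|].
  intros x Hx. assert (Hx1 := Rlt_le_trans _ _ _ Hx (Rmin_l _ _)). assert (Hx2 := Rlt_le_trans _ _ _ Hx (Rmin_r _ _)).
  assert (Hfar : bd_far x a b c d (r / 2)).
  { assert (A : forall w : C, r <= Cmod (w - z) -> r / 2 <= Cmod (w - x)).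
    { intros w Hw. generalize (Cmod_triangle_rev (w - z) (x - z)).
      replace (w - z - (x - z))%C with (w - x)%C by ring. lra. }
    destruct Hz as [Z1 Z2]. split; intros t Ht; split; apply A; solve [apply Z1, Ht | apply Z2, Ht]. }
  assert (Cz := bd_far_cont _ _ _ _ _ _ Hr Hz). assert (Bz := bd_far_le _ _ _ _ _ _ Hr Hz).
  assert (Hr2 : 0 < r / 2) by lra.
  assert (Cx := bd_far_cont _ _ _ _ _ _ Hr2 Hfar). assert (Bx := bd_far_le _ _ _ _ _ _ Hr2 Hfar).
  assert (Czz := bd_cont_mult _ _ _ _ _ _ Cz Cz). assert (Bzz := bd_le_mult _ _ _ _ _ _ _ _ Bz Bz).
  assert (C3 := bd_cont_mult _ _ _ _ _ _ Hk (bd_cont_mult _ _ _ _ _ _ Cx Czz)).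
  assert (B3 := bd_le_mult _ _ _ _ _ _ _ _ HkK (bd_le_mult _ _ _ _ _ _ _ _ Bx Bzz)).
  assert (B := RI_bound' _ _ _ _ _ _ Hab Hcd C3 B3). fold L in B.
  set (I3 := RI (fun w => k w * (/ (w - x) * (/ (w - z) * / (w - z))))%C a b c d) in B.
  assert (E : (RI (fun w => k w * / (w - x)) a b c d - RI (fun w => k w * / (w - z)) a b c d
     - RI (fun w => k w * (/ (w - z) * / (w - z))) a b c d * (x - z))%C = ((x - z) * (x - z) * I3)%C).
  { assert (E0 : RI (fun w => k w * / (w - x))%C a b c d =
      RI (fun w => k w * / (w - z) + ((x - z) * (k w * (/ (w - z) * / (w - z)))
           + (x - z) * (x - z) * (k w * (/ (w - x) * (/ (w - z) * / (w - z))))))%C a b c d).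
    { assert (A : forall w : C, r <= Cmod (w - z) -> r / 2 <= Cmod (w - x) -> (k w * / (w - x))%C =
        (k w * / (w - z) + ((x - z) * (k w * (/ (w - z) * / (w - z)))
           + (x - z) * (x - z) * (k w * (/ (w - x) * (/ (w - z) * / (w - z))))))%C).
      { intros w H1 H2. field. split; apply Cmod_gt_0; lra. }
      destruct Hz as [Z1 Z2]. destruct Hfar as [F1 F2].
      apply RI_ext; try assumption; intros t Ht; split; apply A; solve [apply Z1, Ht | apply Z2, Ht | apply F1, Ht | apply F2, Ht]. }
    assert (Cs : forall (s : C) g, bd_cont g a b c d -> bd_cont (fun w => s * g w)%C a b c d).
    { intros s g Hg. apply (bd_cont_mult (fun _ => s)); [|exact Hg]. split; split; apply Ccont_const. }
    assert (C1 := bd_cont_mult _ _ _ _ _ _ Hk Cz). assert (C2 := bd_cont_mult _ _ _ _ _ _ Hk Czz).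
    assert (C2' := Cs (x - z)%C _ C2). assert (C3' := Cs ((x - z) * (x - z))%C _ C3).
    rewrite E0.
    rewrite (RI_plus (fun w => k w * / (w - z))%C _ a b c d Hab Hcd C1).
    2:{ destruct C2' as [P1 P2], C3' as [P3 P4]. split; intros t Ht; split; apply Ccont_plus;
       solve [apply P1, Ht | apply P2, Ht | apply P3, Ht | apply P4, Ht]. }
    rewrite (RI_plus _ _ a b c d Hab Hcd C2' C3').
    rewrite (RI_scal (x - z)%C _ a b c d Hab Hcd C2), (RI_scal ((x - z) * (x - z))%C _ a b c d Hab Hcd C3).
    fold I3. ring. }
  rewrite E, !Cmod_mult. set (D := Cmod (x - z)) in *. assert (HD : 0 <= D) by apply Cmod_ge_0.
  assert (HI := Cmod_ge_0 I3). apply Rlt_div_r in Hx2; [|lra].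
  assert (D * Cmod I3 <= D * (L + 1)) by (apply Rmult_le_compat_l; lra). nra.
Qed.

(** * Consequences of Cauchy's formula *)

Lemma RI_opp_ext0 (a b c d : R) : a <= b -> c <= d -> RI (fun _ => RtoC 0) a b c d = 0.
Proof.
  intros Hab Hcd. rewrite (RI_ext _ (fun y => 0 + 0 * (y - 0))%C); try assumption.
  - apply RI_affine; assumption.
  - intros; split; ring.
  - intros; split; ring.
Qed.

(** Cauchy's formula is applied to k = (w - z) Y(w), which is continuous at z with value 0 because Y
    is bounded. The radius 3 r leaves room for the square of half-side r on which one integrates.
    The bound on the derivative is part of the conclusion because the descent on the order of a pole
    relies on it. *)
Theorem Riemann_removable (Y : C -> C) (z : C) (r B : R) : 0 < r -> 0 <= B ->
  (forall x, 0 < Cmod (x - z) < 3 * r -> exists l, Cder Y x l) ->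
  (forall x, 0 < Cmod (x - z) < 3 * r -> Cmod (Y x) <= B) ->
  exists (Yh : C -> C) (B' : R), (forall x, 0 < Cmod (x - z) < r / 2 -> Yh x = Y x) /\
    forall x, Cmod (x - z) < r / 2 -> exists l, Cder Yh x l /\ Cmod l <= B'.
Proof.
  intros Hr HB Hd Hb. destruct z as [p q]. set (z := (p, q) : C) in *.
  set (a := p - r). set (b := p + r). set (c := q - r). set (d := q + r).
  set (k := fun w => ((w - z) * Y w)%C).
  assert (Hab : a <= b) by (unfold a, b; lra). assert (Hcd : c <= d) by (unfold c, d; lra).
  assert (Hk0 : k z = 0) by (unfold k; ring).
  assert (Hin : forall x y, a <= x <= b -> c <= y <= d -> Cmod ((x, y) - z) < 3 * r).
  { intros x y Hx Hy. unfold a, b, c, d in *. eapply Rle_lt_trans; [apply Cmod_le_Re_Im|].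
    simpl. assert (Rabs (x + - p) <= r) by (apply Rabs_le; lra).
    assert (Rabs (y + - q) <= r) by (apply Rabs_le; lra). lra. }
  assert (Hkd : forall x, 0 < Cmod (x - z) < 3 * r -> exists l, Cder k x l).
  { intros x Hx. destruct (Hd x Hx) as [l Hl]. eexists. apply Cder_mult; [|exact Hl].
    apply Cder_minus; [apply Cder_id|apply Cder_const]. }
  assert (Hkc : rect_cont k a b c d).
  { intros x y Hx Hy. destruct (Ceq_dec (x, y) z) as [->|E].
    - intros e He. exists (Rmin r (e / (B + 1))). split; [apply Rmin_pos; [assumption|apply Rdiv_lt_0_compat; lra]|].
      intros w Hw. rewrite Hk0. replace (k w - 0)%C with (k w) by ring.
      destruct (Ceq_dec w z) as [->|Ew]; [rewrite Hk0, Cmod_0; assumption|].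
      assert (0 < Cmod (w - z)) by (apply Cmod_gt_0, Cminus_eq_contra, Ew).
      assert (Hw1 := Rlt_le_trans _ _ _ Hw (Rmin_l _ _)). assert (Hw2 := Rlt_le_trans _ _ _ Hw (Rmin_r _ _)).
      unfold k. rewrite Cmod_mult. specialize (Hb w ltac:(lra)). apply Rlt_div_r in Hw2; [|lra].
      assert (Cmod (w - z) * Cmod (Y w) <= Cmod (w - z) * B) by (apply Rmult_le_compat_l; lra). nra.
    - destruct (Hkd (x, y)) as [l Hl]; [|eapply Cder_cont, Hl].
      split; [apply Cmod_gt_0, Cminus_eq_contra, E|apply Hin; assumption]. }
  assert (CF : forall x, 0 < Cmod (x - z) < r / 2 ->
    RI (fun w => k w * / (w - x))%C a b c d = (2 * RtoC PI * Ci * k x)%C).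
  { intros [x y] Hxy. destruct (Hkd (x, y)) as [l Hl]; [lra|].
    assert (L1 := re_le_Cmod ((x, y) - z)). assert (L2 := im_le_Cmod ((x, y) - z)). simpl in L1, L2.
    apply Rabs_le_between in L1. apply Rabs_le_between in L2.
    apply (Cauchy_formula (p :: nil) k a b c d x y l); unfold a, b, c, d in *; try lra; try assumption.
    intros x' y' Hx' Hy' Hn. apply Hkd. split; [|apply Hin; lra].
    apply Cmod_gt_0, Cminus_eq_contra. intros [= -> ->]. apply Hn. left. reflexivity. }
  assert (Hfar : forall x, Cmod (x - z) < r / 2 -> bd_far x a b c d (r / 2)).
  { intros [x y] Hxy. apply bd_far_intro.
    - assert (L1 := re_le_Cmod ((x, y) - z)). simpl in L1. apply Rabs_le_between in L1. unfold a, b. lra.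
    - assert (L1 := im_le_Cmod ((x, y) - z)). simpl in L1. apply Rabs_le_between in L1. unfold c, d. lra. }
  assert (Hzz : Cmod (z - z) < r / 2) by (replace (z - z)%C with (RtoC 0) by ring; rewrite Cmod_0; lra).
  assert (Hbk : bd_cont k a b c d) by (apply rect_bd_cont; assumption).
  assert (Hnz : (forall x, a <= x <= b -> 0 < Cmod ((x, c) - z) < 3 * r /\ 0 < Cmod ((x, d) - z) < 3 * r) /\
    (forall y, c <= y <= d -> 0 < Cmod ((a, y) - z) < 3 * r /\ 0 < Cmod ((b, y) - z) < 3 * r)).
  { destruct (Hfar z Hzz) as [F1 F2]. split; intros t Ht; split;
      (split; [eapply Rlt_le_trans with (r / 2); [lra|solve [apply F1, Ht | apply F2, Ht]] | apply Hin; lra]). }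
  destruct Hnz as [N1 N2].
  assert (HbY : bd_cont Y a b c d).
  { assert (A : forall x, 0 < Cmod (x - z) < 3 * r -> Ccont Y x).
    { intros x Hx. destruct (Hd x Hx) as [l Hl]. eapply Cder_cont, Hl. }
    split; intros t Ht; split; apply A; solve [apply N1, Ht | apply N2, Ht]. }
  assert (HbYB : bd_le Y a b c d B).
  { split; intros t Ht; split; apply Hb; solve [apply N1, Ht | apply N2, Ht]. }
  assert (Hr2 : 0 < r / 2) by lra.
  (* The Cauchy integral of [k] is continuous at [z], so it equals [2 i pi k] there as well. *)
  assert (H0 : RI (fun w => k w * / (w - z))%C a b c d = 0).
  { assert (HkB : bd_le k a b c d (3 * r * B)).
    { assert (A : forall x, 0 < Cmod (x - z) < 3 * r -> Cmod (k x) <= 3 * r * B).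
      { intros x Hx. unfold k. rewrite Cmod_mult. apply Rmult_le_compat; try apply Cmod_ge_0; [lra|apply Hb, Hx]. }
      split; intros t Ht; split; apply A; solve [apply N1, Ht | apply N2, Ht]. }
    assert (HkB0 : 0 <= 3 * r * B) by nra.
    assert (Hc := Cder_cont _ _ _ (Cauchy_type_der k a b c d _ _ z Hab Hcd HkB0 Hbk HkB Hr2 (Hfar z Hzz))).
    set (H := fun x => RI (fun w => k w * / (w - x))%C a b c d) in *. change (H z = 0).
    assert (Hck : Ccont k z) by (apply Hkc; unfold a, b, c, d; lra).
    apply Cmod_eq_0. apply Rle_antisym; [|apply Cmod_ge_0]. apply le_epsilon. intros e He.
    destruct (Hc (e / 2)) as (d1 & Hd1 & Hs1); [lra|].
    set (K := Cmod (2 * RtoC PI * Ci)). assert (HK : 0 <= K) by apply Cmod_ge_0.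
    destruct (Hck (e / (2 * (K + 1)))) as (d2 & Hd2 & Hs2); [apply Rdiv_lt_0_compat; lra|].
    set (s := Rmin (Rmin d1 d2) (r / 2)). assert (Hs : 0 < s) by (repeat apply Rmin_pos; lra).
    assert (K1 : s <= d1) by (eapply Rle_trans; apply Rmin_l).
    assert (K2 : s <= d2) by (eapply Rle_trans; [apply Rmin_l|apply Rmin_r]).
    assert (K3 : s <= r / 2) by apply Rmin_r.
    set (x := (z + RtoC (s / 2))%C).
    assert (Ex : Cmod (x - z) = s / 2).
    { replace (x - z)%C with (RtoC (s / 2)) by (unfold x; ring). rewrite Cmod_R, Rabs_pos_eq; lra. }
    specialize (Hs1 x ltac:(lra)). specialize (Hs2 x ltac:(lra)).
    assert (Fx : H x = (2 * RtoC PI * Ci * k x)%C) by exact (CF x ltac:(lra)).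
    rewrite Hk0 in Hs2. replace (k x - 0)%C with (k x) in Hs2 by ring.
    assert (Cmod (H x) <= e / 2).
    { rewrite Fx, Cmod_mult. fold K. apply Rlt_div_r in Hs2; [|lra]. generalize (Cmod_ge_0 (k x)); nra. }
    generalize (Cmod_triangle_rev (H z) (H x)). rewrite (Cmod_sub_sym (H z)). lra. }
  (* The extension is the Cauchy integral of Y itself. It equals Y off z because k(w)/(w-x) =
     k(w)/(w-z) + (x-z) Y(w)/(w-x), where the first term has integral zero by [H0]. *)
  exists (fun x => (/ (2 * RtoC PI * Ci) * RI (fun w => Y w * / (w - x)) a b c d)%C).
  assert (Npi : (2 * RtoC PI * Ci)%C <> 0).
  { intros E. apply (f_equal Im) in E. simpl in E. generalize PI_RGT_0. lra. }
  exists (Cmod (/ (2 * RtoC PI * Ci)) * (2 * (B * (/ (r / 2) * / (r / 2))) * ((b - a) + (d - c)))).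
  split.
  - intros x Hx. specialize (CF x Hx). destruct (Hfar x (proj2 Hx)) as [F1 F2].
    assert (Cx := bd_far_cont _ _ _ _ _ _ Hr2 (Hfar x (proj2 Hx))).
    assert (Cz := bd_far_cont _ _ _ _ _ _ Hr2 (Hfar z Hzz)). destruct (Hfar z Hzz) as [F3 F4].
    assert (E : RI (fun w => k w * / (w - x))%C a b c d =
      RI (fun w => k w * / (w - z) + (x - z) * (Y w * / (w - x)))%C a b c d).
    { assert (A : forall w : C, r / 2 <= Cmod (w - x) -> r / 2 <= Cmod (w - z) ->
        (k w * / (w - x))%C = (k w * / (w - z) + (x - z) * (Y w * / (w - x)))%C).
      { intros w A1 A2. unfold k. field. split; apply Cmod_gt_0; lra. }
      apply RI_ext; try assumption; intros t Ht; split; apply A; solve [apply F1, Ht | apply F2, Ht | apply F3, Ht | apply F4, Ht]. }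
    assert (CYx := bd_cont_mult _ _ _ _ _ _ HbY Cx).
    rewrite (RI_plus (fun w => k w * / (w - z))%C (fun w => (x - z) * (Y w * / (w - x)))%C) in E; try assumption.
    + rewrite (RI_scal (x - z)%C) in E by assumption. rewrite H0, CF, Cplus_0_l in E.
      assert (Nx : (x - z)%C <> 0) by (apply Cmod_gt_0; lra).
      apply (f_equal (fun u => / (2 * RtoC PI * Ci) * (/ (x - z) * u))%C) in E. unfold k in E.
      transitivity (/ (2 * RtoC PI * Ci) * (/ (x - z) * ((x - z) * RI (fun w => Y w * / (w - x)) a b c d)))%C.
      * field. split; [assumption|]. split; [apply Ci_nz|]. intros E'. apply RtoC_inj in E'. generalize PI_RGT_0. lra.
      * rewrite <- E. field. split; [assumption|]. split; [apply Ci_nz|]. intros E'; apply RtoC_inj in E'; generalize PI_RGT_0; lra.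
    + apply bd_cont_mult; assumption.
    + apply (bd_cont_mult (fun _ => (x - z)%C)); [|assumption]. split; split; apply Ccont_const.
  - intros x Hx. specialize (Hfar x Hx). eexists. split.
    + apply Cder_scal. apply (Cauchy_type_der Y a b c d B (r / 2)); assumption.
    + rewrite Cmod_mult. apply Rmult_le_compat_l; [apply Cmod_ge_0|].
      assert (Cx := bd_far_cont _ _ _ _ _ _ Hr2 Hfar). assert (Bx := bd_far_le _ _ _ _ _ _ Hr2 Hfar).
      apply RI_bound'; try assumption.
      * apply bd_cont_mult; [assumption|]. apply bd_cont_mult; assumption.
      * apply bd_le_mult; [assumption|]. apply bd_le_mult; assumption.
Qed.

Lemma Cmod_RtoC_mult (k : R) (w : C) : 0 <= k -> Cmod (RtoC k * w) = k * Cmod w.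
Proof. intros H. rewrite Cmod_mult, Cmod_R, Rabs_pos_eq by assumption. reflexivity. Qed.

Definition Ccos (u : C) : C := ((Cexp (Ci * u) + Cexp (- Ci * u)) / 2)%C.

Lemma Im_Ccos (u : C) : Im (Ccos u) = sin (Re u) * ((exp (- Im u) - exp (Im u)) / 2).
Proof.
  unfold Ccos, Cexp.
  replace (Re (Ci * u)) with (- Im u) by (unfold Re, Im; simpl; ring).
  replace (Im (Ci * u)) with (Re u) by (unfold Re, Im; simpl; ring).
  replace (Re (- Ci * u)) with (Im u) by (unfold Re, Im; simpl; ring).
  replace (Im (- Ci * u)) with (- Re u) by (unfold Re, Im; simpl; ring).
  rewrite cos_neg, sin_neg. unfold Im at 1. simpl. field.
Qed.

Lemma Cder_Ccos (u : C) : exists l, Cder Ccos u l.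
Proof.
  eexists. unfold Ccos. apply Cder_mult; [|apply Cder_const].
  apply Cder_plus.
  - apply (Cder_comp Cexp (fun u => Ci * u)%C); [apply Cder_Cexp|apply Cder_scal, Cder_id].
  - apply (Cder_comp Cexp (fun u => - Ci * u)%C); [apply Cder_Cexp|apply Cder_scal, Cder_id].
Qed.

(* The weight [exp (- i n cos (k (w - (a, d))))] has modulus 1 on the three other edges
   and is exponentially large in [n] inside. *)
Theorem zero_of_zero_bottom (f : C -> C) (a b c d : R) : a < b -> c < d -> rect_cont f a b c d ->
  (forall x y, a < x < b -> c < y < d -> exists k, Cder f (x, y) k) ->
  (forall x, a <= x <= b -> f (x, c) = 0) ->
  forall p q, a < p < b -> c < q < d -> f (p, q) = 0.
Proof.
  intros Hab Hcd Hc Hd H0 p q Hp Hq.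
  assert (Hpi := PI_RGT_0).
  (* The real part of the argument of the cosine then runs from 0 to pi across the rectangle. In the
     product of a sine and a hyperbolic sine that gives Im cos, the sine vanishes on both vertical
     edges and the other factor on the top edge; inside, the product is positive. *)
  set (kap := PI / (b - a)). assert (Hkap : 0 < kap) by (apply Rdiv_lt_0_compat; lra).
  set (arg := fun w => (RtoC kap * (w - (a, d)))%C).
  assert (Earg : forall x y, Re (arg (x, y)) = kap * (x - a) /\ Im (arg (x, y)) = kap * (y - d)).
  { intros; unfold arg, Re, Im; simpl; split; ring. }
  set (W := fun (n : nat) w => Cexp (- Ci * RtoC (INR n) * Ccos (arg w))%C).
  assert (MW : forall n w, Cmod (W n w) = exp (INR n * Im (Ccos (arg w)))).
  { intros n w. unfold W. rewrite Cmod_Cexp. f_equal. generalize (Ccos (arg w)). intros u.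
    unfold Re, Im; simpl; ring. }
  assert (DW : forall n w, exists l, Cder (W n) w l).
  { intros n w. destruct (Cder_Ccos (arg w)) as [l Hl]. eexists.
    apply (Cder_comp Cexp (fun w => - Ci * RtoC (INR n) * Ccos (arg w))%C); [apply Cder_Cexp|].
    apply Cder_scal. apply (Cder_comp Ccos arg); [exact Hl|].
    apply Cder_scal. apply Cder_minus; [apply Cder_id|apply Cder_const]. }
  destruct (rect_bounded f a b c d) as (K & HK & HB); try assumption; try lra.
  set (r := Rmin (Rmin (p - a) (b - p)) (Rmin (q - c) (d - q))).
  assert (Hr : 0 < r) by (repeat apply Rmin_pos; lra).
  assert (K1 : r <= p - a) by (eapply Rle_trans; apply Rmin_l).
  assert (K2 : r <= b - p) by (eapply Rle_trans; [apply Rmin_l|apply Rmin_r]).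
  assert (K3 : r <= q - c) by (eapply Rle_trans; [apply Rmin_r|apply Rmin_l]).
  assert (K4 : r <= d - q) by (eapply Rle_trans; [apply Rmin_r|apply Rmin_r]).
  assert (Hfar : bd_far (p, q) a b c d r) by (apply bd_far_intro; lra).
  set (s := Im (Ccos (arg (p, q)))).
  assert (Hs : 0 < s).
  { unfold s. rewrite Im_Ccos. destruct (Earg p q) as [-> ->]. apply Rmult_lt_0_compat.
    - apply sin_gt_0; [apply Rmult_lt_0_compat; lra|].
      replace PI with (kap * (b - a)) by (unfold kap; field; lra). apply Rmult_lt_compat_l; lra.
    - assert (exp (kap * (q - d)) < exp (- (kap * (q - d)))) by (apply exp_increasing; nra). lra. }
  set (L := 2 * (K * / r) * ((b - a) + (d - c))).
  assert (Bound : forall n, 2 * PI * (Cmod (f (p, q)) * exp (INR n * s)) <= L).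
  { intros n. destruct (Hd p q Hp Hq) as [k Hk]. destruct (DW n (p, q)) as [m Hm].
    assert (Hc' : rect_cont (fun w => f w * W n w)%C a b c d).
    { intros x y Hx Hy. apply Ccont_mult; [apply Hc; assumption|]. destruct (DW n (x, y)) as [u Hu].
      eapply Cder_cont, Hu. }
    assert (CF := Cauchy_formula nil (fun w => f w * W n w)%C a b c d p q (k * W n (p, q) + f (p, q) * m)%C Hp Hq Hc').
    lapply CF; clear CF; [intros CF|].
    2:{ intros x y Hx Hy _. destruct (Hd x y Hx Hy) as [k' Hk']. destruct (DW n (x, y)) as [m' Hm'].
        eexists. apply Cder_mult; eassumption. }
    specialize (CF (Cder_mult _ _ _ _ _ Hk Hm)).
    apply (f_equal Cmod) in CF. rewrite !Cmod_mult, Cmod_Ci, !Cmod_R, MW in CF. fold s in CF.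
    rewrite !Rabs_pos_eq in CF by lra.
    replace (2 * PI * (Cmod (f (p, q)) * exp (INR n * s))) with (2 * PI * 1 * (Cmod (f (p, q)) * exp (INR n * s))) by ring.
    rewrite <- CF. apply RI_bound'; try lra.
    - apply bd_cont_mult; [apply rect_bd_cont; try lra; exact Hc'|]. apply bd_cont_inv; assumption.
    - apply bd_le_mult; [|apply bd_far_le; assumption].
      assert (Side : forall x y, a <= x <= b -> c <= y <= d -> f (x, y) = 0 \/ Im (Ccos (arg (x, y))) = 0 ->
        Cmod (f (x, y) * W n (x, y)) <= K).
      { intros x y Hx Hy [E|E].
        - rewrite E, Cmult_0_l, Cmod_0. exact HK.
        - rewrite Cmod_mult, MW, E, Rmult_0_r, exp_0, Rmult_1_r. apply HB; assumption. }
      split; intros t Ht; split; apply Side; try lra.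
      + left; apply H0; assumption.
      + right. rewrite Im_Ccos. destruct (Earg t d) as [_ ->]. rewrite Rminus_diag, Rmult_0_r, Ropp_0, exp_0. field.
      + right. rewrite Im_Ccos. destruct (Earg a t) as [-> _]. rewrite Rminus_diag, Rmult_0_r, sin_0. ring.
      + right. rewrite Im_Ccos. destruct (Earg b t) as [-> _].
        replace (kap * (b - a)) with PI by (unfold kap; field; lra). rewrite sin_PI. ring. }
  apply Cmod_eq_0. destruct (Req_dec (Cmod (f (p, q))) 0) as [|Hn]; [assumption|exfalso].
  assert (Hm := Cmod_ge_0 (f (p, q))). set (m := Cmod (f (p, q))) in *.
  assert (Hm0 : 0 < m) by (destruct Hm; [assumption|congruence]).
  assert (P0 : 0 < 2 * PI * m) by (apply Rmult_lt_0_compat; lra).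
  assert (P1 : 0 < 2 * PI * m * s) by (apply Rmult_lt_0_compat; lra).
  destruct (nfloor_ex (L / (2 * PI * m * s))) as [n [_ Hn2]].
  { apply Rdiv_le_0_compat; [|exact P1].
    specialize (Bound O). simpl in Bound. rewrite Rmult_0_l, exp_0 in Bound. nra. }
  apply Rlt_div_l in Hn2; [|exact P1].
  specialize (Bound (S n)). rewrite S_INR in Bound.
  assert (E1 : 1 + (INR n + 1) * s <= exp ((INR n + 1) * s)) by apply exp_ineq1_le.
  assert (B2 : 2 * PI * m * (1 + (INR n + 1) * s) <= L).
  { eapply Rle_trans; [|exact Bound].
    replace (2 * PI * (m * exp ((INR n + 1) * s))) with (2 * PI * m * exp ((INR n + 1) * s)) by ring.
    apply Rmult_le_compat_l; lra. }
  nra.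
Qed.

Corollary zero_of_zero_left (f : C -> C) (a b c d : R) : a < b -> c < d -> rect_cont f a b c d ->
  (forall x y, a < x < b -> c < y < d -> exists k, Cder f (x, y) k) ->
  (forall y, c <= y <= d -> f (a, y) = 0) ->
  forall p q, a < p < b -> c < q < d -> f (p, q) = 0.
Proof.
  intros Hab Hcd Hc Hd H0 p q Hp Hq.
  assert (E : forall x y, (- Ci * (x, y))%C = (y, - x)) by (intros; apply C_ext; simpl; ring).
  assert (F := zero_of_zero_bottom (fun w => f (- Ci * w)%C) (- d) (- c) a b).
  assert (D : forall w, Cder (fun w => - Ci * w)%C w (- Ci * 1)%C) by (intros; apply Cder_scal, Cder_id).
  specialize (F ltac:(lra) ltac:(lra)). replace q with (- - q) by ring. rewrite <- (E (- q) p).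
  apply F; try lra.
  - intros x y Hx Hy. apply (Ccont_comp f (fun w => - Ci * w)%C); [|eapply Cder_cont, D].
    rewrite E. apply Hc; lra.
  - intros x y Hx Hy. destruct (Hd y (- x)) as [k Hk]; try lra. eexists.
    apply (Cder_comp f (fun w => - Ci * w)%C); [|apply D]. rewrite E. exact Hk.
  - intros x Hx. rewrite E. apply H0. lra.
Qed.

(** * Primitives on vertically slit domains *)

Lemma RI_swap_h (f : C -> C) (a b c d : R) :
  (forall x, Rmin a b <= x <= Rmax a b -> Ccont f (x, c) /\ Ccont f (x, d)) ->
  RI f b a c d = (- RI f a b c d)%C.
Proof.
  intros H. unfold RI.
  rewrite (CI_swap (fun x => f (x, c)) a b), (CI_swap (fun x => f (x, d)) a b); [ring|..];
    apply ex_CI_cont; intros; apply Ccont_horiz; apply H; assumption.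
Qed.

Lemma RI_swap_v (f : C -> C) (a b c d : R) :
  (forall y, Rmin c d <= y <= Rmax c d -> Ccont f (a, y) /\ Ccont f (b, y)) ->
  RI f a b d c = (- RI f a b c d)%C.
Proof.
  intros H. unfold RI.
  rewrite (CI_swap (fun y => f (a, y)) c d), (CI_swap (fun y => f (b, y)) c d); [ring|..];
    apply ex_CI_cont; intros; apply Ccont_vert; apply H; assumption.
Qed.

Lemma Goursat_hull (f : C -> C) (a b c d : R) :
  (forall x y, Rmin a b <= x <= Rmax a b -> Rmin c d <= y <= Rmax c d -> exists l, Cder f (x, y) l) ->
  RI f a b c d = 0.
Proof.
  intros H.
  assert (Hc : forall x y, Rmin a b <= x <= Rmax a b -> Rmin c d <= y <= Rmax c d -> Ccont f (x, y)).
  { intros x y Hx Hy. destruct (H x y Hx Hy) as [l Hl]. eapply Cder_cont, Hl. }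
  assert (M : forall u v, Rmin u v <= u <= Rmax u v /\ Rmin u v <= v <= Rmax u v).
  { intros u v. generalize (Rmin_l u v) (Rmin_r u v) (Rmax_l u v) (Rmax_r u v). lra. }
  assert (Opp0 : forall u : C, u = 0 -> (- u)%C = 0) by (intros u ->; ring).
  destruct (Rle_dec a b) as [Hab|Hab]; [|rewrite RI_swap_h by (intros x Hx; rewrite Rmin_comm, Rmax_comm in Hx; split; apply Hc; try exact Hx; apply M); apply Opp0];
  (destruct (Rle_dec c d) as [Hcd|Hcd]; [|rewrite RI_swap_v by (intros x Hx; rewrite Rmin_comm, Rmax_comm in Hx; split; apply Hc; try exact Hx; apply M); apply Opp0]);
  apply Goursat_closed; try lra; intros x y Hx Hy; apply H;
  unfold Rmin, Rmax; destruct (Rle_dec a b); destruct (Rle_dec c d); lra.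
Qed.

Lemma CI_const (k : C) (a b : R) : CI (fun _ => k) a b = (k * RtoC (b - a))%C.
Proof.
  rewrite (CI_FTC (fun x => 0 + k * RtoC x)%C).
  - rewrite RtoC_minus. ring.
  - intros; apply Rder_affine.
  - intros; apply continuous_const.
Qed.

Lemma CI_near_const (F : R -> C) (k : C) (a b e : R) :
  (forall t, Rmin a b <= t <= Rmax a b -> Rcont F t) ->
  (forall t, Rmin a b <= t <= Rmax a b -> Cmod (F t - k) <= e) ->
  Cmod (CI F a b - k * RtoC (b - a)) <= e * Rabs (b - a).
Proof.
  intros Hc He. rewrite <- CI_const.
  assert (Hk : forall t, Rcont (fun _ => (- k)%C) t) by (intros; apply continuous_const).
  rewrite <- CI_minus.
  - apply Cmod_CI_dist; [|exact He]. intros t Ht.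
    apply (Rcont_plus F (fun _ => (- k)%C)); [apply Hc, Ht|apply Hk].
  - apply ex_CI_cont, Hc.
  - apply ex_CI_cont. intros; apply continuous_const.
Qed.

(** The primitive integrates along the base line of height b and then vertically. Path independence
    is needed only for thin rectangles around one vertical segment, so the domain enters only
    through a tube around each segment from the base line to a point; this suits domains with
    vertical cuts. *)
Theorem vertical_primitive (I : R -> Prop) (Om : C -> Prop) (g : C -> C) (b a0 : R) :
  I a0 -> (forall s t u, I s -> I u -> s <= t <= u -> I t) ->
  (forall a, I a -> Om (a, b)) ->
  (forall x y, Om (x, y) -> I x -> exists r, 0 < r /\ forall x' s, Rabs (x' - x) < r ->
     Rmin b y - r < s < Rmax b y + r -> exists l, Cder g (x', s) l) ->
  exists F, forall w, Om w -> I (Re w) -> Cder F w (g w).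
Proof.
  intros Ha0 HI Hb Ht.
  exists (fun w => (CI (fun t => g (t, b)) a0 (Re w) + Ci * CI (fun s => g (Re w, s)) b (Im w))%C).
  intros [x y] Hw Hx. simpl in Hx. destruct (Ht x y Hw Hx) as (r & Hr & Hs).
  assert (Hsc : forall x' s, Rabs (x' - x) < r -> Rmin b y - r < s < Rmax b y + r -> Ccont g (x', s)).
  { intros x' s H1 H2. destruct (Hs x' s H1 H2) as [l Hl]. eapply Cder_cont, Hl. }
  assert (Hmm : Rmin b y <= b <= Rmax b y /\ Rmin b y <= y <= Rmax b y).
  { generalize (Rmin_l b y) (Rmin_r b y) (Rmax_l b y) (Rmax_r b y). lra. }
  intros e He.
  assert (Hgc : Ccont g (x, y)) by (apply Hsc; [rewrite Rminus_diag, Rabs_R0; assumption|lra]).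
  destruct (Hgc (e / 2)) as (d & Hd & Hsd); [lra|].
  exists (Rmin r (d / 2)). split; [apply Rmin_pos; lra|]. intros [x' y'] Hy.
  assert (Hy1 := Rlt_le_trans _ _ _ Hy (Rmin_l _ _)). assert (Hy2 := Rlt_le_trans _ _ _ Hy (Rmin_r _ _)).
  assert (Dx := re_le_Cmod ((x', y') - (x, y))). assert (Dy := im_le_Cmod ((x', y') - (x, y))).
  change (Rabs (x' - x) <= Cmod ((x', y') - (x, y))) in Dx. change (Rabs (y' - y) <= Cmod ((x', y') - (x, y))) in Dy.
  set (D := Cmod ((x', y') - (x, y))) in *. simpl Re; simpl Im.
  assert (Ax : forall t, Rmin x x' <= t <= Rmax x x' -> Rabs (t - x) <= Rabs (x' - x)).
  { intros t. unfold Rmin, Rmax. destruct (Rle_dec x x'); intros; unfold Rabs; destruct (Rcase_abs _), (Rcase_abs _); lra. }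
  assert (Ay : forall t, Rmin y y' <= t <= Rmax y y' -> Rabs (t - y) <= Rabs (y' - y)).
  { intros t. unfold Rmin, Rmax. destruct (Rle_dec y y'); intros; unfold Rabs; destruct (Rcase_abs _), (Rcase_abs _); lra. }
  assert (Ab : forall t, Rmin b y <= t <= Rmax b y -> Rmin b y - r < t < Rmax b y + r) by (intros; lra).
  assert (Ay' : forall t, Rmin y y' <= t <= Rmax y y' -> Rmin b y - r < t < Rmax b y + r).
  { intros t H. apply Ay in H. assert (H' : Rabs (t - y) < r) by lra. apply Rabs_lt_between in H'. lra. }
  assert (Hbase : ex_CI (fun t => g (t, b)) a0 x).
  { apply ex_CI_cont. intros t Htt. apply Ccont_horiz.
    assert (It : I t).
    { destruct (Rle_dec a0 x).
      - rewrite Rmin_left, Rmax_right in Htt by assumption. apply (HI a0 t x); assumption.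
      - rewrite Rmin_right, Rmax_left in Htt by lra. apply (HI x t a0); assumption. }
    destruct (Ht t b (Hb t It) It) as (r' & Hr' & Hs'). destruct (Hs' t b) as [l Hl].
    - rewrite Rminus_diag, Rabs_R0; assumption.
    - rewrite Rmin_left, Rmax_left; lra.
    - eapply Cder_cont, Hl. }
  rewrite <- (CI_Chasles (fun t => g (t, b)) a0 x x'); [|exact Hbase|].
  2:{ apply ex_CI_cont. intros t Htt. apply Ccont_horiz, Hsc; [eapply Rle_lt_trans; [apply Ax, Htt|lra]|apply Ab; lra]. }
  rewrite <- (CI_Chasles (fun s => g (x', s)) b y y').
  2:{ apply ex_CI_cont. intros t Htt. apply Ccont_vert, Hsc; [lra|apply Ab, Htt]. }
  2:{ apply ex_CI_cont. intros t Htt. apply Ccont_vert, Hsc; [lra|apply Ay', Htt]. }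
  (* Goursat's theorem on the rectangle between the two vertical legs trades the piece of the base
     line over [x, x'] for the same piece at height y, where g is close to its value at (x, y). *)
  assert (G : RI g x x' b y = 0).
  { apply Goursat_hull. intros t s H1 H2. apply Hs; [eapply Rle_lt_trans; [apply Ax, H1|lra]|apply Ab, H2]. }
  unfold RI in G.
  set (u0 := CI (fun t => g (t, b)) a0 x) in *. set (u1 := CI (fun x => g (x, b)) x x') in *.
  set (u2 := CI (fun y => g (x', y)) b y) in *. set (u3 := CI (fun x => g (x, y)) x x') in *.
  set (u4 := CI (fun y => g (x, y)) b y) in *. set (u5 := CI (fun s => g (x', s)) y y') in *.
  assert (B3 : Cmod (u3 - g (x, y) * RtoC (x' - x)) <= e / 2 * Rabs (x' - x)).
  { apply CI_near_const.
    - intros t Htt. apply Ccont_horiz, Hsc; [eapply Rle_lt_trans; [apply Ax, Htt|lra]|apply Ab; lra].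
    - intros t Htt. apply Rlt_le, Hsd. eapply Rle_lt_trans; [apply Cmod_le_Re_Im|]. simpl.
      replace (y + - y) with 0 by ring. rewrite Rabs_R0. specialize (Ax t Htt). unfold Rminus in *. lra. }
  assert (B5 : Cmod (u5 - g (x, y) * RtoC (y' - y)) <= e / 2 * Rabs (y' - y)).
  { apply CI_near_const.
    - intros t Htt. apply Ccont_vert, Hsc; [lra|apply Ay', Htt].
    - intros t Htt. apply Rlt_le, Hsd. eapply Rle_lt_trans; [apply Cmod_le_Re_Im|]. simpl.
      specialize (Ay t Htt). unfold Rminus in *. lra. }
  replace (u0 + u1 + Ci * (u2 + u5) - (u0 + Ci * u4) - g (x, y) * ((x', y') - (x, y)))%C
    with ((u1 + Ci * u2 - u3 - Ci * u4) + ((u3 - g (x, y) * RtoC (x' - x)) + Ci * (u5 - g (x, y) * RtoC (y' - y))))%C.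
  2:{ replace ((x', y') - (x, y))%C with (RtoC (x' - x) + Ci * RtoC (y' - y))%C by (apply C_ext; simpl; ring). ring. }
  rewrite G, Cplus_0_l. eapply Rle_trans; [apply Cmod_triangle|]. rewrite Cmod_mult, Cmod_Ci. nra.
Qed.

Lemma Ccst_vert (f : C -> C) (a s t : R) :
  (forall u, Rmin s t <= u <= Rmax s t -> Cder f (a, u) 0) -> f (a, s) = f (a, t).
Proof.
  intros H. apply (Rder_zero_const (fun y => f (a, y))). intros u Hu.
  eapply Rder_eq; [|apply Cder_vert, H, Hu]. ring.
Qed.

Lemma zero_der_const (I : R -> Prop) (Om : C -> Prop) (f : C -> C) (b : R) :
  (forall s t u, I s -> I u -> s <= t <= u -> I t) ->
  (forall a, I a -> Om (a, b)) ->
  (forall x y s, Om (x, y) -> I x -> Rmin b y <= s <= Rmax b y -> Om (x, s)) ->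
  (forall w, Om w -> I (Re w) -> Cder f w 0) ->
  forall w v, Om w -> I (Re w) -> Om v -> I (Re v) -> f w = f v.
Proof.
  intros HI Hb Hv Hd.
  assert (A : forall w, Om w -> I (Re w) -> f w = f (Re w, b)).
  { intros [x y] Hw Hx. simpl in *. symmetry. apply Ccst_vert. intros u Hu.
    apply Hd; [apply (Hv x y); assumption|assumption]. }
  intros w v Hw Hx Hv' Hx'. rewrite (A w Hw Hx), (A v Hv' Hx').
  apply (Rder_zero_const (fun x => f (x, b))). intros t Ht.
  assert (It : I t).
  { destruct (Rle_dec (Re w) (Re v)).
    - rewrite Rmin_left, Rmax_right in Ht by assumption. apply (HI (Re w) t (Re v)); assumption.
    - rewrite Rmin_right, Rmax_left in Ht by lra. apply (HI (Re v) t (Re w)); assumption. }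
  apply Cder_horiz, Hd; [apply Hb, It|exact It].
Qed.

(** On the common strip, which is connected, the two primitives differ by a constant. After
    correcting the second one they are switched in the middle of the strip. *)
Lemma glue_primitives (Om : C -> Prop) (g F1 F2 : C -> C) (r1 r2 : R) : r1 < r2 ->
  (forall w, Om w -> Re w < r2 -> Cder F1 w (g w)) ->
  (forall w, Om w -> r1 < Re w -> Cder F2 w (g w)) ->
  (forall w, r1 < Re w < r2 -> Om w) ->
  exists F, forall w, Om w -> Cder F w (g w).
Proof.
  intros Hr H1 H2 Hs.
  set (mu := (r1 + r2) / 2). assert (Hmu : r1 < mu < r2) by (unfold mu; lra).
  set (k := (F1 (mu, 0) - F2 (mu, 0))%C).
  assert (Hk : forall w, r1 < Re w < r2 -> F1 w = (F2 w + k)%C).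
  { intros w Hw. unfold k.
    assert (E : (F1 w - F2 w)%C = (F1 (mu, 0) - F2 (mu, 0))%C).
    { apply (zero_der_const (fun x => r1 < x < r2) (fun w => r1 < Re w < r2) (fun w => F1 w - F2 w)%C 0); simpl; auto.
      - intros; lra.
      - intros v Hv _. apply (Cder_eq _ _ (g v - g v)%C); [ring|].
        apply Cder_minus; [apply H1|apply H2]; try (apply Hs; assumption); lra. }
    rewrite <- E. ring. }
  exists (fun w => if Rlt_dec (Re w) mu then F1 w else (F2 w + k)%C). intros w Hw.
  destruct (Rlt_dec (Re w) r2) as [H|H].
  - apply (Cder_ext_loc F1 _ _ _ (r2 - Re w)); [lra| |apply H1; assumption].
    intros y Hy. destruct (Rlt_dec (Re y) mu) as [H'|H']; [reflexivity|].
    apply Hk. assert (L := Re_lip w y). apply Rabs_le_between in L. lra.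
  - apply (Cder_ext_loc (fun w => F2 w + k)%C _ _ _ (Re w - mu)); [lra| |].
    + intros y Hy. assert (L := Re_lip w y). apply Rabs_le_between in L.
      destruct (Rlt_dec (Re y) mu) as [H'|H']; [lra|reflexivity].
    + eapply Cder_eq; [|apply Cder_plus; [apply H2; [assumption|lra]|apply Cder_const]]. ring.
Qed.

(** * Finite sums *)

Lemma Csum_0 (a : nat -> C) : Csum 0 a = 0.
Proof. unfold Csum. rewrite sum_n_m_zero by lia. reflexivity. Qed.

Lemma Csum_S (n : nat) (a : nat -> C) : Csum (S n) a = (Csum n a + a (S n))%C.
Proof. unfold Csum. rewrite sum_n_Sm by lia. reflexivity. Qed.

Lemma Csum_ext (n : nat) (a b : nat -> C) : (forall p, (1 <= p <= n)%nat -> a p = b p) -> Csum n a = Csum n b.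
Proof.
  induction n as [|n IH]; intros H; [rewrite !Csum_0; reflexivity|].
  rewrite !Csum_S, IH, H by (try lia; intros; apply H; lia). reflexivity.
Qed.

Lemma Csum_plus (n : nat) (a b : nat -> C) : Csum n (fun p => a p + b p)%C = (Csum n a + Csum n b)%C.
Proof.
  induction n as [|n IH]; [rewrite !Csum_0; ring|]. rewrite !Csum_S, IH. ring.
Qed.

Lemma Csum_scal (n : nat) (k : C) (a : nat -> C) : Csum n (fun p => k * a p)%C = (k * Csum n a)%C.
Proof.
  induction n as [|n IH]; [rewrite !Csum_0; ring|]. rewrite !Csum_S, IH. ring.
Qed.

Lemma Csum_scal_r (n : nat) (k : C) (a : nat -> C) : Csum n (fun p => a p * k)%C = (Csum n a * k)%C.
Proof.
  induction n as [|n IH]; [rewrite !Csum_0; ring|]. rewrite !Csum_S, IH. ring.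
Qed.

Lemma Csum_conj (n : nat) (a : nat -> C) : Cconj (Csum n a) = Csum n (fun p => Cconj (a p)).
Proof.
  induction n as [|n IH]; [rewrite !Csum_0; apply C_ext; simpl; ring|]. rewrite !Csum_S, Cplus_conj, IH. reflexivity.
Qed.

Lemma Csum_minus (n : nat) (a b : nat -> C) : Csum n (fun p => a p - b p)%C = (Csum n a - Csum n b)%C.
Proof.
  induction n as [|n IH]; [rewrite !Csum_0; ring|]. rewrite !Csum_S, IH. ring.
Qed.

Lemma Csum_delta (n q : nat) (k : C) : (1 <= q <= n)%nat ->
  Csum n (fun p => if Nat.eq_dec p q then k else 0) = k.
Proof.
  induction n as [|n IH]; intros Hq; [lia|]. rewrite Csum_S.
  destruct (Nat.eq_dec (S n) q) as [<-|E].
  - rewrite (Csum_ext _ _ (fun _ => 0 * 0)%C).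
    + rewrite Csum_scal. ring.
    + intros p Hp. destruct (Nat.eq_dec p (S n)); [lia|ring].
  - rewrite IH by lia. ring.
Qed.

Lemma Csum_single_out (n q : nat) (a : nat -> C) : (1 <= q <= n)%nat ->
  Csum n a = (a q + Csum n (fun p => if Nat.eq_dec p q then 0 else a p))%C.
Proof.
  intros Hq. rewrite <- (Csum_delta n q (a q) Hq) at 1. rewrite <- Csum_plus.
  apply Csum_ext. intros p Hp. destruct (Nat.eq_dec p q) as [->|]; ring.
Qed.

Lemma Cder_Csum (n : nat) (F : nat -> C -> C) (G : nat -> C) (x : C) :
  (forall p, (1 <= p <= n)%nat -> Cder (F p) x (G p)) ->
  Cder (fun y => Csum n (fun p => F p y)) x (Csum n G).
Proof.
  induction n as [|n IH]; intros H.
  - apply Cder_ext with (f := fun _ => 0); [intros; rewrite Csum_0; reflexivity|].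
    rewrite Csum_0. apply Cder_const.
  - apply Cder_ext with (f := fun y => (Csum n (fun p => F p y) + F (S n) y)%C); [intros; rewrite Csum_S; reflexivity|].
    rewrite Csum_S. apply Cder_plus; [apply IH; intros; apply H; lia|apply H; lia].
Qed.

Lemma Csum_bound_uniform {T} (n : nat) (S : T -> Prop) (a : nat -> T -> C) (w : T -> R) :
  (forall x, S x -> 0 <= w x) ->
  (forall p, (1 <= p <= n)%nat -> exists K, forall x, S x -> Cmod (a p x) <= K * w x) ->
  exists K, 0 <= K /\ forall x, S x -> Cmod (Csum n (fun p => a p x)) <= K * w x.
Proof.
  intros Hw. induction n as [|n IH]; intros H.
  - exists 0. split; [lra|]. intros x _. rewrite Csum_0, Cmod_0. lra.
  - destruct IH as (K1 & HK1 & H1); [intros; apply H; lia|].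
    destruct (H (Datatypes.S n)) as (K2 & H2); [lia|].
    exists (K1 + Rabs K2). split; [generalize (Rabs_pos K2); lra|]. intros x Hx. rewrite Csum_S.
    eapply Rle_trans; [apply Cmod_triangle|]. specialize (H1 x Hx). specialize (H2 x Hx). specialize (Hw x Hx).
    assert (K2 * w x <= Rabs K2 * w x) by (apply Rmult_le_compat_r; [assumption|apply Rle_abs]). lra.
Qed.

(** The parameter type is left free so that it can be a pair of a branch number and a point; the
    resulting constants are uniform in both. *)
Lemma Csum_Im_bound_uniform {T} (n : nat) (S : T -> Prop) (a : nat -> T -> C) :
  (forall p, (1 <= p <= n)%nat -> exists K, forall x, S x -> Rabs (Im (a p x)) <= K) ->
  exists K, forall x, S x -> Rabs (Im (Csum n (fun p => a p x))) <= K.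
Proof.
  induction n as [|n IH]; intros H.
  - exists 0. intros x _. rewrite Csum_0. simpl. rewrite Rabs_R0. lra.
  - destruct IH as (K1 & H1); [intros; apply H; lia|].
    destruct (H (Datatypes.S n)) as (K2 & H2); [lia|].
    exists (K1 + K2). intros x Hx. rewrite Csum_S, im_plus.
    eapply Rle_trans; [apply Rabs_triang|]. specialize (H1 x Hx). specialize (H2 x Hx). lra.
Qed.

Lemma uniform_radius (n : nat) (Q : nat -> R -> Prop) :
  (forall p r r', Q p r -> 0 < r' <= r -> Q p r') ->
  (forall p, (1 <= p <= n)%nat -> exists r, 0 < r /\ Q p r) ->
  exists r, 0 < r /\ forall p, (1 <= p <= n)%nat -> Q p r.
Proof.
  intros HQ. induction n as [|n IH]; intros H.
  - exists 1. split; [lra|]. intros; lia.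
  - destruct IH as (r1 & Hr1 & H1); [intros; apply H; lia|].
    destruct (H (S n)) as (r2 & Hr2 & H2); [lia|].
    assert (A := Rmin_l r1 r2). assert (B := Rmin_r r1 r2). assert (D := Rmin_pos _ _ Hr1 Hr2).
    exists (Rmin r1 r2). split; [assumption|]. intros p Hp. destruct (Nat.eq_dec p (S n)) as [->|].
    + apply HQ with r2; [assumption|lra].
    + apply HQ with r1; [apply H1; lia|lra].
Qed.

Lemma uniform_bound (n : nat) (a : nat -> R) : exists K, 0 <= K /\ forall p, (1 <= p <= n)%nat -> a p <= K.
Proof.
  induction n as [|n (K & HK & H)].
  - exists 0. split; [lra|]. intros; lia.
  - exists (Rmax K (a (S n))). split; [eapply Rle_trans; [exact HK|apply Rmax_l]|]. intros p Hp.
    destruct (Nat.eq_dec p (S n)) as [->|]; [apply Rmax_r|].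
    eapply Rle_trans; [apply H; lia|apply Rmax_l].
Qed.

(** * The branches of [f] and the slit domains *)

Lemma Carg_bound (w : C) : Rabs (Carg w) <= PI.
Proof.
  unfold Carg. assert (H := acos_bound (Re w / Cmod w)).
  destruct (Rle_dec 0 (Im w)); [|rewrite Rabs_Ropp]; rewrite Rabs_pos_eq; lra.
Qed.

(** The constant 3 i pi / 2 is the one for which the logarithm with downward cut agrees with the
    original one to the right of the pole. To the left it is larger by 2 i pi, as after one crossing
    of the upward cut. *)
Lemma Clog_Ci_right (w : C) : 0 < Re w ->
  (Clog (- Ci * w) + 3 * RtoC PI * Ci / 2)%C = (Clog (Ci * w) + RtoC PI * Ci / 2)%C.
Proof.
  intros H. unfold Clog. rewrite !Cmod_mult, Cmod_opp.
  assert (E1 : Re (- Ci * w) = Im w) by (unfold Re, Im; simpl; ring).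
  assert (E2 : Im (- Ci * w) = - Re w) by (unfold Re, Im; simpl; ring).
  assert (E3 : Re (Ci * w) = - Im w) by (unfold Re, Im; simpl; ring).
  assert (E4 : Im (Ci * w) = Re w) by (unfold Re, Im; simpl; ring).
  rewrite (Carg_lower (- Ci * w)), (Carg_upper (Ci * w)) by (rewrite ?E2, ?E4; lra). rewrite E1, E2, E3, E4.
  replace (Im w / - Re w) with (- Im w / Re w) by (field; lra).
  apply C_ext; simpl; field.
Qed.

Lemma Clog_Ci_left (w : C) : Re w < 0 ->
  (Clog (- Ci * w) + 3 * RtoC PI * Ci / 2)%C = (Clog (Ci * w) + RtoC PI * Ci / 2 + 2 * RtoC PI * Ci)%C.
Proof.
  intros H. unfold Clog. rewrite !Cmod_mult, Cmod_opp.
  assert (E1 : Re (- Ci * w) = Im w) by (unfold Re, Im; simpl; ring).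
  assert (E2 : Im (- Ci * w) = - Re w) by (unfold Re, Im; simpl; ring).
  assert (E3 : Re (Ci * w) = - Im w) by (unfold Re, Im; simpl; ring).
  assert (E4 : Im (Ci * w) = Re w) by (unfold Re, Im; simpl; ring).
  rewrite (Carg_upper (- Ci * w)), (Carg_lower (Ci * w)) by (rewrite ?E2, ?E4; lra). rewrite E1, E2, E3, E4.
  replace (Im w / - Re w) with (- Im w / Re w) by (field; lra).
  apply C_ext; simpl; field.
Qed.

Section Potential.

Variables (eps : R) (P : nat) (c z : nat -> C) (lam : R).
Hypothesis Heps : 0 < eps.
Hypothesis HP : (1 <= P)%nat.
Hypothesis Him : forall p : nat, (1 <= p <= P)%nat -> 0 < Im (z p).
Hypothesis Hre : forall p : nat, (1 <= p)%nat -> (p < P)%nat -> Re (z p) < Re (z (S p)).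
Hypothesis Hlam : 0 < lam.

Lemma Re_z_lt (p q : nat) : (1 <= p)%nat -> (p < q)%nat -> (q <= P)%nat -> Re (z p) < Re (z q).
Proof.
  intros Hp Hpq Hq. induction q as [|q IH]; [lia|].
  destruct (Nat.eq_dec p q) as [->|].
  - apply Hre; lia.
  - apply Rlt_trans with (Re (z q)); [apply IH; lia|apply Hre; lia].
Qed.

Lemma Re_z_le (p q : nat) : (1 <= p)%nat -> (p <= q)%nat -> (q <= P)%nat -> Re (z p) <= Re (z q).
Proof.
  intros. destruct (Nat.eq_dec p q) as [->|]; [lra|]. apply Rlt_le, Re_z_lt; lia.
Qed.

(* The domain [G] with the cuts of z_1, ..., z_m turned downwards. *)
Definition slit_dom (m : nat) (x : C) : Prop :=
  forall p : nat, (1 <= p <= P)%nat ->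
    ((p <= m)%nat -> ~ down_ray (z p) x) /\
    ((m < p)%nat -> ~ up_ray (z p) x /\ ~ down_ray (Cconj (z p)) x).

(* The determination of [f] on [slit_dom m] which agrees with [f] to the right of z_m. *)
Definition fb (m : nat) (x : C) : C :=
  Csum P (fun p =>
    c p * (if (p <=? m)%nat then Clog (- Ci * (x - z p)) + 3 * RtoC PI * Ci / 2
           else Clog (Ci * (x - z p)) + RtoC PI * Ci / 2)
    + Cconj (c p) * (Clog (- Ci * (x - Cconj (z p))) - RtoC PI * Ci / 2))%C.

Lemma slit_dom_0 (x : C) : slit_dom 0 x <-> in_G P z x.
Proof.
  split; intros H p Hp.
  - apply (H p Hp); lia.
  - split; [lia|]. intros _. apply H, Hp.
Qed.

Lemma fb_0 (x : C) : fb 0 x = Defs.f P c z x.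
Proof.
  apply Csum_ext. intros p Hp. destruct (Nat.leb_spec p 0); [lia|]. reflexivity.
Qed.

Lemma slit_dom_off (m : nat) (x : C) : (forall p, (1 <= p <= P)%nat -> Re x <> Re (z p)) -> slit_dom m x.
Proof.
  intros H p Hp. specialize (H p Hp). unfold down_ray, up_ray. rewrite re_conj. tauto.
Qed.

Lemma slit_dom_neq (m p : nat) (x : C) : slit_dom m x -> (1 <= p <= P)%nat -> x <> z p /\ x <> Cconj (z p).
Proof.
  intros H Hp. specialize (Him p Hp). destruct (H p Hp) as [H1 H2].
  destruct (Nat.le_gt_cases p m) as [L|L].
  - specialize (H1 L). split; intros ->; apply H1; split; rewrite ?re_conj, ?im_conj; lra.
  - destruct (H2 L) as [H3 H4]. split; intros ->; [apply H3|apply H4]; split; lra.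
Qed.

Lemma slit_star (m p : nat) (x : C) : slit_dom m x -> (1 <= p <= P)%nat -> slit (- Ci * (x - Cconj (z p))).
Proof.
  intros H Hp. specialize (Him p Hp). destruct (H p Hp) as [H1 H2].
  assert (E1 : Re (- Ci * (x - Cconj (z p))) = Im x + Im (z p)) by (unfold Re, Im; simpl; ring).
  assert (E2 : Im (- Ci * (x - Cconj (z p))) = Re (z p) - Re x) by (unfold Re, Im; simpl; ring).
  unfold slit. rewrite E1, E2.
  destruct (Req_dec (Re x) (Re (z p))) as [E|E]; [left|right; lra].
  apply Rnot_le_lt. intros Hle. destruct (Nat.le_gt_cases p m) as [L|L].
  - apply (H1 L). split; lra.
  - apply (H2 L). split; rewrite ?re_conj, ?im_conj; lra.
Qed.

Lemma slit_down (m p : nat) (x : C) : slit_dom m x -> (1 <= p <= P)%nat -> (p <= m)%nat -> slit (- Ci * (x - z p)).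
Proof.
  intros H Hp L. destruct (H p Hp) as [H1 _]. specialize (H1 L).
  assert (E1 : Re (- Ci * (x - z p)) = Im x - Im (z p)) by (unfold Re, Im; simpl; ring).
  assert (E2 : Im (- Ci * (x - z p)) = Re (z p) - Re x) by (unfold Re, Im; simpl; ring).
  unfold slit. rewrite E1, E2.
  destruct (Req_dec (Re x) (Re (z p))) as [E|E]; [left|right; lra].
  apply Rnot_le_lt. intros Hle. apply H1. split; lra.
Qed.

Lemma slit_up (m p : nat) (x : C) : slit_dom m x -> (1 <= p <= P)%nat -> (m < p)%nat -> slit (Ci * (x - z p)).
Proof.
  intros H Hp L. destruct (H p Hp) as [_ H1]. destruct (H1 L) as [H2 _].
  assert (E1 : Re (Ci * (x - z p)) = Im (z p) - Im x) by (unfold Re, Im; simpl; ring).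
  assert (E2 : Im (Ci * (x - z p)) = Re x - Re (z p)) by (unfold Re, Im; simpl; ring).
  unfold slit. rewrite E1, E2.
  destruct (Req_dec (Re x) (Re (z p))) as [E|E]; [left|right; lra].
  apply Rnot_le_lt. intros Hle. apply H2. split; lra.
Qed.

Lemma Cder_Clog_affine (k a x : C) : k <> 0 -> slit (k * (x - a)) -> Cder (fun y => Clog (k * (y - a))%C) x (/ (x - a))%C.
Proof.
  intros Hk Hs. assert (Hn := slit_neq_0 _ Hs).
  assert (Hx : (x - a)%C <> 0) by (intros E; apply Hn; rewrite E; ring).
  apply (Cder_eq _ _ (/ (k * (x - a)) * (k * (1 - 0)))%C); [field; split; assumption|].
  apply (Cder_comp Clog (fun y => k * (y - a))%C); [apply Cder_Clog, Hs|].
  apply Cder_scal, Cder_minus; [apply Cder_id|apply Cder_const].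
Qed.

Lemma Copp_Ci_nz : (- Ci)%C <> 0.
Proof. intros E. apply (f_equal Im) in E. simpl in E. lra. Qed.

Lemma Cder_fb (m : nat) (x : C) : slit_dom m x -> Cder (fb m) x (u0 P c z x).
Proof.
  intros H. apply Cder_Csum. intros p Hp. destruct (slit_dom_neq m p x H Hp) as [N1 N2].
  apply Cder_plus.
  - apply (Cder_eq _ _ (c p * (/ (x - z p) + 0))%C); [unfold Cdiv; ring|]. apply Cder_scal. destruct (Nat.leb_spec p m) as [L|L].
    + apply (Cder_plus (fun x => Clog (- Ci * (x - z p)))%C); [|apply Cder_const].
      apply Cder_Clog_affine; [apply Copp_Ci_nz|apply (slit_down m); assumption].
    + apply (Cder_plus (fun x => Clog (Ci * (x - z p)))%C); [|apply Cder_const].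
      apply Cder_Clog_affine; [apply Ci_nz|apply (slit_up m); assumption].
  - apply (Cder_eq _ _ (Cconj (c p) * (/ (x - Cconj (z p)) - 0))%C); [unfold Cdiv; ring|]. apply Cder_scal.
    apply (Cder_minus (fun x => Clog (- Ci * (x - Cconj (z p))))%C); [|apply Cder_const].
    apply Cder_Clog_affine; [apply Copp_Ci_nz|apply (slit_star m); assumption].
Qed.

Lemma fb_right (n m : nat) (x : C) : (n <= m)%nat ->
  (forall p, (1 <= p <= P)%nat -> (n < p <= m)%nat -> Re (z p) < Re x) -> fb m x = fb n x.
Proof.
  intros Hnm H. apply Csum_ext. intros p Hp. f_equal. f_equal.
  destruct (Nat.leb_spec p m), (Nat.leb_spec p n); try lia; try reflexivity.
  apply Clog_Ci_right. rewrite re_minus. specialize (H p Hp). lapply H; [lra|lia].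
Qed.

(** The increment 2 i pi sum c_p, n < p <= m, of the determination of f between branches n and m to
    the left of z_{n+1}, ..., z_m. *)
Definition jump (n m : nat) : C :=
  Csum P (fun p => if ((n <? p)%nat && (p <=? m)%nat)%bool then c p * (2 * RtoC PI * Ci) else 0)%C.

Lemma fb_left (n m : nat) (x : C) : (n <= m)%nat ->
  (forall p, (1 <= p <= P)%nat -> (n < p <= m)%nat -> Re x < Re (z p)) -> fb m x = (fb n x + jump n m)%C.
Proof.
  intros Hnm H. unfold fb, jump. rewrite <- Csum_plus. apply Csum_ext. intros p Hp.
  destruct (Nat.leb_spec p m), (Nat.leb_spec p n), (Nat.ltb_spec n p); try lia; cbn [andb]; try ring.
  rewrite Clog_Ci_left.
  - ring.
  - rewrite re_minus. specialize (H p Hp). lapply H; [lra|lia].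
Qed.

(* exp(-i h / eps) *)
Definition Eb (m : nat) (x : C) : C := Cexp (- Ci * (RtoC lam * x + fb m x) / RtoC eps)%C.

Lemma eps_neq_0 : RtoC eps <> 0.
Proof. intros E. apply RtoC_inj in E. lra. Qed.

Lemma lam_neq_0 : RtoC lam <> 0.
Proof. intros E. apply RtoC_inj in E. lra. Qed.

Lemma Cmod_Eb (m : nat) (x : C) : Cmod (Eb m x) = exp ((lam * Im x + Im (fb m x)) / eps).
Proof.
  unfold Eb. rewrite Cmod_Cexp. f_equal. unfold Cdiv. rewrite <- RtoC_inv by lra.
  rewrite re_scal_r. unfold Re, Im; simpl. field. lra.
Qed.

Lemma Eb_neq_0 (m : nat) (x : C) : Eb m x <> 0.
Proof. apply Cexp_neq_0. Qed.

Lemma Cder_Eb (m : nat) (x : C) : slit_dom m x ->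
  Cder (Eb m) x (- Ci / RtoC eps * (RtoC lam + u0 P c z x) * Eb m x)%C.
Proof.
  intros H. apply (Cder_eq _ _ (Eb m x * (- Ci * (RtoC lam * 1 + u0 P c z x) * / RtoC eps + - Ci * (RtoC lam * x + fb m x) * 0))%C).
  { unfold Cdiv. ring. }
  unfold Eb at 1. apply (Cder_comp Cexp (fun x => - Ci * (RtoC lam * x + fb m x) / RtoC eps)%C).
  - apply Cder_Cexp.
  - apply (Cder_mult (fun x => - Ci * (RtoC lam * x + fb m x))%C (fun _ => / RtoC eps)%C); [|apply Cder_const].
    apply Cder_scal. apply Cder_plus; [apply Cder_scal, Cder_id|apply Cder_fb, H].
Qed.

Definition jumpE (n m : nat) : C := Cexp (- Ci * jump n m / RtoC eps)%C.

Lemma Eb_right (n m : nat) (x : C) : (n <= m)%nat ->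
  (forall p, (1 <= p <= P)%nat -> (n < p <= m)%nat -> Re (z p) < Re x) -> Eb m x = Eb n x.
Proof. intros H1 H2. unfold Eb. rewrite (fb_right n m) by assumption. reflexivity. Qed.

Lemma Eb_left (n m : nat) (x : C) : (n <= m)%nat ->
  (forall p, (1 <= p <= P)%nat -> (n < p <= m)%nat -> Re x < Re (z p)) -> Eb m x = (jumpE n m * Eb n x)%C.
Proof.
  intros H1 H2. unfold Eb, jumpE. rewrite (fb_left n m) by assumption. rewrite <- Cexp_plus. f_equal.
  unfold Cdiv. ring.
Qed.

(* The rational factor of the integrands; [w0 = 1] for b and the inhomogeneous problem, [w0 = 0] for A. *)
Definition Rd (w0 : C) (d : nat -> C) (x : C) : C := (w0 * RtoC lam + Csum P (fun p => d p / (x - z p)))%C.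

Lemma Cder_Rd (w0 : C) (d : nat -> C) (x : C) : (forall p, (1 <= p <= P)%nat -> x <> z p) ->
  Cder (Rd w0 d) x (Csum P (fun p => - d p / ((x - z p) * (x - z p))))%C.
Proof.
  intros H. apply (Cder_eq _ _ (0 + Csum P (fun p => - d p / ((x - z p) * (x - z p))))%C); [ring|].
  apply Cder_plus; [apply Cder_const|]. apply (Cder_Csum P (fun p x => d p / (x - z p))%C). intros p Hp.
  assert (N : (x - z p)%C <> 0) by (apply Cminus_eq_contra, H, Hp).
  eapply Cder_eq; [|apply (Cder_div (fun _ => d p) (fun x => x - z p)%C); [exact N|apply Cder_const|
    apply Cder_minus; [apply Cder_id|apply Cder_const]]]. field; assumption.
Qed.

(** * Estimates at infinity and near the poles *)

Definition fterm (m p : nat) (x : C) : C :=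
  (c p * (if (p <=? m)%nat then Clog (- Ci * (x - z p)) + 3 * RtoC PI * Ci / 2
          else Clog (Ci * (x - z p)) + RtoC PI * Ci / 2)
   + Cconj (c p) * (Clog (- Ci * (x - Cconj (z p))) - RtoC PI * Ci / 2))%C.

(** All arguments are bounded, and Im c_p multiplies only the difference of the two real logarithms
    because the second residue is the conjugate of the first. The constant 4 pi is 5 pi / 2 + 3 pi /
    2, the bounds for the two shifted arguments. *)
Lemma Im_fterm (m p : nat) (x : C) :
  Rabs (Im (fterm m p x) - Im (c p) * (ln (Cmod (x - z p)) - ln (Cmod (x - Cconj (z p))))) <= Rabs (Re (c p)) * (4 * PI).
Proof.
  assert (Hpi := PI_RGT_0).
  set (l1 := ln (Cmod (x - z p))). set (l2 := ln (Cmod (x - Cconj (z p)))).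
  assert (E : exists A B, Rabs A <= 5 * PI / 2 /\ Rabs B <= 3 * PI / 2 /\ fterm m p x = (c p * (l1, A) + Cconj (c p) * (l2, B))%C).
  { unfold fterm, Clog. rewrite !Cmod_mult, Cmod_opp, Cmod_Ci, !Rmult_1_l. fold l1 l2.
    assert (HB : Rabs (Carg (- Ci * (x - Cconj (z p))) - PI / 2) <= 3 * PI / 2).
    { generalize (Carg_bound (- Ci * (x - Cconj (z p)))). intros H. apply Rabs_le_between in H. apply Rabs_le; lra. }
    destruct (Nat.leb_spec p m).
    - exists (Carg (- Ci * (x - z p)) + 3 * PI / 2), (Carg (- Ci * (x - Cconj (z p))) - PI / 2).
      split; [|split; [exact HB|]].
      + generalize (Carg_bound (- Ci * (x - z p))). intros H'. apply Rabs_le_between in H'. apply Rabs_le; lra.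
      + f_equal; f_equal; apply C_ext; unfold Re, Im; simpl; field.
    - exists (Carg (Ci * (x - z p)) + PI / 2), (Carg (- Ci * (x - Cconj (z p))) - PI / 2).
      split; [|split; [exact HB|]].
      + generalize (Carg_bound (Ci * (x - z p))). intros H'. apply Rabs_le_between in H'. apply Rabs_le; lra.
      + f_equal; f_equal; apply C_ext; unfold Re, Im; simpl; field. }
  destruct E as (A & B & HA & HB & ->).
  replace (Im (c p * (l1, A) + Cconj (c p) * (l2, B)) - Im (c p) * (l1 - l2)) with (Re (c p) * (A + B))
    by (unfold Re, Im; simpl; ring).
  rewrite Rabs_mult. apply Rmult_le_compat_l; [apply Rabs_pos|].
  eapply Rle_trans; [apply Rabs_triang|]. lra.
Qed.

Lemma ln_dist (a b d D : R) : 0 < d -> d * a <= D * b -> d * b <= D * a -> 0 < a -> 0 < b -> 0 < D ->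
  Rabs (ln a - ln b) <= Rabs (ln D - ln d).
Proof.
  intros Hd H1 H2 Ha Hb HD.
  assert (L : forall u v, 0 < u -> 0 < v -> u <= v -> ln u <= ln v).
  { intros u v Hu Hv [H| ->]; [apply Rlt_le, ln_increasing; assumption|lra]. }
  apply L in H1, H2; try (apply Rmult_lt_0_compat; assumption).
  rewrite !ln_mult in H1, H2 by assumption.
  eapply Rle_trans; [|apply Rle_abs]. apply Rabs_le; lra.
Qed.

(** Beyond this radius the distances to all z_p and to their conjugates are comparable with |x|, up
    to a factor 2. *)
Definition far (R0 : R) : Prop := 1 <= R0 /\ forall p, (1 <= p <= P)%nat -> 2 * Cmod (z p) + 1 <= R0.

Lemma far_ex : exists R0, far R0.
Proof.
  destruct (uniform_bound P (fun p => 2 * Cmod (z p) + 1)) as (K & HK & H).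
  exists (K + 1). split; [lra|]. intros p Hp. specialize (H p Hp). lra.
Qed.

Lemma far_dist (R0 : R) (p : nat) (x : C) : far R0 -> (1 <= p <= P)%nat -> R0 <= Cmod x ->
  Cmod x / 2 <= Cmod (x - z p) <= 2 * Cmod x /\ Cmod x / 2 <= Cmod (x - Cconj (z p)) <= 2 * Cmod x.
Proof.
  intros [H1 H2] Hp Hx. specialize (H2 p Hp).
  assert (A : forall w, Cmod w = Cmod (z p) -> Cmod x / 2 <= Cmod (x - w) <= 2 * Cmod x).
  { intros w Hw. generalize (Cmod_triangle_rev x w) (Cmod_triangle x (- w)). rewrite Cmod_opp.
    change (x + - w)%C with (x - w)%C. lra. }
  split; apply A; [reflexivity|apply Cmod_conj].
Qed.

(** At infinity the logarithms attached to z_p and to its conjugate compensate each other in the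
    imaginary part. Hence |E| is comparable with e^{lam Im x / eps} in all directions and for all
    branches at once. *)
Lemma Im_fb_far (R0 : R) : far R0 -> exists K, forall m x, R0 <= Cmod x -> Rabs (Im (fb m x)) <= K.
Proof.
  intros HR.
  destruct (Csum_Im_bound_uniform P (fun mx : nat * C => R0 <= Cmod (snd mx)) (fun p mx => fterm (fst mx) p (snd mx))) as [K HK].
  - intros p Hp. exists (Rabs (Re (c p)) * (4 * PI) + Rabs (Im (c p)) * Rabs (ln 2 - ln (/ 2))).
    intros [m x] Hx. cbn [fst snd] in *. destruct (far_dist R0 p x HR Hp Hx) as [D1 D2]. destruct HR as [HR1 _].
    generalize (Im_fterm m p x). set (l := ln (Cmod (x - z p)) - ln (Cmod (x - Cconj (z p)))). intros B.
    assert (B2 : Rabs l <= Rabs (ln 2 - ln (/ 2))) by (apply ln_dist; lra).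
    replace (Im (fterm m p x)) with ((Im (fterm m p x) - Im (c p) * l) + Im (c p) * l) by ring.
    eapply Rle_trans; [apply Rabs_triang|]. rewrite Rabs_mult.
    assert (Rabs (Im (c p)) * Rabs l <= Rabs (Im (c p)) * Rabs (ln 2 - ln (/ 2))) by (apply Rmult_le_compat_l; [apply Rabs_pos|assumption]).
    lra.
  - exists K. intros m x Hx. apply (HK (m, x)). exact Hx.
Qed.

Lemma z_neq (p q : nat) : (1 <= p <= P)%nat -> (1 <= q <= P)%nat -> p <> q -> Re (z p) <> Re (z q).
Proof.
  intros Hp Hq Hn. destruct (Nat.lt_ge_cases p q).
  - generalize (Re_z_lt p q); lia || (intros H1; specialize (H1 ltac:(lia) ltac:(lia) ltac:(lia)); lra).
  - generalize (Re_z_lt q p). intros H1; specialize (H1 ltac:(lia) ltac:(lia) ltac:(lia)); lra.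
Qed.

(* A punctured disc around z_q below which no other singularity lies. *)
Definition near (q : nat) (r : R) : Prop := 0 < r /\ r <= Im (z q) / 2 /\
  forall p, (1 <= p <= P)%nat -> p <> q -> r <= Rabs (Re (z p) - Re (z q)) / 2.

Lemma near_ex (q : nat) : (1 <= q <= P)%nat -> exists r, near q r.
Proof.
  intros Hq.
  destruct (uniform_radius P (fun p r => p <> q -> r <= Rabs (Re (z p) - Re (z q)) / 2)) as (r & Hr & H).
  - intros p r r' H Hr Hn. specialize (H Hn). lra.
  - intros p Hp. destruct (Nat.eq_dec p q) as [->|Hn].
    + exists 1. split; [lra|congruence].
    + exists (Rabs (Re (z p) - Re (z q)) / 2). split; [|intros; lra].
      assert (0 < Rabs (Re (z p) - Re (z q))); [|lra]. apply Rabs_pos_lt.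
      generalize (z_neq p q Hp Hq Hn). lra.
  - specialize (Him q Hq). exists (Rmin r (Im (z q) / 2)). split; [apply Rmin_pos; lra|]. split; [apply Rmin_r|].
    intros p Hp Hn. eapply Rle_trans; [apply Rmin_l|apply H; assumption].
Qed.

Lemma near_mono (q : nat) (r r' : R) : near q r -> 0 < r' <= r -> near q r'.
Proof.
  intros (H1 & H2 & H3) H. split; [lra|]. split; [lra|]. intros p Hp Hn. specialize (H3 p Hp Hn). lra.
Qed.

Lemma near_dist (q p : nat) (r : R) (x : C) : near q r -> (1 <= p <= P)%nat -> (1 <= q <= P)%nat -> Cmod (x - z q) < r ->
  (p <> q -> r <= Rabs (Re x - Re (z p))) /\ (p <> q -> r <= Cmod (x - z p)) /\ r <= Cmod (x - Cconj (z p)) /\ 0 < Im x.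
Proof.
  intros (H1 & H2 & H3) Hp Hq Hx.
  assert (Lr := Re_lip (z q) x). assert (Li := Im_lip (z q) x).
  apply Rabs_le_between in Li.
  assert (A : p <> q -> r <= Rabs (Re x - Re (z p))).
  { intros Hn. specialize (H3 p Hp Hn).
    replace (Re (z p) - Re (z q)) with ((Re x - Re (z q)) - (Re x - Re (z p))) in H3 by ring.
    generalize (Rabs_triang (Re x - Re (z q)) (- (Re x - Re (z p)))). rewrite Rabs_Ropp. unfold Rminus in *. lra. }
  split; [exact A|]. split; [|split].
  - intros Hn. eapply Rle_trans; [apply A, Hn|apply Re_lip].
  - eapply Rle_trans; [|apply im_le_Cmod]. rewrite im_minus, im_conj. eapply Rle_trans; [|apply Rle_abs].
    specialize (Him p Hp). lra.
  - specialize (Him q Hq). lra.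
Qed.

(** Near z_q the only unbounded contribution is Im c_q times the logarithm of the distance, whatever
    the branch. So |E| behaves like the power Im c_q / eps of the distance. *)
Lemma Im_fb_near (q : nat) (r : R) : (1 <= q <= P)%nat -> near q r ->
  exists K, forall m x, 0 < Cmod (x - z q) < r -> Rabs (Im (fb m x) - Im (c q) * ln (Cmod (x - z q))) <= K.
Proof.
  intros Hq Hn.
  destruct (Csum_Im_bound_uniform P (fun mx : nat * C => 0 < Cmod (snd mx - z q) < r)
    (fun p mx => (fterm (fst mx) p (snd mx) - if Nat.eq_dec p q then Ci * RtoC (Im (c q) * ln (Cmod (snd mx - z q))) else 0)%C)) as [K HK].
  - intros p Hp.
    destruct (uniform_bound P (fun p => Cmod (z q - z p) + Cmod (z q - Cconj (z p)) + r)) as (D & HD & HDp).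
    specialize (HDp p Hp). simpl in HDp.
    exists (Rabs (Re (c p)) * (4 * PI) + Rabs (Im (c p)) * (Rabs (ln D - ln r) + Rabs (ln (D) - ln r) + Rabs (ln r) + Rabs (ln D))).
    intros [m x] Hx. cbn [fst snd] in *. destruct (near_dist q p r x Hn Hp Hq (proj2 Hx)) as (_ & D1 & D2 & _).
    assert (Hr : 0 < r) by apply Hn.
    generalize (Im_fterm m p x). intros B.
    assert (Cz : forall w, Cmod (x - w) <= Cmod (z q - w) + r).
    { intros w. replace (x - w)%C with ((x - z q) + (z q - w))%C by ring.
      eapply Rle_trans; [apply Cmod_triangle|]. lra. }
    assert (C1 := Cz (z p)). assert (C2 := Cz (Cconj (z p))).
    assert (P1 := Cmod_ge_0 (z q - z p)). assert (P2 := Cmod_ge_0 (z q - Cconj (z p))).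
    assert (Q1 := Rabs_pos (ln D - ln r)). assert (Q2 := Rabs_pos (ln r)). assert (Q3 := Rabs_pos (ln D)).
    assert (L : forall u v, 0 < u -> 0 < v -> u <= v -> ln u <= ln v).
    { intros u v Hu Hv [H| ->]; [apply Rlt_le, ln_increasing; assumption|lra]. }
    assert (LD : forall u, r <= u <= D -> Rabs (ln u) <= Rabs (ln r) + Rabs (ln D)).
    { intros u Hu. assert (G1 := L r u ltac:(lra) ltac:(lra) ltac:(lra)). assert (G2 := L u D ltac:(lra) ltac:(lra) ltac:(lra)).
      apply Rabs_le. generalize (Rle_abs (ln D)) (Rle_abs (- ln r)). rewrite Rabs_Ropp. lra. }
    set (l2 := ln (Cmod (x - Cconj (z p)))) in *.
    assert (B2 : Rabs l2 <= Rabs (ln r) + Rabs (ln D)) by (apply LD; lra).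
    destruct (Nat.eq_dec p q) as [->|Hpq].
    + set (l := ln (Cmod (x - z q))) in *.
      replace (Im (fterm m q x - Ci * RtoC (Im (c q) * l))) with ((Im (fterm m q x) - Im (c q) * (l - l2)) + - (Im (c q) * l2))
        by (rewrite im_minus; unfold Re, Im; simpl; ring).
      eapply Rle_trans; [apply Rabs_triang|]. rewrite Rabs_Ropp, Rabs_mult.
      assert (Rabs (Im (c q)) * Rabs l2 <= Rabs (Im (c q)) * (Rabs (ln D - ln r) + Rabs (ln D - ln r) + Rabs (ln r) + Rabs (ln D)))
        by (apply Rmult_le_compat_l; [apply Rabs_pos|lra]).
      lra.
    + specialize (D1 Hpq). set (l1 := ln (Cmod (x - z p))) in *.
      assert (B3 : Rabs (l1 - l2) <= Rabs (ln D - ln r)).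
      { apply ln_dist; try lra; nra. }
      replace (Im (fterm m p x - 0)) with ((Im (fterm m p x) - Im (c p) * (l1 - l2)) + (Im (c p) * (l1 - l2)))
        by (rewrite im_minus; unfold Re, Im; simpl; ring).
      eapply Rle_trans; [apply Rabs_triang|]. rewrite Rabs_mult.
      assert (Rabs (Im (c p)) * Rabs (l1 - l2) <= Rabs (Im (c p)) * (Rabs (ln D - ln r) + Rabs (ln D - ln r) + Rabs (ln r) + Rabs (ln D)))
        by (apply Rmult_le_compat_l; [apply Rabs_pos|lra]).
      lra.
  - exists K. intros m x Hx. specialize (HK (m, x) Hx). cbn [fst snd] in HK.
    rewrite Csum_minus, Csum_delta, im_minus in HK by assumption.
    replace (Im (Ci * RtoC (Im (c q) * ln (Cmod (x - z q))))) with (Im (c q) * ln (Cmod (x - z q))) in HK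
      by (unfold Re, Im; simpl; ring).
    exact HK.
Qed.

Lemma Cmod_div_le (d w : C) (k : R) : 0 < k -> k <= Cmod w -> Cmod (d / w) <= Cmod d * / k.
Proof.
  intros Hk H. unfold Cdiv. rewrite Cmod_mult. apply Rmult_le_compat_l; [apply Cmod_ge_0|].
  apply Cmod_inv_le; assumption.
Qed.

Lemma Rd_far (R0 : R) (d : nat -> C) : far R0 -> exists K, 0 <= K /\ forall x, R0 <= Cmod x -> Cmod (Rd 0 d x) <= K * / Cmod x.
Proof.
  intros HR. destruct (Csum_bound_uniform P (fun x : C => R0 <= Cmod x) (fun p x => (d p / (x - z p))%C) (fun x => / Cmod x)) as (K & HK & H).
  - intros x Hx. destruct HR as [HR _]. apply Rlt_le, Rinv_0_lt_compat. lra.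
  - intros p Hp. exists (2 * Cmod (d p)). intros x Hx. destruct (far_dist R0 p x HR Hp Hx) as [D1 _]. destruct HR as [HR _].
    replace (2 * Cmod (d p) * / Cmod x) with (Cmod (d p) * / (Cmod x / 2)) by (field; lra).
    apply Cmod_div_le; lra.
  - exists K. split; [assumption|]. intros x Hx. unfold Rd. rewrite Cmult_0_l, Cplus_0_l. apply H, Hx.
Qed.

Lemma Rd_der_far (R0 : R) (d : nat -> C) : far R0 -> exists K, 0 <= K /\ forall x, R0 <= Cmod x ->
  Cmod (Csum P (fun p => - d p / ((x - z p) * (x - z p))))%C <= K * / (Cmod x * Cmod x).
Proof.
  intros HR. apply (Csum_bound_uniform P (fun x : C => R0 <= Cmod x) (fun p x => (- d p / ((x - z p) * (x - z p)))%C) (fun x => / (Cmod x * Cmod x))).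
  - intros x Hx. destruct HR as [HR _]. apply Rlt_le, Rinv_0_lt_compat. nra.
  - intros p Hp. exists (4 * Cmod (d p)). intros x Hx. destruct (far_dist R0 p x HR Hp Hx) as [D1 _]. destruct HR as [HR _].
    replace (4 * Cmod (d p) * / (Cmod x * Cmod x)) with (Cmod (- d p) * / (Cmod x / 2 * (Cmod x / 2))) by (rewrite Cmod_opp; field; lra).
    apply Cmod_div_le; [nra|]. rewrite Cmod_mult. apply Rmult_le_compat; lra.
Qed.

Lemma u0_far (R0 : R) : far R0 -> exists K, 0 <= K /\ forall x, R0 <= Cmod x -> Cmod (u0 P c z x) <= K * / Cmod x.
Proof.
  intros HR. apply (Csum_bound_uniform P (fun x : C => R0 <= Cmod x) (fun p x => (c p / (x - z p) + Cconj (c p) / (x - Cconj (z p)))%C) (fun x => / Cmod x)).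
  - intros x Hx. destruct HR as [HR _]. apply Rlt_le, Rinv_0_lt_compat. lra.
  - intros p Hp. exists (4 * Cmod (c p)). intros x Hx. destruct (far_dist R0 p x HR Hp Hx) as [D1 D2]. destruct HR as [HR _].
    replace (4 * Cmod (c p) * / Cmod x) with (Cmod (c p) * / (Cmod x / 2) + Cmod (Cconj (c p)) * / (Cmod x / 2)) by (rewrite Cmod_conj; field; lra).
    eapply Rle_trans; [apply Cmod_triangle|]. apply Rplus_le_compat; apply Cmod_div_le; lra.
Qed.

Lemma Rd_near (q : nat) (r : R) (w0 : C) (d : nat -> C) : (1 <= q <= P)%nat -> near q r ->
  exists K, 0 <= K /\ forall x, 0 < Cmod (x - z q) < r -> Cmod (Rd w0 d x) <= K * / Cmod (x - z q).
Proof.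
  intros Hq Hn. assert (Hr : 0 < r) by apply Hn.
  destruct (Csum_bound_uniform P (fun x : C => 0 < Cmod (x - z q) < r) (fun p x => (d p / (x - z p))%C) (fun x => / Cmod (x - z q))) as (K & HK & H).
  - intros x Hx. apply Rlt_le, Rinv_0_lt_compat. lra.
  - intros p Hp. exists (Cmod (d p)). intros x Hx. apply Cmod_div_le; [lra|].
    destruct (Nat.eq_dec p q) as [->|E]; [lra|]. destruct (near_dist q p r x Hn Hp Hq (proj2 Hx)) as (_ & D & _). specialize (D E). lra.
  - exists (Cmod w0 * lam * r + K). split.
    { generalize (Cmod_ge_0 w0); intros. assert (0 <= Cmod w0 * lam) by nra. nra. }
    intros x Hx. unfold Rd. eapply Rle_trans; [apply Cmod_triangle|]. rewrite Rmult_plus_distr_r.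
    apply Rplus_le_compat; [|apply H, Hx]. rewrite Cmod_mult, Cmod_R, Rabs_pos_eq by lra.
    rewrite Rmult_assoc with (r3 := / _). rewrite <- (Rmult_1_r (Cmod w0 * lam)) at 1. apply Rmult_le_compat_l.
    + generalize (Cmod_ge_0 w0); nra.
    + apply Rle_div_r; lra.
Qed.

(** * Primitives of the integrands *)

(** On a vertical line through a pole the domain leaves an open half-line or, between an upward cut
    and that of the conjugate, an open segment. It contains the segment between any two of its
    points together with a margin. *)
Lemma slit_tube (m : nat) (b x y : R) : slit_dom m (x, y) -> slit_dom m (x, b) ->
  exists r, 0 < r /\ forall x' s, Rabs (x' - x) < r -> Rmin b y - r < s < Rmax b y + r -> slit_dom m (x', s).
Proof.
  intros Hy Hb.
  destruct (uniform_radius P (fun p r => forall x' s, Rabs (x' - x) < r -> Rmin b y - r < s < Rmax b y + r ->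
    ((p <= m)%nat -> ~ down_ray (z p) (x', s)) /\
    ((m < p)%nat -> ~ up_ray (z p) (x', s) /\ ~ down_ray (Cconj (z p)) (x', s)))) as (r & Hr & H).
  - intros p r r' H Hr x' s H1 H2. apply H; lra.
  - intros p Hp. destruct (Hy p Hp) as [Y1 Y2]. destruct (Hb p Hp) as [B1 B2]. unfold down_ray, up_ray in *.
    rewrite !re_conj, !im_conj in *. change (Re (x, y)) with x in *. change (Im (x, y)) with y in *.
    change (Re (x, b)) with x in *. change (Im (x, b)) with b in *.
    destruct (Req_dec x (Re (z p))) as [E|E].
    + destruct (Nat.le_gt_cases p m) as [L|L].
      * specialize (Y1 L). specialize (B1 L).
        assert (Z1 : Im (z p) < y) by lra. assert (Z2 : Im (z p) < b) by lra.
        assert (Z3 : Im (z p) < Rmin b y) by (apply Rmin_glb_lt; assumption).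
        exists (Rmin b y - Im (z p)). split; [lra|]. intros x' s H1 H2.
        change (Re (x', s)) with x'; change (Im (x', s)) with s. split; [lra|lia].
      * specialize (Y2 L). specialize (B2 L). destruct Y2 as [Y2 Y3], B2 as [B2 B3].
        assert (Z1 : y < Im (z p)) by lra. assert (Z2 : b < Im (z p)) by lra.
        assert (Z3 : - Im (z p) < y) by lra. assert (Z4 : - Im (z p) < b) by lra.
        assert (Z5 : - Im (z p) < Rmin b y) by (apply Rmin_glb_lt; assumption).
        assert (Z6 : Rmax b y < Im (z p)) by (apply Rmax_lub_lt; assumption).
        exists (Rmin (Rmin b y + Im (z p)) (Im (z p) - Rmax b y)). split; [apply Rmin_pos; lra|]. intros x' s H1 H2.
        generalize (Rmin_l (Rmin b y + Im (z p)) (Im (z p) - Rmax b y)) (Rmin_r (Rmin b y + Im (z p)) (Im (z p) - Rmax b y)). intros.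
        change (Re (x', s)) with x'; change (Im (x', s)) with s. split; [lia|]. split; lra.
    + exists (Rabs (x - Re (z p))). split; [apply Rabs_pos_lt; lra|]. intros x' s H1 _.
      change (Re (x', s)) with x'. rewrite Rabs_minus_sym in H1.
      assert (x' <> Re (z p)) by (intros ->; lra). tauto.
  - exists r. split; [assumption|]. intros x' s H1 H2 p Hp. apply (H p Hp); assumption.
Qed.

Lemma slit_dom_open (m : nat) (x : C) : slit_dom m x -> exists r, 0 < r /\ forall y, Cmod (y - x) < r -> slit_dom m y.
Proof.
  destruct x as [x y]. intros H. destruct (slit_tube m y x y H H) as (r & Hr & Hs).
  exists r. split; [assumption|]. intros [x' y'] Hy. rewrite Rmin_left, Rmax_left in Hs by lra.
  apply Hs.
  - eapply Rle_lt_trans; [apply (Re_lip (x, y) (x', y'))|exact Hy].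
  - assert (L := Im_lip (x, y) (x', y')). simpl in L. assert (L2 : Rabs (y' - y) < r) by lra.
    apply Rabs_lt_between in L2. lra.
Qed.

Lemma slit_dom_segment (m : nat) (b x y s : R) : slit_dom m (x, y) -> slit_dom m (x, b) ->
  Rmin b y <= s <= Rmax b y -> slit_dom m (x, s).
Proof.
  intros H1 H2 Hs. destruct (slit_tube m b x y H1 H2) as (r & Hr & H). apply H; [rewrite Rminus_diag, Rabs_R0|]; lra.
Qed.

(** Left of z_{m+1} only downward cuts occur in branch m, and every vertical line can be entered
    from high above. Right of z_m the cuts at the remaining poles leave the real axis free. The
    overlap of the two regions is the strip between z_m and z_{m+1}. *)
Definition left_of (m : nat) (x : R) : Prop := forall p, (1 <= p <= P)%nat -> (m < p)%nat -> x < Re (z p).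
Definition right_of (m : nat) (x : R) : Prop := forall p, (1 <= p <= P)%nat -> (p <= m)%nat -> Re (z p) < x.

Definition above (T : R) : Prop := forall p, (1 <= p <= P)%nat -> Im (z p) < T.

Lemma above_ex : exists T, above T /\ 0 < T.
Proof.
  destruct (uniform_bound P (fun p => Im (z p))) as (K & HK & H). exists (K + 1). split; [|lra].
  intros p Hp. specialize (H p Hp). lra.
Qed.

Lemma right_base (m : nat) (x : R) : right_of m x -> slit_dom m (x, 0).
Proof.
  intros H p Hp. specialize (H p Hp). specialize (Him p Hp). unfold up_ray, down_ray. rewrite re_conj, im_conj.
  change (Re (x, 0)) with x. change (Im (x, 0)) with 0. split; [|lra]. intros L. specialize (H L). lra.
Qed.

Lemma left_base (m : nat) (T x : R) : above T -> left_of m x -> slit_dom m (x, T).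
Proof.
  intros HT H p Hp. specialize (H p Hp). specialize (HT p Hp). unfold up_ray, down_ray. rewrite re_conj.
  change (Re (x, T)) with x. change (Im (x, T)) with T. split; [lra|]. intros L. specialize (H L). lra.
Qed.

Lemma left_of_convex (m : nat) (s t u : R) : left_of m s -> left_of m u -> s <= t <= u -> left_of m t.
Proof. intros _ H Ht p Hp L. specialize (H p Hp L). lra. Qed.

Lemma right_of_convex (m : nat) (s t u : R) : right_of m s -> right_of m u -> s <= t <= u -> right_of m t.
Proof. intros H _ Ht p Hp L. specialize (H p Hp L). lra. Qed.

Lemma left_of_G0 (m : nat) (x : R) : x < Re (z 1%nat) -> left_of m x.
Proof. intros H p Hp _. generalize (Re_z_le 1 p). intros H1. specialize (H1 ltac:(lia) ltac:(lia) ltac:(lia)). lra. Qed.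

Lemma slit_dom_G0 (m : nat) (x : C) : in_G0 z x -> slit_dom m x.
Proof.
  intros H. apply slit_dom_off. intros p Hp. unfold in_G0 in H. generalize (left_of_G0 0 (Re x) H p Hp). intros L. specialize (L ltac:(lia)). lra.
Qed.

(** The vertical construction works with a high base line on the left part and with the real axis on
    the right part; the two primitives are glued in the strip between z_m and z_{m+1}. For m = 0 the
    right part, for m = P the left part, is already everything. *)
Lemma slit_primitive (m : nat) (g : C -> C) : (m <= P)%nat -> (forall x, slit_dom m x -> exists l, Cder g x l) ->
  exists F, forall x, slit_dom m x -> Cder F x (g x).
Proof.
  intros Hm Hg. destruct above_ex as (T & HT & _).
  assert (L : exists F, forall x, slit_dom m x -> left_of m (Re x) -> Cder F x (g x)).
  { apply (vertical_primitive (left_of m) (slit_dom m) g T (Re (z 1%nat) - 1)).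
    - apply left_of_G0. lra.
    - apply left_of_convex.
    - intros a Ha. apply left_base; assumption.
    - intros x y Hxy Hx. destruct (slit_tube m T x y Hxy) as (r & Hr & H); [apply left_base; assumption|].
      exists r. split; [assumption|]. intros x' s H1 H2. apply Hg, H; assumption. }
  assert (Rr : exists F, forall x, slit_dom m x -> right_of m (Re x) -> Cder F x (g x)).
  { apply (vertical_primitive (right_of m) (slit_dom m) g 0 (Re (z P) + 1)).
    - intros p Hp _. generalize (Re_z_le p P). intros H1. specialize (H1 ltac:(lia) ltac:(lia) ltac:(lia)). lra.
    - apply right_of_convex.
    - intros a Ha. apply right_base; assumption.
    - intros x y Hxy Hx. destruct (slit_tube m 0 x y Hxy) as (r & Hr & H); [apply right_base; assumption|].
      exists r. split; [assumption|]. intros x' s H1 H2. apply Hg, H; assumption. }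
  destruct L as [F1 H1], Rr as [F2 H2].
  destruct (Nat.eq_dec m 0) as [->|E0].
  { exists F2. intros x Hx. apply H2; [assumption|]. intros p Hp; lia. }
  destruct (Nat.eq_dec m P) as [EP|EP].
  { exists F1. intros x Hx. apply H1; [assumption|]. intros p Hp; lia. }
  apply (glue_primitives (slit_dom m) g F1 F2 (Re (z m)) (Re (z (S m)))).
  - apply Hre; lia.
  - intros w Hw Hx. apply H1; [assumption|]. intros p Hp L. generalize (Re_z_le (S m) p).
    intros H3. specialize (H3 ltac:(lia) ltac:(lia) ltac:(lia)). lra.
  - intros w Hw Hx. apply H2; [assumption|]. intros p Hp L. generalize (Re_z_le p m).
    intros H3. specialize (H3 ltac:(lia) ltac:(lia) ltac:(lia)). lra.
  - intros w Hw. apply slit_dom_off. intros p Hp E. destruct (Nat.le_gt_cases p m) as [L|L].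
    + generalize (Re_z_le p m). intros H3. specialize (H3 ltac:(lia) ltac:(lia) ltac:(lia)). lra.
    + generalize (Re_z_le (S m) p). intros H3. specialize (H3 ltac:(lia) ltac:(lia) ltac:(lia)). lra.
Qed.

Lemma slit_const_left (m : nat) (F : C -> C) :
  (forall x, slit_dom m x -> left_of m (Re x) -> Cder F x 0) ->
  forall x y, slit_dom m x -> left_of m (Re x) -> slit_dom m y -> left_of m (Re y) -> F x = F y.
Proof.
  intros H. destruct above_ex as (T & HT & _).
  apply (zero_der_const (left_of m) (slit_dom m) F T).
  - apply left_of_convex.
  - intros a Ha. apply left_base; assumption.
  - intros x y s Hxy Hx Hs. apply (slit_dom_segment m T x y s); try assumption. apply left_base; assumption.
  - exact H.
Qed.

Lemma slit_const_right (m : nat) (F : C -> C) :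
  (forall x, slit_dom m x -> right_of m (Re x) -> Cder F x 0) ->
  forall x y, slit_dom m x -> right_of m (Re x) -> slit_dom m y -> right_of m (Re y) -> F x = F y.
Proof.
  intros H.
  apply (zero_der_const (right_of m) (slit_dom m) F 0).
  - apply right_of_convex.
  - intros a Ha. apply right_base; assumption.
  - intros x y s Hxy Hx Hs. apply (slit_dom_segment m 0 x y s); try assumption. apply right_base; assumption.
  - exact H.
Qed.

Lemma Cder_EbRd (m : nat) (w0 : C) (d : nat -> C) (x : C) : slit_dom m x ->
  exists l, Cder (fun x => Eb m x * Rd w0 d x)%C x l.
Proof.
  intros H. eexists. apply Cder_mult; [apply Cder_Eb, H|]. apply Cder_Rd.
  intros p Hp. apply (slit_dom_neq m); assumption.
Qed.

Lemma Eb_far (R0 : R) : far R0 -> exists K, 0 < K /\ forall m x, R0 <= Cmod x ->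
  / K * exp (lam / eps * Im x) <= Cmod (Eb m x) <= K * exp (lam / eps * Im x).
Proof.
  intros HR. destruct (Im_fb_far R0 HR) as [K HK]. exists (exp (K / eps)). split; [apply exp_pos|]. intros m x Hx.
  specialize (HK m x Hx). apply Rabs_le_between in HK. rewrite Cmod_Eb, <- exp_Ropp, <- !exp_plus.
  assert (He : 0 < / eps) by (apply Rinv_0_lt_compat; assumption).
  assert (M : forall a b, a <= b -> exp a <= exp b) by (intros a b [H| ->]; [apply Rlt_le, exp_increasing; assumption|lra]).
  split; apply M; unfold Rdiv.
  - replace (- (K * / eps) + lam * / eps * Im x) with ((- K + lam * Im x) * / eps) by ring.
    apply Rmult_le_compat_r; lra.
  - replace (K * / eps + lam * / eps * Im x) with ((K + lam * Im x) * / eps) by ring.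
    apply Rmult_le_compat_r; lra.
Qed.

Lemma Rder_bound_by (Phi F : R -> C) (G dG : R -> R) (a b : R) : a <= b ->
  (forall t, a <= t <= b -> Rder Phi t (F t)) ->
  (forall t, a <= t <= b -> Rcont F t) ->
  (forall t, a <= t <= b -> is_derive G t (dG t)) ->
  (forall t, a <= t <= b -> continuous dG t) ->
  (forall t, a <= t <= b -> Cmod (F t) <= dG t) ->
  Cmod (Phi b - Phi a) <= G b - G a.
Proof.
  intros Hab H1 H2 H3 H4 H5. rewrite Cmod_norm.
  apply (norm_RInt_le (V := C_R_NormedModule)) with (f := F) (g := dG) (a := a) (b := b).
  - exact Hab.
  - intros t Ht. rewrite <- Cmod_norm. apply H5, Ht.
  - apply is_CI_FTC; rewrite Rmin_left, Rmax_right by assumption; assumption.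
  - apply (is_RInt_derive (V := R_CompleteNormedModule)); rewrite Rmin_left, Rmax_right by assumption; assumption.
Qed.

Lemma Rder_bound_exp (Phi F : R -> C) (k kap a b : R) : a <= b -> 0 < kap ->
  (forall t, a <= t <= b -> Rder Phi t (F t)) ->
  (forall t, a <= t <= b -> Rcont F t) ->
  (forall t, a <= t <= b -> Cmod (F t) <= k * exp (kap * t)) ->
  Cmod (Phi b - Phi a) <= k / kap * exp (kap * b) - k / kap * exp (kap * a).
Proof.
  intros Hab Hk H1 H2 H3.
  apply (Rder_bound_by Phi F (fun t => k / kap * exp (kap * t)) (fun t => k * exp (kap * t))); try assumption.
  - intros t _. auto_derive; [trivial|]. field. lra.
  - intros t _. apply (ex_derive_continuous (K := R_AbsRing) (V := R_NormedModule)). auto_derive. trivial.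
Qed.

Lemma G0_Cmod (R0 a y : R) : y <= - R0 -> R0 <= Cmod (a, y).
Proof.
  intros H. eapply Rle_trans; [|apply im_le_Cmod]. simpl. eapply Rle_trans; [|rewrite <- Rabs_Ropp; apply Rle_abs]. lra.
Qed.

(* The bound normalises the primitive to vanish at -i oo in G_0. *)
Definition is_prim (m : nat) (w0 : C) (d : nat -> C) (F : C -> C) : Prop :=
  (forall x, slit_dom m x -> Cder F x (Eb m x * Rd w0 d x)%C) /\
  exists K B, forall x, in_G0 z x -> Im x <= B -> Cmod (F x) <= K * exp (lam / eps * Im x).

Lemma exp_small (K kap : R) : 0 < kap -> forall e, 0 < e -> exists B, forall y, y <= B -> K * exp (kap * y) < e.
Proof.
  intros Hk e He. set (K' := Rabs K + 1). assert (HK : 0 < K') by (unfold K'; generalize (Rabs_pos K); lra).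
  exists (ln (e / K') / kap - 1). intros y Hy.
  apply Rle_lt_trans with (K' * exp (kap * y)).
  { apply Rmult_le_compat_r; [apply Rlt_le, exp_pos|]. unfold K'. generalize (Rle_abs K). lra. }
  assert (H : kap * y < ln (e / K')).
  { apply Rle_lt_trans with (kap * (ln (e / K') / kap - 1)); [apply Rmult_le_compat_l; lra|].
    replace (kap * (ln (e / K') / kap - 1)) with (ln (e / K') - kap) by (field; lra). lra. }
  apply exp_increasing in H. rewrite exp_ln in H by (apply Rdiv_lt_0_compat; assumption).
  apply Rlt_div_r in H; [|assumption]. lra.
Qed.

Lemma is_prim_small (m : nat) (w0 : C) (d : nat -> C) (F : C -> C) : is_prim m w0 d F ->
  forall e, 0 < e -> exists B, forall x, in_G0 z x -> Im x <= B -> Cmod (F x) < e.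
Proof.
  intros [_ (K & B & H)] e He. destruct (exp_small K (lam / eps)) with (e := e) as [B' H']; [apply Rdiv_lt_0_compat; assumption|assumption|].
  exists (Rmin B B'). intros x Hx Hi. eapply Rle_lt_trans; [apply H|apply H']; try assumption.
  - eapply Rle_trans; [exact Hi|apply Rmin_l].
  - eapply Rle_trans; [exact Hi|apply Rmin_r].
Qed.

(** The integrand is O(e^{lam y / eps}) at depth y, so any primitive has a limit at -i oo along a
    vertical line of G_0, and subtracting this limit gives the required bound. *)
Lemma is_prim_ex (m : nat) (w0 : C) (d : nat -> C) : (m <= P)%nat -> exists F, is_prim m w0 d F.
Proof.
  intros Hm. destruct (slit_primitive m (fun x => Eb m x * Rd w0 d x)%C Hm) as [Fa HFa].
  { intros x Hx. apply Cder_EbRd, Hx. }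
  destruct far_ex as [R0 HR]. destruct (Eb_far R0 HR) as (K1 & HK1 & HE).
  destruct (Rd_far R0 d HR) as (K2 & HK2 & HRd). assert (HR1 : 1 <= R0) by apply HR.
  set (k := K1 * (Cmod w0 * lam + K2)).
  assert (Hk : 0 <= k). { unfold k. apply Rmult_le_pos; [lra|]. generalize (Cmod_ge_0 w0). nra. }
  set (kap := lam / eps) in *. assert (Hkap : 0 < kap) by (apply Rdiv_lt_0_compat; assumption).
  assert (Hg : forall x, R0 <= Cmod x -> Cmod (Eb m x * Rd w0 d x) <= k * exp (kap * Im x)).
  { intros x Hx. rewrite Cmod_mult. unfold k.
    replace (K1 * (Cmod w0 * lam + K2) * exp (kap * Im x)) with (K1 * exp (kap * Im x) * (Cmod w0 * lam + K2)) by ring.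
    apply Rmult_le_compat; try apply Cmod_ge_0; [apply HE, Hx|].
    specialize (HRd x Hx). unfold Rd in *. eapply Rle_trans; [apply Cmod_triangle|].
    rewrite Cmod_mult, Cmod_R, Rabs_pos_eq by lra. apply Rplus_le_compat_l.
    rewrite Cmult_0_l, Cplus_0_l in HRd. eapply Rle_trans; [exact HRd|].
    rewrite <- (Rmult_1_r K2) at 2. apply Rmult_le_compat_l; [assumption|].
    rewrite <- Rinv_1. apply Rinv_le_contravar; lra. }
  assert (HG : forall a y, a < Re (z 1%nat) -> slit_dom m (a, y)) by (intros a y Ha; apply slit_dom_G0; exact Ha).
  assert (Hv : forall a y y', a < Re (z 1%nat) -> y' <= y -> y <= - R0 ->
    Cmod (Fa (a, y) - Fa (a, y')) <= k / kap * exp (kap * y)).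
  { intros a y y' Ha Hyy Hy.
    apply Rle_trans with (k / kap * exp (kap * y) - k / kap * exp (kap * y')).
    - apply (Rder_bound_exp (fun y => Fa (a, y)) (fun y => Eb m (a, y) * Rd w0 d (a, y) * Ci)%C); try assumption.
      + intros t Ht. apply (Cder_vert Fa), HFa, HG, Ha.
      + intros t Ht. destruct (Cder_EbRd m w0 d (a, t)) as [l Hl]; [apply HG, Ha|].
        apply (Ccont_vert (fun x => Eb m x * Rd w0 d x * Ci)%C). apply Ccont_mult; [eapply Cder_cont, Hl|apply Ccont_const].
      + intros t Ht. rewrite Cmod_mult, Cmod_Ci, Rmult_1_r. apply (Hg (a, t)). apply G0_Cmod. lra.
    - assert (0 <= k / kap * exp (kap * y')); [|lra]. apply Rmult_le_pos; [apply Rdiv_le_0_compat; assumption|apply Rlt_le, exp_pos]. }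
  set (a0 := Re (z 1%nat) - 1). assert (Ha0 : a0 < Re (z 1%nat)) by (unfold a0; lra).
  destruct (proj1 (Hierarchy.filterlim_locally_cauchy (U := C_R_CompleteNormedModule)
    (F := Rbar_locally m_infty) (fun y => Fa (a0, y)))) as [L HL].
  { intros e. destruct (exp_small (k / kap) kap Hkap (e / 2)) as [B HB]; [generalize (cond_pos e); lra|].
    exists (fun y => y < Rmin B (- R0)). split; [exists (Rmin B (- R0)); auto|].
    assert (Sm : forall u v, v <= u -> u < Rmin B (- R0) -> Cmod (Fa (a0, u) - Fa (a0, v)) < e / 2).
    { intros u v Huv Hu. eapply Rle_lt_trans; [apply Hv; try assumption|apply HB].
      - generalize (Rmin_r B (- R0)). lra. - generalize (Rmin_l B (- R0)). lra. }
    intros u v Hu Hw. apply C_NormedModule_mixin_compat1. change (Cmod (Fa (a0, v) - Fa (a0, u)) < e).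
    generalize (cond_pos e); intros.
    destruct (Rle_dec u v) as [Huv|Huv].
    - specialize (Sm v u Huv Hw). lra.
    - rewrite Cmod_sub_sym. specialize (Sm u v ltac:(lra) Hu). lra. }
  rewrite filterlim_Cmod in HL by apply _.
  (* The limit is the same on all vertical lines of G_0: at great depth y' a horizontal move from a0
     to a costs only |a - a0| e^{kap y'}. *)
  assert (HLa : forall a y, a < Re (z 1%nat) -> y <= - R0 -> Cmod (Fa (a, y) - L) <= k / kap * exp (kap * y)).
  { intros a y Ha Hy. apply le_epsilon. intros e He.
    destruct (HL (e / 2)) as [B HB]; [lra|].
    destruct (exp_small (k * Rabs (a - a0)) kap Hkap (e / 2)) as [B' HB']; [lra|].
    set (y' := Rmin (Rmin (B - 1) B') y).
    assert (Y1 : y' <= B - 1) by (eapply Rle_trans; apply Rmin_l).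
    assert (Y2 : y' <= B') by (eapply Rle_trans; [apply Rmin_l|apply Rmin_r]).
    assert (Y3 : y' <= y) by apply Rmin_r.
    specialize (HB y' ltac:(lra)). specialize (HB' y' Y2). specialize (Hv a y y' Ha Y3 Hy).
    assert (Hh : Cmod (Fa (a, y') - Fa (a0, y')) <= k * exp (kap * y') * Rabs (a - a0)).
    { apply (Rder_bound (fun t => Fa (t, y')) (fun t => Eb m (t, y') * Rd w0 d (t, y'))%C); intros t Ht;
        (assert (Htz : t < Re (z 1%nat)) by (generalize (Rmax_lub_lt a0 a (Re (z 1%nat)) Ha0 Ha); lra)).
      - apply (Cder_horiz Fa), HFa, HG, Htz.
      - destruct (Cder_EbRd m w0 d (t, y')) as [l Hl]; [apply HG, Htz|].
        apply (Ccont_horiz (fun x => Eb m x * Rd w0 d x)%C). eapply Cder_cont, Hl.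
      - apply (Hg (t, y')). apply G0_Cmod. lra. }
    replace (Fa (a, y) - L)%C with ((Fa (a, y) - Fa (a, y')) + ((Fa (a, y') - Fa (a0, y')) + (Fa (a0, y') - L)))%C by ring.
    eapply Rle_trans; [apply Cmod_triangle|]. eapply Rle_trans; [apply Rplus_le_compat_l, Cmod_triangle|]. lra. }
  exists (fun x => Fa x - L)%C. split.
  - intros x Hx. apply (Cder_eq _ _ (Eb m x * Rd w0 d x - 0)%C); [ring|].
    apply Cder_minus; [apply HFa, Hx|apply Cder_const].
  - exists (k / kap), (- R0). intros [a y] Ha Hy. apply HLa; assumption.
Qed.

(** Left of z_{n+1} the two integrands are proportional with factor [jumpE n m], so F' - jumpE F is
    constant there; the normalisation at -i oo in G_0 makes the constant zero. *)
Lemma is_prim_left (n m : nat) (w0 : C) (d : nat -> C) (F F' : C -> C) : (n <= m <= P)%nat ->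
  is_prim n w0 d F -> is_prim m w0 d F' ->
  forall x, slit_dom n x -> left_of n (Re x) -> F' x = (jumpE n m * F x)%C.
Proof.
  intros Hnm HF HF' x Hx Hl.
  assert (Hsub : forall x, slit_dom n x -> left_of n (Re x) -> slit_dom m x).
  { intros y Hy Hyl p Hp. specialize (Hyl p Hp). unfold down_ray, up_ray. destruct (Hy p Hp) as [H1 H2]. rewrite re_conj.
    split; intros L.
    - destruct (Nat.le_gt_cases p n) as [L'|L']; [apply H1, L'|]. specialize (Hyl L'). lra.
    - assert (n < p)%nat by lia. specialize (Hyl H). lra. }
  assert (HE : forall x, slit_dom n x -> left_of n (Re x) -> Eb m x = (jumpE n m * Eb n x)%C).
  { intros y Hy Hyl. apply Eb_left; [lia|]. intros p Hp L. apply Hyl; lia. }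
  set (D := fun x => (F' x - jumpE n m * F x)%C).
  assert (HD : forall x, slit_dom n x -> left_of n (Re x) -> Cder D x 0).
  { intros y Hy Hyl. unfold D. apply (Cder_eq _ _ (Eb m y * Rd w0 d y - jumpE n m * (Eb n y * Rd w0 d y))%C).
    - rewrite HE by assumption. ring.
    - apply Cder_minus; [apply HF', Hsub; assumption|apply Cder_scal, HF, Hy]. }
  assert (HD0 : D x = 0).
  { apply Cmod_eq_0. apply Rle_antisym; [|apply Cmod_ge_0]. apply le_epsilon. intros e He.
    set (kj := Cmod (jumpE n m)). assert (Hkj : 0 <= kj) by apply Cmod_ge_0.
    destruct (is_prim_small _ _ _ _ HF (e / (2 * (kj + 1)))) as [B1 HB1]; [apply Rdiv_lt_0_compat; lra|].
    destruct (is_prim_small _ _ _ _ HF' (e / 2)) as [B2 HB2]; [lra|].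
    set (w := (Re (z 1%nat) - 1, Rmin B1 B2) : C).
    assert (Hw : in_G0 z w) by (unfold in_G0, w; simpl; lra).
    rewrite (slit_const_left n D HD x w); try assumption; [|apply slit_dom_G0, Hw|apply left_of_G0, Hw].
    specialize (HB1 w Hw (Rmin_l _ _)). specialize (HB2 w Hw (Rmin_r _ _)).
    unfold D. eapply Rle_trans; [apply Cmod_triangle|]. rewrite Cmod_opp, Cmod_mult. fold kj.
    apply Rlt_div_r in HB1; [|lra]. generalize (Cmod_ge_0 (F w)); nra. }
  unfold D in HD0. apply Ceq_minus in HD0. exact HD0.
Qed.

(** Right of z_m branches 0 and m of E coincide, so the two primitives differ by a constant. No
    normalisation is available on that side; by [line_U] the constant is minus the integral over
    U_m. *)
Lemma is_prim_right_diff (m : nat) (w0 : C) (d : nat -> C) (F F' : C -> C) (x y : C) :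
  is_prim 0 w0 d F -> is_prim m w0 d F' ->
  slit_dom 0 y -> right_of m (Re y) -> slit_dom 0 x -> right_of m (Re x) -> (F' x - F x)%C = (F' y - F y)%C.
Proof.
  intros HF HF' Hy Hyr Hx Hr.
  assert (Hsub : forall x, right_of m (Re x) -> slit_dom m x <-> slit_dom 0 x).
  { intros v Hv. split; intros H p Hp; specialize (Hv p Hp); destruct (H p Hp) as [H1 H2]; unfold down_ray, up_ray in *; rewrite re_conj in *.
    - split; [lia|]. intros _. destruct (Nat.le_gt_cases p m) as [L|L]; [specialize (Hv L); lra|apply H2, L].
    - split; [intros L; specialize (Hv L); lra|]. intros L. apply H2. lia. }
  apply (slit_const_right m (fun x => F' x - F x)%C); try assumption; try (apply Hsub; assumption).
  intros v Hv Hvr. apply (Cder_eq _ _ (Eb m v * Rd w0 d v - Eb 0 v * Rd w0 d v)%C).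
  - rewrite (Eb_right 0 m) by (try lia; intros p Hp L; apply Hvr; lia). ring.
  - apply Cder_minus; [apply HF', Hv|apply HF, Hsub; assumption].
Qed.

Lemma is_prim_right (m : nat) (w0 : C) (d : nat -> C) (F F' : C -> C) (y : C) :
  is_prim 0 w0 d F -> is_prim m w0 d F' ->
  slit_dom 0 y -> right_of m (Re y) -> F' y = F y ->
  forall x, slit_dom 0 x -> right_of m (Re x) -> F' x = F x.
Proof.
  intros HF HF' Hy Hyr E x Hx Hr. apply Ceq_minus.
  rewrite (is_prim_right_diff m w0 d F F' x y) by assumption. rewrite E. ring.
Qed.

(** * Integrals along the contours *)

(** Convergence of the improper integral with the two ends treated separately and the parameter axis
    cut at 0, where the contours turn. In this form integrals add and scale without double
    limits. *)
Definition is_line (F : R -> C) (V : C) : Prop :=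
  (forall t, Rcont F t) /\ exists V1 V2,
    filterlim (fun t => CI F t 0) (Rbar_locally m_infty) (locally (T := C_UniformSpace) V1) /\
    filterlim (fun t => CI F 0 t) (Rbar_locally p_infty) (locally (T := C_UniformSpace) V2) /\ V = (V1 + V2)%C.

Lemma is_line_RInt_gen (F : R -> C) (V : C) : is_line F V ->
  is_RInt_gen (V := C_R_NormedModule) F (Rbar_locally m_infty) (Rbar_locally p_infty) V.
Proof.
  intros (Hc & V1 & V2 & H1 & H2 & ->) Q HQ.
  apply locally_Cmod in HQ. destruct HQ as (d & Hd & HQ).
  rewrite filterlim_Cmod in H1 by apply _. rewrite filterlim_Cmod in H2 by apply _.
  apply (Filter_prod _ _ _ _ _ (H1 (d / 2) ltac:(lra)) (H2 (d / 2) ltac:(lra))).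
  intros a b Ha Hb. cbn [fst snd]. exists (CI F a 0 + CI F 0 b)%C. split.
  - apply (is_RInt_Chasles (V := C_R_NormedModule)) with 0; apply CI_correct, ex_CI_cont; intros; apply Hc.
  - apply HQ. replace (CI F a 0 + CI F 0 b - (V1 + V2))%C with ((CI F a 0 - V1) + (CI F 0 b - V2))%C by ring.
    eapply Rle_lt_trans; [apply Cmod_triangle|]. lra.
Qed.

Lemma is_line_ex (F : R -> C) (V : C) : is_line F V -> ex_int_line F.
Proof. intros H. exists V. apply is_line_RInt_gen, H. Qed.

Lemma is_line_unique (F : R -> C) (V : C) : is_line F V -> int_line F = V.
Proof.
  intros H. apply is_line_RInt_gen in H. unfold int_line.
  exact (is_RInt_gen_unique (V := C_R_CompleteNormedModule) F V H).
Qed.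

Lemma is_line_ext (F G : R -> C) (V : C) : (forall t, F t = G t) -> is_line F V -> is_line G V.
Proof.
  intros E (Hc & V1 & V2 & H1 & H2 & HV). split.
  - intros t. apply (continuous_ext F); [exact E|apply Hc].
  - exists V1, V2. split; [|split; [|exact HV]].
    + apply filterlim_ext with (f := fun t => CI F t 0); [|exact H1]. intros; apply CI_ext; intros; apply E.
    + apply filterlim_ext with (f := fun t => CI F 0 t); [|exact H2]. intros; apply CI_ext; intros; apply E.
Qed.

Lemma filterlim_C_plus {T} (FF : (T -> Prop) -> Prop) {HF : Filter FF} (g k : T -> C) (a b : C) :
  filterlim g FF (locally (T := C_UniformSpace) a) -> filterlim k FF (locally (T := C_UniformSpace) b) ->
  filterlim (fun t => g t + k t)%C FF (locally (T := C_UniformSpace) (a + b)%C).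
Proof.
  rewrite !filterlim_Cmod by apply _. intros H1 H2 e He.
  assert (A := filter_and (F := FF) _ _ (H1 (e / 2) ltac:(lra)) (H2 (e / 2) ltac:(lra))).
  apply filter_imp with (2 := A). intros t [B1 B2].
  replace (g t + k t - (a + b))%C with ((g t - a) + (k t - b))%C by ring.
  eapply Rle_lt_trans; [apply Cmod_triangle|]. lra.
Qed.

Lemma filterlim_C_mult {T} (FF : (T -> Prop) -> Prop) {HF : Filter FF} (g k : T -> C) (a b : C) :
  filterlim g FF (locally (T := C_UniformSpace) a) -> filterlim k FF (locally (T := C_UniformSpace) b) ->
  filterlim (fun t => g t * k t)%C FF (locally (T := C_UniformSpace) (a * b)%C).
Proof.
  rewrite !filterlim_Cmod by apply _. intros H1 H2 e He.
  assert (Ha := Cmod_ge_0 a). assert (Hb := Cmod_ge_0 b).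
  assert (A := filter_and (F := FF) _ _ (H1 (e / (2 * (Cmod b + 1))) ltac:(apply Rdiv_lt_0_compat; lra))
    (filter_and (F := FF) _ _ (H2 1 ltac:(lra)) (H2 (e / (2 * (Cmod a + 1))) ltac:(apply Rdiv_lt_0_compat; lra)))).
  apply filter_imp with (2 := A). intros t [B1 [B2 B3]].
  assert (B4 : Cmod (k t) <= Cmod b + 1) by (generalize (Cmod_triangle_rev (k t) b); lra).
  replace (g t * k t - a * b)%C with ((g t - a) * k t + a * (k t - b))%C by ring.
  eapply Rle_lt_trans; [apply Cmod_triangle|]. rewrite !Cmod_mult.
  apply Rlt_div_r in B1; [|lra]. apply Rlt_div_r in B3; [|lra].
  assert (Cmod (g t - a) * Cmod (k t) <= Cmod (g t - a) * (Cmod b + 1)) by (apply Rmult_le_compat_l; [apply Cmod_ge_0|lra]).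
  assert (Cmod a * Cmod (k t - b) <= (Cmod a + 1) * Cmod (k t - b)) by (apply Rmult_le_compat_r; [apply Cmod_ge_0|lra]).
  nra.
Qed.

Lemma filterlim_C_const {T} (FF : (T -> Prop) -> Prop) {HF : Filter FF} (a : C) :
  filterlim (fun _ : T => a) FF (locally (T := C_UniformSpace) a).
Proof. apply filterlim_const. Qed.

Lemma is_line_plus (F G : R -> C) (V W : C) : is_line F V -> is_line G W -> is_line (fun t => F t + G t)%C (V + W)%C.
Proof.
  intros (Hc & V1 & V2 & H1 & H2 & ->) (Hc' & W1 & W2 & H1' & H2' & ->). split.
  - intros t. apply Rcont_plus; auto.
  - exists (V1 + W1)%C, (V2 + W2)%C. split; [|split; [|ring]].
    + apply filterlim_ext with (f := fun t => (CI F t 0 + CI G t 0)%C).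
      * intros t. symmetry. apply CI_plus; apply ex_CI_cont; auto.
      * apply filterlim_C_plus; [apply _|assumption..].
    + apply filterlim_ext with (f := fun t => (CI F 0 t + CI G 0 t)%C).
      * intros t. symmetry. apply CI_plus; apply ex_CI_cont; auto.
      * apply filterlim_C_plus; [apply _|assumption..].
Qed.

Lemma is_line_scal (k : C) (F : R -> C) (V : C) : is_line F V -> is_line (fun t => k * F t)%C (k * V)%C.
Proof.
  intros (Hc & V1 & V2 & H1 & H2 & ->). split.
  - intros t. apply Rcont_mult; [apply continuous_const|auto].
  - exists (k * V1)%C, (k * V2)%C. split; [|split; [|ring]].
    + apply filterlim_ext with (f := fun t => (k * CI F t 0)%C).
      * intros t. symmetry. apply CI_scal; apply ex_CI_cont; auto.
      * apply filterlim_C_mult; [apply _|apply filterlim_C_const; apply _|assumption].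
    + apply filterlim_ext with (f := fun t => (k * CI F 0 t)%C).
      * intros t. symmetry. apply CI_scal; apply ex_CI_cont; auto.
      * apply filterlim_C_mult; [apply _|apply filterlim_C_const; apply _|assumption].
Qed.

Lemma is_line_Csum (n : nat) (F : nat -> R -> C) (V : nat -> C) :
  (forall p, (1 <= p <= n)%nat -> is_line (F p) (V p)) -> is_line (fun t => Csum n (fun p => F p t)) (Csum n V).
Proof.
  induction n as [|n IH]; intros H.
  - apply is_line_ext with (F := fun _ => RtoC 0); [intros; rewrite Csum_0; reflexivity|]. rewrite Csum_0. split.
    + intros; apply continuous_const.
    + exists (RtoC 0), (RtoC 0). assert (E : forall a b, CI (fun _ => RtoC 0) a b = 0) by (intros; rewrite CI_const; ring).
      split; [|split; [|ring]].
      * apply filterlim_ext with (f := fun _ => RtoC 0); [intros; rewrite E; reflexivity|apply filterlim_C_const; apply _].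
      * apply filterlim_ext with (f := fun _ => RtoC 0); [intros; rewrite E; reflexivity|apply filterlim_C_const; apply _].
  - apply is_line_ext with (F := fun t => (Csum n (fun p => F p t) + F (S n) t)%C); [intros; rewrite Csum_S; reflexivity|].
    rewrite Csum_S. apply is_line_plus; [apply IH; intros; apply H; lia|apply H; lia].
Qed.

(** Two primitives are allowed because the branch used along U_m changes at parameter 0. *)
Lemma is_line_primitive (F Phi1 Phi2 : R -> C) (L1 L2 : C) :
  (forall t, Rcont F t) ->
  (forall t, t <= 0 -> Rder Phi1 t (F t)) -> (forall t, 0 <= t -> Rder Phi2 t (F t)) ->
  filterlim Phi1 (Rbar_locally m_infty) (locally (T := C_UniformSpace) L1) ->
  filterlim Phi2 (Rbar_locally p_infty) (locally (T := C_UniformSpace) L2) ->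
  is_line F (Phi1 0 - L1 + (L2 - Phi2 0))%C.
Proof.
  intros Hc H1 H2 HL1 HL2. split; [assumption|]. exists (Phi1 0 - L1)%C, (L2 - Phi2 0)%C.
  rewrite filterlim_Cmod in HL1 by apply _. rewrite filterlim_Cmod in HL2 by apply _.
  split; [|split; [|reflexivity]]; apply filterlim_Cmod; try apply _; intros e He.
  - destruct (HL1 e He) as [B HB]. exists (Rmin B 0). intros t Ht.
    assert (Ht1 := Rlt_le_trans _ _ _ Ht (Rmin_l _ _)). assert (Ht2 := Rlt_le_trans _ _ _ Ht (Rmin_r _ _)).
    rewrite (CI_FTC Phi1).
    + replace (Phi1 0 - Phi1 t - (Phi1 0 - L1))%C with (- (Phi1 t - L1))%C by ring. rewrite Cmod_opp. apply HB, Ht1.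
    + rewrite Rmin_left, Rmax_right by lra. intros; apply H1; lra.
    + auto.
  - destruct (HL2 e He) as [B HB]. exists (Rmax B 0). intros t Ht.
    assert (Ht1 := Rle_lt_trans _ _ _ (Rmax_l _ _) Ht). assert (Ht2 := Rle_lt_trans _ _ _ (Rmax_r _ _) Ht).
    rewrite (CI_FTC Phi2).
    + replace (Phi2 t - Phi2 0 - (L2 - Phi2 0))%C with (Phi2 t - L2)%C by ring. apply HB, Ht1.
    + rewrite Rmin_left, Rmax_right by lra. intros; apply H2; lra.
    + auto.
Qed.

(** One integrand for all entries of the system: its integral is row m of A applied to d, minus w0
    times b_m. *)
Definition cint (w0 : C) (d : nat -> C) (gam : contour) (t : R) : C :=
  (contour_phase eps lam gam t * Rd w0 d (path gam t) * speed gam t)%C.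

Lemma branch_der (gam : contour) (t : R) : continues_f P c z gam ->
  Rder (path gam) t (speed gam t) -> Rder (branch gam) t (u0 P c z (path gam t) * speed gam t)%C.
Proof.
  intros Hf Hp. destruct (Hf t) as (g & H1 & H2).
  apply locally_Cmod in H1. destruct H1 as (d & Hd & H1).
  apply (is_derive_ext_loc (K := R_AbsRing) (V := C_R_NormedModule) (fun t => g (path gam t))).
  - apply filter_imp with (2 := H2). intros s Hs. symmetry. exact Hs.
  - apply Cder_Rder; [|exact Hp]. apply Cder_is_derive, H1.
    replace (path gam t - path gam t)%C with (RtoC 0) by ring. rewrite Cmod_0. exact Hd.
Qed.

(** Uniqueness of continuation: [branch] and the branch m of f have the same derivative along the
    path, so agreement at one parameter persists while the path stays in the domain. *)
Lemma branch_fb (m : nat) (gam : contour) (s t : R) :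
  (forall t, Rder (path gam) t (speed gam t)) -> continues_f P c z gam ->
  (forall u, Rmin s t <= u <= Rmax s t -> slit_dom m (path gam u)) ->
  branch gam s = fb m (path gam s) -> branch gam t = fb m (path gam t).
Proof.
  intros Hp Hf Hd Hs. apply Ceq_minus.
  rewrite <- (Rder_zero_const (fun t => branch gam t - fb m (path gam t))%C s t).
  - rewrite Hs. ring.
  - intros u Hu.
    apply (Rder_eq _ _ (u0 P c z (path gam u) * speed gam u - u0 P c z (path gam u) * speed gam u)%C); [ring|].
    apply (is_derive_minus (K := R_AbsRing) (V := C_R_NormedModule)).
    + apply branch_der; [assumption|apply Hp].
    + apply Cder_Rder; [apply Cder_fb, Hd, Hu|apply Hp].
Qed.

Lemma phase_Eb (m : nat) (gam : contour) (t : R) : branch gam t = fb m (path gam t) ->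
  contour_phase eps lam gam t = Eb m (path gam t).
Proof. intros H. unfold contour_phase, Eb. rewrite H. reflexivity. Qed.

Lemma cint_cont (w0 : C) (d : nat -> C) (gam : contour) (t : R) :
  Rder (path gam) t (speed gam t) -> continuous (speed gam) t -> continues_f P c z gam ->
  (exists m, slit_dom m (path gam t)) -> Rcont (cint w0 d gam) t.
Proof.
  intros Hp Hs Hf [m Hm]. apply Rcont_mult; [|exact Hs]. apply Rcont_mult.
  - apply (Ccont_Rcont Cexp (fun t => - Ci * (RtoC lam * path gam t + branch gam t) / RtoC eps)%C).
    + eapply Cder_cont, Cder_Cexp.
    + apply Rcont_mult; [|apply continuous_const]. apply Rcont_mult; [apply continuous_const|].
      apply Rcont_plus; [|eapply Rder_cont, branch_der; eassumption].
      apply Rcont_mult; [apply continuous_const|]. eapply Rder_cont, Hp.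
  - apply (Ccont_Rcont (Rd w0 d)); [|eapply Rder_cont, Hp]. eapply Cder_cont, Cder_Rd.
    intros p Hpp. apply (slit_dom_neq m); assumption.
Qed.

Lemma is_prim_path (m : nat) (w0 : C) (d : nat -> C) (F : C -> C) (gam : contour) (t : R) :
  is_prim m w0 d F -> Rder (path gam) t (speed gam t) -> slit_dom m (path gam t) -> branch gam t = fb m (path gam t) ->
  Rder (fun t => F (path gam t)) t (cint w0 d gam t).
Proof.
  intros HF Hp Hd Hb. unfold cint. rewrite (phase_Eb m) by assumption. apply Cder_Rder; [apply HF, Hd|exact Hp].
Qed.

Lemma is_prim_end (m : nat) (w0 : C) (d : nat -> C) (F : C -> C) (gam : contour) (FF : (R -> Prop) -> Prop) {HFF : Filter FF} :
  is_prim m w0 d F -> tends_to_minus_i_infty_in_G0 z gam FF ->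
  filterlim (fun t => F (path gam t)) FF (locally (T := C_UniformSpace) (RtoC 0)).
Proof.
  intros HF [H1 H2]. apply filterlim_Cmod; [apply _|]. intros e He.
  destruct (is_prim_small _ _ _ _ HF e He) as [B HB].
  assert (H3 : FF (fun t => Im (path gam t) < B)) by (apply (H1 (fun y => y < B)); exists B; auto).
  apply filter_imp with (2 := filter_and (F := FF) _ _ H2 H3). intros t [A1 A2].
  replace (F (path gam t) - 0)%C with (F (path gam t)) by ring. apply HB; [exact A1|lra].
Qed.

Lemma branch_start (gam : contour) (t : R) : contour_from_minus_i_infty P c z gam ->
  (forall u, u <= t -> in_G P z (path gam u)) -> branch gam t = fb 0 (path gam t).
Proof.
  intros (H1 & H2 & H3 & H4 & [B H5]) Hd.
  set (s := Rmin (B - 1) t).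
  assert (S1 : s <= B - 1) by apply Rmin_l. assert (S2 : s <= t) by apply Rmin_r.
  apply (branch_fb 0 gam s t); try assumption.
  - intros u Hu. rewrite Rmax_right in Hu by assumption. apply slit_dom_0, Hd. lra.
  - rewrite fb_0. apply H5. lra.
Qed.

Lemma right_of_p0 (m : nat) (x : R) : (1 <= m <= P)%nat -> Re (z m) < x -> right_of m x.
Proof.
  intros Hm H p Hp L. generalize (Re_z_le p m). intros H3. specialize (H3 ltac:(lia) ltac:(lia) ltac:(lia)). lra.
Qed.

(** Up to the turning point the contour lies in the domain of branch 0, afterwards in that of branch
    m. At the turning point, to the right of z_m, the branches agree, and both primitives vanish at
    the ends. *)
Lemma line_U (m : nat) (w0 : C) (d : nat -> C) (F0 Fm : C -> C) (gam : contour) : (1 <= m <= P)%nat ->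
  is_U P c z m gam -> is_prim 0 w0 d F0 -> is_prim m w0 d Fm ->
  is_line (cint w0 d gam) (F0 (path gam 0) - Fm (path gam 0))%C.
Proof.
  intros Hm (H1 & H2 & H3 & H4 & H5 & H6) HF0 HFm.
  assert (B0 : forall t, t <= 0 -> branch gam t = fb 0 (path gam t)).
  { intros t Ht. apply branch_start; [assumption|]. intros u Hu. apply H2. lra. }
  assert (Bm : forall t, 0 <= t -> branch gam t = fb m (path gam t)).
  { intros t Ht. apply (branch_fb m gam 0 t).
    - apply H1. - apply H1.
    - intros u Hu. rewrite Rmin_left in Hu by assumption. exact (H5 u (proj1 Hu)).
    - rewrite B0 by lra. symmetry. apply fb_right; [lia|].
      intros p Hp L. apply (right_of_p0 m); try assumption. lia. }
  destruct H1 as (H1a & H1b & H1c & H1d & H1e).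
  replace (F0 (path gam 0) - Fm (path gam 0))%C with (F0 (path gam 0) - 0 + (0 - Fm (path gam 0)))%C by ring.
  apply (is_line_primitive _ (fun t => F0 (path gam t)) (fun t => Fm (path gam t))).
  - intros t. apply cint_cont; auto. destruct (Rle_dec t 0) as [Ht|Ht].
    + exists O. apply slit_dom_0, H2, Ht.
    + exists m. exact (H5 t ltac:(lra)).
  - intros t Ht. apply (is_prim_path 0 w0 d F0); auto. apply slit_dom_0, H2, Ht.
  - intros t Ht. apply (is_prim_path m w0 d Fm); auto. exact (H5 t Ht).
  - apply (is_prim_end 0 w0 d F0); [apply _|assumption..].
  - apply (is_prim_end m w0 d Fm); [apply _|assumption..].
Qed.

Lemma Eb_near (q : nat) (r : R) : (1 <= q <= P)%nat -> near q r ->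
  exists K, 0 < K /\ forall m x, 0 < Cmod (x - z q) < r ->
    / K * exp (Im (c q) / eps * ln (Cmod (x - z q))) <= Cmod (Eb m x) <= K * exp (Im (c q) / eps * ln (Cmod (x - z q))).
Proof.
  intros Hq Hn. destruct (Im_fb_near q r Hq Hn) as [K HK].
  set (K' := lam * (Cmod (z q) + r) + K). exists (exp (K' / eps)). split; [apply exp_pos|]. intros m x Hx.
  specialize (HK m x Hx). apply Rabs_le_between in HK. rewrite Cmod_Eb, <- exp_Ropp, <- !exp_plus.
  assert (He : 0 < / eps) by (apply Rinv_0_lt_compat; assumption).
  assert (M : forall a b, a <= b -> exp a <= exp b) by (intros a b [H| ->]; [apply Rlt_le, exp_increasing; assumption|lra]).
  assert (Hi : Rabs (Im x) <= Cmod (z q) + r).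
  { eapply Rle_trans; [apply im_le_Cmod|]. replace x with ((x - z q) + z q)%C by ring. eapply Rle_trans; [apply Cmod_triangle|]. lra. }
  apply Rabs_le_between in Hi. set (l := ln (Cmod (x - z q))) in *.
  assert (Hl : - (lam * (Cmod (z q) + r)) <= lam * Im x <= lam * (Cmod (z q) + r)) by nra.
  split; apply M; unfold Rdiv, K'.
  - replace (- ((lam * (Cmod (z q) + r) + K) * / eps) + Im (c q) * / eps * l)
      with ((- (lam * (Cmod (z q) + r) + K) + Im (c q) * l) * / eps) by ring.
    apply Rmult_le_compat_r; lra.
  - replace ((lam * (Cmod (z q) + r) + K) * / eps + Im (c q) * / eps * l)
      with (((lam * (Cmod (z q) + r) + K) + Im (c q) * l) * / eps) by ring.
    apply Rmult_le_compat_r; lra.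
Qed.

Lemma near_slit_up (q m : nat) (r : R) (x : C) : (1 <= q <= P)%nat -> (m < q)%nat -> near q r -> Cmod (x - z q) < r ->
  ~ up_ray (z q) x -> slit_dom m x.
Proof.
  intros Hq Hm Hn Hx Hu p Hp. destruct (near_dist q p r x Hn Hp Hq Hx) as (D1 & _ & _ & D3). assert (Hr : 0 < r) by apply Hn.
  destruct (Nat.eq_dec p q) as [->|E].
  - split; [lia|]. intros _. split; [assumption|]. intros [_ H]. rewrite im_conj in H. specialize (Him q Hq). lra.
  - specialize (D1 E). assert (Re x <> Re (z p)) by (intros E'; rewrite E', Rminus_diag, Rabs_R0 in D1; lra).
    unfold up_ray, down_ray. rewrite re_conj. tauto.
Qed.

Lemma near_slit_down (q m : nat) (r : R) (x : C) : (1 <= q <= P)%nat -> (q <= m)%nat -> near q r -> Cmod (x - z q) < r ->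
  ~ down_ray (z q) x -> slit_dom m x.
Proof.
  intros Hq Hm Hn Hx Hu p Hp. destruct (near_dist q p r x Hn Hp Hq Hx) as (D1 & _ & _ & D3). assert (Hr : 0 < r) by apply Hn.
  destruct (Nat.eq_dec p q) as [->|E].
  - split; [|lia]. intros _. assumption.
  - specialize (D1 E). assert (Re x <> Re (z p)) by (intros E'; rewrite E', Rminus_diag, Rabs_R0 in D1; lra).
    unfold up_ray, down_ray. rewrite re_conj. tauto.
Qed.

Lemma seg_bound (F g : C -> C) (x y : C) (K : R) :
  (forall t, 0 <= t <= 1 -> Cder F (x + (y - x) * RtoC t)%C (g (x + (y - x) * RtoC t)%C) /\
     Ccont g (x + (y - x) * RtoC t)%C /\ Cmod (g (x + (y - x) * RtoC t)%C) <= K) ->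
  Cmod (F y - F x) <= K * Cmod (y - x).
Proof.
  intros H.
  assert (B : Cmod (F (x + (y - x) * RtoC 1)%C - F (x + (y - x) * RtoC 0)%C) <= K * Cmod (y - x) * Rabs (1 - 0)).
  { apply (Rder_bound (fun t => F (x + (y - x) * RtoC t)%C) (fun t => g (x + (y - x) * RtoC t) * (y - x))%C);
      rewrite Rmin_left, Rmax_right by lra; intros t Ht.
    - apply Cder_Rder; [apply H, Ht|apply Rder_affine].
    - apply Rcont_mult; [|apply continuous_const].
      apply (Ccont_Rcont g); [apply H, Ht|apply Rcont_affine].
    - rewrite Cmod_mult. apply Rmult_le_compat_r; [apply Cmod_ge_0|apply H, Ht]. }
  replace (x + (y - x) * RtoC 1)%C with y in B by ring. replace (x + (y - x) * RtoC 0)%C with x in B by ring.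
  rewrite Rminus_0_r, Rabs_R1, Rmult_1_r in B. exact B.
Qed.

Lemma ball_convex (w x y : C) (t rho : R) : 0 <= t <= 1 -> Cmod (x - w) <= rho -> Cmod (y - w) <= rho ->
  Cmod (x + (y - x) * RtoC t - w) <= rho.
Proof.
  intros Ht Hx Hy. replace (x + (y - x) * RtoC t - w)%C with (RtoC (1 - t) * (x - w) + RtoC t * (y - w))%C
    by (rewrite RtoC_minus; ring).
  eapply Rle_trans; [apply Cmod_triangle|]. rewrite !Cmod_RtoC_mult by lra. nra.
Qed.

(** The condition says c_q = i (n+1) eps, so E vanishes at z_q to order n + 1 and absorbs the simple
    pole of the rational factor; an integral ending at z_q then converges. *)
Lemma exceptional_c (q : nat) : exceptional eps c q -> exists n, Re (c q) = 0 /\ Im (c q) / eps = INR (S n).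
Proof.
  intros [n H]. exists n. assert (E : c q = (Ci * RtoC (INR (S n) * eps))%C).
  { rewrite RtoC_mult. replace (c q) with (- Ci * (Ci * c q / RtoC eps) * RtoC eps)%C.
    - rewrite H. ring.
    - replace (- Ci * (Ci * c q / RtoC eps) * RtoC eps)%C with (- (Ci * Ci) * c q * (RtoC eps / RtoC eps))%C by (unfold Cdiv; ring).
      replace (Ci * Ci)%C with (- (1))%C by (apply C_ext; simpl; ring).
      unfold Cdiv. rewrite Cinv_r by apply eps_neq_0. ring. }
  rewrite E. set (N := INR (S n)). clearbody N. unfold Re, Im. simpl. split; [ring|field; lra].
Qed.

Lemma exp_INR_ln (n : nat) (x : R) : 0 < x -> exp (INR n * ln x) = x ^ n.
Proof.
  intros Hx. induction n as [|n IH]; [simpl; rewrite Rmult_0_l; apply exp_0|].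
  rewrite S_INR. simpl. rewrite Rmult_plus_distr_r, exp_plus, IH, Rmult_1_l, exp_ln by assumption. ring.
Qed.

(** The integrand is O(rho^n) at distance rho, so F is Cauchy along the vertical approach from
    below. Any other point is joined to the point of this approach at the same distance; the
    constant 3 k is k for the vertical part and 2 k for the chord. *)
Lemma exceptional_limit (q : nat) (w0 : C) (d : nat -> C) (F : C -> C) : (1 <= q <= P)%nat ->
  exceptional eps c q -> is_prim 0 w0 d F -> exists n L K r, Im (c q) / eps = INR (S n) /\ near q r /\ 0 <= K /\
    forall x, slit_dom 0 x -> Cmod (x - z q) < r -> Cmod (F x - L) <= K * Cmod (x - z q) ^ S n.
Proof.
  intros Hq Hex [HF _]. destruct (exceptional_c q Hex) as (n & _ & Hn).
  destruct (near_ex q Hq) as [r Hr]. destruct (Eb_near q r Hq Hr) as (K1 & HK1 & HE).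
  destruct (Rd_near q r w0 d Hq Hr) as (K2 & HK2 & HR). set (k := K1 * K2). assert (Hk : 0 <= k) by (unfold k; nra).
  set (g := fun x => (Eb 0 x * Rd w0 d x)%C).
  assert (Hg : forall rho x, 0 < Cmod (x - z q) <= rho -> rho < r -> Cmod (g x) <= k * rho ^ n).
  { intros rho x Hx Hrho. unfold g. rewrite Cmod_mult. specialize (HE 0%nat x ltac:(lra)). specialize (HR x ltac:(lra)).
    rewrite Hn, exp_INR_ln in HE by lra. set (s := Cmod (x - z q)) in *.
    apply Rle_trans with (K1 * s ^ S n * (K2 * / s)); [apply Rmult_le_compat; try apply Cmod_ge_0; [apply HE|exact HR]|].
    replace (K1 * s ^ S n * (K2 * / s)) with (k * s ^ n) by (unfold k; simpl; field; lra).
    apply Rmult_le_compat_l; [assumption|]. apply pow_incr. lra. }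
  assert (Hseg : forall rho x y, rho < r -> Cmod (x - z q) <= rho -> Cmod (y - z q) <= rho ->
     (forall t, 0 <= t <= 1 -> ~ up_ray (z q) (x + (y - x) * RtoC t)%C) -> Cmod (F y - F x) <= k * rho ^ n * Cmod (y - x)).
  { intros rho x y Hrho Hx Hy Hu. apply (seg_bound F g). intros t Ht. specialize (Hu t Ht).
    assert (Hb := ball_convex (z q) x y t rho Ht Hx Hy). set (w := (x + (y - x) * RtoC t)%C) in *.
    assert (Hs : slit_dom 0 w) by (apply (near_slit_up q 0 r); try assumption; [lia|lra]).
    split; [apply HF, Hs|]. split.
    - destruct (Cder_EbRd 0 w0 d w Hs) as [l Hl]. eapply Cder_cont, Hl.
    - apply Hg; [|assumption]. split; [|assumption]. apply Cmod_gt_0, Cminus_eq_contra. intros E.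
      apply Hu. rewrite E. split; lra. }
  (* The approach to z_q from below, opposite to the upward cut. *)
  set (w := fun rho : R => (z q - Ci * RtoC rho)%C).
  assert (Ew : forall rho, Re (w rho) = Re (z q) /\ Im (w rho) = Im (z q) - rho).
  { intros; unfold w, Re, Im; simpl; split; ring. }
  assert (Hw : forall rho, 0 <= rho -> Cmod (w rho - z q) = rho).
  { intros rho H. unfold w. replace (z q - Ci * RtoC rho - z q)%C with (- (Ci * RtoC rho))%C by ring.
    rewrite Cmod_opp, Cmod_mult, Cmod_Ci, Cmod_R, Rabs_pos_eq by assumption. ring. }
  assert (A1 : forall rho rho', 0 < rho' <= rho -> rho < r -> Cmod (F (w rho') - F (w rho)) <= k * rho ^ n * (rho - rho')).
  { intros rho rho' H1 H2. replace (rho - rho') with (Cmod (w rho' - w rho)).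
    - apply Hseg; try (rewrite Hw by lra; lra); [assumption|]. intros t Ht [_ H].
      rewrite im_plus, im_scal_r, im_minus in H. destruct (Ew rho) as [_ E1]. destruct (Ew rho') as [_ E2].
      rewrite E1, E2 in H. nra.
    - unfold w. replace (z q - Ci * RtoC rho' - (z q - Ci * RtoC rho))%C with (Ci * RtoC (rho - rho'))%C by (rewrite RtoC_minus; ring).
      rewrite Cmod_mult, Cmod_Ci, Cmod_R, Rabs_pos_eq by lra. ring. }
  assert (Hr0 : 0 < r) by apply Hr.
  assert (PA : forall s, 0 < s -> 0 < s ^ n) by (intros; apply pow_lt; assumption).
  destruct (proj1 (Hierarchy.filterlim_locally_cauchy (U := C_R_CompleteNormedModule)
    (F := at_right 0) (fun rho => F (w rho)))) as [L HL].
  { intros e. set (r1 := Rmin (r / 2) (e / (k * (r / 2) ^ n + 1))).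
    assert (Hkr : 0 <= k * (r / 2) ^ n) by (apply Rmult_le_pos; [assumption|]; apply Rlt_le, PA; lra).
    assert (Hr1 : 0 < r1) by (apply Rmin_pos; [lra|]; apply Rdiv_lt_0_compat; [apply cond_pos|lra]).
    assert (R1 : r1 <= r / 2) by apply Rmin_l.
    assert (R2 : k * (r / 2) ^ n * r1 < e).
    { assert (R3 : r1 <= e / (k * (r / 2) ^ n + 1)) by apply Rmin_r. apply Rle_div_r in R3; [|lra]. lra. }
    exists (fun rho => 0 < rho < r1). split.
    - exists (mkposreal r1 Hr1). intros y Hy Hy0. change (Rabs (y - 0) < r1) in Hy. rewrite Rminus_0_r in Hy.
      apply Rabs_lt_between in Hy. lra.
    - assert (Sm : forall u v, 0 < v <= u -> u < r1 -> Cmod (F (w v) - F (w u)) < e).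
      { intros u v Huv Hu. eapply Rle_lt_trans; [apply A1; [assumption|lra]|].
        apply Rle_lt_trans with (k * (r / 2) ^ n * r1); [|assumption].
        apply Rmult_le_compat; [apply Rmult_le_pos; [assumption|apply Rlt_le, PA; lra]|lra| |lra].
        apply Rmult_le_compat_l; [assumption|]. apply pow_incr; lra. }
      intros u v Hu Hv. apply C_NormedModule_mixin_compat1. change (Cmod (F (w v) - F (w u)) < e).
      destruct (Rle_dec u v); [rewrite Cmod_sub_sym|]; apply Sm; lra. }
  rewrite filterlim_Cmod in HL by apply _.
  assert (A2 : forall rho, 0 < rho < r -> Cmod (F (w rho) - L) <= k * rho ^ S n).
  { intros rho Hrho. apply le_epsilon. intros e He. destruct (HL e He) as [dl Hdl].
    assert (Hdp := cond_pos dl). set (rho' := Rmin (dl / 2) rho).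
    assert (R0' : 0 < rho') by (apply Rmin_pos; lra). assert (R1 : rho' <= dl / 2) by apply Rmin_l. assert (R2 : rho' <= rho) by apply Rmin_r.
    specialize (Hdl rho'). lapply Hdl; [clear Hdl; intros Hdl|change (Rabs (rho' - 0) < dl); rewrite Rminus_0_r, Rabs_pos_eq; lra].
    specialize (Hdl R0'). specialize (A1 rho rho' ltac:(lra) ltac:(lra)).
    replace (F (w rho) - L)%C with (- (F (w rho') - F (w rho)) + (F (w rho') - L))%C by ring.
    eapply Rle_trans; [apply Cmod_triangle|]. rewrite Cmod_opp. simpl.
    assert (k * rho ^ n * (rho - rho') <= k * (rho * rho ^ n)).
    { replace (k * (rho * rho ^ n)) with (k * rho ^ n * rho) by ring. apply Rmult_le_compat_l; [|lra].
      apply Rmult_le_pos; [assumption|apply Rlt_le, PA; lra]. }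
    lra. }
  exists n, L, (3 * k), r. split; [assumption|]. split; [assumption|]. split; [lra|]. intros x Hx Hxr.
  destruct (slit_dom_neq 0 q x Hx Hq) as [Nx _].
  assert (Hrho : 0 < Cmod (x - z q)) by (apply Cmod_gt_0, Cminus_eq_contra, Nx).
  set (rho := Cmod (x - z q)) in *.
  assert (A3 : Cmod (F (w rho) - F x) <= k * rho ^ n * Cmod (w rho - x)).
  { apply Hseg; [assumption|unfold rho; lra|rewrite Hw; lra|]. intros t Ht [H1 H2].
    destruct (Ew rho) as [E1 E2]. rewrite re_plus, re_scal_r, re_minus, E1 in H1. rewrite im_plus, im_scal_r, im_minus, E2 in H2.
    (* The chord from x to the point below z_q avoids the upward cut: if x is on the vertical line,
       x lies below z_q as well; otherwise only the end point is on that line, and it is below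
       z_q. *)
    destruct (Req_dec (Re x) (Re (z q))) as [E|E].
    - apply (proj1 (proj2 (Hx q Hq) ltac:(lia))). split; [assumption|].
      apply Rnot_lt_le. intros Hlt.
      assert (0 <= (1 - t) * (Im (z q) - Im x)) by (apply Rmult_le_pos; lra).
      destruct (Rle_dec t (1 / 2)); nra.
    - assert (t = 1) by nra. subst t. lra. }
  assert (A4 : Cmod (w rho - x) <= 2 * rho).
  { replace (w rho - x)%C with ((w rho - z q) - (x - z q))%C by ring. eapply Rle_trans; [apply Cmod_triangle|].
    rewrite Cmod_opp, Hw by lra. fold rho. lra. }
  specialize (A2 rho ltac:(lra)).
  replace (F x - L)%C with (- (F (w rho) - F x) + (F (w rho) - L))%C by ring.
  eapply Rle_trans; [apply Cmod_triangle|]. rewrite Cmod_opp. simpl in *.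
  assert (k * rho ^ n * Cmod (w rho - x) <= k * rho ^ n * (2 * rho)).
  { apply Rmult_le_compat_l; [|exact A4]. apply Rmult_le_pos; [assumption|apply Rlt_le, PA; lra]. }
  replace (3 * k * (rho * rho ^ n)) with (k * rho ^ n * (2 * rho) + k * (rho * rho ^ n)) by ring. lra.
Qed.

Lemma line_ell0 (q n : nat) (w0 : C) (d : nat -> C) (F : C -> C) (gam : contour) (L : C) (K r : R) : (1 <= q <= P)%nat ->
  is_ell0 P c z q gam -> is_prim 0 w0 d F -> 0 < r -> 0 <= K ->
  (forall x, slit_dom 0 x -> Cmod (x - z q) < r -> Cmod (F x - L) <= K * Cmod (x - z q) ^ S n) ->
  is_line (cint w0 d gam) L.
Proof.
  intros Hq (H1 & H2 & H3) HF Hr HK HL.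
  assert (B0 : forall t, branch gam t = fb 0 (path gam t)) by (intros t; apply branch_start; auto).
  assert (Hd : forall t, slit_dom 0 (path gam t)) by (intros t; apply slit_dom_0, H2).
  destruct H1 as (H1a & H1b & H1c & H1d & H1e).
  replace L with (F (path gam 0) - 0 + (L - F (path gam 0)))%C by ring.
  apply (is_line_primitive _ (fun t => F (path gam t)) (fun t => F (path gam t))).
  - intros t. apply cint_cont; auto. exists O. apply Hd.
  - intros t Ht. apply (is_prim_path 0 w0 d F); auto.
  - intros t Ht. apply (is_prim_path 0 w0 d F); auto.
  - apply (is_prim_end 0 w0 d F); [apply _|assumption..].
  - apply filterlim_Cmod; [apply _|]. intros e He. rewrite filterlim_Cmod in H3 by apply _.
    set (r' := Rmin (Rmin r 1) (e / (K + 1))).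
    assert (Hr' : 0 < r') by (repeat apply Rmin_pos; try lra; apply Rdiv_lt_0_compat; lra).
    assert (R1 : r' <= r) by (eapply Rle_trans; apply Rmin_l).
    assert (R2 : r' <= 1) by (eapply Rle_trans; [apply Rmin_l|apply Rmin_r]).
    assert (R3 : r' <= e / (K + 1)) by apply Rmin_r. apply Rle_div_r in R3; [|lra].
    apply filter_imp with (2 := H3 r' Hr'). intros t Ht.
    eapply Rle_lt_trans; [apply HL; [apply Hd|lra]|]. set (s := Cmod (path gam t - z q)) in *.
    assert (Hs : 0 <= s) by apply Cmod_ge_0.
    assert (Hpw : s ^ S n <= s). { simpl. rewrite <- (Rmult_1_r s) at 3. apply Rmult_le_compat_l; [assumption|].
      rewrite <- (pow1 n). apply pow_incr. lra. }
    assert (K * s ^ S n <= K * s) by (apply Rmult_le_compat_l; assumption). nra.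
Qed.

(** * The Cauchy projection *)

(* Only the values on [0 <= Im x] matter; the reflection makes the extension continuous
   in a full neighbourhood of each real point. *)
Definition refl (W : C -> C) (x : C) : C := W (Re x, Rabs (Im x)).

Lemma refl_eq (W : C -> C) (x : C) : 0 <= Im x -> refl W x = W x.
Proof. intros H. unfold refl. rewrite Rabs_pos_eq by assumption. destruct x; reflexivity. Qed.

Lemma refl_eq_near (W : C -> C) (x : C) : 0 < Im x -> forall y, Cmod (y - x) < Im x -> W y = refl W y.
Proof.
  intros H y Hy. symmetry. apply refl_eq. assert (L := Im_lip x y). apply Rabs_le_between in L. lra.
Qed.

Lemma refl_der (W : C -> C) (x : C) : bounded_analytic_extension W -> 0 < Im x -> exists l, Cder (refl W) x l.
Proof.
  intros (H & _ & _) Hx. destruct (H x Hx) as [l Hl]. exists l.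
  apply (Cder_ext_loc W _ _ _ (Im x)); [assumption|apply refl_eq_near, Hx|apply Cder_is_derive, Hl].
Qed.

Lemma bae_real (W : C -> C) (x : R) : bounded_analytic_extension W -> forall e, 0 < e ->
  exists d, 0 < d /\ forall y, Cmod (y - RtoC x) < d -> 0 < Im y -> Cmod (W y - W (RtoC x)) < e.
Proof.
  intros (_ & _ & H) e He. specialize (H x (fun w => Cmod (w - W (RtoC x)) < e)).
  lapply H; [clear H; intros H|apply locally_Cmod; exists e; auto].
  apply locally_Cmod in H. destruct H as (d & Hd & H). exists d. split; assumption.
Qed.

(** At a real point the assumption speaks only of approach from strictly above. Nearby real points
    are handled by lifting them slightly, to a height at which W is close to both boundary
    values. *)
Lemma refl_cont (W : C -> C) (x : C) : bounded_analytic_extension W -> 0 <= Im x -> Ccont (refl W) x.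
Proof.
  intros HW [Hx|Hx].
  - destruct (refl_der W x HW Hx) as [l Hl]. eapply Cder_cont, Hl.
  - intros e He. destruct x as [x y]. simpl in Hx. subst y.
    destruct (bae_real W x HW (e / 2)) as (d & Hd & H); [lra|].
    assert (Hr : refl W (x, 0) = W (RtoC x)) by (apply refl_eq; simpl; lra). rewrite Hr.
    exists d. split; [assumption|]. intros [u v] Hy. unfold refl. simpl Re; simpl Im.
    assert (Hm : forall v', Rabs v' = Rabs v -> Cmod ((u, v') - RtoC x) = Cmod ((u, v) - (x, 0))).
    { intros v' Hv. unfold Cmod. f_equal. simpl.
      assert (v' * v' = v * v) by (change (Rsqr v' = Rsqr v); rewrite (Rsqr_abs v'), (Rsqr_abs v), Hv; reflexivity).
      nra. }
    destruct (Req_dec v 0) as [->|Hv].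
    + rewrite Rabs_R0. destruct (bae_real W u HW (e / 2)) as (d' & Hd' & H'); [lra|].
      set (s := Rmin (d' / 2) ((d - Cmod ((u, 0) - (x, 0))) / 2)).
      assert (Hs : 0 < s) by (apply Rmin_pos; lra).
      assert (S1 : s <= d' / 2) by apply Rmin_l. assert (S2 : s <= (d - Cmod ((u, 0) - (x, 0))) / 2) by apply Rmin_r.
      assert (E : Cmod ((u, s) - RtoC u) = s).
      { replace ((u, s) - RtoC u)%C with (Ci * RtoC s)%C by (apply C_ext; simpl; ring).
        rewrite Cmod_mult, Cmod_Ci, Cmod_R, Rabs_pos_eq; lra. }
      specialize (H' (u, s) ltac:(lra) Hs).
      specialize (H (u, s)). lapply H; [clear H; intros H|].
      2:{ replace ((u, s) - RtoC x)%C with (((u, s) - RtoC u) + ((u, 0) - (x, 0)))%C by (apply C_ext; simpl; ring).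
          eapply Rle_lt_trans; [apply Cmod_triangle|]. lra. }
      specialize (H Hs).
      replace (W (u, 0) - W (RtoC x))%C with (- (W (u, s) - W (RtoC u)) + (W (u, s) - W (RtoC x)))%C by (unfold RtoC; ring).
      eapply Rle_lt_trans; [apply Cmod_triangle|]. rewrite Cmod_opp. lra.
    + apply Rlt_trans with (e / 2); [|lra]. apply H; [rewrite Hm by (apply Rabs_Rabsolu); assumption|].
      simpl. apply Rabs_pos_lt, Hv.
Qed.

Lemma refl_bound (W : C -> C) : bounded_analytic_extension W -> exists B, 0 <= B /\ forall x, 0 <= Im x -> Cmod (refl W x) <= B.
Proof.
  intros HW. assert (HW' := HW). destruct HW' as (_ & (B & HB) & _).
  assert (B0 : 0 <= B) by (eapply Rle_trans; [apply Cmod_ge_0|apply (HB Ci); simpl; lra]).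
  exists B. split; [assumption|]. intros x Hx. rewrite refl_eq by assumption. destruct Hx as [Hx|Hx]; [apply HB, Hx|].
  apply le_epsilon. intros e He. destruct x as [x y]. simpl in Hx. subst y.
  destruct (bae_real W x HW e He) as (d & Hd & H).
  specialize (H (mkC x (d / 2))). lapply H; [clear H; intros H|].
  - specialize (H ltac:(simpl; lra)). specialize (HB (mkC x (d / 2)) ltac:(simpl; lra)).
    change (x, 0) with (RtoC x). generalize (Cmod_triangle_rev (W (RtoC x)) (W (mkC x (d / 2)))). rewrite Cmod_sub_sym. lra.
  - replace (mkC x (d / 2) - RtoC x)%C with (Ci * RtoC (d / 2))%C by (apply C_ext; simpl; ring).
    rewrite Cmod_mult, Cmod_Ci, Cmod_R, Rabs_pos_eq; lra.
Qed.

Lemma RI_Csum (n : nat) (F : nat -> C -> C) (a b c' d : R) : a <= b -> c' <= d ->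
  (forall p, (1 <= p <= n)%nat -> bd_cont (F p) a b c' d) ->
  bd_cont (fun w => Csum n (fun p => F p w)) a b c' d /\
  RI (fun w => Csum n (fun p => F p w)) a b c' d = Csum n (fun p => RI (F p) a b c' d).
Proof.
  intros Hab Hcd. induction n as [|n IH]; intros H.
  - split.
    + split; split; (eapply Ccont_ext_loc with (f := fun _ => RtoC 0); [apply Rlt_0_1|intros; rewrite Csum_0; reflexivity|apply Ccont_const]).
    + rewrite Csum_0. rewrite <- (RI_opp_ext0 a b c' d Hab Hcd). apply RI_ext; try assumption; intros; rewrite !Csum_0; split; reflexivity.
  - destruct IH as [IH1 IH2]; [intros; apply H; lia|]. assert (HS := H (S n) ltac:(lia)).
    assert (E : forall w, (Csum n (fun p => F p w) + F (S n) w)%C = Csum (S n) (fun p => F p w)) by (intros; rewrite Csum_S; reflexivity).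
    split.
    + destruct IH1 as [I1 I2], HS as [S1 S2].
      split; intros t Ht; split; (eapply Ccont_ext_loc with (f := fun w => (Csum n (fun p => F p w) + F (S n) w)%C);
        [apply Rlt_0_1|intros; apply E|apply Ccont_plus; solve [apply I1, Ht | apply I2, Ht | apply S1, Ht | apply S2, Ht]]).
    + rewrite Csum_S, <- IH2, <- (RI_plus (fun w => Csum n (fun p => F p w)) (F (S n))) by assumption.
      apply RI_ext; try assumption; intros; rewrite !E; split; reflexivity.
Qed.

(* [u0 W] minus its polar parts in the upper half-plane. *)
Definition regular_part (W : C -> C) (x : C) : C :=
  (u0 P c z x * refl W x - Csum P (fun p => c p * W (z p) / (x - z p)))%C.

(** The singular term and its polar part combine into c_p times a difference quotient of W at z_p,
    which stays continuous once the derivative is filled in. At the poles themselves only continuity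
    is recorded, which the form of Goursat's theorem permits. *)
Lemma regular_part_ext (W : C -> C) : bounded_analytic_extension W ->
  exists psi, (forall x, 0 <= Im x -> Ccont psi x) /\
    (forall x, 0 < Im x -> (forall p, (1 <= p <= P)%nat -> x <> z p) -> exists l, Cder psi x l) /\
    (forall x, (forall p, (1 <= p <= P)%nat -> x <> z p) -> psi x = regular_part W x).
Proof.
  intros HW.
  assert (HK : forall n, (n <= P)%nat -> exists k : nat -> C, forall p, (1 <= p <= n)%nat -> Cder (refl W) (z p) (k p)).
  { induction n as [|n IH]; intros Hn.
    - exists (fun _ => RtoC 0). intros; lia.
    - destruct IH as [k Hk]; [lia|]. destruct (refl_der W (z (S n)) HW) as [l Hl]; [apply Him; lia|].
      exists (fun p => if Nat.eq_dec p (S n) then l else k p). intros p Hp.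
      destruct (Nat.eq_dec p (S n)) as [->|]; [exact Hl|apply Hk; lia]. }
  destruct (HK P (le_n P)) as [k Hk].
  exists (fun x => Csum P (fun p => c p * dquot (refl W) (z p) (k p) x + Cconj (c p) * refl W x / (x - Cconj (z p)))%C).
  assert (Nstar : forall x p, 0 <= Im x -> (1 <= p <= P)%nat -> x <> Cconj (z p)).
  { intros x p Hx Hp ->. rewrite im_conj in Hx. specialize (Him p Hp). lra. }
  split; [|split].
  - intros x Hx.
    assert (A : forall n, (n <= P)%nat -> Ccont (fun x => Csum n (fun p => c p * dquot (refl W) (z p) (k p) x + Cconj (c p) * refl W x / (x - Cconj (z p)))%C) x).
    { induction n as [|n IH]; intros Hn.
      - eapply Ccont_ext_loc with (f := fun _ => RtoC 0); [apply Rlt_0_1|intros; rewrite Csum_0; reflexivity|apply Ccont_const].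
      - eapply Ccont_ext_loc; [apply Rlt_0_1|intros y _; symmetry; apply Csum_S|]. apply Ccont_plus; [apply IH; lia|].
        apply Ccont_plus.
        + apply Ccont_mult; [apply Ccont_const|]. apply dquot_cont; [apply Hk; lia|]. apply refl_cont; assumption.
        + apply Ccont_div.
          * apply Cminus_eq_contra, Nstar; [assumption|lia].
          * apply Ccont_mult; [apply Ccont_const|apply refl_cont; assumption].
          * apply Ccont_minus; [apply Ccont_id|apply Ccont_const]. }
    apply A. lia.
  - intros x Hx Hn. destruct (refl_der W x HW Hx) as [l Hl].
    assert (A : forall n, (n <= P)%nat -> exists l, Cder (fun x => Csum n (fun p => c p * dquot (refl W) (z p) (k p) x + Cconj (c p) * refl W x / (x - Cconj (z p)))%C) x l).
    { induction n as [|n IH]; intros Hnn.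
      - exists 0. eapply Cder_ext with (f := fun _ => RtoC 0); [intros; rewrite Csum_0; reflexivity|apply Cder_const].
      - destruct IH as [l1 H1]; [lia|]. destruct (dquot_der (refl W) (z (S n)) (k (S n)) x) as [l2 H2].
        + apply Hn; lia. + exists l; exact Hl.
        + eexists. eapply Cder_ext; [intros y; symmetry; apply Csum_S|]. apply Cder_plus; [exact H1|].
          apply Cder_plus; [apply Cder_scal, H2|].
          apply (Cder_div (fun x => Cconj (c (S n)) * refl W x)%C (fun x => x - Cconj (z (S n)))%C).
          * apply Cminus_eq_contra, Nstar; [lra|lia].
          * apply Cder_scal, Hl.
          * apply Cder_minus; [apply Cder_id|apply Cder_const]. }
    apply A. lia.
  - intros x Hn. unfold regular_part, u0. rewrite <- Csum_scal_r, <- Csum_minus. apply Csum_ext. intros p Hp.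
    unfold dquot. destruct (Ceq_dec x (z p)) as [E|_]; [exfalso; exact (Hn p Hp E)|].
    rewrite (refl_eq W (z p)) by (apply Rlt_le, Him, Hp). unfold Cdiv. ring.
Qed.

(** By partial fractions the two residues are opposite. This is why the polar parts do not
    contribute to the Cauchy integral. *)
Lemma RI_two_poles (a b c' d : R) (x y u v : R) : a < x < b -> c' < y < d -> a < u < b -> c' < v < d -> (x, y) <> (u, v) ->
  RI (fun w => / (w - (x, y)) * / (w - (u, v)))%C a b c' d = 0.
Proof.
  intros H1 H2 H3 H4 Hn. set (p := (x, y) : C) in *. set (q := (u, v) : C) in *.
  assert (Npq : (p - q)%C <> 0) by (apply Cminus_eq_contra, Hn).
  assert (Bp := bd_cont_inv a b c' d x y H1 H2). assert (Bq := bd_cont_inv a b c' d u v H3 H4). fold p in Bp. fold q in Bq.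
  destruct (bd_neq a b c' d x y H1 H2) as [N1 N2]. destruct (bd_neq a b c' d u v H3 H4) as [N3 N4]. fold p in N1, N2. fold q in N3, N4.
  transitivity (RI (fun w => / (p - q) * / (w - p) + - / (p - q) * / (w - q))%C a b c' d).
  - assert (A : forall w : C, w <> p -> w <> q -> (/ (w - p) * / (w - q))%C = (/ (p - q) * / (w - p) + - / (p - q) * / (w - q))%C).
    { intros w A1 A2. field. repeat split; first [exact Npq | apply Cminus_eq_contra; assumption]. }
    apply RI_ext; try lra; intros t Ht; split; apply A; solve [apply N1, Ht | apply N2, Ht | apply N3, Ht | apply N4, Ht].
  - rewrite (RI_plus (fun w => / (p - q) * / (w - p))%C (fun w => - / (p - q) * / (w - q))%C); try lra.
    + rewrite (RI_scal (/ (p - q))%C (fun w => / (w - p))%C), (RI_scal (- / (p - q))%C (fun w => / (w - q))%C) by (try lra; assumption).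
      unfold p, q. rewrite !RI_inv by assumption. ring.
    + apply (bd_cont_mult (fun _ => (/ (p - q))%C)); [|assumption]. split; split; apply Ccont_const.
    + apply (bd_cont_mult (fun _ => (- / (p - q))%C)); [|assumption]. split; split; apply Ccont_const.
Qed.

Lemma Ccont_u0 (x : C) : (forall p, (1 <= p <= P)%nat -> x <> z p /\ x <> Cconj (z p)) -> Ccont (u0 P c z) x.
Proof.
  intros H.
  assert (A : forall n, (n <= P)%nat -> Ccont (u0 n c z) x).
  { induction n as [|n IH]; intros Hn.
    - eapply Ccont_ext_loc with (f := fun _ => RtoC 0); [apply Rlt_0_1|intros; unfold u0; rewrite Csum_0; reflexivity|apply Ccont_const].
    - eapply Ccont_ext_loc; [apply Rlt_0_1|intros y _; symmetry; unfold u0; apply Csum_S|]. apply Ccont_plus; [apply IH; lia|].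
      destruct (H (S n)) as [H1 H2]; [lia|].
      apply Ccont_plus; (apply Ccont_div; [apply Cminus_eq_contra; assumption|apply Ccont_const|apply Ccont_minus; [apply Ccont_id|apply Ccont_const]]). }
  apply A. lia.
Qed.

Lemma Ccont_u0_real (x : R) : Ccont (u0 P c z) (RtoC x).
Proof.
  apply Ccont_u0. intros p Hp. specialize (Him p Hp). split; intros E; apply (f_equal Im) in E; rewrite ?im_conj in E; simpl in E; lra.
Qed.

(** Cauchy's formula for the regular part on [-X, X] x [0, X]: adding the polar parts back changes
    nothing, and since u0 = O(1/|x|) and W is bounded, the three upper edges are O(1/X). With y
    below all poles the point is distinct from each z_p. *)
Lemma Cplus_integral (W : C -> C) (x y : R) : bounded_analytic_extension W -> 0 < y ->
  (forall p, (1 <= p <= P)%nat -> y < Im (z p)) ->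
  filterlim (fun X => CI (fun t => u0 P c z (RtoC t) * refl W (RtoC t) * / (RtoC t - (x, y)))%C (- X) X) (Rbar_locally p_infty)
    (locally (T := C_UniformSpace) (2 * RtoC PI * Ci * regular_part W (x, y))%C).
Proof.
  intros HW Hy Hyz.
  destruct (regular_part_ext W HW) as (psi & P1 & P2 & P3).
  destruct (refl_bound W HW) as (B & HB & HWB). destruct far_ex as [R0 HR]. destruct (u0_far R0 HR) as (K & HK & HU).
  set (xi := (x, y) : C) in *.
  assert (Nxi : forall p, (1 <= p <= P)%nat -> xi <> z p).
  { intros p Hp E. specialize (Hyz p Hp). rewrite <- E in Hyz. simpl in Hyz. lra. }
  apply filterlim_Cmod; [apply _|]. intros e He.
  (* The edges cost 2 K B / X on each side and 4 K B / X on top, 8 K B / X in all; the last entry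
     brings this below e. *)
  set (R1 := Rmax (R0 + 1) (Rmax (2 * Cmod xi + 1) (16 * (K * B) / e + 1))).
  assert (G1 : R0 + 1 <= R1) by apply Rmax_l.
  assert (G2 : 2 * Cmod xi + 1 <= R1) by (eapply Rle_trans; [apply Rmax_l|apply Rmax_r]).
  assert (G3 : 16 * (K * B) / e + 1 <= R1) by (eapply Rle_trans; [apply Rmax_r|apply Rmax_r]).
  exists R1. intros X HX. assert (HR1 : 1 <= R0) by apply HR.
  assert (Hzin : forall w : C, 2 * Cmod w + 1 <= X -> - X < Re w < X /\ Im w < X).
  { intros w Hw. assert (L1 := re_le_Cmod w). assert (L2 := im_le_Cmod w). apply Rabs_le_between in L1. apply Rabs_le_between in L2.
    generalize (Cmod_ge_0 w). lra. }
  assert (Hin : forall p, (1 <= p <= P)%nat -> - X < Re (z p) < X /\ 0 < Im (z p) < X).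
  { intros p Hp. destruct HR as [_ HR2]. specialize (HR2 p Hp). destruct (Hzin (z p)) as [A1 A2]; [lra|]. split; [assumption|]. split; [apply Him, Hp|assumption]. }
  destruct (Hzin xi) as [X1 X2]; [lra|]. simpl in X1, X2.
  assert (Hbd : forall u v, - X <= u <= X -> 0 <= v <= X -> (u = - X \/ u = X \/ v = X) -> X <= Cmod (u, v)).
  { intros u v Hu Hv Huv. destruct Huv as [E|[E|E]].
    - eapply Rle_trans; [|apply re_le_Cmod]. simpl. rewrite E, Rabs_Ropp. apply Rle_abs.
    - eapply Rle_trans; [|apply re_le_Cmod]. simpl. rewrite E. apply Rle_abs.
    - eapply Rle_trans; [|apply im_le_Cmod]. simpl. rewrite E. apply Rle_abs. }
  assert (Hnz : forall u v p, - X <= u <= X -> 0 <= v <= X -> (u = - X \/ u = X \/ v = X \/ v = 0) -> (1 <= p <= P)%nat -> (u, v) <> z p).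
  { intros u v p Hu Hv Huv Hp E. destruct (Hin p Hp) as [I1 I2]. rewrite <- E in I1, I2. simpl in I1, I2. lra. }
  assert (Hnc : forall u v p, 0 <= v -> (1 <= p <= P)%nat -> (u, v) <> Cconj (z p)).
  { intros u v p Hv Hp E. specialize (Him p Hp). apply (f_equal Im) in E. rewrite im_conj in E. simpl in E. lra. }
  set (phi := fun w => (u0 P c z w * refl W w * / (w - xi))%C).
  assert (Nx : forall u v, - X <= u <= X -> 0 <= v <= X -> (u = - X \/ u = X \/ v = X \/ v = 0) -> (u, v) <> xi).
  { intros u v Hu Hv Huv E. injection E as -> ->. lra. }
  assert (Hphic : forall u v, - X <= u <= X -> 0 <= v <= X -> (u = - X \/ u = X \/ v = X \/ v = 0) -> Ccont phi (u, v)).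
  { intros u v Hu Hv Huv. apply Ccont_mult; [apply Ccont_mult|].
    - apply Ccont_u0. intros p Hp. split; [apply Hnz; assumption|apply Hnc; [lra|assumption]].
    - apply refl_cont; [assumption|]. simpl; lra.
    - apply (Ccont_inv (fun w => w - xi)%C); [apply Cminus_eq_contra, Nx; assumption|]. apply Ccont_minus; [apply Ccont_id|apply Ccont_const]. }
  assert (X0 : 1 <= X) by (generalize (Cmod_ge_0 xi); lra).
  assert (Hphib : forall u v, - X <= u <= X -> 0 <= v <= X -> (u = - X \/ u = X \/ v = X) -> Cmod (phi (u, v)) <= 2 * (K * B) / (X * X)).
  { intros u v Hu Hv Huv. specialize (Hbd u v Hu Hv Huv). set (w := (u, v) : C) in *. unfold phi.
    specialize (HU w ltac:(lra)). specialize (HWB w ltac:(simpl; lra)).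
    assert (D : X / 2 <= Cmod (w - xi)) by (generalize (Cmod_triangle_rev w xi); lra).
    rewrite !Cmod_mult.
    replace (2 * (K * B) / (X * X)) with (K * / X * B * / (X / 2)) by (field; lra).
    apply Rmult_le_compat; try apply Cmod_ge_0; [apply Rmult_le_pos; apply Cmod_ge_0| |apply Cmod_inv_le; lra].
    apply Rmult_le_compat; try apply Cmod_ge_0; [|assumption].
    eapply Rle_trans; [exact HU|]. apply Rmult_le_compat_l; [assumption|]. apply Rinv_le_contravar; lra. }
  assert (EI : RI phi (- X) X 0 X = (2 * RtoC PI * Ci * regular_part W xi)%C).
  { destruct (P2 xi) as [l Hl]; [simpl; lra|exact Nxi|].
    assert (CF := Cauchy_formula (map (fun p => Re (z p)) (seq 1 P)) psi (- X) X 0 X x y l X1 (conj Hy X2)).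
    lapply CF; [clear CF; intros CF|intros u v Hu Hv; apply P1; simpl; lra].
    lapply CF; [clear CF; intros CF|].
    2:{ intros u v Hu Hv Hl'. apply P2; [simpl; lra|]. intros p Hp E. apply Hl'. apply in_map_iff. exists p.
        split; [rewrite <- E; reflexivity|]. apply in_seq. lia. }
    specialize (CF Hl). fold xi in CF. rewrite (P3 xi Nxi) in CF.
    assert (Hbxi : bd_cont (fun w => / (w - xi))%C (- X) X 0 X) by (apply bd_cont_inv; lra).
    assert (Hbz : forall p, (1 <= p <= P)%nat -> bd_cont (fun w => (c p * W (z p)) * (/ (w - z p) * / (w - xi)))%C (- X) X 0 X).
    { intros p Hp. destruct (Hin p Hp) as [I1 I2]. apply (bd_cont_mult (fun _ => (c p * W (z p))%C)).
      - split; split; apply Ccont_const.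
      - apply bd_cont_mult; [|assumption]. destruct (z p) as [u v]. apply bd_cont_inv; assumption. }
    destruct (RI_Csum P (fun p w => (c p * W (z p)) * (/ (w - z p) * / (w - xi)))%C (- X) X 0 X ltac:(lra) ltac:(lra) Hbz) as [S1 S2].
    assert (S3 : Csum P (fun p => RI (fun w => (c p * W (z p)) * (/ (w - z p) * / (w - xi)))%C (- X) X 0 X) = 0).
    { rewrite (Csum_ext P _ (fun p => 0 * 0)%C); [rewrite Csum_scal; ring|]. intros p Hp. destruct (Hin p Hp) as [I1 I2].
      assert (Nz := Nxi p Hp).
      rewrite (RI_scal (c p * W (z p))%C (fun w => / (w - z p) * / (w - xi))%C); try lra.
      - destruct (z p) as [u v] eqn:Ez. unfold xi. rewrite RI_two_poles; try assumption; [ring|lra|]. intros E; apply Nz; symmetry; exact E.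
      - apply bd_cont_mult; [|assumption]. destruct (z p) as [u v]. apply bd_cont_inv; assumption. }
    rewrite <- CF.
    assert (Hbpsi : bd_cont (fun w => psi w * / (w - xi))%C (- X) X 0 X).
    { apply bd_cont_mult; [|assumption]. split; intros t Ht; split; apply P1; simpl; lra. }
    transitivity (RI (fun w => psi w * / (w - xi) + Csum P (fun p => (c p * W (z p)) * (/ (w - z p) * / (w - xi))))%C (- X) X 0 X).
    - assert (A : forall u v, - X <= u <= X -> 0 <= v <= X -> (u = - X \/ u = X \/ v = X \/ v = 0) ->
        phi (u, v) = (psi (u, v) * / ((u, v) - xi) + Csum P (fun p => (c p * W (z p)) * (/ ((u, v) - z p) * / ((u, v) - xi))))%C).
      { intros u v Hu Hv Huv. rewrite P3 by (intros p Hp; apply Hnz; assumption). unfold phi, regular_part.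
        rewrite (Csum_ext P (fun p => (c p * W (z p)) * (/ ((u, v) - z p) * / ((u, v) - xi)))%C
          (fun p => (c p * W (z p) / ((u, v) - z p)) * / ((u, v) - xi))%C) by (intros; unfold Cdiv; ring).
        rewrite Csum_scal_r. ring. }
      apply RI_ext; try lra; intros t Ht; split; apply A; try lra; tauto.
    - rewrite (RI_plus _ _ (- X) X 0 X ltac:(lra) ltac:(lra) Hbpsi S1), S2, S3. ring. }
  assert (Ebot : (RI phi (- X) X 0 X)%C = (CI (fun t => phi (RtoC t)) (- X) X + (Ci * CI (fun v => phi (X, v)) 0 X - CI (fun u => phi (u, X)) (- X) X - Ci * CI (fun v => phi (- X, v)%R) 0 X))%C).
  { unfold RI. unfold RtoC. ring. }
  rewrite EI in Ebot. unfold phi in Ebot at 1.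
  set (I0 := CI (fun t => (u0 P c z (RtoC t) * refl W (RtoC t) * / (RtoC t - xi))%C) (- X) X) in *.
  rewrite Ebot. 
  assert (B1 : Cmod (CI (fun v => phi (X, v)) 0 X) <= 2 * (K * B) / (X * X) * (X - 0)).
  { apply CI_bound; [lra| |].
    - apply (ex_CI_vert phi); [lra|]. intros; apply Hphic; lra.
    - intros; apply Hphib; lra. }
  assert (B2 : Cmod (CI (fun v => phi (- X, v)%R) 0 X) <= 2 * (K * B) / (X * X) * (X - 0)).
  { apply CI_bound; [lra| |].
    - apply (ex_CI_vert phi); [lra|]. intros; apply Hphic; lra.
    - intros; apply Hphib; lra. }
  assert (B3 : Cmod (CI (fun u => phi (u, X)) (- X) X) <= 2 * (K * B) / (X * X) * (X - - X)).
  { apply CI_bound; [lra| |].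
    - apply (ex_CI_horiz phi); [lra|]. intros; apply Hphic; lra.
    - intros; apply Hphib; lra. }
  set (J1 := CI (fun v => phi (X, v)) 0 X) in *. set (J2 := CI (fun v => phi (- X, v)%R) 0 X) in *. set (J3 := CI (fun u => phi (u, X)) (- X) X) in *.
  replace (I0 - (I0 + (Ci * J1 - J3 - Ci * J2)))%C with (J3 + (Ci * J2 + - (Ci * J1)))%C by ring.
  eapply Rle_lt_trans; [apply Cmod_triangle|]. eapply Rle_lt_trans; [apply Rplus_le_compat_l, Cmod_triangle|].
  rewrite Cmod_opp, !Cmod_mult, Cmod_Ci.
  assert (HX2 : 16 * (K * B) / e < X) by lra. apply Rlt_div_l in HX2; [|assumption].
  assert (T : 8 * (K * B) / X < e) by (apply Rlt_div_l; nra).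
  replace (2 * (K * B) / (X * X) * (X - 0)) with (2 * (K * B) / X) in * by (field; lra).
  replace (2 * (K * B) / (X * X) * (X - - X)) with (4 * (K * B) / X) in * by (field; lra).
  unfold Rdiv in *. lra.
Qed.

Lemma is_RInt_gen_sym (F : R -> C) (J L : C) :
  is_RInt_gen (V := C_R_NormedModule) F (Rbar_locally m_infty) (Rbar_locally p_infty) J ->
  filterlim (fun X => CI F (- X) X) (Rbar_locally p_infty) (locally (T := C_UniformSpace) L) -> J = L.
Proof.
  intros H1 H2.
  assert (H3 : filterlim (fun X => CI F (- X) X) (Rbar_locally p_infty) (locally (T := C_UniformSpace) J)).
  { apply filterlim_Cmod; [apply _|]. intros e He.
    specialize (H1 (fun y => Cmod (y - J) < e)). lapply H1; [clear H1; intros H1|apply locally_Cmod; exists e; auto].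
    destruct H1 as [Q S [A HA] [B HB] H]. exists (Rmax (- A) B). intros X HX.
    assert (G1 := Rle_lt_trans _ _ _ (Rmax_l _ _) HX). assert (G2 := Rle_lt_trans _ _ _ (Rmax_r _ _) HX).
    destruct (H (- X) X) as (y & Hy1 & Hy2); [apply HA; lra|apply HB; lra|]. cbn [fst snd] in Hy1.
    rewrite (is_CI_unique _ _ _ _ Hy1). exact Hy2. }
  apply (filterlim_locally_unique (K := R_AbsRing) (V := C_R_NormedModule) (F := Rbar_locally p_infty) (fun X => CI F (- X) X)); assumption.
Qed.

(** For small delta the integral at x + i delta is known from [Cplus_integral], symmetric truncation
    being enough to identify a convergent integral. Continuity of the regular part down to the real
    axis then gives the limit. *)
Lemma Cplus_value (W : C -> C) (x : R) (Cw : C) : bounded_analytic_extension W ->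
  is_Cplus (fun y => u0 P c z (RtoC y) * W (RtoC y))%C x Cw -> Cw = regular_part W (RtoC x).
Proof.
  intros HW (J & HJ & HL).
  destruct (uniform_radius P (fun p r => r <= Im (z p))) as (r & Hr & Hrz).
  { intros; lra. } { intros p Hp. exists (Im (z p)). split; [apply Him, Hp|lra]. }
  assert (Npi : (2 * RtoC PI * Ci)%C <> 0).
  { intros E. apply (f_equal Im) in E. simpl in E. generalize PI_RGT_0. lra. }
  assert (EJ : forall d, 0 < d < r -> J d = (2 * RtoC PI * Ci * regular_part W (x, d))%C).
  { intros d Hd. apply (is_RInt_gen_sym (fun y => (u0 P c z (RtoC y) * refl W (RtoC y) * / (RtoC y - (x, d)))%C)).
    - assert (E : forall y, (u0 P c z (RtoC y) * W (RtoC y) / (RtoC y - (RtoC x + Ci * RtoC d)))%C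
        = (u0 P c z (RtoC y) * refl W (RtoC y) * / (RtoC y - (x, d)))%C).
      { intros y. rewrite refl_eq by (simpl; lra). unfold Cdiv. do 3 f_equal. apply C_ext; simpl; ring. }
      specialize (HJ d (proj1 Hd)). intros Q HQ. specialize (HJ Q HQ). unfold filtermapi in *.
      apply filter_imp with (2 := HJ). intros [a b] (y & Hy1 & Hy2). exists y. split; [|exact Hy2].
      apply (is_RInt_ext (V := C_R_NormedModule)) with (2 := Hy1). intros; apply E.
    - apply Cplus_integral; [assumption|lra|]. intros p Hp. specialize (Hrz p Hp). lra. }
  destruct (regular_part_ext W HW) as (psi & P1 & P2 & P3).
  assert (H3 : filterlim (fun d => / (2 * RtoC PI * Ci) * J d)%C (at_right 0) (locally (T := C_UniformSpace) (regular_part W (RtoC x)))).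
  { apply filterlim_Cmod; [apply _|]. intros e He.
    destruct (P1 (RtoC x) ltac:(simpl; lra) e He) as (d & Hd & Hs).
    assert (Hm : 0 < Rmin d r) by (apply Rmin_pos; assumption).
    exists (mkposreal _ Hm). intros y Hy Hy0. change (Rabs (y - 0) < Rmin d r) in Hy. rewrite Rminus_0_r, Rabs_pos_eq in Hy by lra.
    assert (Y1 := Rlt_le_trans _ _ _ Hy (Rmin_l _ _)). assert (Y2 := Rlt_le_trans _ _ _ Hy (Rmin_r _ _)).
    rewrite EJ by lra.
    assert (Nz : forall v p, 0 <= v < r -> (1 <= p <= P)%nat -> (x, v) <> z p).
    { intros v p Hv Hp E. specialize (Hrz p Hp). rewrite <- E in Hrz. simpl in Hrz. lra. }
    assert (E1 : psi (@pair R R x y) = regular_part W (@pair R R x y)) by (apply P3; intros p Hp; apply Nz; [lra|assumption]).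
    assert (E2 : psi (RtoC x) = regular_part W (RtoC x)) by (apply P3; intros p Hp; apply (Nz 0 p); [lra|assumption]).
    rewrite <- E1, <- E2.
    replace (/ (2 * RtoC PI * Ci) * (2 * RtoC PI * Ci * psi (@pair R R x y)))%C with (psi (@pair R R x y)).
    - apply Hs. replace (@pair R R x y - RtoC x)%C with (Ci * RtoC y)%C by (apply C_ext; simpl; ring).
      rewrite Cmod_mult, Cmod_Ci, Cmod_R, Rabs_pos_eq; lra.
    - rewrite Cmult_assoc, Cinv_l by exact Npi. ring. }
  apply (filterlim_locally_unique (K := R_AbsRing) (V := C_R_NormedModule) (F := at_right 0) (fun d => (/ (2 * RtoC PI * Ci) * J d)%C)); assumption.
Qed.

(** * The Jost solution *)

Lemma Clog_scale (k : R) (w : C) : 0 < k -> w <> 0 -> Clog (RtoC k * w) = (Clog w + RtoC (ln k))%C.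
Proof.
  intros Hk Hw. assert (Hm : 0 < Cmod w) by (apply Cmod_gt_0, Hw).
  unfold Clog. rewrite Cmod_RtoC_mult by lra. rewrite ln_mult by assumption.
  replace (Carg (RtoC k * w)) with (Carg w).
  - apply C_ext; simpl; ring.
  - unfold Carg. rewrite Cmod_RtoC_mult, re_scal_l, im_scal_l by lra.
    replace (k * Re w / (k * Cmod w)) with (Re w / Cmod w) by (field; lra).
    destruct (Rle_dec 0 (Im w)), (Rle_dec 0 (k * Im w)); try reflexivity; nra.
Qed.

Lemma Clog_infty (a k : C) (s : R) : Cmod k = 1 -> slit k -> Clog k = (0, s) ->
  filterlim (fun x : R => Clog (k * (RtoC x - a)) - RtoC (ln x))%C (Rbar_locally p_infty) (locally (T := C_UniformSpace) (0, s)).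
Proof.
  intros Hk1 Hk Hs. apply filterlim_Cmod; [apply _|]. intros e He.
  destruct (Clog_cont k Hk e He) as (d & Hd & H).
  assert (Ha := Cmod_ge_0 a).
  exists (Rmax (Cmod a + 1) (Cmod a / d + 1)). intros x Hx.
  assert (X1 := Rle_lt_trans _ _ _ (Rmax_l _ _) Hx). assert (X2 := Rle_lt_trans _ _ _ (Rmax_r _ _) Hx).
  assert (Hx0 : 0 < x) by lra. assert (Nx : RtoC x <> 0) by (intros E; apply RtoC_inj in E; lra).
  assert (E : (k * (RtoC x - a))%C = (RtoC x * (k * (1 - a / RtoC x)))%C) by (field; assumption).
  rewrite E, Clog_scale; [|assumption|].
  - replace (Clog (k * (1 - a / RtoC x)) + RtoC (ln x) - RtoC (ln x) - (0, s))%C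
      with (Clog (k * (1 - a / RtoC x)) - Clog k)%C by (rewrite Hs; ring).
    apply H. replace (k * (1 - a / RtoC x) - k)%C with (- (k * (a / RtoC x)))%C by ring.
    rewrite Cmod_opp, Cmod_mult, Hk1, Cmod_div, Cmod_R, Rabs_pos_eq by (assumption || lra).
    rewrite Rmult_1_l. apply Rlt_div_l; [assumption|].
    assert (X3 : Cmod a / d < x) by lra. apply Rlt_div_l in X3; lra.
  - intros E0. assert (E1 : (k * (RtoC x - a))%C = 0) by (rewrite E, E0; ring).
    apply (f_equal Cmod) in E1. rewrite Cmod_mult, Hk1, Cmod_0, Rmult_1_l in E1.
    generalize (Cmod_triangle_rev (RtoC x) a). rewrite Cmod_R, Rabs_pos_eq by lra. lra.
Qed.

Lemma filterlim_Csum {T} (FF : (T -> Prop) -> Prop) {HF : Filter FF} (n : nat) (g : nat -> T -> C) (l : nat -> C) :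
  (forall p, (1 <= p <= n)%nat -> filterlim (g p) FF (locally (T := C_UniformSpace) (l p))) ->
  filterlim (fun t => Csum n (fun p => g p t)) FF (locally (T := C_UniformSpace) (Csum n l)).
Proof.
  induction n as [|n IH]; intros H.
  - apply filterlim_ext with (f := fun _ => RtoC 0); [intros; rewrite Csum_0; reflexivity|]. rewrite Csum_0. apply filterlim_const.
  - apply filterlim_ext with (f := fun t => (Csum n (fun p => g p t) + g (S n) t)%C); [intros; rewrite Csum_S; reflexivity|].
    rewrite Csum_S. apply filterlim_C_plus; [assumption|apply IH; intros; apply H; lia|apply H; lia].
Qed.

(** The condition on the residues allows ln x to be subtracted from every logarithm. In the limit
    z_p contributes i pi c_p and its conjugate -i pi conj(c_p); the same condition turns the sum
    into 2 i pi sum c_p. *)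
Lemma f_pinfty : Csum P (fun p => (c p + Cconj (c p))%C) = 0 ->
  filterlim (fun x : R => fb 0 (RtoC x)) (Rbar_locally p_infty) (locally (T := C_UniformSpace) (2 * RtoC PI * Ci * Csum P c)%C).
Proof.
  intros Hsum.
  assert (S1 : slit Ci) by (right; simpl; lra). assert (S2 : slit (- Ci)) by (right; simpl; lra).
  assert (L1 : Clog Ci = (0, PI / 2)).
  { unfold Clog. rewrite Cmod_Ci, ln_1, Carg_upper by (simpl; lra). simpl. unfold Rdiv. rewrite Rmult_0_l, atan_0, Rminus_0_r. reflexivity. }
  assert (L2 : Clog (- Ci) = (0, - (PI / 2))).
  { unfold Clog. rewrite Cmod_opp, Cmod_Ci, ln_1, Carg_lower by (simpl; lra).
    replace (Re (- Ci) / Im (- Ci)) with 0 by (simpl; field). rewrite atan_0, Rminus_0_r. reflexivity. }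
  apply filterlim_ext with (f := fun x : R => Csum P (fun p =>
    (c p * ((Clog (Ci * (RtoC x - z p)) - RtoC (ln x)) + RtoC PI * Ci / 2)
     + Cconj (c p) * ((Clog (- Ci * (RtoC x - Cconj (z p))) - RtoC (ln x)) - RtoC PI * Ci / 2))%C)).
  { intros x. rewrite fb_0. unfold Defs.f. symmetry. apply Ceq_minus. rewrite <- Csum_minus.
    rewrite (Csum_ext P _ (fun p => (c p + Cconj (c p)) * RtoC (ln x))%C) by (intros; ring).
    rewrite Csum_scal_r, Hsum. ring. }
  replace (2 * RtoC PI * Ci * Csum P c)%C with (Csum P (fun p =>
    c p * ((0, PI / 2)%R + RtoC PI * Ci / 2) + Cconj (c p) * ((0, - (PI / 2))%R - RtoC PI * Ci / 2))%C).
  - apply filterlim_Csum; [apply _|]. intros p Hp.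
    assert (K : forall k : C, filterlim (fun _ : R => k) (Rbar_locally p_infty) (locally (T := C_UniformSpace) k)) by (intros; apply filterlim_const).
    apply filterlim_C_plus; [apply _| |]; apply filterlim_C_mult; try apply _; try apply K;
      apply (filterlim_C_plus (Rbar_locally p_infty)); try apply K.
    + apply Clog_infty; [apply Cmod_Ci|assumption..].
    + apply Clog_infty; [rewrite Cmod_opp; apply Cmod_Ci|assumption..].
  - assert (E1 : ((0, (PI / 2)%R) + RtoC PI * Ci / 2)%C = (RtoC PI * Ci)%C) by (apply C_ext; simpl; field).
    assert (E2 : ((0, (- (PI / 2))%R) - RtoC PI * Ci / 2)%C = (- (RtoC PI * Ci))%C) by (apply C_ext; simpl; field).
    rewrite (Csum_ext P _ (fun p => (2 * RtoC PI * Ci) * c p - (c p + Cconj (c p)) * (RtoC PI * Ci))%C).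
    + rewrite Csum_minus, Csum_scal, Csum_scal_r, Hsum. ring.
    + intros p Hp. rewrite E1, E2. ring.
Qed.

Lemma slit_dom_real (x : R) : slit_dom 0 (RtoC x).
Proof. apply right_base. intros p Hp; lia. Qed.

Lemma jost_ode (w0 : C) (W : C -> C) (x : R) : solves_spectral eps P c z lam w0 W ->
  Rder (fun t => W (RtoC t)) x (Ci / RtoC eps * ((RtoC lam + u0 P c z (RtoC x)) * W (RtoC x)
     - Rd w0 (fun p => c p * W (z p)) (RtoC x)))%C.
Proof.
  intros [HW H]. destruct (H x) as (dw & Cw & H1 & H2 & H3).
  rewrite (Cplus_value W x Cw HW H2) in H3. unfold regular_part in H3. rewrite refl_eq in H3 by (simpl; lra).
  eapply Rder_eq; [|exact H1]. unfold Rd. set (S := Csum P _) in *. set (u := u0 P c z (RtoC x)) in *. set (w := W (RtoC x)) in *.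
  assert (He := eps_neq_0). match goal with |- ?a = ?b => change (@eq C a b) end. symmetry.
  assert (E : (Ci * RtoC eps * dw)%C = (- (u * w - S) - RtoC lam * (w - w0))%C).
  { rewrite <- H3. ring. }
  assert (Hi : (Ci * Ci)%C = (-1)%C) by (apply C_ext; simpl; ring).
  transitivity (- Ci / RtoC eps * (Ci * RtoC eps * dw))%C.
  - rewrite E. field. assumption.
  - transitivity (- (Ci * Ci) * dw)%C; [field; assumption|rewrite Hi; ring].
Qed.

(** E is the integrating factor of the equation. The shift k is 1 for the integral that gives beta
    and 0 for the comparison with the primitive. *)
Lemma phase_der (k : C) (W : C -> C) (x : R) (dW : C) : Rder (fun t => W (RtoC t)) x dW ->
  Rder (fun t => ((W (RtoC t) - k) * Eb 0 (RtoC t))%C) x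
    ((dW - Ci / RtoC eps * (RtoC lam + u0 P c z (RtoC x)) * (W (RtoC x) - k)) * Eb 0 (RtoC x))%C.
Proof.
  intros H. eapply Rder_eq; [|apply Rder_mult].
  3:{ apply (Cder_horiz (Eb 0) 0). apply Cder_Eb. apply slit_dom_real. }
  2:{ apply (is_derive_minus (K := R_AbsRing) (V := C_R_NormedModule)); [exact H|].
      apply (is_derive_const (K := R_AbsRing) (V := C_R_NormedModule)). }
  change (x, 0) with (RtoC x). change (@zero C_R_NormedModule) with (RtoC 0).
  change (minus dW (RtoC 0)) with (dW - 0)%C. unfold Cdiv. ring.
Qed.

Lemma Eb_real_bounded : exists K R0, 0 < K /\ 1 <= R0 /\ forall x, R0 <= Rabs x -> Cmod (Eb 0 (RtoC x)) <= K.
Proof.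
  destruct far_ex as [R0 HR]. destruct (Eb_far R0 HR) as (K & HK & H). exists K, R0.
  split; [assumption|]. split; [apply HR|]. intros x Hx. specialize (H O (RtoC x)). rewrite Cmod_R in H.
  specialize (H Hx). simpl Im in H. rewrite Rmult_0_r, exp_0, !Rmult_1_r in H. apply H.
Qed.

Lemma Eb_real_null (g : R -> C) (FF : (R -> Prop) -> Prop) {HFF : Filter FF} :
  (forall B, FF (fun x => B <= Rabs x)) ->
  filterlim g FF (locally (T := C_UniformSpace) (RtoC 0)) ->
  filterlim (fun x => g x * Eb 0 (RtoC x))%C FF (locally (T := C_UniformSpace) (RtoC 0)).
Proof.
  intros Hb H. destruct Eb_real_bounded as (K & R0 & HK & HR0 & HE).
  apply filterlim_Cmod; [assumption|]. rewrite filterlim_Cmod in H by assumption. intros e He.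
  assert (He' : 0 < e / K) by (apply Rdiv_lt_0_compat; assumption).
  apply filter_imp with (2 := filter_and (F := FF) _ _ (Hb R0) (H _ He')). intros x [A1 A2].
  replace (g x * Eb 0 (RtoC x) - 0)%C with (g x * Eb 0 (RtoC x))%C by ring. replace (g x - 0)%C with (g x) in A2 by ring.
  rewrite Cmod_mult. apply Rlt_div_r in A2; [|assumption].
  apply Rle_lt_trans with (Cmod (g x) * K); [|assumption]. apply Rmult_le_compat_l; [apply Cmod_ge_0|apply HE, A1].
Qed.

Lemma m_infty_large (B : R) : Rbar_locally m_infty (fun x => B <= Rabs x).
Proof. exists (- B). intros x Hx. rewrite <- Rabs_Ropp. eapply Rle_trans; [|apply Rle_abs]. lra. Qed.

Lemma p_infty_large (B : R) : Rbar_locally p_infty (fun x => B <= Rabs x).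
Proof. exists B. intros x Hx. eapply Rle_trans; [|apply Rle_abs]. lra. Qed.

Lemma filterlim_minus_const (g : R -> C) (l : C) (FF : (R -> Prop) -> Prop) {HFF : Filter FF} :
  filterlim g FF (locally (T := C_UniformSpace) l) -> filterlim (fun x => g x - l)%C FF (locally (T := C_UniformSpace) (RtoC 0)).
Proof.
  intros H. replace (RtoC 0) with (l + - l)%C by ring. apply filterlim_C_plus; [assumption|assumption|apply filterlim_const].
Qed.

(** The integrand has the primitive -i eps (M - 1) E, which vanishes at -oo. At +oo the scattering
    relation isolates beta, and the limit of f supplies the factor e^{2 pi sum c_p / eps}. *)
Lemma beta_line (M Nbar N : C -> C) (beta : C) :
  Csum P (fun p => (c p + Cconj (c p))%C) = 0 ->
  is_Jost_M eps P c z lam M -> is_Jost_Nbar eps P c z lam Nbar -> is_Jost_N eps P c z lam N ->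
  (forall x : R, (M (RtoC x) - Nbar (RtoC x))%C = (beta * N (RtoC x))%C) ->
  is_line (beta_integrand eps P c z lam (fun p => c p * M (z p))%C)
    (- Ci * RtoC eps * (beta * Cexp (2 * RtoC PI / RtoC eps * Csum P c)))%C.
Proof.
  intros Hsum [HM HM1] [_ HN1] [_ HN2] Hbeta.
  set (v := fun p => (c p * M (z p))%C). assert (He := eps_neq_0).
  assert (Hi : (Ci * Ci)%C = (-1)%C) by (apply C_ext; simpl; ring).
  set (Phi := fun t : R => (- Ci * RtoC eps * ((M (RtoC t) - 1) * Eb 0 (RtoC t)))%C).
  assert (EE : forall x : R, Cexp (- Ci * h P c z lam (RtoC x) / RtoC eps) = Eb 0 (RtoC x)).
  { intros x. unfold Eb, h. rewrite fb_0. reflexivity. }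
  assert (HD : forall t, Rder Phi t (beta_integrand eps P c z lam v t)).
  { intros t. eapply Rder_eq; [|apply Rder_scal, phase_der, jost_ode, HM].
    unfold beta_integrand. rewrite EE. unfold Rd. fold v. set (S := Csum P _). set (u := u0 P c z (RtoC t)).
    set (w := M (RtoC t)). set (E := Eb 0 (RtoC t)).
    transitivity (- (Ci * Ci) * (E * (u - S)))%C; [|rewrite Hi; ring]. field. assumption. }
  assert (HC : forall t, Rcont (beta_integrand eps P c z lam v) t).
  { intros t. unfold beta_integrand.
    apply (continuous_ext (fun x : R => Eb 0 (RtoC x) * (u0 P c z (RtoC x) - (Rd 0 v (RtoC x))))%C).
    { intros x. rewrite EE. unfold Rd. rewrite Cmult_0_l, Cplus_0_l. reflexivity. }
    assert (Hs := slit_dom_real t).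
    apply (Ccont_horiz (fun w => Eb 0 w * (u0 P c z w - Rd 0 v w))%C 0 t).
    apply Ccont_mult; [eapply Cder_cont, Cder_Eb, Hs|]. apply Ccont_minus; [apply Ccont_u0_real|].
    eapply Cder_cont, Cder_Rd. intros p Hp. apply (slit_dom_neq 0); assumption. }
  assert (K : forall (k : C) b, filterlim (fun _ : R => k) (Rbar_locally b) (locally (T := C_UniformSpace) k)) by (intros; apply filterlim_const).
  replace (- Ci * RtoC eps * (beta * Cexp (2 * RtoC PI / RtoC eps * Csum P c)))%C
    with (Phi 0 - 0 + (- Ci * RtoC eps * (beta * Cexp (2 * RtoC PI / RtoC eps * Csum P c)) - Phi 0))%C by ring.
  apply (is_line_primitive _ Phi Phi); auto.
  - replace (RtoC 0) with (- Ci * RtoC eps * RtoC 0)%C by ring. apply filterlim_C_mult; [apply _|apply K|].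
    apply (Eb_real_null (fun t => M (RtoC t) - 1)%C); [apply _|apply m_infty_large|].
    apply filterlim_minus_const; [apply _|exact HM1].
  - apply filterlim_C_mult; [apply _|apply K|].
    (* M - 1 is split as beta N + (Nbar - 1). The oscillation of N cancels against the linear part
       of h, and Nbar - 1 tends to 0 while E stays bounded. *)
    apply filterlim_ext with (f := fun t : R => ((beta * (N (RtoC t) * Cexp (- Ci * RtoC lam * RtoC t / RtoC eps)))
       * Cexp (- Ci / RtoC eps * fb 0 (RtoC t)) + (Nbar (RtoC t) - 1) * Eb 0 (RtoC t))%C).
    { intros t. assert (E1 : Eb 0 (RtoC t) = (Cexp (- Ci * RtoC lam * RtoC t / RtoC eps) * Cexp (- Ci / RtoC eps * fb 0 (RtoC t)))%C).
      { rewrite <- Cexp_plus. unfold Eb. f_equal. field. assumption. }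
      replace (M (RtoC t) - 1)%C with (beta * N (RtoC t) + (Nbar (RtoC t) - 1))%C by (rewrite <- Hbeta; ring).
      rewrite E1. ring. }
    replace (beta * Cexp (2 * RtoC PI / RtoC eps * Csum P c))%C
      with ((beta * 1) * Cexp (- Ci / RtoC eps * (2 * RtoC PI * Ci * Csum P c)) + 0)%C.
    2:{ replace (- Ci / RtoC eps * (2 * RtoC PI * Ci * Csum P c))%C with (- (Ci * Ci) * (2 * RtoC PI / RtoC eps * Csum P c))%C by (field; assumption).
        rewrite Hi. replace (- -1 * (2 * RtoC PI / RtoC eps * Csum P c))%C with (2 * RtoC PI / RtoC eps * Csum P c)%C by ring. ring. }
    apply filterlim_C_plus; [apply _| |].
    + apply filterlim_C_mult; [apply _|apply filterlim_C_mult; [apply _|apply K|exact HN2]|].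
      assert (Hf := filterlim_C_mult (Rbar_locally p_infty) _ _ _ _ (K (- Ci / RtoC eps)%C p_infty) (f_pinfty Hsum)).
      apply (filterlim_comp _ _ _ _ Cexp _ _ _ Hf).
      intros Q HQ. apply locally_Cmod in HQ. destruct HQ as (d & Hd & HQ).
      destruct (Cder_cont _ _ _ (Cder_Cexp (- Ci / RtoC eps * (2 * RtoC PI * Ci * Csum P c))%C) d Hd) as (d' & Hd' & H').
      apply locally_Cmod. exists d'. split; [assumption|]. intros y Hy. apply HQ, H', Hy.
    + apply (Eb_real_null (fun t => Nbar (RtoC t) - 1)%C); [apply _|apply p_infty_large|].
      apply filterlim_minus_const; [apply _|exact HN1].
Qed.

(** * Comparison of the Jost solution with the normalised primitive *)

Lemma vert_decay (H dH : C -> C) (a y k : R) : 0 <= k ->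
  (forall s, s <= y -> Cder H (a, s) (dH (a, s)) /\ Ccont dH (a, s) /\ Cmod (dH (a, s)) <= k * exp (lam / eps * s)) ->
  (forall e, 0 < e -> exists B, forall s, s <= B -> Cmod (H (a, s)) < e) ->
  Cmod (H (a, y)) <= k / (lam / eps) * exp (lam / eps * y).
Proof.
  intros Hk Hd H0. set (kap := lam / eps) in *. assert (Hkap : 0 < kap) by (apply Rdiv_lt_0_compat; assumption).
  apply le_epsilon. intros e He. destruct (H0 e He) as [B HB].
  set (s := Rmin B y). assert (S1 : s <= B) by apply Rmin_l. assert (S2 : s <= y) by apply Rmin_r.
  assert (D : Cmod (H (a, y) - H (a, s)) <= k / kap * exp (kap * y) - k / kap * exp (kap * s)).
  { apply (Rder_bound_exp (fun t => H (a, t)) (fun t => dH (a, t) * Ci)%C); try assumption; intros t Ht.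
    - apply (Cder_vert H), Hd. lra.
    - apply (Ccont_vert (fun w => dH w * Ci)%C). apply Ccont_mult; [apply Hd; lra|apply Ccont_const].
    - rewrite Cmod_mult, Cmod_Ci, Rmult_1_r. apply Hd. lra. }
  specialize (HB s S1).
  assert (0 <= k / kap * exp (kap * s)) by (apply Rmult_le_pos; [apply Rdiv_le_0_compat; assumption|apply Rlt_le, exp_pos]).
  generalize (Cmod_triangle_rev (H (a, y)) (H (a, s))). lra.
Qed.

Lemma is_prim_vert_null (m : nat) (w0 : C) (d : nat -> C) (F : C -> C) (a : R) : is_prim m w0 d F -> a < Re (z 1%nat) ->
  forall e, 0 < e -> exists B, forall s, s <= B -> Cmod (F (a, s)) < e.
Proof.
  intros HF Ha e He. destruct (is_prim_small _ _ _ _ HF e He) as [B HB]. exists B. intros s Hs. apply HB; assumption.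
Qed.

Lemma Eb_vert_null (m : nat) (k : C) (a : R) : forall e, 0 < e -> exists B, forall s, s <= B -> Cmod (k * Eb m (a, s)) < e.
Proof.
  intros e He. destruct far_ex as [R0 HR]. destruct (Eb_far R0 HR) as (K & HK & HE).
  destruct (exp_small (Cmod k * K) (lam / eps)) with (e := e) as [B HB]; [apply Rdiv_lt_0_compat; assumption|assumption|].
  exists (Rmin B (- R0)). intros s Hs. assert (S1 := Rle_trans _ _ _ Hs (Rmin_l _ _)). assert (S2 := Rle_trans _ _ _ Hs (Rmin_r _ _)).
  rewrite Cmod_mult. eapply Rle_lt_trans; [|apply (HB s S1)]. rewrite Rmult_assoc. apply Rmult_le_compat_l; [apply Cmod_ge_0|].
  apply (HE m (a, s)). apply G0_Cmod, S2.
Qed.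

Lemma left_Cmod (R0 a y : R) : a <= - R0 -> R0 <= Cmod (a, y) /\ Rabs a <= Cmod (a, y).
Proof.
  intros H. assert (L := re_le_Cmod (a, y)). simpl Re in L. split; [|assumption].
  eapply Rle_trans; [|exact L]. rewrite <- Rabs_Ropp. eapply Rle_trans; [|apply Rle_abs]. lra.
Qed.

(** Subtracting i eps w0 E removes the constant part of the rational factor: the difference has
    derivative E (sum d_p/(x-z_p) - w0 u0), which is O(e^{lam s / eps} / |a|) on the line Re x = a.
    Integration from -i oo up to the real axis gives O(1/|a|). *)
Lemma prim_asym (w0 : C) (d : nat -> C) (F : C -> C) : is_prim 0 w0 d F ->
  filterlim (fun x : R => F (RtoC x) - Ci * RtoC eps * w0 * Eb 0 (RtoC x))%C (Rbar_locally m_infty) (locally (T := C_UniformSpace) (RtoC 0)).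
Proof.
  intros HF. destruct far_ex as [R0 HR]. destruct (Eb_far R0 HR) as (K & HK & HE).
  destruct (u0_far R0 HR) as (K1 & HK1 & HU). destruct (Rd_far R0 d HR) as (K2 & HK2 & HRd).
  assert (HR1 : 1 <= R0) by apply HR. assert (Hw := Cmod_ge_0 w0).
  set (kap := lam / eps). assert (Hkap : 0 < kap) by (apply Rdiv_lt_0_compat; assumption).
  set (k := K * (K2 + Cmod w0 * K1)). assert (Hk : 0 <= k) by (unfold k; apply Rmult_le_pos; [lra|]; generalize (Rmult_le_pos _ _ Hw HK1); lra).
  apply filterlim_Cmod; [apply _|]. intros e He.
  exists (Rmin (- R0) (Rmin (Re (z 1%nat) - 1) (- (k / kap / e + 1)))). intros a Ha.
  assert (A1 := Rlt_le_trans _ _ _ Ha (Rmin_l _ _)). assert (A2 := Rlt_le_trans _ _ _ Ha (Rmin_r _ _)).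
  assert (A3 := Rlt_le_trans _ _ _ A2 (Rmin_l _ _)). assert (A4 := Rlt_le_trans _ _ _ A2 (Rmin_r _ _)).
  set (H := fun x => (F x - Ci * RtoC eps * w0 * Eb 0 x)%C).
  set (dH := fun x => (Eb 0 x * (Rd 0 d x - w0 * u0 P c z x))%C).
  replace (F (RtoC a) - Ci * RtoC eps * w0 * Eb 0 (RtoC a) - 0)%C with (H (a, 0)) by (unfold H; change (a, 0) with (RtoC a); ring).
  assert (Ra : Rabs a = - a) by (apply Rabs_left1; lra).
  assert (Hs : forall s, slit_dom 0 (a, s)) by (intros s; apply slit_dom_G0; unfold in_G0; simpl; lra).
  eapply Rle_lt_trans; [apply (vert_decay H dH a 0 (k / (- a)))|].
  - apply Rdiv_le_0_compat; lra.
  - intros s _. destruct (left_Cmod R0 a s) as [L1 L2]; [lra|]. assert (Hsd := Hs s). split; [|split].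
    + unfold H, dH. eapply Cder_eq; [|apply Cder_minus; [apply HF, Hsd|apply Cder_scal, Cder_Eb, Hsd]].
      unfold Rd. assert (Hi : (Ci * Ci)%C = (-1)%C) by (apply C_ext; simpl; ring).
      set (S := Csum P _). set (E := Eb 0 (a, s)). set (u := u0 P c z (a, s)).
      transitivity (E * (w0 * RtoC lam + S) + (Ci * Ci) * (w0 * (RtoC lam + u) * E))%C; [field; apply eps_neq_0|]. rewrite Hi. ring.
    + apply Ccont_mult; [eapply Cder_cont, Cder_Eb, Hsd|]. apply Ccont_minus.
      * eapply Cder_cont, Cder_Rd. intros p Hp. apply (slit_dom_neq 0); assumption.
      * apply Ccont_mult; [apply Ccont_const|]. apply Ccont_u0. intros p Hp. apply (slit_dom_neq 0); assumption.
    + unfold dH. rewrite Cmod_mult. fold kap.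
      replace (k / - a * exp (kap * s)) with (K * exp (kap * s) * ((K2 + Cmod w0 * K1) * / - a)) by (unfold k, Rdiv; ring).
      apply Rmult_le_compat; try apply Cmod_ge_0; [apply HE, L1|].
      assert (Hinv : / Cmod (a, s) <= / - a) by (apply Rinv_le_contravar; lra).
      assert (T := Cmod_triangle (Rd 0 d (a, s)) (- (w0 * u0 P c z (a, s)))). rewrite Cmod_opp, Cmod_mult in T.
      specialize (HU (a, s) L1). specialize (HRd (a, s) L1).
      assert (G1 : K2 * / Cmod (a, s) <= K2 * / - a) by (apply Rmult_le_compat_l; assumption).
      assert (G2 : Cmod w0 * Cmod (u0 P c z (a, s)) <= Cmod w0 * (K1 * / - a)).
      { apply Rmult_le_compat_l; [assumption|]. eapply Rle_trans; [exact HU|]. apply Rmult_le_compat_l; assumption. }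
      unfold Cminus. lra.
  - intros e' He'. destruct (is_prim_vert_null 0 w0 d F a HF ltac:(lra) (e' / 2)) as [B1 HB1]; [lra|].
    destruct (Eb_vert_null 0 (Ci * RtoC eps * w0)%C a (e' / 2)) as [B2 HB2]; [lra|].
    exists (Rmin B1 B2). intros s Hss. specialize (HB1 s (Rle_trans _ _ _ Hss (Rmin_l _ _))). specialize (HB2 s (Rle_trans _ _ _ Hss (Rmin_r _ _))).
    unfold H. eapply Rle_lt_trans; [apply Cmod_triangle|]. rewrite Cmod_opp. lra.
  - fold kap. rewrite Rmult_0_r, exp_0, Rmult_1_r.
    assert (A5 : k / kap / e < - a) by lra. apply Rlt_div_l in A5; [|assumption].
    replace (k / - a / kap) with (k / kap / - a) by (field; lra). apply Rlt_div_l; lra.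
Qed.

(** Both sides have the same derivative on the line, and at -oo both are asymptotic to i eps E, by
    [prim_asym] and by M -> 1. *)
Lemma M_prim_real (M F : C -> C) : is_Jost_M eps P c z lam M -> is_prim 0 1 (fun p => c p * M (z p))%C F ->
  forall x : R, F (RtoC x) = (Ci * RtoC eps * (M (RtoC x) * Eb 0 (RtoC x)))%C.
Proof.
  intros [HM HM1] HF x. apply Ceq_minus. set (v := fun p => (c p * M (z p))%C) in *.
  set (D := fun t : R => (F (RtoC t) - Ci * RtoC eps * (M (RtoC t) * Eb 0 (RtoC t)))%C). change (D x = 0).
  assert (Hi : (Ci * Ci)%C = (-1)%C) by (apply C_ext; simpl; ring).
  assert (HD : forall t, Rder D t (RtoC 0)).
  { intros t. unfold D.
    assert (R1 : Rder (fun t => Ci * RtoC eps * (M (RtoC t) * Eb 0 (RtoC t)))%C t (Eb 0 (RtoC t) * Rd 1 v (RtoC t))%C).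
    { apply (is_derive_ext (K := R_AbsRing) (V := C_R_NormedModule)) with (f := fun t : R => (Ci * RtoC eps * ((M (RtoC t) - 0) * Eb 0 (RtoC t)))%C).
      { intros s. match goal with |- ?a = ?b => change (@eq C a b) end. ring. }
      eapply Rder_eq; [|apply Rder_scal, phase_der, jost_ode, HM]. fold v.
      set (RR := Rd 1 v (RtoC t)). set (E := Eb 0 (RtoC t)). set (u := u0 P c z (RtoC t)). set (w := M (RtoC t)).
      transitivity (- (Ci * Ci) * (E * RR))%C; [field; apply eps_neq_0|]. rewrite Hi. ring. }
    eapply Rder_eq; [|apply (is_derive_minus (K := R_AbsRing) (V := C_R_NormedModule));
      [apply (Cder_horiz F 0 t), HF, slit_dom_real|exact R1]].
    change (Eb 0 (RtoC t) * Rd 1 v (RtoC t) - Eb 0 (RtoC t) * Rd 1 v (RtoC t) = 0)%C. ring. }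
  assert (HL : filterlim D (Rbar_locally m_infty) (locally (T := C_UniformSpace) (RtoC 0))).
  { apply filterlim_ext with (f := fun x : R => ((F (RtoC x) - Ci * RtoC eps * 1 * Eb 0 (RtoC x)) +
      (- Ci * RtoC eps) * ((M (RtoC x) - 1) * Eb 0 (RtoC x)))%C).
    { intros t. unfold D. ring. }
    replace (RtoC 0) with (0 + (- Ci * RtoC eps) * 0)%C by ring.
    apply filterlim_C_plus; [apply _|apply (prim_asym 1 v F HF)|].
    apply filterlim_C_mult; [apply _|apply filterlim_const|].
    apply (Eb_real_null (fun t => M (RtoC t) - 1)%C); [apply _|apply m_infty_large|].
    apply filterlim_minus_const; [apply _|exact HM1]. }
  apply (filterlim_locally_unique (K := R_AbsRing) (V := C_R_NormedModule) (F := Rbar_locally m_infty) D); [|exact HL].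
  apply filterlim_ext with (f := fun _ => D x); [|apply filterlim_const].
  intros t. apply Rder_zero_const. intros; apply HD.
Qed.

(** The identity on the real axis spreads upwards in a thin rectangle around the vertical segment
    through the point, as a function continuous up to the bottom edge and zero there. *)
Lemma M_prim_upper (M F : C -> C) : is_Jost_M eps P c z lam M -> is_prim 0 1 (fun p => c p * M (z p))%C F ->
  forall x, slit_dom 0 x -> 0 < Im x -> F x = (Ci * RtoC eps * (refl M x * Eb 0 x))%C.
Proof.
  intros HM HF [p q] Hx Hq. simpl in Hq. assert (HW : bounded_analytic_extension M) by apply HM.
  destruct (slit_tube 0 0 p q Hx) as (r & Hr & Ht); [apply right_base; intros p' Hp'; lia|].
  rewrite Rmin_left, Rmax_right in Ht by lra.
  assert (Hs : forall x y, p - r / 2 <= x <= p + r / 2 -> 0 <= y <= q + r / 2 -> slit_dom 0 (x, y)).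
  { intros x y H1 H2. apply Ht; [apply Rabs_lt_between; lra|lra]. }
  apply Ceq_minus.
  apply (zero_of_zero_bottom (fun x => F x - Ci * RtoC eps * (refl M x * Eb 0 x))%C (p - r / 2) (p + r / 2) 0 (q + r / 2)); try lra.
  - intros x y H1 H2. assert (Hxy := Hs x y H1 H2). apply Ccont_minus; [eapply Cder_cont, HF, Hxy|].
    apply Ccont_mult; [apply Ccont_const|]. apply Ccont_mult; [apply refl_cont; [assumption|simpl; lra]|].
    eapply Cder_cont, Cder_Eb, Hxy.
  - intros x y H1 H2. assert (Hxy := Hs x y ltac:(lra) ltac:(lra)). destruct (refl_der M (x, y) HW) as [l Hl]; [simpl; lra|].
    eexists. apply Cder_minus; [apply HF, Hxy|]. apply Cder_scal, Cder_mult; [exact Hl|apply Cder_Eb, Hxy].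
  - intros x H1. change (x, 0) with (RtoC x). rewrite (M_prim_real M F HM HF), refl_eq by (simpl; lra). ring.
Qed.

(** For branch m the identity F_m = i eps M E_m is carried from above G_0, over the poles z_1, ...,
    z_m, into the strip to their right. There branch 0 satisfies it too and E_m = E_0, so the two
    primitives agree at the turning point. *)
Lemma M_line_U (M : C -> C) (m : nat) (gam : contour) : (1 <= m <= P)%nat -> is_Jost_M eps P c z lam M ->
  is_U P c z m gam -> is_line (cint 1 (fun p => c p * M (z p))%C gam) 0.
Proof.
  intros Hm HM HU. set (v := fun p => (c p * M (z p))%C).
  destruct (is_prim_ex 0 1 v ltac:(lia)) as [F0 HF0]. destruct (is_prim_ex m 1 v ltac:(lia)) as [Fm HFm].
  assert (HW : bounded_analytic_extension M) by apply HM.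
  assert (HL := line_U m 1 v F0 Fm gam Hm HU HF0 HFm). destruct HU as (_ & HU1 & HU2 & HU3 & _).
  set (p0 := path gam 0) in *.
  assert (Hl : left_of m (Re p0)).
  { intros p Hp L. specialize (HU3 ltac:(lia)). generalize (Re_z_le (S m) p). intros G. specialize (G ltac:(lia) ltac:(lia) ltac:(lia)). lra. }
  assert (Hr : right_of m (Re p0)) by (apply right_of_p0; assumption).
  (* The rectangle must extend beyond the turning point without reaching the upward cut of z_{m+1},
     so that the turning abscissa is interior. *)
  assert (HX : exists X, Re p0 < X /\ left_of m X).
  { destruct (Nat.eq_dec m P) as [E|E].
    - exists (Re p0 + 1). split; [lra|]. intros p Hp L. lia.
    - specialize (HU3 ltac:(lia)). exists ((Re p0 + Re (z (S m))) / 2). split; [lra|]. intros p Hp L.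
      generalize (Re_z_le (S m) p). intros G. specialize (G ltac:(lia) ltac:(lia) ltac:(lia)). lra. }
  destruct HX as (X & HX1 & HX2). destruct above_ex as (T & HT & HT0).
  assert (Hab : forall s, T <= s -> above s) by (intros s Hs p Hp; specialize (HT p Hp); lra).
  set (a := Re (z 1%nat) - 1).
  assert (Hs : forall x y, a <= x <= X -> T <= y -> slit_dom m (x, y)).
  { intros x y H1 H2. apply left_base; [apply Hab, H2|]. intros p Hp L. specialize (HX2 p Hp L). lra. }
  assert (Hz1 : Re (z 1%nat) < Re p0) by (apply Hr; lia).
  (* The rectangle lies above all poles, where branch m has no cut up to X. On its left edge, over
     G_0, passing from branch 0 to branch m multiplies both F and E by [jumpE 0 m]. *)
  assert (Hz : (fun x => Fm x - Ci * RtoC eps * (refl M x * Eb m x))%C (Re p0, T + 1) = 0).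
  { apply (zero_of_zero_left (fun x => Fm x - Ci * RtoC eps * (refl M x * Eb m x))%C a X T (T + 2)); try (unfold a; lra).
    - intros x y H1 H2. assert (Hxy := Hs x y H1 ltac:(lra)). apply Ccont_minus; [eapply Cder_cont, HFm, Hxy|].
      apply Ccont_mult; [apply Ccont_const|]. apply Ccont_mult; [apply refl_cont; [assumption|simpl; lra]|].
      eapply Cder_cont, Cder_Eb, Hxy.
    - intros x y H1 H2. assert (Hxy := Hs x y ltac:(lra) ltac:(lra)). destruct (refl_der M (x, y) HW) as [l Hl']; [simpl; lra|].
      eexists. apply Cder_minus; [apply HFm, Hxy|]. apply Cder_scal, Cder_mult; [exact Hl'|apply Cder_Eb, Hxy].
    - intros y Hy. assert (Ha : in_G0 z (a, y)) by (unfold in_G0, a; simpl; lra). assert (Ha0 := slit_dom_G0 0 (a, y) Ha).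
      rewrite (is_prim_left 0 m 1 v F0 Fm ltac:(lia) HF0 HFm (a, y) Ha0) by (apply left_of_G0; exact Ha).
      rewrite (M_prim_upper M F0 HM HF0 (a, y) Ha0) by (simpl; lra).
      rewrite (Eb_left 0 m) by (try lia; intros p Hp L; apply (left_of_G0 0 _ Ha); lia). ring. }
  assert (Hq : slit_dom 0 (Re p0, T + 1)).
  { apply slit_dom_off. intros p Hp E. simpl in E. destruct (Nat.le_gt_cases p m) as [L|L].
    - specialize (Hr p Hp L). lra. - specialize (Hl p Hp L). lra. }
  assert (E : Fm (Re p0, T + 1) = F0 (Re p0, T + 1)).
  { apply Ceq_minus in Hz. rewrite Hz, (M_prim_upper M F0 HM HF0) by (try assumption; simpl; lra).
    rewrite (Eb_right 0 m) by (try lia; intros p Hp L; apply Hr; lia). reflexivity. }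
  assert (E2 : Fm p0 = F0 p0).
  { apply (is_prim_right m 1 v F0 Fm (Re p0, T + 1)); try assumption. apply slit_dom_0, HU1. lra. }
  rewrite E2 in HL. replace (RtoC 0) with (F0 p0 - F0 p0)%C by ring. exact HL.
Qed.

(** The integral is the limit of F at z_m. Since F = i eps M E with M bounded and E vanishing at
    z_m, the limit is zero. *)
Lemma M_line_ell0 (M : C -> C) (m : nat) (gam : contour) : (1 <= m <= P)%nat -> is_Jost_M eps P c z lam M ->
  exceptional eps c m -> is_ell0 P c z m gam -> is_line (cint 1 (fun p => c p * M (z p))%C gam) 0.
Proof.
  intros Hm HM Hex Hl. set (v := fun p => (c p * M (z p))%C).
  destruct (is_prim_ex 0 1 v ltac:(lia)) as [F HF].
  destruct (exceptional_limit m 1 v F Hm Hex HF) as (n & L & K & r & Hn & Hr & HK & HL).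
  assert (HW : bounded_analytic_extension M) by apply HM.
  destruct (refl_bound M HW) as (B & HB & HMB). destruct (Eb_near m r Hm Hr) as (K1 & HK1 & HE).
  assert (L0 : L = 0).
  { apply Cmod_eq_0. apply Rle_antisym; [|apply Cmod_ge_0]. apply le_epsilon. intros e He.
    set (k := K + eps * (B * K1)). assert (Hk : 0 <= k). { unfold k. assert (0 <= eps * (B * K1)) by (repeat apply Rmult_le_pos; lra). lra. }
    assert (Hr0 : 0 < r) by apply Hr.
    set (s := Rmin (Rmin (r / 2) 1) (e / (k + 1))).
    assert (Hs : 0 < s) by (repeat apply Rmin_pos; try lra; apply Rdiv_lt_0_compat; lra).
    assert (S1 : s <= r / 2) by (eapply Rle_trans; apply Rmin_l). assert (S2 : s <= 1) by (eapply Rle_trans; [apply Rmin_l|apply Rmin_r]).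
    assert (S3 : s <= e / (k + 1)) by apply Rmin_r. apply Rle_div_r in S3; [|lra].
    set (w := (z m - Ci * RtoC s)%C).
    assert (Ew : Cmod (w - z m) = s).
    { unfold w. replace (z m - Ci * RtoC s - z m)%C with (- (Ci * RtoC s))%C by ring.
      rewrite Cmod_opp, Cmod_mult, Cmod_Ci, Cmod_R, Rabs_pos_eq; lra. }
    assert (Iw : Im w = Im (z m) - s) by (unfold w, Re, Im; simpl; ring).
    assert (Hw : slit_dom 0 w) by (apply (near_slit_up m 0 r); try assumption; [lia|lra|intros [_ H]; lra]).
    destruct (near_dist m m r w Hr Hm Hm ltac:(lra)) as (_ & _ & _ & Hwi).
    specialize (HL w Hw ltac:(lra)). rewrite (M_prim_upper M F HM HF w Hw Hwi) in HL.
    specialize (HE 0%nat w ltac:(lra)). specialize (HMB w ltac:(lra)). rewrite Hn, exp_INR_ln, Ew in HE by lra. rewrite Ew in HL.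
    assert (Hps : s ^ S n <= s).
    { simpl. rewrite <- (Rmult_1_r s) at 3. apply Rmult_le_compat_l; [lra|]. rewrite <- (pow1 n). apply pow_incr. lra. }
    assert (Hps0 : 0 < s ^ S n) by (apply pow_lt; assumption).
    set (X := (Ci * RtoC eps * (refl M w * Eb 0 w))%C) in *.
    assert (HXb : Cmod X <= eps * (B * K1) * s ^ S n).
    { unfold X. rewrite !Cmod_mult, Cmod_Ci, Cmod_R, Rabs_pos_eq, Rmult_1_l by lra.
      replace (eps * (B * K1) * s ^ S n) with (eps * (B * (K1 * s ^ S n))) by ring.
      apply Rmult_le_compat_l; [lra|]. apply Rmult_le_compat; try apply Cmod_ge_0; [assumption|apply HE]. }
    assert (T := Cmod_triangle_rev L X). rewrite Cmod_sub_sym in T.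
    assert (k * s ^ S n <= k * s) by (apply Rmult_le_compat_l; assumption). unfold k in *. nra. }
  rewrite L0 in HL. apply (line_ell0 m n 1 v F gam 0 K r); try assumption. apply Hr.
Qed.

(** * The homogeneous linear system *)

Lemma Eb_near_pow (q n : nat) (r : R) : (1 <= q <= P)%nat -> near q r -> Im (c q) / eps = INR (S n) ->
  exists K, 0 < K /\ forall m x, 0 < Cmod (x - z q) < r ->
    / K * Cmod (x - z q) ^ S n <= Cmod (Eb m x) <= K * Cmod (x - z q) ^ S n.
Proof.
  intros Hq Hr Hn. destruct (Eb_near q r Hq Hr) as (K & HK & HE). exists K. split; [assumption|]. intros m x Hx.
  specialize (HE m x Hx). rewrite Hn, exp_INR_ln in HE by lra. exact HE.
Qed.

Lemma is_line_value (F : R -> C) (V W : C) : is_line F V -> is_line F W -> V = W.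
Proof. intros H1 H2. rewrite <- (is_line_unique _ _ H1). apply is_line_unique, H2. Qed.

Lemma prim_right_U (m : nat) (d : nat -> C) (F0 Fm : C -> C) (gam : contour) : (1 <= m <= P)%nat ->
  is_U P c z m gam -> is_line (cint 0 d gam) 0 -> is_prim 0 0 d F0 -> is_prim m 0 d Fm ->
  forall x, slit_dom 0 x -> right_of m (Re x) -> Fm x = F0 x.
Proof.
  intros Hm HU HL HF0 HFm. assert (HL2 := line_U m 0 d F0 Fm gam Hm HU HF0 HFm).
  assert (E := is_line_value _ _ _ HL2 HL). apply Ceq_minus in E. destruct HU as (_ & HU1 & HU2 & _).
  apply (is_prim_right m 0 d F0 Fm (path gam 0)); try assumption.
  - apply slit_dom_0, HU1. lra.
  - apply right_of_p0; assumption.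
  - symmetry. exact E.
Qed.

Lemma near_right_of (q : nat) (r : R) (x : C) : (1 <= q <= P)%nat -> near q r -> Cmod (x - z q) < r ->
  right_of (q - 1) (Re x) /\ left_of q (Re x).
Proof.
  intros Hq Hn Hx. assert (L := Re_lip (z q) x). apply Rabs_le_between in L. destruct Hn as (Hr & _ & H3).
  split; intros p Hp Lp; specialize (H3 p Hp ltac:(lia)).
  - generalize (Re_z_lt p q). intros G. specialize (G ltac:(lia) ltac:(lia) ltac:(lia)). rewrite Rabs_left in H3 by lra. lra.
  - generalize (Re_z_lt q p). intros G. specialize (G ltac:(lia) ltac:(lia) ltac:(lia)). rewrite Rabs_pos_eq in H3 by lra. lra.
Qed.

(** The integral over ell_0(z_m) being zero, F_0 tends to 0 at z_m on both sides of the cut. F_m is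
    followed along a segment of length 2 s at height s above z_m: it starts small by the previous
    branch, and its derivative is bounded because E_m absorbs the pole. Hence the constant F_m - F_0
    on the right is O(s) for every small s. *)
Lemma prim_right_exceptional (m : nat) (d : nat -> C) (F0 Fm1 Fm : C -> C) (gam : contour) : (1 <= m <= P)%nat ->
  exceptional eps c m -> is_ell0 P c z m gam -> is_line (cint 0 d gam) 0 ->
  is_prim 0 0 d F0 -> is_prim (m - 1) 0 d Fm1 -> is_prim m 0 d Fm ->
  (forall x, slit_dom 0 x -> right_of (m - 1) (Re x) -> Fm1 x = F0 x) ->
  forall x, slit_dom 0 x -> right_of m (Re x) -> Fm x = F0 x.
Proof.
  intros Hm Hex Hl HL HF0 HFm1 HFm IH x Hx Hxr.
  destruct (exceptional_limit m 0 d F0 Hm Hex HF0) as (n & L & K & r & Hn & Hr & HK & HLim).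
  assert (Hr0 : 0 < r) by apply Hr.
  assert (L0 : L = 0).
  { apply (is_line_value (cint 0 d gam)); [|exact HL]. apply (line_ell0 m n 0 d F0 gam L K r); assumption. }
  subst L.
  destruct (Eb_near_pow m n r Hm Hr Hn) as (K1 & HK1 & HE). destruct (Rd_near m r 0 d Hm Hr) as (K2 & HK2 & HR).
  set (J := Cmod (jumpE (m - 1) m)). assert (HJ : 0 <= J) by apply Cmod_ge_0.
  apply Ceq_minus. apply Cmod_eq_0. apply Rle_antisym; [|apply Cmod_ge_0]. apply le_epsilon. intros e He.
  set (k := 2 * (J * K) + 2 * K + K1 * K2 * 2 ). assert (Hk : 0 <= k).
  { unfold k. assert (0 <= J * K) by (apply Rmult_le_pos; assumption). assert (0 <= K1 * K2) by (apply Rmult_le_pos; lra). lra. }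
  set (s := Rmin (Rmin (r / 4) (1 / 4)) (e / (k + 1))).
  assert (Hs : 0 < s) by (repeat apply Rmin_pos; try lra; apply Rdiv_lt_0_compat; lra).
  assert (S1 : s <= r / 4) by (eapply Rle_trans; apply Rmin_l). assert (S2 : s <= 1 / 4) by (eapply Rle_trans; [apply Rmin_l|apply Rmin_r]).
  assert (S3 : s <= e / (k + 1)) by apply Rmin_r. apply Rle_div_r in S3; [|lra].
  set (w := fun t : R => (z m + (t, s))%C).
  assert (Ew : forall t, - s <= t <= s -> s <= Cmod (w t - z m) <= 2 * s).
  { intros t Ht. unfold w. replace (z m + (t, s) - z m)%C with (mkC t s) by (apply C_ext; simpl; ring). split.
    - eapply Rle_trans; [|apply im_le_Cmod]. simpl. apply Rle_abs.
    - eapply Rle_trans; [apply Cmod_le_Re_Im|]. simpl. rewrite (Rabs_pos_eq s) by lra. assert (Rabs t <= s) by (apply Rabs_le; lra). lra. }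
  assert (Iw : forall t, Im (w t) = Im (z m) + s) by reflexivity.
  assert (Rw : forall t, Re (w t) = Re (z m) + t) by reflexivity.
  assert (Hwm : forall t, - s <= t <= s -> slit_dom m (w t)).
  { intros t Ht. apply (near_slit_down m m r); try assumption; [lia|generalize (Ew t Ht); lra|]. intros [_ H]. rewrite Iw in H. lra. }
  assert (Hw0 : forall t, - s <= t <= s -> t <> 0 -> slit_dom 0 (w t)).
  { intros t Ht Ht0. apply (near_slit_up m 0 r); try assumption; [lia|generalize (Ew t Ht); lra|]. intros [H _]. rewrite Rw in H. lra. }
  assert (Pw : forall t, - s <= t <= s -> Cmod (w t - z m) ^ S n <= 2 * s).
  { intros t Ht. specialize (Ew t Ht). set (u := Cmod (w t - z m)) in *. simpl. rewrite <- (Rmult_1_r (2 * s)).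
    apply Rmult_le_compat; try lra; [apply pow_le; lra|]. rewrite <- (pow1 n). apply pow_incr. lra. }
  assert (B0 : forall t, - s <= t <= s -> t <> 0 -> Cmod (F0 (w t)) <= 2 * K * s).
  { intros t Ht Ht0. specialize (HLim (w t) (Hw0 t Ht Ht0) ltac:(generalize (Ew t Ht); lra)).
    replace (F0 (w t) - 0)%C with (F0 (w t)) in HLim by ring. specialize (Pw t Ht).
    assert (K * Cmod (w t - z m) ^ S n <= K * (2 * s)) by (apply Rmult_le_compat_l; assumption). lra. }
  assert (Bl : Cmod (Fm (w (- s))) <= J * (2 * K * s)).
  { destruct (near_right_of m r (w (- s)) Hm Hr) as [N1 _]; [generalize (Ew (- s)); lra|].
    assert (Hl1 : left_of (m - 1) (Re (w (- s)))).
    { intros p Hp Lp. rewrite Rw. generalize (Re_z_le m p). intros G. specialize (G ltac:(lia) ltac:(lia) ltac:(lia)). lra. }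
    assert (Hd1 : slit_dom (m - 1) (w (- s))).
    { apply (near_slit_up m (m - 1) r); try assumption; [lia|generalize (Ew (- s)); lra|]. intros [H _]. rewrite Rw in H. lra. }
    rewrite (is_prim_left (m - 1) m 0 d Fm1 Fm ltac:(lia) HFm1 HFm _ Hd1 Hl1).
    rewrite IH by (try assumption; apply Hw0; lra). rewrite Cmod_mult. fold J.
    apply Rmult_le_compat_l; [assumption|]. apply B0; lra. }
  assert (Bm : Cmod (Fm (w s) - Fm (w (- s))) <= K1 * K2 * (s - - s)).
  { rewrite <- (Rabs_pos_eq (s - - s)) by lra.
    apply (Rder_bound (fun t => Fm (w t)) (fun t => Eb m (w t) * Rd 0 d (w t))%C); rewrite Rmin_left, Rmax_right by lra; intros t Ht.
    - eapply Rder_eq; [|apply (Cder_Rder Fm w); [apply HFm, Hwm, Ht|]].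
      2:{ unfold w. apply (is_derive_ext (K := R_AbsRing) (V := C_R_NormedModule)) with (f := fun t : R => ((z m + (0, s)) + 1 * RtoC t)%C).
          - intros u. match goal with |- ?a = ?b => change (@eq C a b) end. apply C_ext; simpl; ring.
          - apply Rder_affine. }
      ring.
    - apply (Ccont_Rcont (fun x => Eb m x * Rd 0 d x)%C w).
      + destruct (Cder_EbRd m 0 d (w t) (Hwm t Ht)) as [l Hl']. eapply Cder_cont, Hl'.
      + apply (continuous_ext (fun t : R => ((z m + (0, s)) + 1 * RtoC t)%C)); [|apply Rcont_affine].
        intros u. unfold w. apply C_ext; simpl; ring.
    - assert (E := Ew t Ht). specialize (HE m (w t) ltac:(lra)). specialize (HR (w t) ltac:(lra)).
      set (u := Cmod (w t - z m)) in *. rewrite Cmod_mult.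
      apply Rle_trans with (K1 * u ^ S n * (K2 * / u)); [apply Rmult_le_compat; try apply Cmod_ge_0; [apply HE|exact HR]|].
      replace (K1 * u ^ S n * (K2 * / u)) with (K1 * K2 * u ^ n) by (simpl; field; lra).
      rewrite <- (Rmult_1_r (K1 * K2)) at 2. apply Rmult_le_compat_l; [apply Rmult_le_pos; lra|].
      rewrite <- (pow1 n). apply pow_incr. lra. }
  assert (Hrs : right_of m (Re (w s))) by (apply right_of_p0; [assumption|rewrite Rw; lra]).
  rewrite (is_prim_right_diff m 0 d F0 Fm x (w s)) by (try assumption; apply Hw0; lra).
  assert (B0s := B0 s ltac:(lra) ltac:(lra)).
  replace (Fm (w s) - F0 (w s))%C with ((Fm (w s) - Fm (w (- s)%R)) + (Fm (w (- s)%R) + - F0 (w s)))%C by ring.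
  eapply Rle_trans; [apply Cmod_triangle|]. eapply Rle_trans; [apply Rplus_le_compat_l, Cmod_triangle|]. rewrite Cmod_opp.
  unfold k in S3. lra.
Qed.

(** The induction over m is forced by the exceptional poles: crossing one of them uses the matching
    already obtained to its left, whereas an ordinary U_m gives the statement directly. *)
Lemma prim_right_all (d : nat -> C) (Gam : nat -> contour) (F0 : C -> C) :
  (forall m, (1 <= m <= P)%nat -> is_Cm eps P c z m (Gam m)) ->
  (forall m, (1 <= m <= P)%nat -> is_line (cint 0 d (Gam m)) 0) -> is_prim 0 0 d F0 ->
  forall m, (m <= P)%nat -> forall Fm, is_prim m 0 d Fm -> forall x, slit_dom 0 x -> right_of m (Re x) -> Fm x = F0 x.
Proof.
  intros HG HL HF0. induction m as [|m IH]; intros Hm Fm HFm x Hx Hxr.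
  - assert (Hw : in_G0 z (Re (z 1%nat) - 1, 0)) by (unfold in_G0; simpl; lra).
    set (w := (Re (z 1%nat) - 1, 0) : C) in *. assert (Hws := slit_dom_G0 0 w Hw).
    apply (is_prim_right 0 0 d F0 Fm w); try assumption; [intros p Hp; lia|].
    rewrite (is_prim_left 0 0 0 d F0 Fm ltac:(lia) HF0 HFm w Hws) by (apply left_of_G0, Hw).
    unfold jumpE, jump. rewrite (Csum_ext P _ (fun p => 0 * 0)%C).
    + rewrite Csum_scal. replace (- Ci * (0 * Csum P (fun _ => 0)) / RtoC eps)%C with (RtoC 0) by (unfold Cdiv; ring).
      rewrite Cexp_0. ring.
    + intros p Hp. destruct (Nat.ltb_spec 0 p), (Nat.leb_spec p 0); cbn [andb]; try lia; ring.
  - destruct (is_prim_ex m 0 d ltac:(lia)) as [Fm1 HFm1]. specialize (HL (S m) ltac:(lia)).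
    destruct (HG (S m) ltac:(lia)) as [H1 H2]. destruct (Classical_Prop.classic (exceptional eps c (S m))) as [Hex|Hex].
    + apply (prim_right_exceptional (S m) d F0 Fm1 Fm (Gam (S m))); try assumption; [lia|apply H1, Hex| |];
        replace (S m - 1)%nat with m by lia; [assumption|]. intros y. apply IH; [lia|assumption].
    + apply (prim_right_U (S m) d F0 Fm (Gam (S m))); try assumption; [lia|apply H2, Hex].
Qed.

Lemma strip_ex (x : R) : (forall p, (1 <= p <= P)%nat -> x <> Re (z p)) -> exists m, (m <= P)%nat /\ right_of m x /\ left_of m x.
Proof.
  intros H.
  assert (A : forall k, (k <= P)%nat -> exists m, (m <= k)%nat /\ right_of m x /\
    forall p, (1 <= p <= k)%nat -> (m < p)%nat -> x < Re (z p)).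
  { induction k as [|k IH]; intros Hk.
    - exists O. split; [lia|]. split; [intros p Hp; lia|intros; lia].
    - destruct (Rlt_dec (Re (z (S k))) x) as [L|L].
      + exists (S k). split; [lia|]. split; [apply right_of_p0; [lia|assumption]|intros; lia].
      + destruct IH as (m & H1 & H2 & H3); [lia|]. exists m. split; [lia|]. split; [assumption|]. intros p Hp Lp.
        destruct (Nat.eq_dec p (S k)) as [->|]; [specialize (H (S k) ltac:(lia)); lra|apply H3; lia]. }
  destruct (A P (le_n P)) as (m & H1 & H2 & H3). exists m. split; [assumption|]. split; assumption.
Qed.

(* The solution of the homogeneous spectral ODE attached to a kernel vector [d] of the linear system. *)
Definition Yq (m : nat) (F : C -> C) (x : C) : C := (- Ci / RtoC eps * (F x / Eb m x))%C.

(** In the strip between z_m and z_{m+1} the comparison passes through branch m: it is proportional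
    to branch P with the same factor in F and E, and equal to branch 0 by the kernel condition. *)
Lemma Yq_agree (d : nat -> C) (Gam : nat -> contour) (F0 FP : C -> C) (x : C) :
  (forall m, (1 <= m <= P)%nat -> is_Cm eps P c z m (Gam m)) ->
  (forall m, (1 <= m <= P)%nat -> is_line (cint 0 d (Gam m)) 0) -> is_prim 0 0 d F0 -> is_prim P 0 d FP ->
  (forall p, (1 <= p <= P)%nat -> Re x <> Re (z p)) -> Yq P FP x = Yq 0 F0 x.
Proof.
  intros HG HL HF0 HFP Hx. destruct (strip_ex (Re x) Hx) as (m & Hm & Hr & Hl).
  destruct (is_prim_ex m 0 d Hm) as [Fm HFm].
  unfold Yq. f_equal. rewrite (is_prim_left m P 0 d Fm FP ltac:(lia) HFm HFP) by (try assumption; apply slit_dom_off, Hx).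
  rewrite (Eb_left m P) by (try lia; intros p Hp Lp; apply Hl; lia).
  rewrite (prim_right_all d Gam F0 HG HL HF0 m Hm Fm HFm) by (try assumption; apply slit_dom_off, Hx).
  rewrite (Eb_right 0 m) by (try lia; intros p Hp Lp; apply Hr; lia).
  field. split; [apply Eb_neq_0|apply Cexp_neq_0].
Qed.

Lemma Yq_ode (m : nat) (d : nat -> C) (F : C -> C) (x : C) : is_prim m 0 d F -> slit_dom m x ->
  Cder (Yq m F) x (Ci / RtoC eps * ((RtoC lam + u0 P c z x) * Yq m F x - Rd 0 d x))%C.
Proof.
  intros [HF _] Hx. unfold Yq. eapply Cder_eq; [|apply Cder_scal, (Cder_div F (Eb m)); [apply Eb_neq_0|apply HF, Hx|apply Cder_Eb, Hx]].
  set (E := Eb m x). set (u := u0 P c z x). assert (NE : E <> 0) by apply Eb_neq_0. field. split; [exact NE|apply eps_neq_0].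
Qed.

(** * Behaviour of the homogeneous solution at the poles *)

Lemma Cder_pow (a x : C) (k : nat) : Cder (fun y => (y - a) ^ S k)%C x (RtoC (INR (S k)) * (x - a) ^ k)%C.
Proof.
  assert (D : Cder (fun y => y - a)%C x 1).
  { apply (Cder_eq _ _ (1 - 0)%C); [ring|]. apply Cder_minus; [apply Cder_id|apply Cder_const]. }
  induction k as [|k IH].
  - apply Cder_ext with (f := fun y => (y - a)%C); [intros; simpl; ring|]. apply (Cder_eq _ _ 1); [simpl; ring|exact D].
  - apply Cder_ext with (f := fun y => ((y - a) * (y - a) ^ S k)%C); [intros; simpl; ring|].
    apply (Cder_eq _ _ (1 * (x - a) ^ S k + (x - a) * (RtoC (INR (S k)) * (x - a) ^ k))%C).
    + rewrite (S_INR (S k)), RtoC_plus. rewrite (Cpow_S (x - a) k). ring.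
    + apply (Cder_mult (fun y => y - a)%C (fun y => (y - a) ^ S k)%C); assumption.
Qed.

Lemma near_neq (q p : nat) (r : R) (x : C) : (1 <= q <= P)%nat -> (1 <= p <= P)%nat -> near q r -> 0 < Cmod (x - z q) < r ->
  x <> z p /\ 0 < Im x.
Proof.
  intros Hq Hp Hn Hx. destruct (near_dist q p r x Hn Hp Hq (proj2 Hx)) as (_ & D & _ & D3). split; [|assumption].
  destruct (Nat.eq_dec p q) as [->|E].
  - intros ->. replace (z q - z q)%C with (RtoC 0) in Hx by ring. rewrite Cmod_0 in Hx. lra.
  - specialize (D E). intros ->. replace (z p - z p)%C with (RtoC 0) in D by ring. rewrite Cmod_0 in D. destruct Hn. lra.
Qed.

Lemma near_le (q : nat) (b : R) : (1 <= q <= P)%nat -> 0 < b -> exists r, near q r /\ r <= b.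
Proof.
  intros Hq Hb. destruct (near_ex q Hq) as [r Hr]. exists (Rmin r b). split; [|apply Rmin_r].
  apply (near_mono q r); [assumption|]. split; [apply Rmin_pos; [apply Hr|assumption]|apply Rmin_l].
Qed.

(** At z_q the function has at most a pole of order k, expressed without Laurent series. *)
Definition bounded_order (q k : nat) (Y : C -> C) : Prop :=
  exists r B, near q r /\ 0 <= B /\ forall x, 0 < Cmod (x - z q) < r -> Cmod ((x - z q) ^ k * Y x)%C <= B.

Definition ode_near (q : nat) (d : nat -> C) (Y : C -> C) : Prop :=
  forall x r, near q r -> 0 < Cmod (x - z q) < r ->
    Cder Y x (Ci / RtoC eps * ((RtoC lam + u0 P c z x) * Y x - Rd 0 d x))%C.

(** Estimates through F_0 are available only off the vertical line through z_q, which carries the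
    cut. Y itself is continuous across it, so the bound follows by shifting the point to the right
    by s and letting s tend to 0. *)
Lemma bounded_order_dense (q k : nat) (d : nat -> C) (Y : C -> C) (r B : R) : near q r -> ode_near q d Y ->
  (forall x, 0 < Cmod (x - z q) < r -> Re x <> Re (z q) -> Cmod ((x - z q) ^ k * Y x)%C <= B) ->
  forall x, 0 < Cmod (x - z q) < r -> Cmod ((x - z q) ^ k * Y x)%C <= B.
Proof.
  intros Hr HY H x Hx. destruct (Req_dec (Re x) (Re (z q))) as [E|E]; [|apply H; assumption].
  apply le_epsilon. intros e He.
  assert (Hc : Ccont (fun x => (x - z q) ^ k * Y x)%C x).
  { apply Ccont_mult; [|eapply Cder_cont, (HY x r); assumption]. destruct k.
    - apply (Ccont_ext_loc (fun _ => RtoC 1) _ _ 1 Rlt_0_1); [intros; reflexivity|apply Ccont_const].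
    - eapply Cder_cont, Cder_pow. }
  destruct (Hc e He) as (dl & Hdl & Hs).
  set (s := Rmin (dl / 2) (Rmin (Cmod (x - z q) / 2) ((r - Cmod (x - z q)) / 2))).
  assert (S0 : 0 < s) by (repeat apply Rmin_pos; lra).
  assert (S1 : s <= dl / 2) by apply Rmin_l. assert (S2 : s <= Cmod (x - z q) / 2) by (eapply Rle_trans; [apply Rmin_r|apply Rmin_l]).
  assert (S3 : s <= (r - Cmod (x - z q)) / 2) by (eapply Rle_trans; [apply Rmin_r|apply Rmin_r]).
  set (y := (x + RtoC s)%C).
  assert (Ey : Cmod (y - x) = s) by (unfold y; replace (x + RtoC s - x)%C with (RtoC s) by ring; rewrite Cmod_R, Rabs_pos_eq; lra).
  assert (Y1 : Cmod (y - z q) <= Cmod (x - z q) + s).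
  { replace (y - z q)%C with ((x - z q) + (y - x))%C by ring. eapply Rle_trans; [apply Cmod_triangle|]. lra. }
  assert (Y2 : Cmod (x - z q) - s <= Cmod (y - z q)).
  { generalize (Cmod_triangle_rev (x - z q) (x - y)). replace (x - z q - (x - y))%C with (y - z q)%C by ring. rewrite (Cmod_sub_sym x y). lra. }
  assert (Hy : Cmod ((y - z q) ^ k * Y y)%C <= B).
  { apply H; [lra|]. unfold y. rewrite re_plus. simpl Re. change (Re (RtoC s)) with s in *. unfold RtoC, Re in *; simpl in *. lra. }
  specialize (Hs y ltac:(lra)). generalize (Cmod_triangle_rev ((x - z q) ^ k * Y x) ((y - z q) ^ k * Y y)). rewrite Cmod_sub_sym. lra.
Qed.

Lemma u0_near (q : nat) (r : R) : (1 <= q <= P)%nat -> near q r ->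
  exists K, 0 <= K /\ forall x, 0 < Cmod (x - z q) < r -> Cmod (u0 P c z x - c q / (x - z q)) <= K.
Proof.
  intros Hq Hr. assert (Hr0 : 0 < r) by apply Hr.
  destruct (Csum_bound_uniform P (fun x : C => 0 < Cmod (x - z q) < r)
    (fun p x => (c p / (x - z p) + Cconj (c p) / (x - Cconj (z p)) - if Nat.eq_dec p q then c q / (x - z q) else 0)%C) (fun _ => 1)) as (K & HK & H).
  - intros; lra.
  - intros p Hp. exists (2 * (Cmod (c p) * / r)). intros x Hx. rewrite Rmult_1_r.
    destruct (near_dist q p r x Hr Hp Hq (proj2 Hx)) as (_ & D1 & D2 & _).
    assert (T2 : Cmod (Cconj (c p) / (x - Cconj (z p))) <= Cmod (c p) * / r) by (rewrite <- (Cmod_conj (c p)); apply Cmod_div_le; assumption).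
    assert (T0 : 0 <= Cmod (c p) * / r) by (apply Rmult_le_pos; [apply Cmod_ge_0|apply Rlt_le, Rinv_0_lt_compat; assumption]).
    destruct (Nat.eq_dec p q) as [->|E].
    + replace (c q / (x - z q) + Cconj (c q) / (x - Cconj (z q)) - c q / (x - z q))%C with (Cconj (c q) / (x - Cconj (z q)))%C by ring. lra.
    + specialize (D1 E). assert (T1 : Cmod (c p / (x - z p)) <= Cmod (c p) * / r) by (apply Cmod_div_le; assumption).
      replace (c p / (x - z p) + Cconj (c p) / (x - Cconj (z p)) - 0)%C with (c p / (x - z p) + Cconj (c p) / (x - Cconj (z p)))%C by ring.
      eapply Rle_trans; [apply Cmod_triangle|]. lra.
  - exists K. split; [assumption|]. intros x Hx. specialize (H x Hx). cbv beta in H. rewrite Csum_minus, (Csum_delta P q _ Hq), Rmult_1_r in H. exact H.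
Qed.

(* The ODE forces the leading Laurent coefficient at a pole of order [S k] to vanish
   unless [i c_q / eps = - (S k)]. *)
Lemma bounded_order_descent (q k : nat) (d : nat -> C) (Y : C -> C) : (1 <= q <= P)%nat -> ode_near q d Y ->
  ~ exceptional eps c q -> bounded_order q (S k) Y -> bounded_order q k Y.
Proof.
  intros Hq HY Hne (r0 & B & Hr0 & HB & Hbd).
  destruct (near_le q (Rmin r0 1) Hq) as (r & Hr & Hrle); [apply Rmin_pos; [apply Hr0|lra]|].
  assert (R1 : r <= r0) by (eapply Rle_trans; [exact Hrle|apply Rmin_l]). assert (R2 : r <= 1) by (eapply Rle_trans; [exact Hrle|apply Rmin_r]).
  assert (Rp : 0 < r) by apply Hr.
  set (T := fun x => ((x - z q) ^ S k * Y x)%C).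
  assert (HT : forall x, 0 < Cmod (x - z q) < r -> Cder T x
    (RtoC (INR (S k)) * (x - z q) ^ k * Y x + (x - z q) ^ S k * (Ci / RtoC eps * ((RtoC lam + u0 P c z x) * Y x - Rd 0 d x)))%C).
  { intros x Hx. apply Cder_mult; [apply Cder_pow|apply (HY x r); assumption]. }
  destruct (Riemann_removable T (z q) (r / 3) B) as (Th & B' & E & HTh); [lra|assumption| | |].
  { intros x Hx. eexists. apply HT. lra. } { intros x Hx. apply Hbd. lra. }
  destruct (u0_near q r Hq Hr) as (K1 & HK1 & HU). destruct (Rd_near q r 0 d Hq Hr) as (K2 & HK2 & HR).
  set (kk := (RtoC (INR (S k)) + Ci * c q / RtoC eps)%C).
  assert (Nk : kk <> 0).
  { intros E0. apply Hne. exists k. unfold kk in E0.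
    replace (Ci * c q / RtoC eps)%C with (RtoC (INR (S k)) + Ci * c q / RtoC eps - RtoC (INR (S k)))%C by ring. rewrite E0. ring. }
  assert (Pk : 0 < Cmod kk) by (apply Cmod_gt_0, Nk).
  set (B2 := B' + / eps * ((lam + K1) * B + K2)).
  exists (r / 6), (Rabs (B2 / Cmod kk)). split; [apply (near_mono q r); [assumption|lra]|]. split; [apply Rabs_pos|].
  intros x Hx. assert (Hx6 : 0 < Cmod (x - z q) < r / 3 / 2) by lra. assert (Hxr : 0 < Cmod (x - z q) < r) by lra.
  destruct (HTh x (proj2 Hx6)) as (l & Hl & Hlb). specialize (HT x Hxr).
  assert (Hl2 : l = (RtoC (INR (S k)) * (x - z q) ^ k * Y x + (x - z q) ^ S k * (Ci / RtoC eps * ((RtoC lam + u0 P c z x) * Y x - Rd 0 d x)))%C).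
  { apply (Cder_unique T x); [|exact HT].
    apply (Cder_ext_loc Th _ _ _ (Rmin (Cmod (x - z q)) (r / 3 / 2 - Cmod (x - z q)))); [apply Rmin_pos; lra| |exact Hl].
    intros y Hy. assert (Y1 := Rlt_le_trans _ _ _ Hy (Rmin_l _ _)). assert (Y2 := Rlt_le_trans _ _ _ Hy (Rmin_r _ _)).
    apply E. generalize (Cmod_triangle_rev (x - z q) (x - y)) (Cmod_triangle (x - z q) (y - x)).
    replace (x - z q - (x - y))%C with (y - z q)%C by ring. replace (x - z q + (y - x))%C with (y - z q)%C by ring.
    rewrite (Cmod_sub_sym x y). lra. }
  assert (Nx : (x - z q)%C <> 0) by (apply Cmod_gt_0; lra).
  (* In the derivative of T = (x - z_q)^(k+1) Y the power rule and the polar part c_q/(x - z_q) of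
     u0 combine into the factor [kk]. All the other terms are bounded, and so is the derivative l by
     the removable singularity theorem. *)
  assert (Key : (kk * ((x - z q) ^ k * Y x))%C = (l - Ci / RtoC eps * ((RtoC lam + (u0 P c z x - c q / (x - z q))) * T x - (x - z q) ^ S k * Rd 0 d x))%C).
  { rewrite Hl2. unfold kk, T. rewrite Cpow_S. field. repeat split; first [exact Nx|apply eps_neq_0]. }
  specialize (HU x Hxr). specialize (HR x Hxr). specialize (Hbd x ltac:(lra)). fold (T x) in Hbd.
  set (rho := Cmod (x - z q)) in *.
  assert (HRk : Cmod ((x - z q) ^ S k * Rd 0 d x) <= K2).
  { rewrite Cmod_mult, Cmod_pow. fold rho. simpl.
    apply Rle_trans with (rho * rho ^ k * (K2 * / rho)); [apply Rmult_le_compat_l; [apply Rmult_le_pos; [lra|apply pow_le; lra]|exact HR]|].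
    replace (rho * rho ^ k * (K2 * / rho)) with (K2 * rho ^ k) by (field; lra). rewrite <- (Rmult_1_r K2) at 2.
    apply Rmult_le_compat_l; [assumption|]. rewrite <- (pow1 k). apply pow_incr. lra. }
  assert (HLu : Cmod (RtoC lam + (u0 P c z x - c q / (x - z q))) <= lam + K1).
  { eapply Rle_trans; [apply Cmod_triangle|]. rewrite Cmod_R, Rabs_pos_eq by lra. lra. }
  assert (HB2 : Cmod kk * Cmod ((x - z q) ^ k * Y x) <= B2).
  { rewrite <- Cmod_mult, Key. eapply Rle_trans; [apply Cmod_triangle|]. rewrite Cmod_opp, Cmod_mult. unfold B2.
    apply Rplus_le_compat; [exact Hlb|]. rewrite Cmod_div, Cmod_Ci, Cmod_R, Rabs_pos_eq by (apply eps_neq_0 || lra).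
    replace (1 / eps) with (/ eps) by (field; lra). apply Rmult_le_compat_l; [apply Rlt_le, Rinv_0_lt_compat; assumption|].
    eapply Rle_trans; [apply Cmod_triangle|]. rewrite Cmod_opp, Cmod_mult. apply Rplus_le_compat; [|assumption].
    apply Rmult_le_compat; try apply Cmod_ge_0; assumption. }
  eapply Rle_trans; [|apply Rle_abs]. apply Rle_div_r; [assumption|]. lra.
Qed.

Lemma bounded_order_0 (q k : nat) (d : nat -> C) (Y : C -> C) : (1 <= q <= P)%nat -> ode_near q d Y ->
  ~ exceptional eps c q -> bounded_order q k Y -> bounded_order q 0 Y.
Proof.
  intros Hq HY Hne. induction k as [|k IH]; intros H; [exact H|]. apply IH. apply (bounded_order_descent q k d Y); assumption.
Qed.

Lemma Cmod_mono (w w' : C) : Rabs (Re w) <= Rabs (Re w') -> Rabs (Im w) <= Rabs (Im w') -> Cmod w <= Cmod w'.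
Proof.
  intros H1 H2. apply Rsqr_incr_0; try apply Cmod_ge_0. rewrite !Rsqr_pow2, !Cmod2_alt.
  rewrite <- (pow2_abs (Re w)), <- (pow2_abs (Im w)), <- (pow2_abs (Re w')), <- (pow2_abs (Im w')).
  apply Rplus_le_compat; apply pow_incr; split; try apply Rabs_pos; assumption.
Qed.

Lemma pow_le_exp (s rho : R) (N : nat) : Rabs s <= INR N -> 0 < rho <= 1 -> exp (s * ln rho) <= (/ rho) ^ N.
Proof.
  intros Hs Hr. assert (Hi : 0 < / rho) by (apply Rinv_0_lt_compat; lra).
  rewrite <- exp_INR_ln, ln_Rinv by (assumption || lra).
  assert (Hln : ln rho <= 0).
  { destruct (Req_dec rho 1) as [->|Hn]; [rewrite ln_1; lra|]. apply Rlt_le. rewrite <- ln_1. apply ln_increasing; lra. }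
  apply Rabs_le_between in Hs. assert (H : s * ln rho <= INR N * - ln rho) by nra.
  destruct H as [H| ->]; [apply Rlt_le, exp_increasing, H|lra].
Qed.

(** E and 1/E grow at most like the power N of the inverse distance, with N a natural number above
    |Im c_q| / eps, and the rational factor adds one power. Integrating along a path that stays at
    distance at least |x - z_q| gives a polynomial bound for F_0, hence for Y. *)
Lemma Yq_growth (q : nat) (d : nat -> C) (F0 : C -> C) : (1 <= q <= P)%nat -> is_prim 0 0 d F0 ->
  exists N r B, near q r /\ 0 <= B /\
    forall x, 0 < Cmod (x - z q) < r -> Re x <> Re (z q) -> Cmod ((x - z q) ^ N * Yq 0 F0 x)%C <= B.
Proof.
  intros Hq HF. destruct (near_le q 1 Hq Rlt_0_1) as (r & Hr & Hr1). assert (Rp : 0 < r) by apply Hr.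
  destruct (Eb_near q r Hq Hr) as (K1 & HK1 & HE). destruct (Rd_near q r 0 d Hq Hr) as (K2 & HK2 & HR).
  set (s := Im (c q) / eps) in *.
  destruct (nfloor_ex (Rabs s)) as [N0 [_ HN]]; [apply Rabs_pos|]. set (N := S N0).
  assert (HN1 : Rabs s <= INR N) by (unfold N; rewrite S_INR; lra).
  set (g := fun x => (Eb 0 x * Rd 0 d x)%C). set (k := K1 * K2). assert (Hk : 0 <= k) by (unfold k; apply Rmult_le_pos; lra).
  assert (Hg : forall rho w, 0 < rho -> rho <= Cmod (w - z q) < r -> Cmod (g w) <= k * (/ rho) ^ S N).
  { intros rho w Hrho Hw. specialize (HE 0%nat w ltac:(lra)). specialize (HR w ltac:(lra)). set (v := Cmod (w - z q)) in *.
    assert (Hv := pow_le_exp s v N HN1 ltac:(lra)). unfold g. rewrite Cmod_mult.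
    assert (Hiv : 0 < / v) by (apply Rinv_0_lt_compat; lra). assert (Hir : / v <= / rho) by (apply Rinv_le_contravar; lra).
    apply Rle_trans with (K1 * (/ v) ^ N * (K2 * / v)).
    - apply Rmult_le_compat; try apply Cmod_ge_0; [|exact HR]. eapply Rle_trans; [apply HE|]. apply Rmult_le_compat_l; lra.
    - replace (K1 * (/ v) ^ N * (K2 * / v)) with (k * (/ v) ^ S N) by (unfold k; simpl; ring).
      apply Rmult_le_compat_l; [assumption|]. apply pow_incr. lra. }
  set (r1 := r / 4). set (xp := (z q + RtoC r1)%C). set (xm := (z q - RtoC r1)%C).
  set (A := Cmod (F0 xp) + Cmod (F0 xm) + k * (/ r1) ^ S N).
  assert (HA : 0 <= A).
  { unfold A. assert (0 <= k * (/ r1) ^ S N) by (apply Rmult_le_pos; [assumption|apply pow_le, Rlt_le, Rinv_0_lt_compat; unfold r1; lra]).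
    generalize (Cmod_ge_0 (F0 xp)) (Cmod_ge_0 (F0 xm)). lra. }
  assert (Hslit : forall w, Cmod (w - z q) < r -> Re w <> Re (z q) -> slit_dom 0 w).
  { intros w Hw Hn. apply (near_slit_up q 0 r); try assumption; [lia|]. intros [H _]. contradiction. }
  assert (Hseg : forall rho x y, 0 < rho -> (forall t, 0 <= t <= 1 -> rho <= Cmod (x + (y - x) * RtoC t - z q) < r /\ Re (x + (y - x) * RtoC t) <> Re (z q)) ->
     Cmod (F0 y - F0 x) <= k * (/ rho) ^ S N * Cmod (y - x)).
  { intros rho x y Hrho H. apply (seg_bound F0 g). intros t Ht. destruct (H t Ht) as [H1 H2].
    assert (Hs := Hslit _ (proj2 H1) H2). split; [apply HF, Hs|]. split.
    - destruct (Cder_EbRd 0 0 d _ Hs) as [l Hl]. eapply Cder_cont, Hl.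
    - apply Hg; assumption. }
  assert (HFb : forall x, 0 < Cmod (x - z q) < r1 -> Re x <> Re (z q) -> Cmod (F0 x) <= (A + k) * (/ Cmod (x - z q)) ^ S N).
  { intros x Hx Hn. set (rho := Cmod (x - z q)) in *.
    assert (Lr := re_le_Cmod (x - z q)). assert (Li := im_le_Cmod (x - z q)). fold rho in Lr, Li. rewrite re_minus in Lr. rewrite im_minus in Li.
    apply Rabs_le_between in Lr. assert (Li' := Li). apply Rabs_le_between in Li.
    assert (Side : exists sg, (sg = 1 \/ sg = -1) /\ 0 < sg * (Re x - Re (z q))).
    { destruct (Rlt_dec (Re x) (Re (z q))); [exists (-1)|exists 1]; split; lra. }
    destruct Side as (sg & Hsg & Hsx).
    (* From x one first moves horizontally away from the vertical line, so the distance to z_q does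
       not decrease, and then vertically to the base point at distance at least r1. *)
    set (x1 := (z q + mkC (sg * r1) (Im x - Im (z q)))%C). set (x0 := (z q + RtoC (sg * r1))%C).
    assert (Hx0 : Cmod (F0 x0) <= Cmod (F0 xp) + Cmod (F0 xm)).
    { destruct Hsg as [->| ->]; unfold x0.
      - rewrite Rmult_1_l. fold xp. generalize (Cmod_ge_0 (F0 xm)); lra.
      - replace (z q + RtoC (-1 * r1))%C with xm by (unfold xm; apply C_ext; simpl; ring). generalize (Cmod_ge_0 (F0 xp)); lra. }
    assert (B1 : Cmod (F0 x - F0 x1) <= k * (/ rho) ^ S N * Cmod (x - x1)).
    { rewrite (Cmod_sub_sym (F0 x)), (Cmod_sub_sym x). apply Hseg; [lra|]. intros t Ht.
      set (w := (x + (x1 - x) * RtoC t)%C).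
      assert (Er : Re (w - z q) = (1 - t) * (Re x - Re (z q)) + t * (sg * r1)) by (unfold w, x1, Re, Im; simpl; ring).
      assert (Ei : Im (w - z q) = Im x - Im (z q)) by (unfold w, x1, Re, Im; simpl; ring).
      assert (Rge : Rabs (Re (x - z q)) <= Rabs (Re (w - z q)) <= r1).
      { rewrite Er, re_minus. destruct Hsg as [->| ->].
        - rewrite !Rabs_pos_eq by nra. nra. - rewrite !Rabs_left1 by nra. nra. }
      split.
      - split.
        + unfold rho. apply Cmod_mono; [apply Rge|]. rewrite Ei, im_minus. lra.
        + eapply Rle_lt_trans; [apply Cmod_le_Re_Im|]. rewrite Ei. unfold r1 in *. lra.
      - intros Eq. assert (Z : Re (w - z q) = 0) by (rewrite re_minus; lra). rewrite Z, Rabs_R0 in Rge.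
        rewrite re_minus in Rge. assert (Rabs (Re x - Re (z q)) > 0) by (apply Rabs_pos_lt; lra). lra. }
    assert (B2 : Cmod (F0 x1 - F0 x0) <= k * (/ r1) ^ S N * Cmod (x1 - x0)).
    { apply Hseg; [unfold r1; lra|]. intros t Ht. set (w := (x0 + (x1 - x0) * RtoC t)%C).
      assert (Er : Re (w - z q) = sg * r1) by (unfold w, x1, x0, Re, Im; simpl; ring).
      assert (Ei : Im (w - z q) = t * (Im x - Im (z q))) by (unfold w, x1, x0, Re, Im; simpl; ring).
      assert (Rr : Rabs (sg * r1) = r1).
      { destruct Hsg as [->| ->]; [rewrite Rabs_pos_eq|rewrite Rabs_left]; unfold r1; lra. }
      split; [split|].
      - eapply Rle_trans; [|apply re_le_Cmod]. rewrite Er, Rr. lra.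
      - eapply Rle_lt_trans; [apply Cmod_le_Re_Im|]. rewrite Er, Ei, Rr, Rabs_mult, (Rabs_pos_eq t) by lra.
        assert (t * Rabs (Im x - Im (z q)) <= 1 * rho) by (apply Rmult_le_compat; try lra; apply Rabs_pos). unfold r1 in *. lra.
      - intros Eq. assert (Z : Re (w - z q) = 0) by (rewrite re_minus; lra). rewrite Er in Z.
        rewrite Z, Rabs_R0 in Rr. unfold r1 in Rr. lra. }
    assert (D1 : Cmod (x - x1) <= 1).
    { eapply Rle_trans; [apply Cmod_le_Re_Im|].
      replace (Re (x - x1)) with (Re x - Re (z q) - sg * r1) by (unfold x1, Re, Im; simpl; ring).
      replace (Im (x - x1)) with 0 by (unfold x1, Re, Im; simpl; ring). rewrite Rabs_R0, Rplus_0_r.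
      unfold r1 in *. apply Rabs_le. destruct Hsg as [->| ->]; lra. }
    assert (D2 : Cmod (x1 - x0) <= 1).
    { replace (x1 - x0)%C with (Ci * RtoC (Im x - Im (z q)))%C by (unfold x1, x0; apply C_ext; simpl; ring).
      rewrite Cmod_mult, Cmod_Ci, Cmod_R, Rmult_1_l. unfold r1 in *. lra. }
    assert (Hi1 : 1 <= (/ rho) ^ S N).
    { rewrite <- (pow1 (S N)). apply pow_incr. split; [lra|]. rewrite <- Rinv_1. apply Rinv_le_contravar; unfold r1 in *; lra. }
    assert (Hi2 : 0 <= k * (/ r1) ^ S N) by (apply Rmult_le_pos; [assumption|apply pow_le, Rlt_le, Rinv_0_lt_compat; unfold r1; lra]).
    assert (Hi3 : 0 <= k * (/ rho) ^ S N) by (apply Rmult_le_pos; lra).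
    assert (B1' : k * (/ rho) ^ S N * Cmod (x - x1) <= k * (/ rho) ^ S N * 1) by (apply Rmult_le_compat_l; assumption).
    assert (B2' : k * (/ r1) ^ S N * Cmod (x1 - x0) <= k * (/ r1) ^ S N * 1) by (apply Rmult_le_compat_l; assumption).
    replace (F0 x) with ((F0 x - F0 x1) + ((F0 x1 - F0 x0) + F0 x0))%C by ring.
    eapply Rle_trans; [apply Cmod_triangle|]. eapply Rle_trans; [apply Rplus_le_compat_l, Cmod_triangle|].
    assert (A * 1 <= A * (/ rho) ^ S N) by (apply Rmult_le_compat_l; assumption). unfold A in *. lra. }
  (* The exponent is N + 1 for F_0 plus N for 1/E. *)
  exists (S N + N)%nat, r1, (/ eps * ((A + k) * K1)). split; [apply (near_mono q r); [assumption|unfold r1; lra]|].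
  assert (Hie : 0 < / eps) by (apply Rinv_0_lt_compat; assumption).
  split. { apply Rmult_le_pos; [lra|]. apply Rmult_le_pos; lra. }
  intros x Hx Hn. specialize (HFb x Hx Hn). specialize (HE 0%nat x ltac:(unfold r1 in Hx; lra)). set (rho := Cmod (x - z q)) in *.
  assert (Hrho1 : 0 < rho <= 1) by (unfold r1 in Hx; lra).
  assert (Hinv : Cmod (/ Eb 0 x) <= K1 * (/ rho) ^ N).
  { rewrite Cmod_inv by apply Eb_neq_0.
    assert (L : exp (- s * ln rho) <= (/ rho) ^ N) by (apply pow_le_exp; [rewrite Rabs_Ropp; assumption|assumption]).
    apply Rle_trans with (K1 * exp (- s * ln rho)); [|apply Rmult_le_compat_l; lra].
    replace (- s * ln rho) with (- (s * ln rho)) by ring. rewrite exp_Ropp.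
    replace (K1 * / exp (s * ln rho)) with (/ (/ K1 * exp (s * ln rho))) by (field; split; [apply Rgt_not_eq, exp_pos|lra]).
    apply Rinv_le_contravar; [|apply HE]. apply Rmult_lt_0_compat; [apply Rinv_0_lt_compat; assumption|apply exp_pos]. }
  unfold Yq, Cdiv. rewrite !Cmod_mult, Cmod_pow, Cmod_opp, Cmod_Ci, Cmod_inv, Cmod_R, Rabs_pos_eq by (apply eps_neq_0 || lra). fold rho.
  rewrite Rmult_1_l.
  apply Rle_trans with (rho ^ (S N + N) * (/ eps * ((A + k) * (/ rho) ^ S N * (K1 * (/ rho) ^ N)))).
  - apply Rmult_le_compat_l; [apply pow_le; lra|]. apply Rmult_le_compat_l; [lra|]. apply Rmult_le_compat; try apply Cmod_ge_0; assumption.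
  - apply Req_le. rewrite pow_add. 
    replace (rho ^ S N * rho ^ N * (/ eps * ((A + k) * (/ rho) ^ S N * (K1 * (/ rho) ^ N))))
      with ((rho ^ S N * (/ rho) ^ S N) * (rho ^ N * (/ rho) ^ N) * (/ eps * ((A + k) * K1))) by ring.
    rewrite <- !Rpow_mult_distr, Rinv_r, !pow1 by lra. ring.
Qed.

Lemma patch_points (n : nat) (G : C -> C) : (n <= P)%nat ->
  (forall q, (1 <= q <= n)%nat -> exists L, forall e, 0 < e -> exists dl, 0 < dl /\ forall x, 0 < Cmod (x - z q) < dl -> Cmod (G x - L) < e) ->
  exists G', (forall x, (forall p, (1 <= p <= n)%nat -> x <> z p) -> G' x = G x) /\
    forall q, (1 <= q <= n)%nat -> Ccont G' (z q).
Proof.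
  intros Hn. induction n as [|n IH]; intros H.
  - exists G. split; [reflexivity|]. intros; lia.
  - destruct IH as (G' & H1 & H2); [lia|intros; apply H; lia|]. destruct (H (S n)) as (L & HL); [lia|].
    assert (Hd : exists r, 0 < r /\ forall p, (1 <= p <= n)%nat -> r <= Cmod (z p - z (S n))).
    { apply (uniform_radius n (fun p r => r <= Cmod (z p - z (S n)))); [intros; lra|]. intros p Hp. exists (Cmod (z p - z (S n))). split; [|lra].
      apply Cmod_gt_0, Cminus_eq_contra. intros E. apply (z_neq p (S n)); [lia|lia|lia|rewrite E; reflexivity]. }
    destruct Hd as (r & Hr & Hrp).
    exists (fun x => if Ceq_dec x (z (S n)) then L else G' x). split.
    + intros x Hx. destruct (Ceq_dec x (z (S n))) as [E|_]; [exfalso; apply (Hx (S n)); [lia|assumption]|]. apply H1. intros p Hp. apply Hx. lia.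
    + intros q Hq. destruct (Nat.eq_dec q (S n)) as [->|E].
      * intros e He. destruct (HL e He) as (dl & Hdl & Hs). exists (Rmin dl r). split; [apply Rmin_pos; assumption|]. intros y Hy.
        assert (Y1 := Rlt_le_trans _ _ _ Hy (Rmin_l _ _)). assert (Y2 := Rlt_le_trans _ _ _ Hy (Rmin_r _ _)).
        destruct (Ceq_dec (z (S n)) (z (S n))) as [_|]; [|congruence]. destruct (Ceq_dec y (z (S n))) as [->|Ny].
        { replace (L - L)%C with (RtoC 0) by ring. rewrite Cmod_0. assumption. }
        rewrite H1.
        { apply Hs. split; [apply Cmod_gt_0, Cminus_eq_contra, Ny|assumption]. }
        intros p Hp ->. specialize (Hrp p Hp). lra.
      * specialize (Hrp q ltac:(lia)). apply (Ccont_ext_loc G' _ _ r); [assumption| |apply H2; lia].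
        intros y Hy. destruct (Ceq_dec y (z (S n))) as [->|]; [|reflexivity]. rewrite Cmod_sub_sym in Hy. lra.
Qed.

(** Y is defined by branch P where possible and by branch 0 elsewhere. The poles are filled in by
    limits: at an exceptional pole F_0 vanishes to the order of E, and at the others polynomial
    growth and the descent give boundedness; both times the singularity is removable. *)
Theorem Y_exists (d : nat -> C) (Gam : nat -> contour) (F0 FP : C -> C) :
  (forall m, (1 <= m <= P)%nat -> is_Cm eps P c z m (Gam m)) ->
  (forall m, (1 <= m <= P)%nat -> is_line (cint 0 d (Gam m)) 0) -> is_prim 0 0 d F0 -> is_prim P 0 d FP ->
  exists Y : C -> C,
    (forall x, slit_dom 0 x -> Y x = Yq 0 F0 x) /\ (forall x, slit_dom P x -> Y x = Yq P FP x) /\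
    (forall x, 0 <= Im x -> (forall p, (1 <= p <= P)%nat -> x <> z p) ->
       Cder Y x (Ci / RtoC eps * ((RtoC lam + u0 P c z x) * Y x - Rd 0 d x))%C) /\
    (forall x, 0 <= Im x -> Ccont Y x).
Proof.
  intros HG HL HF0 HFP.
  set (Yt := fun x => if ClassicalEpsilon.excluded_middle_informative (slit_dom P x) then Yq P FP x else Yq 0 F0 x).
  assert (YP : forall x, slit_dom P x -> Yt x = Yq P FP x).
  { intros x Hx. unfold Yt. destruct (ClassicalEpsilon.excluded_middle_informative _); [reflexivity|contradiction]. }
  (* A point common to both domains is off the vertical lines through the poles: on such a line one
     domain requires it above z_p, the other below. *)
  assert (Y0 : forall x, slit_dom 0 x -> Yt x = Yq 0 F0 x).
  { intros x Hx. unfold Yt. destruct (ClassicalEpsilon.excluded_middle_informative _) as [H|]; [|reflexivity].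
    apply (Yq_agree d Gam); try assumption. intros p Hp E. destruct (H p Hp) as [A1 _]. specialize (A1 (proj2 Hp)).
    destruct (Hx p Hp) as [_ A2]. destruct (A2 ltac:(lia)) as [A3 _]. unfold down_ray, up_ray in *. lra. }
  (* A point missed by branch P lies strictly below some z_p and, having Im x >= 0, above the cut of
     the conjugate; branch 0 covers it. *)
  assert (Cov : forall x, 0 <= Im x -> (forall p, (1 <= p <= P)%nat -> x <> z p) -> slit_dom P x \/ slit_dom 0 x).
  { intros x Hx Hn. destruct (Classical_Prop.classic (slit_dom P x)) as [H|H]; [left; exact H|right].
    apply Classical_Pred_Type.not_all_ex_not in H. destruct H as [p H]. apply Classical_Prop.imply_to_and in H. destruct H as [Hp H].
    assert (Hdn : down_ray (z p) x).
    { apply Classical_Prop.NNPP. intros Hno. apply H. split; [intros _; exact Hno|lia]. }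
    destruct Hdn as [D1 D2].
    assert (D3 : Im x <> Im (z p)) by (intros E; apply (Hn p Hp); apply C_ext; assumption).
    intros p' Hp'. split; [lia|]. intros _. unfold up_ray, down_ray. rewrite re_conj, im_conj. assert (Him' := Him p' Hp').
    destruct (Nat.eq_dec p' p) as [->|E]; [lra|]. assert (N := z_neq p' p Hp' Hp E). lra. }
  assert (Ode : forall x, 0 <= Im x -> (forall p, (1 <= p <= P)%nat -> x <> z p) ->
       Cder Yt x (Ci / RtoC eps * ((RtoC lam + u0 P c z x) * Yt x - Rd 0 d x))%C).
  { intros x Hx Hn. destruct (Cov x Hx Hn) as [H|H]; destruct (slit_dom_open _ x H) as (r & Hr & Ho).
    - rewrite (YP x H). apply (Cder_ext_loc (Yq P FP) _ _ _ r Hr); [intros y Hy; symmetry; apply YP, Ho, Hy|]. apply Yq_ode; assumption.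
    - rewrite (Y0 x H). apply (Cder_ext_loc (Yq 0 F0) _ _ _ r Hr); [intros y Hy; symmetry; apply Y0, Ho, Hy|]. apply Yq_ode; assumption. }
  assert (Oden : forall q, (1 <= q <= P)%nat -> ode_near q d Yt).
  { intros q Hq x r Hr Hx. apply Ode.
    - apply Rlt_le. apply (near_neq q q r); assumption.
    - intros p Hp. apply (near_neq q p r); assumption. }
  assert (Bd : forall q, (1 <= q <= P)%nat -> bounded_order q 0 Yt).
  { intros q Hq. destruct (Classical_Prop.classic (exceptional eps c q)) as [Hex|Hne].
    - destruct (exceptional_limit q 0 d F0 Hq Hex HF0) as (n & L & K & r & Hn & Hr & HK & HLim). assert (Hr0 : 0 < r) by apply Hr.
      assert (L0 : L = 0).
      { apply (is_line_value (cint 0 d (Gam q))); [|apply HL, Hq]. apply (line_ell0 q n 0 d F0 (Gam q) L K r); try assumption. apply HG; assumption. }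
      subst L. destruct (Eb_near_pow q n r Hq Hr Hn) as (K1 & HK1 & HE).
      exists r, (/ eps * (K * K1)). split; [assumption|]. assert (Hie : 0 < / eps) by (apply Rinv_0_lt_compat; assumption).
      split; [apply Rmult_le_pos; [lra|apply Rmult_le_pos; lra]|].
      apply (bounded_order_dense q 0 d Yt); [assumption|apply Oden, Hq|]. intros x Hx HxR.
      assert (Hs : slit_dom 0 x) by (apply (near_slit_up q 0 r); try assumption; [lia|lra|intros [H _]; contradiction]).
      rewrite (Y0 x Hs). specialize (HLim x Hs (proj2 Hx)). replace (F0 x - 0)%C with (F0 x) in HLim by ring. specialize (HE 0%nat x Hx).
      set (rho := Cmod (x - z q)) in *. assert (Hp : 0 < rho ^ S n) by (apply pow_lt; lra).
      assert (Hinv : Cmod (/ Eb 0 x) <= K1 * / rho ^ S n).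
      { rewrite Cmod_inv by apply Eb_neq_0. replace (K1 * / rho ^ S n) with (/ (/ K1 * rho ^ S n)) by (field; split; lra).
        apply Rinv_le_contravar; [|apply HE]. apply Rmult_lt_0_compat; [apply Rinv_0_lt_compat; assumption|assumption]. }
      change ((x - z q) ^ 0)%C with (RtoC 1). rewrite Cmult_1_l.
      unfold Yq, Cdiv. rewrite !Cmod_mult, Cmod_opp, Cmod_Ci, (Cmod_inv (RtoC eps)), Cmod_R, Rabs_pos_eq, Rmult_1_l by (apply eps_neq_0 || lra).
      apply Rmult_le_compat_l; [lra|]. apply Rle_trans with (K * rho ^ S n * (K1 * / rho ^ S n)).
      + apply Rmult_le_compat; try apply Cmod_ge_0; assumption.
      + apply Req_le. field. lra.
    - destruct (Yq_growth q d F0 Hq HF0) as (N & r & B & Hr & HB & Hg).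
      apply (bounded_order_0 q N d Yt); try assumption; [apply Oden, Hq|].
      exists r, B. split; [assumption|]. split; [assumption|].
      apply (bounded_order_dense q N d Yt); [assumption|apply Oden, Hq|]. intros x Hx HxR.
      rewrite Y0; [apply Hg; assumption|]. apply (near_slit_up q 0 r); try assumption; [lia|lra|intros [H _]; contradiction]. }
  destruct (patch_points P Yt (le_n P)) as (Y & E & HC).
  { intros q Hq. destruct (Bd q Hq) as (r & B & Hr & HB & Hb). assert (Hr0 : 0 < r) by apply Hr.
    destruct (Riemann_removable Yt (z q) (r / 3) B) as (Yh & B' & Eh & Hh); [lra|assumption| | |].
    - intros x Hx. eexists. apply (Oden q Hq x r Hr). lra.
    - intros x Hx. specialize (Hb x ltac:(lra)). change ((x - z q) ^ 0)%C with (RtoC 1) in Hb. rewrite Cmult_1_l in Hb. exact Hb.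
    - exists (Yh (z q)). intros e He. destruct (Hh (z q)) as (l & Hl & _).
      { replace (z q - z q)%C with (RtoC 0) by ring. rewrite Cmod_0. lra. }
      destruct (Cder_cont _ _ _ Hl e He) as (dl & Hdl & Hs). exists (Rmin dl (r / 3 / 2)). split; [apply Rmin_pos; lra|]. intros x [Hx0 Hx].
      rewrite <- Eh; [apply Hs|]; [|split; [assumption|]]; (eapply Rlt_le_trans; [exact Hx|]); [apply Rmin_l|apply Rmin_r]. }
  exists Y.
  assert (Nz : forall m x, slit_dom m x -> forall p, (1 <= p <= P)%nat -> x <> z p).
  { intros m x Hx p Hp. apply (slit_dom_neq m p x Hx Hp). }
  split; [|split; [|split]].
  - intros x Hx. rewrite E by apply (Nz 0%nat x Hx). apply Y0, Hx.
  - intros x Hx. rewrite E by apply (Nz P x Hx). apply YP, Hx.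
  - intros x Hx Hn. rewrite (E x Hn).
    destruct (uniform_radius P (fun p r => r <= Cmod (z p - x))) as (r & Hr & Hrp); [intros; lra| |].
    { intros p Hp. exists (Cmod (z p - x)). split; [|lra]. apply Cmod_gt_0, Cminus_eq_contra. intros E'. apply (Hn p Hp). symmetry. exact E'. }
    apply (Cder_ext_loc Yt _ _ _ r Hr); [|apply Ode; assumption]. intros y Hy. symmetry. apply E. intros p Hp ->. specialize (Hrp p Hp). lra.
  - intros x Hx. destruct (Classical_Prop.classic (exists p, (1 <= p <= P)%nat /\ x = z p)) as [(p & Hp & ->)|Hno].
    + apply HC, Hp.
    + assert (Hn : forall p, (1 <= p <= P)%nat -> x <> z p) by (intros p Hp E'; apply Hno; exists p; split; assumption).
      destruct (uniform_radius P (fun p r => r <= Cmod (z p - x))) as (r & Hr & Hrp); [intros; lra| |].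
      { intros p Hp. exists (Cmod (z p - x)). split; [|lra]. apply Cmod_gt_0, Cminus_eq_contra. intros E'. apply (Hn p Hp). symmetry. exact E'. }
      apply (Ccont_ext_loc Yt _ _ r Hr); [|eapply Cder_cont, Ode; assumption]. intros y Hy. symmetry. apply E. intros p Hp ->. specialize (Hrp p Hp). lra.
Qed.

(** * The virial identity *)

Lemma Ccont_Csum (n : nat) (F : nat -> C -> C) (x : C) : (forall p, (1 <= p <= n)%nat -> Ccont (F p) x) ->
  Ccont (fun y => Csum n (fun p => F p y)) x.
Proof.
  induction n as [|n IH]; intros H.
  - apply (Ccont_ext_loc (fun _ => RtoC 0) _ _ 1 Rlt_0_1); [intros; rewrite Csum_0; reflexivity|apply Ccont_const].
  - apply (Ccont_ext_loc (fun y => Csum n (fun p => F p y) + F (S n) y)%C _ _ 1 Rlt_0_1); [intros; rewrite Csum_S; reflexivity|].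
    apply Ccont_plus; [apply IH; intros; apply H; lia|apply H; lia].
Qed.

Definition Rd1 (d : nat -> C) (x : C) : C := Csum P (fun p => - d p / ((x - z p) * (x - z p)))%C.

(* The subtracted term cancels the leading behaviour of the primitive at infinity:
   the derivative [dHf] decays by a factor 1/x faster than that of [F]. *)
Definition Hf (m : nat) (d : nat -> C) (F : C -> C) (x : C) : C :=
  (F x - Ci * RtoC eps / RtoC lam * (Eb m x * Rd 0 d x))%C.

Definition dHf (m : nat) (d : nat -> C) (x : C) : C :=
  (- / RtoC lam * (Eb m x * (u0 P c z x * Rd 0 d x + Ci * RtoC eps * Rd1 d x)))%C.

Lemma Cder_Hf (m : nat) (d : nat -> C) (F : C -> C) (x : C) : is_prim m 0 d F -> slit_dom m x ->
  Cder (Hf m d F) x (dHf m d x) /\ Ccont (dHf m d) x.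
Proof.
  intros HF Hx. assert (Nx : forall p, (1 <= p <= P)%nat -> x <> z p) by (intros p Hp; apply (slit_dom_neq m); assumption). split.
  - unfold Hf, dHf. eapply Cder_eq; [|apply Cder_minus; [apply HF, Hx|apply Cder_scal, Cder_mult; [apply Cder_Eb, Hx|apply Cder_Rd, Nx]]].
    fold (Rd1 d x). assert (Hi : (Ci * Ci)%C = (-1)%C) by (apply C_ext; simpl; ring).
    set (E := Eb m x). set (R := Rd 0 d x). set (u := u0 P c z x).
    transitivity (E * R + (Ci * Ci) / RtoC lam * (RtoC lam + u) * E * R - Ci * RtoC eps / RtoC lam * E * Rd1 d x)%C.
    + field. split; [apply lam_neq_0|apply eps_neq_0].
    + rewrite Hi. field. apply lam_neq_0.
  - unfold dHf. apply Ccont_mult; [apply Ccont_const|]. apply Ccont_mult; [eapply Cder_cont, Cder_Eb, Hx|]. apply Ccont_plus.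
    + apply Ccont_mult; [|eapply Cder_cont, Cder_Rd, Nx]. apply Ccont_u0. intros p Hp. apply (slit_dom_neq m); assumption.
    + apply Ccont_mult; [apply Ccont_const|]. apply Ccont_Csum. intros p Hp.
      assert (D : Ccont (fun y => y - z p)%C x) by (apply Ccont_minus; [apply Ccont_id|apply Ccont_const]).
      apply Ccont_div; [|apply Ccont_const|apply Ccont_mult; exact D].
      apply Cmult_neq_0; apply Cminus_eq_contra, Nx, Hp.
Qed.

Lemma dHf_far (R0 : R) (d : nat -> C) : far R0 -> exists k, 0 <= k /\ forall m x, R0 <= Cmod x ->
  Cmod (dHf m d x) <= k * / (Cmod x * Cmod x) * exp (lam / eps * Im x).
Proof.
  intros HR. destruct (Eb_far R0 HR) as (K & HK & HE). destruct (u0_far R0 HR) as (K1 & HK1 & HU).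
  destruct (Rd_far R0 d HR) as (K2 & HK2 & HRd). destruct (Rd_der_far R0 d HR) as (K3 & HK3 & HR1).
  exists (/ lam * (K * (K1 * K2 + eps * K3))). assert (Hl : 0 < / lam) by (apply Rinv_0_lt_compat; assumption). split.
  { repeat apply Rmult_le_pos; try lra. apply Rplus_le_le_0_compat; apply Rmult_le_pos; lra. }
  intros m x Hx. assert (H1 : 0 < Cmod x) by (destruct HR; lra).
  unfold dHf. rewrite Cmod_mult, Cmod_opp, Cmod_inv, Cmod_R, Rabs_pos_eq by (apply lam_neq_0 || lra). rewrite Cmod_mult.
  set (rho := Cmod x) in *. set (X := exp _).
  replace (/ lam * (K * (K1 * K2 + eps * K3)) * / (rho * rho) * X) with (/ lam * (K * X * ((K1 * / rho) * (K2 * / rho) + eps * (K3 * / (rho * rho))))) by (field; lra).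
  apply Rmult_le_compat_l; [lra|]. apply Rmult_le_compat; try apply Cmod_ge_0; [apply HE, Hx|].
  eapply Rle_trans; [apply Cmod_triangle|]. rewrite !Cmod_mult, Cmod_Ci, Cmod_R, Rmult_1_l, Rabs_pos_eq by lra.
  apply Rplus_le_compat; [|apply Rmult_le_compat_l; [lra|apply HR1, Hx]].
  apply Rmult_le_compat; try apply Cmod_ge_0; [apply HU, Hx|apply HRd, Hx].
Qed.

Lemma far_inv_sq (R0 a rho : R) : far R0 -> R0 <= a -> a <= rho -> / (rho * rho) <= / (a * a).
Proof. intros [H _] H1 H2. apply Rinv_le_contravar; nra. Qed.

(** Integration of [dHf] upwards from -i oo, its factor 1/|x|^2 being at most 1/X^2 on this line.
    The constant precedes m and F: the estimate serves branch 0 on the left edge and branch P at the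
    start of the top edge. *)
Lemma Hf_left (R0 : R) (d : nat -> C) : far R0 -> exists k, 0 <= k /\ forall m F X s, (m <= P)%nat -> is_prim m 0 d F -> R0 <= X ->
  Cmod (Hf m d F ((- X)%R, s)) <= k * / (X * X) * exp (lam / eps * s).
Proof.
  intros HR. destruct (dHf_far R0 d HR) as (k & Hk & HD). assert (HR1 : 1 <= R0) by apply HR.
  assert (Hkap : 0 < lam / eps) by (apply Rdiv_lt_0_compat; assumption).
  exists (k * / (lam / eps)). split; [apply Rmult_le_pos; [assumption|apply Rlt_le, Rinv_0_lt_compat, Hkap]|].
  intros m F X s Hm HF HX.
  assert (HX0 : (- X)%R < Re (z 1%nat)).
  { destruct HR as [_ HR]. specialize (HR 1%nat ltac:(lia)). generalize (re_le_Cmod (z 1%nat)) (Rcomplements.Rabs_le_between (Re (z 1%nat)) (Cmod (z 1%nat))) (Cmod_ge_0 (z 1%nat)).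
    intros G1 G2 G3. apply G2 in G1. lra. }
  assert (Hi : 0 < / (X * X)) by (apply Rinv_0_lt_compat; nra).
  replace (k * / (lam / eps) * / (X * X) * exp (lam / eps * s)) with ((k * / (X * X)) / (lam / eps) * exp (lam / eps * s)) by (field; repeat split; lra).
  apply (vert_decay (Hf m d F) (dHf m d)).
  - apply Rmult_le_pos; lra.
  - intros t _. assert (Hs : slit_dom m ((- X)%R, t)) by (apply slit_dom_G0; exact HX0).
    destruct (Cder_Hf m d F _ HF Hs) as [D1 D2]. split; [exact D1|]. split; [exact D2|].
    destruct (left_Cmod R0 (- X) t) as [L1 L2]; [lra|]. rewrite Rabs_Ropp, Rabs_pos_eq in L2 by lra.
    eapply Rle_trans; [apply HD, L1|]. apply Rmult_le_compat_r; [apply Rlt_le, exp_pos|]. apply Rmult_le_compat_l; [assumption|].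
    apply (far_inv_sq R0); assumption.
  - intros e He. destruct (Rd_far R0 d HR) as (K2 & HK2 & HRd).
    destruct (is_prim_vert_null m 0 d F (- X) HF HX0 (e / 2)) as [B1 HB1]; [lra|].
    destruct (Eb_vert_null m (Ci * RtoC eps / RtoC lam * RtoC K2)%C (- X) (e / 2)) as [B2 HB2]; [lra|].
    exists (Rmin B1 B2). intros t Ht. specialize (HB1 t (Rle_trans _ _ _ Ht (Rmin_l _ _))). specialize (HB2 t (Rle_trans _ _ _ Ht (Rmin_r _ _))).
    unfold Hf. eapply Rle_lt_trans; [apply Cmod_triangle|]. rewrite Cmod_opp.
    destruct (left_Cmod R0 (- X) t) as [L1 L2]; [lra|]. specialize (HRd _ L1).
    assert (G : Cmod (Ci * RtoC eps / RtoC lam * (Eb m ((- X)%R, t) * Rd 0 d ((- X)%R, t))) <= Cmod (Ci * RtoC eps / RtoC lam * RtoC K2 * Eb m ((- X)%R, t))).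
    { rewrite !(Cmod_mult (Ci * RtoC eps / RtoC lam)), !(Cmod_mult (Ci * RtoC eps / RtoC lam * RtoC K2)), (Cmod_mult (Eb m _)), (Cmod_mult _ (RtoC K2)), (Cmod_R K2), (Rabs_pos_eq K2) by assumption.
      rewrite Rmult_assoc. apply Rmult_le_compat_l; [apply Cmod_ge_0|]. rewrite Rmult_comm. apply Rmult_le_compat_r; [apply Cmod_ge_0|].
      eapply Rle_trans; [exact HRd|]. rewrite <- (Rmult_1_r K2) at 2. apply Rmult_le_compat_l; [assumption|]. rewrite <- Rinv_1. apply Rinv_le_contravar; lra. }
    lra.
Qed.

(** The path runs along the real axis from a fixed point, where 1/t^2 is integrable, and then
    upwards. The bounded term does not tend to 0 with X: it is the part of Y that may be transmitted
    to +oo. *)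
Lemma Hf_right (R0 : R) (d : nat -> C) (F : C -> C) : far R0 -> is_prim 0 0 d F ->
  exists k, 0 <= k /\ forall X s, R0 <= X -> 0 <= s -> Cmod (Hf 0 d F (X, s)) <= k * (1 + / (X * X) * exp (lam / eps * s)).
Proof.
  intros HR HF. destruct (dHf_far R0 d HR) as (k & Hk & HD). assert (HR1 : 1 <= R0) by apply HR.
  assert (Hkap : 0 < lam / eps) by (apply Rdiv_lt_0_compat; assumption). set (kap := lam / eps) in *.
  set (A := Cmod (Hf 0 d F (R0, 0))). assert (HA : 0 <= A) by apply Cmod_ge_0.
  assert (Hik : 0 < / kap) by (apply Rinv_0_lt_compat; assumption).
  assert (HX0 : forall X, R0 <= X -> forall p, (1 <= p <= P)%nat -> Re (z p) < X).
  { intros X HX p Hp. destruct HR as [_ HR]. specialize (HR p Hp). generalize (Rle_abs (Re (z p))) (re_le_Cmod (z p)) (Cmod_ge_0 (z p)). lra. }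
  assert (HS : forall X s, R0 <= X -> slit_dom 0 (X, s)).
  { intros X s HX. apply slit_dom_off. intros p Hp E. specialize (HX0 X HX p Hp). simpl in E. lra. }
  exists (A + k + k * / kap). split; [assert (0 <= k * / kap) by (apply Rmult_le_pos; lra); lra|].
  intros X s HX Hs.
  assert (B1 : Cmod (Hf 0 d F (X, 0) - Hf 0 d F (R0, 0)) <= k).
  { eapply Rle_trans; [apply (Rder_bound_by (fun t => Hf 0 d F (t, 0)) (fun t => dHf 0 d (t, 0)) (fun t => - k * / t) (fun t => k * / (t * t)) R0 X HX)|].
    - intros t Ht. apply Cder_horiz, Cder_Hf; [assumption|]. apply HS; lra.
    - intros t Ht. apply Ccont_horiz, (Cder_Hf 0 d F); [assumption|]. apply HS; lra.
    - intros t Ht. auto_derive; [lra|]. field. lra.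
    - intros t Ht. apply (ex_derive_continuous (K := R_AbsRing) (V := R_NormedModule)). auto_derive. nra.
    - intros t Ht. assert (L : R0 <= Cmod (t, 0)) by (eapply Rle_trans; [|apply re_le_Cmod]; simpl; rewrite Rabs_pos_eq; lra).
      eapply Rle_trans; [apply HD, L|]. change (Im (t, 0)) with 0. rewrite Rmult_0_r, exp_0, Rmult_1_r.
      apply Rmult_le_compat_l; [assumption|]. apply (far_inv_sq R0); [assumption|lra|].
      eapply Rle_trans; [|apply re_le_Cmod]. simpl. apply Rle_abs.
    - assert (0 < / X) by (apply Rinv_0_lt_compat; lra). assert (/ R0 <= 1) by (rewrite <- Rinv_1; apply Rinv_le_contravar; lra). nra. }
  assert (Hi : 0 < / (X * X)) by (apply Rinv_0_lt_compat; nra).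
  assert (B2 : Cmod (Hf 0 d F (X, s) - Hf 0 d F (X, 0)) <= k * / kap * (/ (X * X) * exp (kap * s))).
  { eapply Rle_trans; [apply (Rder_bound_exp (fun t => Hf 0 d F (X, t)) (fun t => dHf 0 d (X, t) * Ci)%C (k * / (X * X)) kap 0 s Hs Hkap)|].
    - intros t Ht. apply Cder_vert, Cder_Hf; [assumption|]. apply HS; lra.
    - intros t Ht. apply Rcont_mult; [|apply (Ccont_Rcont (fun _ => Ci) (fun _ => Ci)); [apply Ccont_const|apply (Rder_cont _ _ 0), Rder_eq with (l := (0 * 1)%C); [ring|]]].
      + apply Ccont_vert, (Cder_Hf 0 d F); [assumption|]. apply HS; lra.
      + apply (Cder_Rder (fun _ => Ci) RtoC t 0 1); [apply Cder_const|]. apply is_derive_ext with (f := fun s => (0 + 1 * RtoC s)%C); [intros u; apply C_ext; simpl; ring|apply Rder_affine].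
    - intros t Ht. rewrite Cmod_mult, Cmod_Ci, Rmult_1_r.
      assert (L0 : X <= Cmod (X, t)) by (eapply Rle_trans; [|apply re_le_Cmod]; simpl; apply Rle_abs).
      eapply Rle_trans; [apply HD; lra|]. apply Rmult_le_compat_r; [apply Rlt_le, exp_pos|]. apply Rmult_le_compat_l; [assumption|].
      apply (far_inv_sq R0); assumption.
    - rewrite Rmult_0_r, exp_0. assert (0 <= k * / (X * X) / kap * 1) by (unfold Rdiv; repeat apply Rmult_le_pos; lra).
      unfold Rdiv in *. lra. }
  replace (Hf 0 d F (X, s)) with ((Hf 0 d F (X, s) - Hf 0 d F (X, 0)) + ((Hf 0 d F (X, 0) - Hf 0 d F (R0, 0)) + Hf 0 d F (R0, 0)))%C by ring.
  eapply Rle_trans; [apply Cmod_triangle|]. eapply Rle_trans; [apply Rplus_le_compat_l, Cmod_triangle|]. fold A.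
  assert (0 <= / (X * X) * exp (kap * s)) by (apply Rmult_le_pos; [lra|apply Rlt_le, exp_pos]).
  assert (0 <= k * / kap) by (apply Rmult_le_pos; lra). set (u := / (X * X) * exp (kap * s)) in *. nra.
Qed.

(** Above all poles branch P has no cut, so the top edge is traversed from its left corner; its
    length 2 X multiplies a derivative of size 1/T^2 relative to the exponential. *)
Lemma Hf_top (R0 : R) (d : nat -> C) (F : C -> C) : far R0 -> is_prim P 0 d F ->
  exists k, 0 <= k /\ forall X T u, R0 <= X -> R0 <= T -> above T -> - X <= u <= X ->
    Cmod (Hf P d F (u, T)) <= k * (/ (X * X) + X * / (T * T)) * exp (lam / eps * T).
Proof.
  intros HR HF. destruct (dHf_far R0 d HR) as (k & Hk & HD). assert (HR1 : 1 <= R0) by apply HR.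
  destruct (Hf_left R0 d HR) as (k' & Hk' & HL).
  exists (k' + 2 * k). split; [lra|]. intros X T u HX HT HaT Hu.
  assert (HS : forall t, slit_dom P (t, T)) by (intros t; apply left_base; [assumption|intros p Hp; lia]).
  specialize (HL P F X T (le_n P) HF HX). set (E := exp _) in *. assert (HE : 0 < E) by apply exp_pos.
  assert (Hi : 0 < / (X * X)) by (apply Rinv_0_lt_compat; nra). assert (Hi2 : 0 < / (T * T)) by (apply Rinv_0_lt_compat; nra).
  assert (B : Cmod (Hf P d F (u, T) - Hf P d F ((- X)%R, T)) <= k * / (T * T) * E * Rabs (u - (- X))).
  { apply (Rder_bound (fun t => Hf P d F (t, T)) (fun t => dHf P d (t, T))).
    - intros t _. apply Cder_horiz, Cder_Hf; [assumption|apply HS].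
    - intros t _. apply Ccont_horiz, (Cder_Hf P d F); [assumption|apply HS].
    - intros t _. assert (L : T <= Cmod (t, T)) by (eapply Rle_trans; [|apply im_le_Cmod]; simpl; apply Rle_abs).
      eapply Rle_trans; [apply HD; lra|]. change (Im (t, T)) with T. fold E. apply Rmult_le_compat_r; [lra|].
      apply Rmult_le_compat_l; [assumption|]. apply (far_inv_sq R0); assumption. }
  rewrite Rabs_pos_eq in B by lra.
  replace (Hf P d F (u, T)) with ((Hf P d F (u, T) - Hf P d F ((- X)%R, T)) + Hf P d F ((- X)%R, T))%C by ring.
  eapply Rle_trans; [apply Cmod_triangle|].
  assert (k * / (T * T) * E * (u - - X) <= k * / (T * T) * E * (2 * X)) by (apply Rmult_le_compat_l; [repeat apply Rmult_le_pos; lra|lra]).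
  assert (0 <= k' * (X * / (T * T)) * E) by (repeat apply Rmult_le_pos; lra).
  assert (0 <= 2 * k * / (X * X) * E) by (repeat apply Rmult_le_pos; lra). lra.
Qed.

(** The difference Y - R/lam is -(i/eps) H/E with H the function [Hf], and |E| is comparable with
    e^{lam Im x / eps}. The bounded part of H on the right becomes the term decaying in s. *)
Lemma Yq_asym (d : nat -> C) (F0 FP Y : C -> C) : is_prim 0 0 d F0 -> is_prim P 0 d FP ->
  (forall x, slit_dom 0 x -> Y x = Yq 0 F0 x) -> (forall x, slit_dom P x -> Y x = Yq P FP x) ->
  exists R0 k, far R0 /\ above R0 /\ 0 <= k /\ forall X T, R0 <= X -> R0 <= T ->
    (forall s, Cmod (Y ((- X)%R, s) - Rd 0 d ((- X)%R, s) / RtoC lam) <= k * / (X * X)) /\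
    (forall s, 0 <= s -> Cmod (Y (X, s) - Rd 0 d (X, s) / RtoC lam) <= k * (exp (- (lam / eps * s)) + / (X * X))) /\
    (forall u, - X <= u <= X -> Cmod (Y (u, T) - Rd 0 d (u, T) / RtoC lam) <= k * (/ (X * X) + X * / (T * T))).
Proof.
  intros HF0 HFP HY0 HYP. destruct far_ex as [R1 HR1]. destruct above_ex as (T1 & HT1 & HT0).
  set (R0 := Rmax R1 T1). assert (L1 : R1 <= R0) by apply Rmax_l. assert (L2 : T1 <= R0) by apply Rmax_r.
  assert (HR : far R0). { destruct HR1 as [A1 A2]. split; [lra|]. intros p Hp. specialize (A2 p Hp). lra. }
  assert (HA : above R0) by (intros p Hp; specialize (HT1 p Hp); lra).
  destruct (Eb_far R0 HR) as (K & HK & HE). destruct (Hf_left R0 d HR) as (k1 & Hk1 & H1).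
  destruct (Hf_right R0 d F0 HR HF0) as (k2 & Hk2 & H2). destruct (Hf_top R0 d FP HR HFP) as (k3 & Hk3 & H3).
  set (kap := lam / eps) in *. assert (HRR : 1 <= R0) by apply HR.
  assert (Hie : 0 < / eps) by (apply Rinv_0_lt_compat; assumption).
  assert (Key : forall m F x B, is_prim m 0 d F -> slit_dom m x -> R0 <= Cmod x -> Cmod (Hf m d F x) <= B ->
    Cmod (Yq m F x - Rd 0 d x / RtoC lam) <= / eps * K * (B * exp (- (kap * Im x)))).
  { intros m F x B HF Hs Hx HB.
    replace (Yq m F x - Rd 0 d x / RtoC lam)%C with (- Ci / RtoC eps * (Hf m d F x / Eb m x))%C.
    - unfold Cdiv. rewrite !Cmod_mult, Cmod_opp, Cmod_Ci, !Cmod_inv, Cmod_R, Rabs_pos_eq, Rmult_1_l by (apply eps_neq_0 || apply Eb_neq_0 || lra).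
      rewrite Rmult_assoc. apply Rmult_le_compat_l; [lra|]. destruct (HE m x Hx) as [E1 _]. fold kap in E1.
      assert (HX := exp_pos (kap * Im x)). assert (HiK : 0 < / K) by (apply Rinv_0_lt_compat; assumption).
      assert (Hinv : / Cmod (Eb m x) <= K * exp (- (kap * Im x))).
      { rewrite exp_Ropp. replace (K * / exp (kap * Im x)) with (/ (/ K * exp (kap * Im x))) by (field; lra).
        apply Rinv_le_contravar; [apply Rmult_lt_0_compat; assumption|exact E1]. }
      replace (K * (B * exp (- (kap * Im x)))) with (B * (K * exp (- (kap * Im x)))) by ring.
      apply Rmult_le_compat; [apply Cmod_ge_0| |exact HB|exact Hinv].
      apply Rlt_le, Rinv_0_lt_compat, Cmod_gt_0, Eb_neq_0.
    - unfold Yq, Hf. assert (NE := Eb_neq_0 m x). set (E := Eb m x) in *. set (R := Rd 0 d x). assert (Hi : (Ci * Ci)%C = (-1)%C) by (apply C_ext; simpl; ring).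
      transitivity (- Ci / RtoC eps * (F x / E) + (Ci * Ci) * (R / RtoC lam))%C; [|rewrite Hi; ring].
      field. repeat split; first [exact NE|apply lam_neq_0|apply eps_neq_0]. }
  assert (Hek : 0 <= / eps * K) by (apply Rmult_le_pos; lra).
  exists R0, (/ eps * K * (k1 + k2 + k3)). split; [exact HR|]. split; [exact HA|]. split; [apply Rmult_le_pos; lra|].
  intros X T HX HT. assert (Hi : 0 < / (X * X)) by (apply Rinv_0_lt_compat; nra). assert (Hi2 : 0 < / (T * T)) by (apply Rinv_0_lt_compat; nra).
  assert (Ex : forall s, exp (kap * s) * exp (- (kap * s)) = 1) by (intros s; rewrite <- exp_plus, Rplus_opp_r; apply exp_0).
  assert (HX0 : forall p, (1 <= p <= P)%nat -> - X < Re (z p) < X).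
  { intros p Hp. destruct HR as [_ HR]. specialize (HR p Hp). generalize (re_le_Cmod (z p)) (Cmod_ge_0 (z p)). intros G1 G2. apply Rcomplements.Rabs_le_between in G1. lra. }
  split; [|split].
  - intros s. assert (Hs : slit_dom 0 ((- X)%R, s)) by (apply slit_dom_G0; unfold in_G0; simpl; apply HX0; lia).
    destruct (left_Cmod R0 (- X) s) as [LC _]; [lra|]. rewrite HY0 by exact Hs.
    eapply Rle_trans; [eapply (Key _ _ _ _ HF0 Hs LC), (H1 0%nat F0 X s); [lia|assumption|assumption]|].
    change (Im ((- X)%R, s)) with s. fold kap. rewrite (Rmult_assoc (k1 * / (X * X))), Ex, Rmult_1_r, (Rmult_assoc (/ eps * K)).
    apply Rmult_le_compat_l; [assumption|]. apply Rmult_le_compat_r; lra.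
  - intros s Hs0. assert (Hs : slit_dom 0 (X, s)) by (apply slit_dom_off; intros p Hp E; specialize (HX0 p Hp); simpl in E; lra).
    assert (LC : R0 <= Cmod (X, s)) by (eapply Rle_trans; [|apply re_le_Cmod]; simpl; rewrite Rabs_pos_eq; lra).
    rewrite HY0 by exact Hs. eapply Rle_trans; [eapply (Key _ _ _ _ HF0 Hs LC), (H2 X s); assumption|].
    change (Im (X, s)) with s. fold kap. rewrite (Rmult_assoc (/ eps * K) (k1 + k2 + k3)). apply Rmult_le_compat_l; [assumption|].
    replace (k2 * (1 + / (X * X) * exp (kap * s)) * exp (- (kap * s))) with (k2 * (exp (- (kap * s)) + / (X * X) * (exp (kap * s) * exp (- (kap * s))))) by ring.
    rewrite Ex, Rmult_1_r. apply Rmult_le_compat_r; [|lra]. generalize (exp_pos (- (kap * s))). lra.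
  - intros u Hu. assert (HaT : above T) by (intros p Hp; specialize (HA p Hp); lra).
    assert (Hs : slit_dom P (u, T)) by (apply left_base; [assumption|intros p Hp; lia]).
    assert (LC : R0 <= Cmod (u, T)) by (eapply Rle_trans; [|apply im_le_Cmod]; simpl; rewrite Rabs_pos_eq; lra).
    rewrite HYP by exact Hs. eapply Rle_trans; [eapply (Key _ _ _ _ HFP Hs LC), (H3 X T u); assumption|].
    change (Im (u, T)) with T. fold kap. rewrite (Rmult_assoc (k3 * (/ (X * X) + X * / (T * T)))), Ex, Rmult_1_r, (Rmult_assoc (/ eps * K)).
    apply Rmult_le_compat_l; [assumption|]. apply Rmult_le_compat_r; [|lra].
    assert (0 <= X * / (T * T)) by (apply Rmult_le_pos; lra). lra.
Qed.

(** * The integrand of the virial identity on the sides of the rectangle *)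

Lemma Csum_far2 (n : nat) (R0 : R) (a w : nat -> C) : 1 <= R0 -> (forall p, (1 <= p <= n)%nat -> 2 * Cmod (w p) + 1 <= R0) ->
  exists K, 0 <= K /\ forall x, R0 <= Cmod x -> Cmod (Csum n (fun p => a p / (x - w p))%C - Csum n a / x) <= K * / (Cmod x * Cmod x).
Proof.
  intros HR Hw. destruct (Csum_bound_uniform n (fun x : C => R0 <= Cmod x) (fun p x => (a p / (x - w p) - a p * / x)%C) (fun x => / (Cmod x * Cmod x))) as (K & HK & H).
  - intros x Hx. apply Rlt_le, Rinv_0_lt_compat. nra.
  - intros p Hp. exists (2 * (Cmod (a p) * Cmod (w p))). intros x Hx. specialize (Hw p Hp).
    assert (Nx : (x <> 0)%C) by (intros ->; rewrite Cmod_0 in Hx; lra).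
    assert (D : Cmod x / 2 <= Cmod (x - w p)) by (generalize (Cmod_triangle_rev x (w p)) (Cmod_ge_0 (w p)); lra).
    assert (Nw : (x - w p <> 0)%C) by (intros E; rewrite E, Cmod_0 in D; lra).
    replace (a p / (x - w p) - a p * / x)%C with (a p * w p * / ((x - w p) * x))%C by (field; split; assumption).
    rewrite !Cmod_mult, Cmod_inv, Cmod_mult by (apply Cmult_neq_0; assumption).
    replace (2 * (Cmod (a p) * Cmod (w p)) * / (Cmod x * Cmod x)) with (Cmod (a p) * Cmod (w p) * / (Cmod x / 2 * Cmod x)) by (field; lra).
    apply Rmult_le_compat_l; [apply Rmult_le_pos; apply Cmod_ge_0|]. apply Rinv_le_contravar; [nra|]. apply Rmult_le_compat_r; lra.
  - exists K. split; [assumption|]. intros x Hx. specialize (H x Hx). cbv beta in H. rewrite Csum_minus, Csum_scal_r in H. exact H.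
Qed.

(* The Schwarz reflection of [Rd 0 d]. *)
Definition Rs (d : nat -> C) (x : C) : C := Csum P (fun p => Cconj (d p) / (x - Cconj (z p)))%C.

Lemma Rs_real (d : nat -> C) (t : R) : Rs d (RtoC t) = Cconj (Rd 0 d (RtoC t)).
Proof.
  unfold Rs, Rd. rewrite Cmult_0_l, Cplus_0_l, Csum_conj. apply Csum_ext. intros p Hp.
  rewrite Cdiv_conj; [|apply Cminus_eq_contra; intros E; apply (f_equal Im) in E; specialize (Him p Hp); simpl in E; lra].
  rewrite Cminus_conj. do 2 f_equal. apply C_ext; simpl; ring.
Qed.

Lemma Cder_Rs (d : nat -> C) (x : C) : 0 <= Im x -> exists l, Cder (Rs d) x l.
Proof.
  intros Hx. exists (Csum P (fun p => - Cconj (d p) / ((x - Cconj (z p)) * (x - Cconj (z p)))))%C. unfold Rs.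
  apply (Cder_Csum P (fun p y => Cconj (d p) / (y - Cconj (z p)))%C). intros p Hp.
  assert (N : (x - Cconj (z p) <> 0)%C).
  { apply Cminus_eq_contra. intros E. apply (f_equal Im) in E. rewrite im_conj in E. specialize (Him p Hp). lra. }
  eapply Cder_eq; [|apply Cder_div; [exact N|apply Cder_const|apply Cder_minus; [apply Cder_id|apply Cder_const]]].
  cbv beta. match goal with |- ?a = ?b => change (@eq C a b) end. field. exact N.
Qed.

(** With S = sum d_p the two factors are S/x and conj(S)/x up to O(1/|x|^2). The leading coefficient
    |S|^2 of the product is real and nonnegative, on which the sign argument rests. *)
Lemma R_far2 (R0 : R) (d : nat -> C) : far R0 -> exists K, 0 <= K /\ forall x, R0 <= Cmod x ->
  Cmod (Rs d x) <= K * / Cmod x /\ Cmod (Rd 0 d x) <= K * / Cmod x /\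
  Cmod (Rs d x * Rd 0 d x - RtoC (Cmod (Csum P d) ^ 2) / (x * x)) <= K * / (Cmod x * Cmod x * Cmod x).
Proof.
  intros [HR HF]. set (S := Csum P d).
  destruct (Csum_far2 P R0 d z HR HF) as (K1 & HK1 & H1).
  destruct (Csum_far2 P R0 (fun p => Cconj (d p)) (fun p => Cconj (z p)) HR) as (K2 & HK2 & H2).
  { intros p Hp. rewrite Cmod_conj. apply HF, Hp. }
  set (s := Cmod S). assert (Hs : 0 <= s) by apply Cmod_ge_0.
  exists (s + K1 + K2 + (s * K1 + s * K2 + K1 * K2)). assert (P1 : 0 <= s * K1) by nra. assert (P2 : 0 <= s * K2) by nra. assert (P3 : 0 <= K1 * K2) by nra.
  split; [lra|]. intros x Hx. specialize (H1 x Hx). specialize (H2 x Hx). rewrite <- Csum_conj in H2. fold S in H1, H2. fold (Rs d x) in H2.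
  assert (ER : Rd 0 d x = Csum P (fun p => d p / (x - z p))%C) by (unfold Rd; ring). rewrite <- ER in H1.
  set (A := Rd 0 d x) in *. set (B := Rs d x) in *.
  assert (Nx : (x <> 0)%C) by (intros ->; rewrite Cmod_0 in Hx; lra). set (i := / Cmod x).
  assert (Hr : 0 < Cmod x) by lra. assert (Hi : 0 < i) by (apply Rinv_0_lt_compat, Hr).
  assert (Hi1 : i <= 1) by (unfold i; rewrite <- Rinv_1; apply Rinv_le_contravar; lra).
  rewrite Rinv_mult in H1, H2. rewrite !Rinv_mult. fold i in H1, H2 |- *.
  assert (M1 : Cmod (S / x) = s * i) by (unfold Cdiv; rewrite Cmod_mult, Cmod_inv by exact Nx; reflexivity).
  assert (M2 : Cmod (Cconj S / x) = s * i) by (unfold Cdiv; rewrite Cmod_mult, Cmod_inv, Cmod_conj by exact Nx; reflexivity).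
  set (r1 := (A - S / x)%C) in *. set (r2 := (B - Cconj S / x)%C) in *.
  assert (Hii : i * i <= i) by nra. assert (Q1 : K1 * (i * i) <= K1 * i) by nra. assert (Q2 : K2 * (i * i) <= K2 * i) by nra.
  split; [|split].
  - replace B with (Cconj S / x + r2)%C by (unfold r2; ring). eapply Rle_trans; [apply Cmod_triangle|]. rewrite M2. nra.
  - replace A with (S / x + r1)%C by (unfold r1; ring). eapply Rle_trans; [apply Cmod_triangle|]. rewrite M1. nra.
  - replace (B * A - RtoC (s ^ 2) / (x * x))%C with (Cconj S / x * r1 + (r2 * (S / x) + r2 * r1))%C.
    + eapply Rle_trans; [apply Cmod_triangle|]. eapply Rle_trans; [apply Rplus_le_compat_l, Cmod_triangle|]. rewrite !Cmod_mult, M1, M2.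
      assert (G0 := Cmod_ge_0 r1). assert (G1 := Cmod_ge_0 r2).
      assert (T1 : s * i * Cmod r1 <= s * i * (K1 * (i * i))) by (apply Rmult_le_compat_l; [nra|assumption]).
      assert (T2 : Cmod r2 * (s * i) <= K2 * (i * i) * (s * i)) by (apply Rmult_le_compat_r; [nra|assumption]).
      assert (T3 : Cmod r2 * Cmod r1 <= K2 * (i * i) * (K1 * i)) by (apply Rmult_le_compat; lra).
      assert (0 <= (s + K1 + K2) * (i * i * i)) by (repeat apply Rmult_le_pos; lra).
      nra.
    + replace (RtoC (s ^ 2)) with (S * Cconj S)%C.
      * unfold r1, r2. field. exact Nx.
      * unfold s. rewrite Cmod2_conj. reflexivity.
Qed.

Lemma Re_div (w v : C) : Re (w / v) = (Re w * Re v + Im w * Im v) / (Re v ^ 2 + Im v ^ 2).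
Proof. unfold Cdiv, Cmult, Cinv, Re, Im, Rdiv. cbn [fst snd]. ring. Qed.

Lemma CI_Re_le (F : R -> C) (G dG : R -> R) (a b : R) : a <= b -> ex_CI F a b ->
  (forall t, a <= t <= b -> is_derive G t (dG t)) -> (forall t, a <= t <= b -> continuous dG t) ->
  (forall t, a <= t <= b -> Re (F t) <= dG t) -> Re (CI F a b) <= G b - G a.
Proof.
  intros Hab HF HG Hc H. assert (H1 := proj1 (proj1 (is_CI_pair _ _ _ _) (CI_correct F a b HF))).
  apply (is_RInt_le (fun t => Re (F t)) dG a b); try assumption.
  - apply (is_RInt_derive (V := R_CompleteNormedModule) G dG); rewrite Rmin_left, Rmax_right by assumption; assumption.
  - intros t Ht. apply H. lra.
Qed.

Lemma CI_Re_ge (F : R -> C) (G dG : R -> R) (a b : R) : a <= b -> ex_CI F a b ->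
  (forall t, a <= t <= b -> is_derive G t (dG t)) -> (forall t, a <= t <= b -> continuous dG t) ->
  (forall t, a <= t <= b -> - Re (F t) <= dG t) -> - Re (CI F a b) <= G b - G a.
Proof.
  intros Hab HF HG Hc H. replace (- Re (CI F a b)) with (Re (CI (fun t => - 1 * F t)%C a b)).
  - apply (CI_Re_le _ G dG); try assumption.
    + exists (- 1 * CI F a b)%C. apply is_CI_scal, CI_correct, HF.
    + intros t Ht. specialize (H t Ht). replace (Re (- 1 * F t)%C) with (- Re (F t)) by (unfold Re; simpl; ring). exact H.
  - rewrite CI_scal by assumption. unfold Re; simpl; ring.
Qed.

(* The signs of the two leading terms are what makes the sides harmless. *)
Lemma Re_main_left (X s : R) : 0 < X -> Re ((((- X)%R, s) - RtoC X) / (((- X)%R, s) * ((- X)%R, s)))%C <= 0.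
Proof.
  intros HX. rewrite Re_div. unfold Re, Im; simpl.
  match goal with |- ?n / ?e <= 0 => assert (E : n = - (2 * (X * X * X))) by ring; assert (D : 0 < e) end.
  { match goal with |- 0 < ?e => replace e with ((X * X + s * s) ^ 2) by (simpl; ring) end. apply pow_lt. nra. }
  rewrite E. assert (0 < X * X * X) by (repeat apply Rmult_lt_0_compat; assumption).
  apply Rle_div_l; [exact D|]. lra.
Qed.

Lemma Re_main_right (X s : R) : 0 < X -> 0 <= Re (((X, s) - RtoC X) / ((X, s) * (X, s)))%C.
Proof.
  intros HX. rewrite Re_div. unfold Re, Im; simpl.
  match goal with |- 0 <= ?n / ?e => replace n with (2 * (X * (s * s))) by ring; assert (D : 0 < e) end.
  { match goal with |- 0 < ?e => replace e with ((X * X + s * s) ^ 2) by (simpl; ring) end. apply pow_lt. nra. }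
  apply Rdiv_le_0_compat; [|exact D]. nra.
Qed.

(** Half of the exponential decay absorbs the factor s, the modulus of the weight on the right
    edge. *)
Lemma mul_exp_neg (a s : R) : 0 < a -> s * exp (- (a * s)) <= 2 / a * exp (- (a / 2 * s)).
Proof.
  intros Ha. replace (- (a * s)) with (- (a / 2 * s) + - (a / 2 * s)) by field. rewrite exp_plus.
  assert (E := exp_pos (- (a / 2 * s))). set (e := exp (- (a / 2 * s))) in *.
  assert (G : a / 2 * s * e <= 1).
  { unfold e. rewrite exp_Ropp. assert (Hx := exp_pos (a / 2 * s)). apply Rle_div_l; [assumption|].
    generalize (exp_ineq1_le (a / 2 * s)). lra. }
  replace (s * (e * e)) with (2 / a * (a / 2 * s * e) * e) by (field; lra).
  assert (0 < 2 / a) by (apply Rdiv_lt_0_compat; lra). apply Rmult_le_compat_r; [lra|]. rewrite <- (Rmult_1_r (2 / a)) at 2.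
  apply Rmult_le_compat_l; lra.
Qed.

(** The main part of q is (|S|^2 / lam) (x - X) / x^2 with S = sum d_p. On the vertical edges it is
    only O(1/X), too large for a tall rectangle, but its real part has the favourable sign; hence
    one-sided bounds there and a bound of the modulus on top. *)
Lemma q_bound (d : nat -> C) (F0 FP Y : C -> C) : is_prim 0 0 d F0 -> is_prim P 0 d FP ->
  (forall x, slit_dom 0 x -> Y x = Yq 0 F0 x) -> (forall x, slit_dom P x -> Y x = Yq P FP x) ->
  exists R0 k, 1 <= R0 /\ 0 <= k /\ forall X T, R0 <= X -> R0 <= T -> X <= T ->
    let q := fun x => ((x - RtoC X) * (Rs d x * Y x))%C in
    (forall s, Re (q ((- X)%R, s)) <= k * / (X * X)) /\
    (forall s, 0 <= s -> - Re (q (X, s)) <= k * (/ X * exp (- (lam / eps / 2 * s)) + / (X * X))) /\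
    (forall u, - X <= u <= X -> Cmod (q (u, T)) <= k * (/ T + / (X * X) + X * / (T * T))) /\
    Cmod (Y (RtoC (- X))) <= k * / X.
Proof.
  intros HF0 HFP HY0 HYP. destruct (Yq_asym d F0 FP Y HF0 HFP HY0 HYP) as (R0 & k & HR & HA & Hk & H).
  destruct (R_far2 R0 d HR) as (K & HK & HRR). assert (HR1 : 1 <= R0) by apply HR.
  set (kap := lam / eps) in *. assert (Hkap : 0 < kap) by (apply Rdiv_lt_0_compat; assumption).
  set (sg := Cmod (Csum P d) ^ 2). assert (Hsg : 0 <= sg) by (apply pow2_ge_0).
  set (il := / lam). assert (Hil : 0 < il) by (apply Rinv_0_lt_compat; assumption).
  assert (Err : forall X x B, R0 <= Cmod x -> Cmod (Y x - Rd 0 d x / RtoC lam) <= B ->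
    Cmod ((x - RtoC X) * (Rs d x * Y x) - RtoC (il * sg) * ((x - RtoC X) / (x * x))) <=
      Cmod (x - RtoC X) * / Cmod x * (K * il * / (Cmod x * Cmod x) + K * B)).
  { intros X x B Hx HB. destruct (HRR x Hx) as (G1 & G2 & G3). fold sg in G3. assert (Nx : (x <> 0)%C) by (intros ->; rewrite Cmod_0 in Hx; lra).
    set (e := (Y x - Rd 0 d x / RtoC lam)%C) in *.
    replace ((x - RtoC X) * (Rs d x * Y x) - RtoC (il * sg) * ((x - RtoC X) / (x * x)))%C
      with ((x - RtoC X) * (RtoC il * (Rs d x * Rd 0 d x - RtoC sg / (x * x)) + Rs d x * e))%C.
    - rewrite Cmod_mult, Rmult_assoc. apply Rmult_le_compat_l; [apply Cmod_ge_0|]. eapply Rle_trans; [apply Cmod_triangle|].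
      rewrite !Cmod_mult, Cmod_R, Rabs_pos_eq by lra.
      replace (/ Cmod x * (K * il * / (Cmod x * Cmod x) + K * B)) with (il * (K * / (Cmod x * Cmod x * Cmod x)) + K * / Cmod x * B) by (field; lra).
      apply Rplus_le_compat; [apply Rmult_le_compat_l; [lra|exact G3]|]. apply Rmult_le_compat; try apply Cmod_ge_0; assumption.
    - unfold e, il. rewrite RtoC_mult, RtoC_inv by lra. field. repeat split; first [exact Nx|apply lam_neq_0]. }
  assert (HKil : 0 <= K * il) by (apply Rmult_le_pos; lra). assert (HKk : 0 <= K * k) by (apply Rmult_le_pos; lra).
  assert (H2k : 0 < 2 / kap) by (apply Rdiv_lt_0_compat; lra).
  (* The sum of the constants of the left, right and top edges and of the bound at -X, in the order
     of the conclusion. *)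
  set (kk := 2 * (K * il + K * k) + (K * il + K * k + K * k * (2 / kap)) + 2 * (K * (K * il + k)) + (K * il + k)).
  assert (HKK : 0 <= K * (K * il + k)) by (apply Rmult_le_pos; lra). assert (HKk2 : 0 <= K * k * (2 / kap)) by (apply Rmult_le_pos; lra).
  exists R0, kk. split; [exact HR1|]. split; [unfold kk; lra|]. intros X T HX HT HXT q.
  destruct (H X T HX HT) as (A1 & A2 & A3). clear H.
  assert (Hi : 0 < / (X * X)) by (apply Rinv_0_lt_compat; nra). assert (Hi1 : 0 < / X) by (apply Rinv_0_lt_compat; lra).
  assert (Hi2 : 0 < / (T * T)) by (apply Rinv_0_lt_compat; nra). assert (Hi3 : 0 < / T) by (apply Rinv_0_lt_compat; lra).
  assert (Hii : / (X * X) <= / X) by (apply Rinv_le_contravar; nra).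
  assert (CX : forall x, X <= Cmod x -> Cmod (x - RtoC X) * / Cmod x <= 2).
  { intros x Hx. apply Rle_div_l; [lra|]. eapply Rle_trans; [apply Cmod_triangle|]. rewrite Cmod_opp, Cmod_R, Rabs_pos_eq by lra. lra. }
  assert (Cinv0 : forall x : C, X <= Cmod x -> / Cmod x <= / X) by (intros x Hx; apply Rinv_le_contravar; lra).
  assert (Cpos : forall x : C, 0 <= Cmod (x - RtoC X) * / Cmod x \/ Cmod x <= 0).
  { intros x. destruct (Rle_lt_dec (Cmod x) 0); [right; assumption|left]. apply Rmult_le_pos; [apply Cmod_ge_0|apply Rlt_le, Rinv_0_lt_compat; assumption]. }
  assert (ReC : forall w m : C, Re w <= Re m + Cmod (w - m) /\ - Re w <= - Re m + Cmod (w - m)).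
  { intros w m. generalize (re_le_Cmod (w - m)). rewrite re_minus. intros G. apply Rcomplements.Rabs_le_between in G. lra. }
  assert (ReS : forall m : C, Re (RtoC (il * sg) * m)%C = il * sg * Re m) by (intros m; unfold Re; simpl; ring).
  assert (Hls : 0 <= il * sg) by (apply Rmult_le_pos; lra).
  split; [|split; [|split]].
  - intros s. assert (L : X <= Cmod ((- X)%R, s)) by (eapply Rle_trans; [|apply re_le_Cmod]; simpl; rewrite Rabs_left; lra).
    specialize (Err X _ _ (Rle_trans _ _ _ HX L) (A1 s)). fold (q ((- X)%R, s)) in Err.
    eapply Rle_trans; [apply (ReC _ (RtoC (il * sg) * ((((- X)%R, s) - RtoC X) / (((- X)%R, s) * ((- X)%R, s))))%C)|].
    rewrite ReS. assert (M := Re_main_left X s ltac:(lra)).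
    assert (M2 : il * sg * Re ((((- X)%R, s) - RtoC X) / (((- X)%R, s) * ((- X)%R, s)))%C <= 0) by nra.
    assert (E2 : K * il * / (Cmod ((- X)%R, s) * Cmod ((- X)%R, s)) + K * (k * / (X * X)) <= (K * il + K * k) * / (X * X)).
    { assert (K * il * / (Cmod ((- X)%R, s) * Cmod ((- X)%R, s)) <= K * il * / (X * X)) by (apply Rmult_le_compat_l; [assumption|apply (far_inv_sq R0); assumption]). lra. }
    assert (E3 : Cmod (((- X)%R, s) - RtoC X) * / Cmod ((- X)%R, s) * (K * il * / (Cmod ((- X)%R, s) * Cmod ((- X)%R, s)) + K * (k * / (X * X))) <= 2 * ((K * il + K * k) * / (X * X))).
    { apply Rmult_le_compat; [destruct (Cpos ((- X)%R, s)); lra| |apply CX, L|exact E2].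
      apply Rplus_le_le_0_compat; apply Rmult_le_pos; try assumption; [|apply Rmult_le_pos; lra]. apply Rlt_le, Rinv_0_lt_compat. nra. }
    assert (0 <= (kk - 2 * (K * il + K * k)) * / (X * X)) by (apply Rmult_le_pos; [unfold kk; lra|lra]). lra.
  - intros s Hs. assert (L : X <= Cmod (X, s)) by (eapply Rle_trans; [|apply re_le_Cmod]; simpl; apply Rle_abs).
    specialize (Err X _ _ (Rle_trans _ _ _ HX L) (A2 s Hs)). fold (q (X, s)) in Err.
    eapply Rle_trans; [apply (ReC _ (RtoC (il * sg) * (((X, s) - RtoC X) / ((X, s) * (X, s))))%C)|].
    rewrite ReS. assert (M := Re_main_right X s ltac:(lra)).
    assert (M2 : 0 <= il * sg * Re (((X, s) - RtoC X) / ((X, s) * (X, s)))%C) by (apply Rmult_le_pos; assumption).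
    assert (ES : Cmod ((X, s) - RtoC X) = s).
    { replace ((X, s) - RtoC X)%C with (Ci * RtoC s)%C by (apply C_ext; simpl; ring). rewrite Cmod_mult, Cmod_Ci, Cmod_R, Rabs_pos_eq by lra. ring. }
    rewrite ES in Err.
    assert (Ls : s * / Cmod (X, s) <= 1).
    { apply Rle_div_l; [lra|]. rewrite Rmult_1_l. eapply Rle_trans; [|apply im_le_Cmod]. simpl. apply Rle_abs. }
    assert (Ls0 : 0 <= s * / Cmod (X, s)) by (apply Rmult_le_pos; [lra|apply Rlt_le, Rinv_0_lt_compat; lra]).
    set (ex := exp (- (kap * s))) in *. assert (Hex : 0 < ex) by apply exp_pos.
    assert (E2 : K * il * / (Cmod (X, s) * Cmod (X, s)) + K * (k * / (X * X)) <= (K * il + K * k) * / (X * X)).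
    { assert (K * il * / (Cmod (X, s) * Cmod (X, s)) <= K * il * / (X * X)) by (apply Rmult_le_compat_l; [assumption|apply (far_inv_sq R0); assumption]). lra. }
    assert (E20 : 0 <= K * il * / (Cmod (X, s) * Cmod (X, s)) + K * (k * / (X * X))).
    { apply Rplus_le_le_0_compat; apply Rmult_le_pos; try assumption; [|apply Rmult_le_pos; lra]. apply Rlt_le, Rinv_0_lt_compat. nra. }
    assert (E3 : s * / Cmod (X, s) * (K * il * / (Cmod (X, s) * Cmod (X, s)) + K * (k * / (X * X))) <= 1 * ((K * il + K * k) * / (X * X))) by (apply Rmult_le_compat; assumption).
    assert (E4 : s * / Cmod (X, s) * (K * (k * ex)) <= K * k * (2 / kap) * (/ X * exp (- (kap / 2 * s)))).
    { replace (s * / Cmod (X, s) * (K * (k * ex))) with (K * k * (s * ex) * / Cmod (X, s)) by ring.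
      replace (K * k * (2 / kap) * (/ X * exp (- (kap / 2 * s)))) with (K * k * (2 / kap * exp (- (kap / 2 * s))) * / X) by ring.
      apply Rmult_le_compat; [apply Rmult_le_pos; [assumption|apply Rmult_le_pos; lra]|apply Rlt_le, Rinv_0_lt_compat; lra| |apply Cinv0, L].
      apply Rmult_le_compat_l; [assumption|]. apply mul_exp_neg, Hkap. }
    assert (E5 : 0 <= / X * exp (- (kap / 2 * s))) by (apply Rmult_le_pos; [lra|apply Rlt_le, exp_pos]).
    replace (s * / Cmod (X, s) * (K * il * / (Cmod (X, s) * Cmod (X, s)) + K * (k * (ex + / (X * X)))))
      with (s * / Cmod (X, s) * (K * il * / (Cmod (X, s) * Cmod (X, s)) + K * (k * / (X * X))) + s * / Cmod (X, s) * (K * (k * ex))) in Err by ring.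
    assert (F1 : 0 <= (kk - (K * il + K * k)) * / (X * X)) by (apply Rmult_le_pos; [unfold kk; lra|lra]).
    assert (F2 : 0 <= (kk - K * k * (2 / kap)) * (/ X * exp (- (kap / 2 * s)))) by (apply Rmult_le_pos; [unfold kk; lra|lra]).
    lra.
  - intros u Hu. assert (L : T <= Cmod (u, T)) by (eapply Rle_trans; [|apply im_le_Cmod]; simpl; apply Rle_abs).
    destruct (HRR (u, T) ltac:(lra)) as (G1 & G2 & _). specialize (A3 u Hu). unfold q. rewrite !Cmod_mult.
    set (B := / (X * X) + X * / (T * T)) in *. assert (HB : 0 <= B) by (unfold B; assert (0 <= X * / (T * T)) by (apply Rmult_le_pos; lra); lra).
    assert (Hinv : / Cmod (u, T) <= / T) by (apply Rinv_le_contravar; lra).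
    assert (HY : Cmod (Y (u, T)) <= K * il * / T + k * B).
    { replace (Y (u, T)) with (Rd 0 d (u, T) / RtoC lam + (Y (u, T) - Rd 0 d (u, T) / RtoC lam))%C by ring.
      eapply Rle_trans; [apply Cmod_triangle|]. apply Rplus_le_compat; [|exact A3].
      unfold Cdiv. rewrite Cmod_mult, Cmod_inv, Cmod_R, Rabs_pos_eq by (apply lam_neq_0 || lra). fold il.
      replace (K * il * / T) with (K * / T * il) by ring. apply Rmult_le_compat_r; [lra|]. eapply Rle_trans; [exact G2|]. apply Rmult_le_compat_l; assumption. }
    assert (HQ : Cmod ((u, T) - RtoC X) * Cmod (Rs d (u, T)) <= 2 * K).
    { specialize (CX (u, T) ltac:(lra)).
      apply Rle_trans with (Cmod ((u, T) - RtoC X) * (K * / Cmod (u, T))); [apply Rmult_le_compat_l; [apply Cmod_ge_0|exact G1]|].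
      replace (Cmod ((u, T) - RtoC X) * (K * / Cmod (u, T))) with (K * (Cmod ((u, T) - RtoC X) * / Cmod (u, T))) by ring.
      rewrite (Rmult_comm 2 K). apply Rmult_le_compat_l; assumption. }
    rewrite <- Rmult_assoc. apply Rle_trans with (2 * K * (K * il * / T + k * B)).
    + apply Rmult_le_compat; [apply Rmult_le_pos; apply Cmod_ge_0|apply Cmod_ge_0|exact HQ|exact HY].
    + assert (F1 : 0 <= K * (K * il) * B) by (repeat apply Rmult_le_pos; lra). assert (F2 : 0 <= K * k * / T) by (repeat apply Rmult_le_pos; lra).
      assert (F3 : 0 <= (kk - 2 * (K * (K * il + k))) * (/ T + B)) by (apply Rmult_le_pos; [unfold kk|]; lra). 
      replace (kk * (/ T + / (X * X) + X * / (T * T))) with (kk * (/ T + B)) by (unfold B; ring). lra.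
  - change (RtoC (- X)) with ((- X)%R, 0). specialize (A1 0). assert (L : X <= Cmod ((- X)%R, 0)) by (eapply Rle_trans; [|apply re_le_Cmod]; simpl; rewrite Rabs_left; lra).
    destruct (HRR ((- X)%R, 0) ltac:(lra)) as (_ & G2 & _).
    replace (Y ((- X)%R, 0)) with (Rd 0 d ((- X)%R, 0) / RtoC lam + (Y ((- X)%R, 0) - Rd 0 d ((- X)%R, 0) / RtoC lam))%C by ring.
    eapply Rle_trans; [apply Cmod_triangle|].
    unfold Cdiv at 1. rewrite Cmod_mult, Cmod_inv, Cmod_R, (Rabs_pos_eq lam) by (apply lam_neq_0 || lra). fold il.
    assert (F1 : Cmod (Rd 0 d ((- X)%R, 0)) * il <= K * / X * il).
    { apply Rmult_le_compat_r; [lra|]. eapply Rle_trans; [exact G2|]. apply Rmult_le_compat_l; [assumption|apply Cinv0, L]. }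
    assert (F2 : k * / (X * X) <= k * / X) by (apply Rmult_le_compat_l; assumption).
    assert (F3 : 0 <= (kk - (K * il + k)) * / X) by (apply Rmult_le_pos; [unfold kk; lra|lra]). lra.
Qed.

Lemma Rder_conj (g : R -> C) (t : R) (l : C) : Rder g t l -> Rder (fun s => Cconj (g s)) t (Cconj l).
Proof.
  rewrite !Rder_iff. intros H e He. destruct (H e He) as (r & Hr & Hs). exists r. split; [assumption|]. intros s Hss.
  specialize (Hs s Hss). rewrite <- (Cmod_conj (g s - g t - l * RtoC (s - t))) in Hs.
  replace (Cconj (g s) - Cconj (g t) - Cconj l * RtoC (s - t))%C with (Cconj (g s - g t - l * RtoC (s - t)))%C; [exact Hs|].
  apply C_ext; simpl; ring.
Qed.

Lemma u0_real_conj (t : R) : Cconj (u0 P c z (RtoC t)) = u0 P c z (RtoC t).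
Proof.
  unfold u0. rewrite Csum_conj. apply Csum_ext. intros p Hp.
  assert (N1 : (RtoC t - z p <> 0)%C) by (apply Cminus_eq_contra; intros E; apply (f_equal Im) in E; specialize (Him p Hp); simpl in E; lra).
  assert (N2 : (RtoC t - Cconj (z p) <> 0)%C) by (apply Cminus_eq_contra; intros E; apply (f_equal Im) in E; rewrite im_conj in E; specialize (Him p Hp); simpl in E; lra).
  assert (E : Cconj (RtoC t) = RtoC t) by (apply C_ext; simpl; ring).
  rewrite Cplus_conj, !Cdiv_conj, !Cminus_conj, !Cconj_conj, E by assumption. ring.
Qed.

(* Integrating the derivative of [(t - X) |Y t|^2]. *)
Lemma virial (d : nat -> C) (Y : C -> C) (X : R) : 0 < X ->
  (forall t : R, Cder Y (RtoC t) (Ci / RtoC eps * ((RtoC lam + u0 P c z (RtoC t)) * Y (RtoC t) - Rd 0 d (RtoC t)))%C) ->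
  is_RInt (fun t => Cmod (Y (RtoC t)) ^ 2) (- X) X
    (2 * X * Cmod (Y (RtoC (- X))) ^ 2
     + 2 / eps * Im (CI (fun t => (RtoC t - RtoC X) * (Rs d (RtoC t) * Y (RtoC t)))%C (- X) X)).
Proof.
  intros HX HY.
  set (q := fun t : R => ((RtoC t - RtoC X) * (Rs d (RtoC t) * Y (RtoC t)))%C).
  assert (HR : forall t, Rder RtoC t (RtoC 1)).
  { intros t. apply is_derive_ext with (f := fun s => (0 + 1 * RtoC s)%C); [intros u; apply C_ext; simpl; ring|apply Rder_affine]. }
  assert (HRc : forall t, Rcont RtoC t) by (intros t; eapply Rder_cont, HR).
  assert (DY : forall t, Rder (fun t => Y (RtoC t)) t (Ci / RtoC eps * ((RtoC lam + u0 P c z (RtoC t)) * Y (RtoC t) - Rd 0 d (RtoC t)))%C).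
  { intros t. eapply Rder_eq; [|apply (Cder_Rder Y RtoC t _ _ (HY t) (HR t))]. match goal with |- ?a = ?b => change (@eq C a b) end. ring. }
  assert (DL : forall t, Rder (fun t => RtoC t - RtoC X)%C t (RtoC 1)).
  { intros t. apply is_derive_ext with (f := fun s => (- RtoC X + 1 * RtoC s)%C); [intros u; apply C_ext; simpl; ring|apply Rder_affine]. }
  assert (Cq : forall t, Rcont q t).
  { intros t. apply Rcont_mult; [eapply Rder_cont, DL|]. apply Rcont_mult; [|eapply Rder_cont, DY].
    destruct (Cder_Rs d (RtoC t)) as [l Hl]; [simpl; lra|]. apply (Ccont_Rcont (Rs d) RtoC); [eapply Cder_cont, Hl|apply HRc]. }
  assert (Cconjc : forall g t, Rcont g t -> Rcont (fun s => Cconj (g s)) t).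
  { intros g t. rewrite !Rcont_iff. intros H e He. destruct (H e He) as (r & Hr & Hs). exists r. split; [assumption|]. intros s Hss.
    rewrite <- Cminus_conj, Cmod_conj. apply Hs, Hss. }
  set (G := fun t : R => ((RtoC t - RtoC X) * (Y (RtoC t) * Cconj (Y (RtoC t))))%C).
  set (dG := fun t : R => (Y (RtoC t) * Cconj (Y (RtoC t)) + Ci / RtoC eps * (q t - Cconj (q t)))%C).
  assert (DG : forall t, Rder G t (dG t)).
  (* Since lam and u0 are real on the line, the terms in (lam + u0) |Y|^2 cancel, and only the
     source R is left, inside q - conj(q). *)
  { intros t. eapply Rder_eq; [|apply Rder_mult; [apply DL|apply Rder_mult; [apply DY|apply Rder_conj, DY]]].
    match goal with |- ?a = ?b => change (@eq C a b) end. unfold dG, q.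
    rewrite Rs_real. set (y := Y (RtoC t)). assert (Eu := u0_real_conj t). set (u := u0 P c z (RtoC t)) in *. set (rr := Rd 0 d (RtoC t)).
    assert (E1 : Cconj (Ci / RtoC eps * ((RtoC lam + u) * y - rr))%C = (- Ci / RtoC eps * ((RtoC lam + u) * Cconj y - Cconj rr))%C).
    { rewrite Cmult_conj, Cdiv_conj, Cminus_conj, Cmult_conj, Cplus_conj, Eu by apply eps_neq_0.
      assert (CR : forall a : R, Cconj (RtoC a) = RtoC a) by (intros a; apply C_ext; simpl; ring).
      rewrite !CR. replace (Cconj Ci) with (- Ci)%C by (apply C_ext; simpl; ring). reflexivity. }
    rewrite E1. rewrite !Cmult_conj, Cconj_conj. replace (Cconj (RtoC t - RtoC X)) with (RtoC t - RtoC X)%C by (apply C_ext; simpl; ring).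
    field. apply eps_neq_0. }
  assert (CG : forall t, Rcont dG t).
  { intros t. apply Rcont_plus.
    - apply Rcont_mult; [eapply Rder_cont, DY|apply Cconjc; eapply Rder_cont, DY].
    - apply Rcont_mult; [apply (Ccont_Rcont (fun _ => (Ci / RtoC eps)%C) RtoC); [apply Ccont_const|apply HRc]|].
      apply Rcont_plus; [apply Cq|]. apply (Ccont_Rcont (fun w => - w)%C (fun s => Cconj (q s))); [|apply Cconjc, Cq].
      apply (Ccont_ext_loc (fun w => 0 - w)%C _ _ 1 Rlt_0_1); [intros; ring|]. apply Ccont_minus; [apply Ccont_const|apply Ccont_id]. }
  assert (I1 := is_CI_FTC G dG (- X) X (fun t _ => DG t) (fun t _ => CG t)).
  apply is_CI_pair in I1. destruct I1 as [I1 _].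
  assert (I2 := proj2 (proj1 (is_CI_pair _ _ _ _) (CI_correct q (- X) X (ex_CI_cont q _ _ (fun t _ => Cq t))))).
  replace (2 * X * Cmod (Y (RtoC (- X))) ^ 2) with (Re (G X - G (- X)%R)%C).
  - assert (I3 := is_RInt_plus (V := R_NormedModule) _ _ _ _ _ _ I1 (is_RInt_scal (V := R_NormedModule) _ _ _ (2 / eps) _ I2)).
    refine (is_RInt_ext _ _ _ _ _ _ I3). intros t _. unfold plus, scal; simpl. unfold mult; simpl.
    change (Cmod (Y (RtoC t)) * (Cmod (Y (RtoC t)) * 1)) with (Cmod (Y (RtoC t)) ^ 2). rewrite Cmod2_alt. unfold dG. set (y := Y (RtoC t)). set (w := q t).
    destruct y as [y1 y2]. destruct w as [w1 w2]. unfold Re, Im, Cdiv. simpl. field. lra.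
  - unfold G. rewrite Cmod2_alt. set (y := Y (RtoC (- X))). set (y' := Y (RtoC X)). destruct y as [y1 y2]. destruct y' as [y1' y2'].
    unfold Re, Im. simpl. ring.
Qed.

(** Goursat's theorem for q, with the poles in the list of exceptional abscissae since Y is known
    only to be continuous there. Since dz = i dy on the vertical edges, the imaginary part of the
    bottom involves their real parts, left minus right. *)
Lemma Im_bottom (d : nat -> C) (Y : C -> C) (X T k : R) : 1 <= X -> 0 < T -> 
  (forall x, 0 <= Im x -> Ccont Y x) ->
  (forall x, 0 <= Im x -> (forall p, (1 <= p <= P)%nat -> x <> z p) -> exists l, Cder Y x l) ->
  let q := fun x => ((x - RtoC X) * (Rs d x * Y x))%C in
  (forall s, Re (q ((- X)%R, s)) <= k * / (X * X)) ->
  (forall s, 0 <= s -> - Re (q (X, s)) <= k * (/ X * exp (- (lam / eps / 2 * s)) + / (X * X))) ->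
  (forall u, - X <= u <= X -> Cmod (q (u, T)) <= k * (/ T + / (X * X) + X * / (T * T))) -> 0 <= k ->
  Im (CI (fun t => q (RtoC t)) (- X) X) <=
    k * (/ T + / (X * X) + X * / (T * T)) * (2 * X) + k * / (X * X) * T + k * (/ X * (2 * eps / lam) + / (X * X) * T).
Proof.
  intros HX HT HYc HYd q HL HR HTp Hk.
  assert (Qc : forall x, 0 <= Im x -> Ccont q x).
  { intros x Hx. apply Ccont_mult; [apply Ccont_minus; [apply Ccont_id|apply Ccont_const]|]. apply Ccont_mult; [|apply HYc, Hx].
    destruct (Cder_Rs d x Hx) as [l Hl]. eapply Cder_cont, Hl. }
  assert (Go : RI q (- X) X 0 T = 0).
  { apply (Goursat (List.map (fun p => Re (z p)) (List.seq 1 P))); [lra|assumption| |].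
    - intros x y _ Hy. apply Qc. simpl. lra.
    - intros x y _ Hy Hn. destruct (Cder_Rs d (x, y)) as [l1 Hl1]; [simpl; lra|].
      destruct (HYd (x, y)) as [l2 Hl2]; [simpl; lra| |].
      + intros p Hp E. apply Hn. apply List.in_map_iff. exists p. split; [rewrite <- E; reflexivity|]. apply List.in_seq. lia.
      + eexists. apply Cder_mult; [apply Cder_minus; [apply Cder_id|apply Cder_const]|apply Cder_mult; [exact Hl1|exact Hl2]]. }
  unfold RI in Go.
  set (Bt := CI (fun x => q (x, 0)) (- X) X) in *. set (Rt := CI (fun y => q (X, y)) 0 T) in *.
  set (Tp := CI (fun x => q (x, T)) (- X) X) in *. set (Lf := CI (fun y => q ((- X)%R, y)) 0 T) in *.
  change (Im Bt <= k * (/ T + / (X * X) + X * / (T * T)) * (2 * X) + k * / (X * X) * T + k * (/ X * (2 * eps / lam) + / (X * X) * T)).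
  assert (EB : Im Bt = Im Tp + Re Lf - Re Rt).
  { apply (f_equal Im) in Go. destruct Bt, Rt, Tp, Lf. unfold Im, Re in *. simpl in *. lra. }
  assert (B1 : Cmod Tp <= k * (/ T + / (X * X) + X * / (T * T)) * (X - - X)).
  { apply CI_bound; [lra| |exact HTp]. apply ex_CI_horiz; [lra|]. intros x _. apply Qc. simpl. lra. }
  assert (B2 : Re Lf <= k * / (X * X) * T - k * / (X * X) * 0).
  { apply (CI_Re_le _ (fun s => k * / (X * X) * s) (fun s => k * / (X * X))).
    - lra. - apply ex_CI_vert; [lra|]. intros y Hy. apply Qc. simpl. lra.
    - intros t _. auto_derive; [trivial|ring].
    - intros t _. apply continuous_const.
    - intros t _. apply HL. }
  (* The factor 2 eps / lam is the total integral of e^{-lam s / (2 eps)} over s >= 0. *)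
  assert (B3 : - Re Rt <= (k * (- (2 * eps / lam) * / X * exp (- (lam / eps / 2 * T)) + / (X * X) * T)) - (k * (- (2 * eps / lam) * / X * exp (- (lam / eps / 2 * 0)) + / (X * X) * 0))).
  { apply (CI_Re_ge _ (fun s => k * (- (2 * eps / lam) * / X * exp (- (lam / eps / 2 * s)) + / (X * X) * s)) (fun s => k * (/ X * exp (- (lam / eps / 2 * s)) + / (X * X)))).
    - lra. - apply ex_CI_vert; [lra|]. intros y Hy. apply Qc. simpl. lra.
    - intros t _. auto_derive; [trivial|]. field. lra.
    - intros t _. apply (ex_derive_continuous (K := R_AbsRing) (V := R_NormedModule)). auto_derive. trivial.
    - intros t Ht. apply HR. lra. }
  rewrite Rmult_0_r, Ropp_0, exp_0 in B3.
  assert (B4 := im_le_Cmod Tp). assert (B5 := Rle_abs (Im Tp)).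
  assert (B6 : 0 <= k * (2 * eps / lam * / X * exp (- (lam / eps / 2 * T)))).
  { assert (0 < 2 * eps / lam) by (apply Rdiv_lt_0_compat; lra). assert (0 < / X) by (apply Rinv_0_lt_compat; lra).
    apply Rmult_le_pos; [assumption|]. apply Rmult_le_pos; [apply Rmult_le_pos; lra|apply Rlt_le, exp_pos]. }
  lra.
Qed.

(** * Vanishing of the homogeneous solution and of the kernel vector *)

Lemma vanishing_of_small_integrals (g : R -> R) (N C0 : R) : (forall t, continuous g t) -> (forall t, 0 <= g t) ->
  (forall n, N <= n -> exists X I, n <= X /\ is_RInt g (- X) X I /\ I <= C0 / n) -> forall t, g t = 0.
Proof.
  intros Hc Hg H t0. apply Rle_antisym; [|apply Hg]. apply Rnot_lt_le. intros Hpos.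
  assert (Hloc : exists r, 0 < r <= 1 /\ forall t, Rabs (t - t0) <= r -> g t0 / 2 <= g t).
  { assert (L := Hc t0). apply (proj1 (filterlim_locally (F := locally t0) g (g t0))) with (eps := mkposreal (g t0 / 2) ltac:(lra)) in L.
    destruct L as [e He]. exists (Rmin (e / 2) 1). assert (E := cond_pos e). split; [split; [apply Rmin_pos; lra|apply Rmin_r]|].
    intros t Ht. assert (B : ball t0 e t). { unfold ball; simpl; unfold AbsRing_ball, abs, minus, plus, opp; simpl. generalize (Rmin_l (e / 2) 1). intros. replace (t + - t0) with (t - t0) by ring. lra. }
    specialize (He t B). unfold ball in He; simpl in He; unfold AbsRing_ball, abs, minus, plus, opp in He; simpl in He.
    apply Rabs_lt_between in He. lra. }
  destruct Hloc as (r & Hr & Hlo).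
  assert (Hr0 : 0 < r * g t0) by (apply Rmult_lt_0_compat; lra).
  set (n := Rmax N (Rmax (Rabs t0 + 1) (Rabs C0 / (r * g t0) + 1))).
  destruct (H n (Rmax_l _ _)) as (X & I & HX & HI & HIn).
  assert (N1 : Rabs t0 + 1 <= n) by (eapply Rle_trans; [apply Rmax_l|apply Rmax_r]).
  assert (N2 : Rabs C0 / (r * g t0) + 1 <= n) by (eapply Rle_trans; [apply Rmax_r|apply Rmax_r]).
  assert (T0 := Rabs_pos t0). assert (T1 := Rle_abs t0). assert (T2 := Rle_abs (- t0)). rewrite Rabs_Ropp in T2.
  assert (Ex : forall a b, ex_RInt g a b) by (intros a b; apply (ex_RInt_continuous (V := R_CompleteNormedModule)); intros; apply Hc).
  assert (E1 := RInt_Chasles g (- X) (t0 - r) X (Ex _ _) (Ex _ _)). assert (E2 := RInt_Chasles g (t0 - r) (t0 + r) X (Ex _ _) (Ex _ _)).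
  rewrite (is_RInt_unique _ _ _ _ HI) in E1. unfold plus in E1, E2; simpl in E1, E2.
  assert (P1 : 0 <= RInt g (- X) (t0 - r)) by (apply RInt_ge_0; [lra|apply Ex|intros; apply Hg]).
  assert (P2 : 0 <= RInt g (t0 + r) X) by (apply RInt_ge_0; [lra|apply Ex|intros; apply Hg]).
  assert (P3 : (t0 + r - (t0 - r)) * (g t0 / 2) <= RInt g (t0 - r) (t0 + r)).
  { rewrite <- (RInt_const (V := R_CompleteNormedModule) (t0 - r) (t0 + r) (g t0 / 2)) at 1.
    apply RInt_le; [lra|apply ex_RInt_const|apply Ex|]. intros t Ht. apply Hlo. apply Rabs_le. lra. }
  assert (Hn : 0 < n) by lra. assert (Lo : r * g t0 <= C0 / n) by lra. apply Rle_div_r in Lo; [|assumption].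
  assert (Up : Rabs C0 / (r * g t0) < n) by lra. apply Rlt_div_l in Up; [|assumption]. generalize (Rle_abs C0). lra.
Qed.

(** The zero on the real axis spreads up a rectangle that stops just below z_q and contains no pole.
    At distance s below z_q, multiplication by x - z_q then leaves |d_q| <= s K, where K bounds the
    other terms. *)
Lemma residue_zero (d : nat -> C) (q : nat) : (1 <= q <= P)%nat -> (forall t : R, Rd 0 d (RtoC t) = 0) -> d q = 0.
Proof.
  intros Hq H0. destruct (near_ex q Hq) as [r Hr]. assert (Hr0 : 0 < r) by apply Hr. assert (Iq := Him q Hq).
  destruct (Csum_bound_uniform P (fun x : C => Cmod (x - z q) < r) (fun p x => (if Nat.eq_dec p q then RtoC 0 else d p / (x - z p))%C) (fun _ => 1)) as (K & HK & HB).
  - intros; lra.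
  - intros p Hp. exists (Cmod (d p) * / r). intros x Hx. rewrite Rmult_1_r.
    destruct (Nat.eq_dec p q) as [->|E].
    + rewrite Cmod_0. apply Rmult_le_pos; [apply Cmod_ge_0|apply Rlt_le, Rinv_0_lt_compat, Hr0].
    + destruct (near_dist q p r x Hr Hp Hq Hx) as (_ & D & _). apply Cmod_div_le; [assumption|apply D, E].
  - assert (Z : forall s, 0 < s < r -> Rd 0 d (Re (z q), Im (z q) - s)%R = 0).
    { intros s Hs. assert (Hs2 : s < Im (z q)) by (destruct Hr as (_ & Hr & _); lra).
      assert (N : forall x y, Re (z q) - r <= x <= Re (z q) + r -> 0 <= y <= Im (z q) - s / 2 -> forall p, (1 <= p <= P)%nat -> ((x, y) : C) <> z p).
      { intros x y Hx Hy p Hp E. destruct (Nat.eq_dec p q) as [->|Ep].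
        - apply (f_equal Im) in E. simpl in E. lra.
        - destruct Hr as (_ & _ & Hr). specialize (Hr p Hp Ep). apply (f_equal Re) in E. simpl in E.
          assert (Rabs (Re (z p) - Re (z q)) <= r) by (apply Rabs_le; lra). lra. }
      apply (zero_of_zero_bottom (Rd 0 d) (Re (z q) - r) (Re (z q) + r) 0 (Im (z q) - s / 2)); [lra|lra| | | |lra|lra].
      - intros x y Hx Hy. eapply Cder_cont, Cder_Rd, N; assumption.
      - intros x y Hx Hy. eexists. apply Cder_Rd, N; lra.
      - intros x _. apply H0. }
    assert (L : forall s, 0 < s < r -> Cmod (d q) <= s * K).
    { intros s Hs. specialize (Z s Hs). set (x := (Re (z q), Im (z q) - s)%R : C) in *.
      assert (Ex : (x - z q)%C = (- Ci * RtoC s)%C) by (unfold x; apply C_ext; unfold Re, Im; simpl; ring).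
      assert (Cx : Cmod (x - z q) = s) by (rewrite Ex, Cmod_mult, Cmod_opp, Cmod_Ci, Cmod_R, Rabs_pos_eq; lra).
      assert (Nx : (x - z q <> 0)%C) by (apply Cmod_gt_0; lra).
      specialize (HB x ltac:(lra)). cbv beta in HB. unfold Rd in Z. rewrite (Csum_single_out P q) in Z by exact Hq.
      set (S := Csum P _) in Z. replace (Csum P _) with S in HB by reflexivity.
      replace (d q) with (- (x - z q) * S)%C.
      - rewrite Cmod_mult, Cmod_opp, Cx. apply Rmult_le_compat_l; [lra|]. lra.
      - replace S with (0 * RtoC lam + (d q / (x - z q) + S) - d q / (x - z q))%C by ring. rewrite Z. field. exact Nx. }
    apply Cmod_eq_0. apply Rle_antisym; [|apply Cmod_ge_0]. apply le_epsilon. intros e He.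
    set (s := Rmin (r / 2) (e / (K + 1))). assert (S1 : s <= r / 2) by apply Rmin_l. assert (S2 : s <= e / (K + 1)) by apply Rmin_r.
    assert (S0 : 0 < s) by (apply Rmin_pos; [lra|apply Rdiv_lt_0_compat; lra]).
    specialize (L s ltac:(lra)). apply Rle_div_r in S2; [|lra]. lra.
Qed.

Theorem uniqueness (d : nat -> C) (Gam : nat -> contour) :
  (forall m, (1 <= m <= P)%nat -> is_Cm eps P c z m (Gam m)) ->
  (forall m, (1 <= m <= P)%nat -> is_line (cint 0 d (Gam m)) 0) -> forall p, (1 <= p <= P)%nat -> d p = 0.
Proof.
  intros HG HL p Hp.
  destruct (is_prim_ex 0 0 d) as [F0 HF0]; [lia|]. destruct (is_prim_ex P 0 d) as [FP HFP]; [lia|].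
  destruct (Y_exists d Gam F0 FP HG HL HF0 HFP) as (Y & HY0 & HYP & HYd & HYc).
  assert (Hd : forall t : R, Cder Y (RtoC t) (Ci / RtoC eps * ((RtoC lam + u0 P c z (RtoC t)) * Y (RtoC t) - Rd 0 d (RtoC t)))%C).
  { intros t. apply HYd; [simpl; lra|]. intros p' Hp'. apply (slit_dom_neq 0 p' _ (slit_dom_real t) Hp'). }
  destruct (q_bound d F0 FP Y HF0 HFP HY0 HYP) as (R0 & k & HR0 & Hk & HQ).
  assert (Yc : forall t, Rcont (fun t => Y (RtoC t)) t).
  { intros t. apply (Ccont_Rcont Y RtoC); [apply HYc; simpl; lra|].
    eapply Rder_cont. apply is_derive_ext with (f := fun s => (0 + 1 * RtoC s)%C); [intros u; apply C_ext; simpl; ring|apply Rder_affine]. }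
  assert (Y0 : forall t : R, Y (RtoC t) = 0).
  { intros t. apply Cmod_eq_0.
    assert (G : Cmod (Y (RtoC t)) ^ 2 = 0).
    { apply (vanishing_of_small_integrals (fun t => Cmod (Y (RtoC t)) ^ 2) R0 (2 * k ^ 2 + 2 / eps * (8 * k + k * (2 * eps / lam)))).
      - intros s. assert (Cm : continuous (fun t => Cmod (Y (RtoC t))) s).
        { apply (proj2 (filterlim_locally (F := locally s) _ _)). intros e. destruct (proj1 (Rcont_iff _ _) (Yc s) e (cond_pos e)) as (r & Hr & Hs).
          exists (mkposreal r Hr). intros y Hy. unfold ball in Hy; simpl in Hy; unfold AbsRing_ball, abs, minus, plus, opp in Hy; simpl in Hy.
          specialize (Hs y Hy). unfold ball; simpl; unfold AbsRing_ball, abs, minus, plus, opp; simpl.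
          apply Rabs_lt_between. generalize (Cmod_triangle_rev (Y (RtoC y)) (Y (RtoC s))) (Cmod_triangle_rev (Y (RtoC s)) (Y (RtoC y))).
          rewrite (Cmod_sub_sym (Y (RtoC s))). lra. }
        apply continuous_ext with (f := fun t => Cmod (Y (RtoC t)) * Cmod (Y (RtoC t))); [intros; simpl; ring|].
        apply (continuous_mult (K := R_AbsRing)); exact Cm.
      - intros s. apply pow2_ge_0.
      - intros n Hn. assert (Hn1 : 1 <= n) by lra. assert (H2 : n <= n * n) by nra. assert (H3 : n * n <= n * (n * n)) by nra.
        (* X = n^2 and T = n^3 satisfy the competing demands X/T, X^2/T^2 and T/X^2 -> 0 of the top
           and of the vertical edges; every error is O(1/n). *)
        exists (n * n). eexists. split; [exact H2|]. split; [apply (virial d Y (n * n)); [nra|exact Hd]|].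
        destruct (HQ (n * n) (n * (n * n))) as (A1 & A2 & A3 & A4); [lra|lra|lra|].
        assert (I := Im_bottom d Y (n * n) (n * (n * n)) k ltac:(lra) ltac:(nra) HYc (fun x Hx Hn => ex_intro _ _ (HYd x Hx Hn)) A1 A2 A3 Hk).
        cbv beta in I. match type of I with Im ?b <= ?r => set (Bt := Im b) in *; set (rhs := r) in I end.
        assert (Hi : 0 < / n) by (apply Rinv_0_lt_compat; lra). assert (Hi1 : / n <= 1) by (rewrite <- Rinv_1; apply Rinv_le_contravar; lra).
        assert (Hel : 0 < eps / lam) by (apply Rdiv_lt_0_compat; assumption). assert (Hie : 0 < 2 / eps) by (apply Rdiv_lt_0_compat; lra).
        assert (Er : rhs <= (8 * k + k * (2 * eps / lam)) * / n).
        { replace rhs with (k * ((2 * / n + 2 * (/ n * / n) + 2 * (/ n * / n)) + / n + (/ n * / n * (2 * (eps / lam)) + / n))) by (unfold rhs; field; lra).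
          replace ((8 * k + k * (2 * eps / lam)) * / n) with (k * (8 * / n + / n * (2 * (eps / lam)))) by (field; lra).
          apply Rmult_le_compat_l; [assumption|]. assert (/ n * / n <= / n) by nra.
          assert (/ n * / n * (2 * (eps / lam)) <= / n * (2 * (eps / lam))) by (apply Rmult_le_compat_r; lra). lra. }
        assert (Ea : 2 * (n * n) * Cmod (Y (RtoC (- (n * n)))) ^ 2 <= 2 * k ^ 2 * / n).
        { apply Rle_trans with (2 * (n * n) * (k * / (n * n)) ^ 2).
          - apply Rmult_le_compat_l; [nra|]. apply pow_incr. split; [apply Cmod_ge_0|exact A4].
          - replace (2 * (n * n) * (k * / (n * n)) ^ 2) with (2 * k ^ 2 * (/ n * / n)) by (field; lra).
            apply Rmult_le_compat_l; [generalize (pow2_ge_0 k); lra|]. nra. }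
        assert (2 / eps * Bt <= 2 / eps * ((8 * k + k * (2 * eps / lam)) * / n)) by (apply Rmult_le_compat_l; lra).
        unfold Rdiv at 2. lra. }
    simpl in G. rewrite Rmult_1_r in G. apply Rmult_integral in G. tauto. }
  apply (residue_zero d p Hp). intros t.
  (* As Y vanishes on the real line, its complex derivative, tested with real increments, vanishes
     there as well; the equation then leaves R = 0. *)
  assert (D1 := Hd t). rewrite Y0 in D1.
  assert (E : (Ci / RtoC eps * ((RtoC lam + u0 P c z (RtoC t)) * 0 - Rd 0 d (RtoC t)))%C = 0).
  { match type of D1 with Cder _ _ ?l => set (dY := l) in * end. apply Cmod_eq_0. apply Rle_antisym; [|apply Cmod_ge_0].
    apply le_epsilon. intros e He. destruct (D1 e He) as (r & Hr & Hs). specialize (Hs (RtoC (t + r / 2))).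
    rewrite !Y0 in Hs. replace (RtoC (t + r / 2) - RtoC t)%C with (RtoC (r / 2)) in Hs by (rewrite RtoC_plus; ring).
    rewrite Cmod_R, Rabs_pos_eq in Hs by lra. specialize (Hs ltac:(lra)).
    replace (0 - 0 - dY * RtoC (r / 2))%C with (- (dY * RtoC (r / 2)))%C in Hs by ring.
    rewrite Cmod_opp, Cmod_mult, Cmod_R, Rabs_pos_eq in Hs by lra. apply Rmult_le_reg_r in Hs; lra. }
  assert (Hi : (Ci * Ci)%C = (-1)%C) by (apply C_ext; simpl; ring).
  transitivity (Ci * RtoC eps * (Ci / RtoC eps * ((RtoC lam + u0 P c z (RtoC t)) * 0 - Rd 0 d (RtoC t))))%C; [|rewrite E; ring].
  transitivity (- (Ci * Ci) * Rd 0 d (RtoC t))%C; [rewrite Hi; ring|field; apply eps_neq_0].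
Qed.

(** * Entries of the linear system and its solution *)

Lemma line_exists (m : nat) (w0 : C) (d : nat -> C) (gam : contour) : (1 <= m <= P)%nat -> is_Cm eps P c z m gam ->
  exists V, is_line (cint w0 d gam) V.
Proof.
  intros Hm [H1 H2]. destruct (is_prim_ex 0 w0 d) as [F0 HF0]; [lia|].
  destruct (Classical_Prop.classic (exceptional eps c m)) as [Hex|Hne].
  - destruct (exceptional_limit m w0 d F0 Hm Hex HF0) as (n & L & K & r & _ & Hr & HK & HLim).
    exists L. apply (line_ell0 m n w0 d F0 gam L K r); try assumption; [apply H1, Hex|apply Hr].
  - destruct (is_prim_ex m w0 d) as [Fm HFm]; [lia|]. eexists. apply (line_U m w0 d F0 Fm); try assumption. apply H2, Hne.
Qed.

Lemma cint_split (w0 : C) (d : nat -> C) (gam : contour) (t : R) :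
  cint w0 d gam t = (w0 * RtoC lam * b_integrand eps lam gam t + Csum P (fun p => A_integrand eps lam z gam p t * d p))%C.
Proof.
  unfold cint, Rd, b_integrand, A_integrand. set (ph := contour_phase eps lam gam t).
  transitivity (w0 * RtoC lam * (ph * speed gam t) + (ph * speed gam t) * Csum P (fun p => d p / (path gam t - z p)))%C; [ring|].
  f_equal. rewrite <- Csum_scal. apply Csum_ext. intros p _. unfold Cdiv. ring.
Qed.

(** A single entry is the case of the unit vector d = e_p with w0 = 0, so convergence of each column
    follows from that of the combined integrand. *)
Lemma A_line (m p : nat) (gam : contour) : (1 <= m <= P)%nat -> (1 <= p <= P)%nat -> is_Cm eps P c z m gam ->
  exists V, is_line (A_integrand eps lam z gam p) V.
Proof.
  intros Hm Hp HG. destruct (line_exists m 0 (fun p' => if Nat.eq_dec p' p then RtoC 1 else RtoC 0) gam Hm HG) as [V HV].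
  exists V. refine (is_line_ext _ _ _ _ HV). intros t. rewrite cint_split.
  rewrite (Csum_ext P _ (fun p' => if Nat.eq_dec p' p then A_integrand eps lam z gam p t else 0)).
  - rewrite Csum_delta by exact Hp. ring.
  - intros p' _. destruct (Nat.eq_dec p' p) as [->|]; ring.
Qed.

Lemma b_line (m : nat) (gam : contour) : (1 <= m <= P)%nat -> is_Cm eps P c z m gam ->
  exists V, is_line (b_integrand eps lam gam) V.
Proof.
  intros Hm HG. destruct (line_exists m 1 (fun _ => RtoC 0) gam Hm HG) as [V HV].
  exists (/ RtoC lam * V)%C. refine (is_line_ext _ _ _ _ (is_line_scal (/ RtoC lam) _ _ HV)). intros t. rewrite cint_split.
  rewrite (Csum_ext P _ (fun p => 0 * A_integrand eps lam z gam p t)%C) by (intros; ring). rewrite Csum_scal. field. apply lam_neq_0.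
Qed.

Lemma cint_line (m : nat) (w0 : C) (d : nat -> C) (Gam : nat -> contour) : (1 <= m <= P)%nat -> is_Cm eps P c z m (Gam m) ->
  is_line (cint w0 d (Gam m)) (Csum P (fun p => A_entry eps lam z Gam m p * d p) - w0 * b_entry eps lam Gam m)%C.
Proof.
  intros Hm HG. destruct (b_line m _ Hm HG) as [b Hb].
  apply is_line_ext with (F := fun t => (Csum P (fun p => d p * A_integrand eps lam z (Gam m) p t) + w0 * RtoC lam * b_integrand eps lam (Gam m) t)%C).
  { intros t. rewrite cint_split. rewrite Cplus_comm. f_equal. apply Csum_ext. intros; ring. }
  replace (Csum P (fun p => A_entry eps lam z Gam m p * d p) - w0 * b_entry eps lam Gam m)%C
    with (Csum P (fun p => d p * A_entry eps lam z Gam m p) + w0 * RtoC lam * b)%C.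
  - apply is_line_plus; [|apply is_line_scal, Hb].
    apply (is_line_Csum P (fun p t => d p * A_integrand eps lam z (Gam m) p t)%C). intros p Hp. apply is_line_scal.
    destruct (A_line m p _ Hm Hp HG) as [V HV]. unfold A_entry. rewrite (is_line_unique _ _ HV). exact HV.
  - unfold b_entry. rewrite (is_line_unique _ _ Hb). rewrite (Csum_ext P _ (fun p => A_entry eps lam z Gam m p * d p)%C) by (intros; ring). ring.
Qed.

(** The values of M solve the system because the combined integrand with w0 = 1 integrates to zero
    over every contour. Any other solution differs by a kernel vector, to which [uniqueness]
    applies. *)
Theorem system_iff (M : C -> C) (Gam : nat -> contour) (v' : nat -> C) : is_Jost_M eps P c z lam M ->
  (forall m, (1 <= m <= P)%nat -> is_Cm eps P c z m (Gam m)) ->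
  (forall m : nat, (1 <= m <= P)%nat -> Csum P (fun p => (A_entry eps lam z Gam m p * v' p)%C) = b_entry eps lam Gam m)
  <-> (forall p : nat, (1 <= p <= P)%nat -> v' p = (c p * M (z p))%C).
Proof.
  intros HM HG.
  assert (HV : forall m : nat, (1 <= m <= P)%nat -> Csum P (fun p => (A_entry eps lam z Gam m p * (c p * M (z p)))%C) = b_entry eps lam Gam m).
  { intros m Hm. assert (L : is_line (cint 1 (fun p => c p * M (z p))%C (Gam m)) 0).
    { destruct (HG m Hm) as [G1 G2]. destruct (Classical_Prop.classic (exceptional eps c m)) as [Hex|Hne].
      - apply (M_line_ell0 M m); try assumption. apply G1, Hex. - apply (M_line_U M m); try assumption. apply G2, Hne. }
    assert (E := is_line_value _ _ _ (cint_line m 1 _ Gam Hm (HG m Hm)) L). cbv beta in E.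
    apply Ceq_minus. rewrite <- E. ring. }
  split.
  - intros H p Hp. apply Ceq_minus.
    apply (uniqueness (fun p => v' p - c p * M (z p))%C Gam HG); [|exact Hp]. intros m Hm.
    assert (L := cint_line m 0 (fun p => v' p - c p * M (z p))%C Gam Hm (HG m Hm)). cbv beta in L.
    assert (E : (Csum P (fun p => A_entry eps lam z Gam m p * (v' p - c p * M (z p))) - 0 * b_entry eps lam Gam m)%C = 0); [|rewrite E in L; exact L].
    rewrite (Csum_ext P _ (fun p => A_entry eps lam z Gam m p * v' p - A_entry eps lam z Gam m p * (c p * M (z p)))%C) by (intros; ring).
    rewrite Csum_minus, H, HV by assumption. ring.
  - intros H m Hm. rewrite <- (HV m Hm). apply Csum_ext. intros p Hp. rewrite H by exact Hp. reflexivity.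
Qed.

End Potential.

Theorem mainTheorem4
  (eps : R) (Heps : 0 < eps)
  (P : nat) (HP : (1 <= P)%nat)
  (c z : nat -> C)
  (Hc : forall p : nat, (1 <= p <= P)%nat -> c p <> RtoC 0)
  (Hsum : Csum P (fun p => (c p + Cconj (c p))%C) = RtoC 0)
  (Him : forall p : nat, (1 <= p <= P)%nat -> 0 < Im (z p))
  (Hre : forall p : nat, (1 <= p)%nat -> (p < P)%nat -> Re (z p) < Re (z (S p)))
  (lam : R) (Hlam : 0 < lam)
  (M Nbar N : C -> C)
  (HM : is_Jost_M eps P c z lam M)
  (HNbar : is_Jost_Nbar eps P c z lam Nbar)
  (HN : is_Jost_N eps P c z lam N)
  (beta : C)
  (Hbeta : forall x : R,
     (M (RtoC x) - Nbar (RtoC x))%C = (beta * N (RtoC x))%C)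
  (Gam : nat -> contour)
  (HGam : forall m : nat, (1 <= m <= P)%nat -> is_Cm eps P c z m (Gam m)) :
  let v := fun p : nat => (c p * M (z p))%C in
  ex_int_line (beta_integrand eps P c z lam v) /\
  beta = (Ci / RtoC eps
          * Cexp (- (2 * RtoC PI / RtoC eps) * Csum P c)
          * int_line (beta_integrand eps P c z lam v))%C /\
  (forall m p : nat, (1 <= m <= P)%nat -> (1 <= p <= P)%nat ->
     ex_int_line (A_integrand eps lam z (Gam m) p)) /\
  (forall m : nat, (1 <= m <= P)%nat ->
     ex_int_line (b_integrand eps lam (Gam m))) /\
  (forall v' : nat -> C,
     (forall m : nat, (1 <= m <= P)%nat ->
        Csum P (fun p => (A_entry eps lam z Gam m p * v' p)%C)
        = b_entry eps lam Gam m)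
     <-> (forall p : nat, (1 <= p <= P)%nat -> v' p = v p)).
Proof.
  intros v.
  assert (HB : is_line (beta_integrand eps P c z lam v) (- Ci * RtoC eps * (beta * Cexp (2 * RtoC PI / RtoC eps * Csum P c)))%C).
  { eapply beta_line; eassumption. }
  assert (HA : forall m p, (1 <= m <= P)%nat -> (1 <= p <= P)%nat -> exists V, is_line (A_integrand eps lam z (Gam m) p) V).
  { intros m p Hm Hp. eapply A_line with (m := m); try eassumption. apply HGam, Hm. }
  assert (Hb : forall m, (1 <= m <= P)%nat -> exists V, is_line (b_integrand eps lam (Gam m)) V).
  { intros m Hm. eapply b_line with (m := m); try eassumption. apply HGam, Hm. }
  split; [exact (is_line_ex _ _ HB)|]. split; [|split; [|split]].
  (* The integral equals -i eps beta e^w, so the prefactor (i / eps) e^{-w} restores beta. *)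
  - rewrite (is_line_unique _ _ HB). set (w := (2 * RtoC PI / RtoC eps * Csum P c)%C).
    replace (- (2 * RtoC PI / RtoC eps) * Csum P c)%C with (- w)%C by (unfold w; ring).
    assert (Ex : (Cexp (- w) * Cexp w)%C = 1) by (rewrite <- Cexp_plus, <- Cexp_0; f_equal; ring).
    assert (Hi : (Ci * Ci)%C = (-1)%C) by (apply C_ext; simpl; ring).
    transitivity (- (Ci * Ci) * (Cexp (- w) * Cexp w) * beta)%C; [rewrite Hi, Ex; ring|].
    field. intros E. apply RtoC_inj in E. lra.
  - intros m p Hm Hp. destruct (HA m p Hm Hp) as [V HV]. exact (is_line_ex _ _ HV).
  - intros m Hm. destruct (Hb m Hm) as [V HV]. exact (is_line_ex _ _ HV).
  - intros v'. eapply system_iff; eassumption.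
Qed.
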